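(* Let $M$ be a connected $n$-dimensional $C^\infty$-smooth manifold, let $\mathcal X=\{X_1,\dots,X_r\}$, $r\ge 2$, be a system of linearly independent $C^\infty$-smooth vector fields on $M$ satisfying the Hörmander condition, and let $d$ be the associated Carnot--Carathéodory distance on $M$. Let $T>0$ and let $\gamma:[-T,T]\to M$ be a length minimizer in $(M,d)$ parametrized by arclength. Then, for any $t\in(-T,T)$, the tangent cone $\mathrm{Tan}(\gamma;t)$ contains a horizontal line.
   Context: Carnot--Carathéodory structure. The vector fields are linearly independent at every point. The Hörmander condition means that at every point of $M$ the iterated commutators of $X_1,\dots,X_r$ (including the $X_i$ themselves) span the tangent space. A Lipschitz curve $\gamma:I\to M$ ($I\subseteq\mathbb R$ an interval) is horizontal if there are $h_1,\dots,h_r\in L^\infty(I)$ (the controls of $\gamma$) with $\dot\gamma(t)=\sum_{i=1}^r h_i(t)X_i(\gamma(t))$ for a.e. $t\in I$. Its length is $L(\gamma)=\int_I|h(t)|\,dt$, where $|h|=(h_1^2+\dots+h_r^2)^{1/2}$; it is parametrized by arclength if $|h(t)|=1$ for a.e. $t$. The Carnot--Carathéodory distance $d(x,y)$ is the infimum of the lengths of the horizontal curves joining $x$ to $y$. A horizontal curve $\gamma:[a,b]\to M$ is a length minimizer if $L(\gamma)=d(\gamma(a),\gamma(b))$. Nilpotent approximation at a point $x\in M$. For $i\ge1$ let $L^i(x)\subseteq T_xM$ be the span of the values at $x$ of all iterated commutators $[X_{j_1},[X_{j_2},\dots,[X_{j_{k-1}},X_{j_k}]\dots]]$ of length $k\le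 i$ (for $k=1$: the $X_j$ themselves), let $m_i=\dim L^i(x)$, $m_0=0$, and let $q$ be the least integer with $L^q(x)=T_xM$. Put $Y_1=X_1,\dots,Y_r=X_r$ and, for $i=2,\dots,q$, choose iterated commutators $Y_{m_{i-1}+1},\dots,Y_{m_i}$ of length $i$ such that $Y_1(x),\dots,Y_{m_i}(x)$ is a basis of $L^i(x)$. Give the index $j$ the weight $w_j=i$ if $m_{i-1}<j\le m_i$. Let $\varphi(y_1,\dots,y_n)=\exp\big(\sum_{j=1}^n y_jY_j\big)(x)$ (time-one flow starting from $x$), a diffeomorphism from a neighborhood of $0\in\mathbb R^n$ onto a neighborhood of $x$ with $\varphi(0)=x$, and let $\delta_\lambda(y)=(\lambda^{w_1}y_1,\dots,\lambda^{w_n}y_n)$ for $\lambda>0$. Writing $X_i=\sum_{j}a_{ij}(y)\partial_{y_j}$ in the coordinates $\varphi$, the limits $p_{ij}(y)=\lim_{\lambda\downarrow0}\lambda^{1-w_j}a_{ij}(\delta_\lambda(y))$ exist locally uniformly on $\mathbb R^n$ and are polynomials with $p_{ij}(\delta_\lambda(y))=\lambda^{w_j-1}p_{ij}(y)$. The nilpotent approximation is the Carnot--Carathéodory structure $(M^\infty,\mathcal X^\infty)$ with $M^\infty=\mathbb R^n$, $\mathcal X^\infty=\{X_1^\infty,\dots,X_r^\infty\}$, $X_i^\infty=\sum_j p_{ij}\partial_{y_j}$, and base point $0$. Tangent cone. For $t\in(-T,T)$, perform the construction of the nilpotent approximation at $x=\gamma(t)$, with any fixed choice of $Y_1,\dots,Y_n$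 such that $Y_1=X_1,\dots,Y_r=X_r$ and, for $i=2,\dots,q$, $Y_{m_{i-1}+1},\dots,Y_{m_i}$ are iterated commutators of length $i$ for which $Y_1(x),\dots,Y_{m_i}(x)$ is a basis of $L^i(x)$. Then $\mathrm{Tan}(\gamma;t)$ is the set of all curves $\kappa:\mathbb R\to M^\infty$ for which there is a sequence $\eta_i\downarrow0$ such that $\delta_{1/\eta_i}\big(\varphi^{-1}(\gamma(t+\eta_i\tau))\big)\to\kappa(\tau)$ uniformly for $\tau$ in compact subsets of $\mathbb R$. (Its elements are length minimizing horizontal curves in $(M^\infty,\mathcal X^\infty)$ parametrized by arclength.) Horizontal line. A horizontal line is a horizontal curve in $(M^\infty,\mathcal X^\infty)$ passing through the base point $0$ and with constant controls, i.e. $\dot\kappa=\sum_{i=1}^r c_iX_i^\infty(\kappa)$ with $c_1,\dots,c_r\in\mathbb R$ constant. *)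

(* Defs.v *)
From HB Require Import structures.
From mathcomp Require Import all_boot all_order all_algebra.
From mathcomp Require Import all_classical all_reals all_analysis.

Set Implicit Arguments.
Unset Strict Implicit.
Unset Printing Implicit Defensive.

Import Order.TTheory GRing.Theory Num.Theory.
Import numFieldNormedType.Exports.

Local Open Scope classical_set_scope.
Local Open Scope ring_scope.

Section smooth_euclidean.
Context {R : realType} {n : nat}.

Definition continuous_on (S T : topologicalType) (U : set S) (F : S -> T) :=
  forall x, U x -> {for x, continuous F}.

(* Class C^k on an open set [U]: all iterated partial derivatives of order at
   most [k] exist and are continuous on [U]. *)
Fixpoint Ck (V : normedModType R) (k : nat) (U : set 'rV[R]_n)
    (F : 'rV[R]_n -> V) : Prop :=
  continuous_on U F /\
  if k is k'.+1 then
    forall j : 'I_n, (forall x, U x -> derivable F x (delta_mx 0 j)) /\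
                     Ck k' U (fun x => 'D_(delta_mx 0 j) F x)
  else True.

Definition smooth_on (V : normedModType R) (U : set 'rV[R]_n)
  (F : 'rV[R]_n -> V) := forall k, Ck k U F.

End smooth_euclidean.

(* A chart of domain [dom c], with coordinate map [coord c] and inverse
   [param c]; the values of [coord c] outside [dom c], and those of [param c]
   outside the image of [dom c], are irrelevant. *)
Record chart (R : realType) (n : nat) (M : topologicalType) := Chart {
  dom : set M;
  coord : M -> 'rV[R]_n;
  param : 'rV[R]_n -> M }.

Definition is_chart (R : realType) (n : nat) (M : topologicalType)
    (c : chart R n M) :=
  [/\ open (dom c), open (coord c @` dom c),
      (forall x, dom c x -> param c (coord c x) = x),
      continuous_on (dom c) (coord c) &
      continuous_on (coord c @` dom c) (param c)].

Record smooth_manifold (R : realType) (n : nat) := SmoothManifold {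
  carrier :> topologicalType;
  atlas : set (chart R n carrier);
  manifold_hausdorff : hausdorff_space carrier;
  manifold_second_countable : @second_countable carrier;
  atlas_chart : forall c, atlas c -> is_chart c;
  atlas_cover : forall x, exists2 c, atlas c & dom c x;
  atlas_compat : forall c c', atlas c -> atlas c' ->
    smooth_on (coord c @` (dom c `&` dom c')) (coord c' \o param c) }.

Section euclidean_manifold.
Context {R : realType} {n : nat}.

Lemma rV_second_countable : @second_countable 'rV[R]_n.
Proof.
pose b (p : 'rV[rat]_n * nat) : set 'rV[R]_n :=
  ball (map_mx (ratr : rat -> R) p.1 : 'rV[R]_n) (p.2.+1%:R^-1 : R).
have k0 k : 0 < k.+1%:R^-1 :> R by rewrite invr_gt0 ltr0n.
exists (range b); first exact: sub_countable (card_image_le _ _) (countableP _).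
split=> [_ [p _ <-]|x V /nbhs_ballP[e /= e0 eV]].
  exact/ball_open.
have e2 : 0 < e / 2 by rewrite divr_gt0.
have [k] := ltr_add_invr (y := 0) e2; rewrite add0r => ke.
have /(@boolp.choice 'I_n rat)[q qP] (j : 'I_n) :
    exists q : rat, ball (x ord0 j) (k.+1%:R^-1 : R) (ratr q : R).
  have [] := @dense_rat R (ball (x ord0 j) k.+1%:R^-1).
  - by exists (x ord0 j); exact: ballxx.
  - exact: ball_open.
  - by move=> z [zx [q _ qz]]; exists q; rewrite qz.
have xq : ball (map_mx (ratr : rat -> R) (\row_j q j) : 'rV[R]_n) (k.+1%:R^-1 : R) x.
  by apply: ball_sym; split=> // i j; rewrite !mxE ord1; exact: qP.
exists (b (\row_j q j, k)) => /=; first by split => //; exists (\row_j q j, k).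
move=> z qz; apply: eV; rewrite (splitr e).
apply: (@ball_triangle _ _ (map_mx (ratr : rat -> R) (\row_j q j) : 'rV[R]_n)).
  exact/ball_sym/(le_ball (ltW ke)).
exact/(le_ball (ltW ke)).
Qed.

Definition id_chart := @Chart R n 'rV[R]_n setT id id.

Let id_chart_is_chart c : [set id_chart] c -> is_chart c.
Proof.
move=> ->; split=> /=.
- exact: openT.
- by rewrite image_id; exact: openT.
- by [].
- by move=> x _; exact: cvg_id.
- by move=> x _; exact: cvg_id.
Qed.

Let id_chart_cover x : exists2 c, [set id_chart] c & dom c x.
Proof. by exists id_chart. Qed.

Lemma smooth_on_cst (V : normedModType R) (U : set 'rV[R]_n) (a : V) :
  smooth_on U (fun _ => a).
Proof.
move=> k; elim: k a => [|k IH] a; split=> //; do ?[by move=> x _; exact: cst_continuous].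
move=> j; split=> [x _|]; first exact: derivable_cst.
rewrite [X in Ck _ _ X](_ : _ = fun _ => 0); first exact: IH.
by apply/funext => x; exact: derive_cst.
Qed.

Lemma smooth_on_id (U : set 'rV[R]_n) : smooth_on U id.
Proof.
case=> [|k]; split=> //; do ?[by move=> x _; exact: cvg_id].
move=> j; split=> [x _|]; first exact: derivable_id.
rewrite [X in Ck _ _ X](_ : _ = fun _ => delta_mx 0 j); first exact: smooth_on_cst.
by apply/funext => x; exact: derive_id.
Qed.

Let id_chart_compat c c' : [set id_chart] c -> [set id_chart] c' ->
  smooth_on (coord c @` (dom c `&` dom c')) (coord c' \o param c).
Proof. by move=> -> ->; exact: smooth_on_id. Qed.

Definition euclidean : smooth_manifold R n :=
  SmoothManifold (@norm_hausdorff R 'rV[R]_n) rV_second_countable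
    id_chart_is_chart id_chart_cover id_chart_compat.

End euclidean_manifold.
Arguments euclidean : clear implicits.

Section smooth_maps.
Context {R : realType}.

Definition smooth_fun (n : nat) (M : smooth_manifold R n) (f : M -> R) :=
  forall c, atlas c -> smooth_on (coord c @` dom c) (f \o param c).

Definition smooth_map_on (n m : nat) (M : smooth_manifold R n)
    (N : smooth_manifold R m) (U : set M) (F : M -> N) :=
  continuous_on U F /\
  forall c d, atlas c -> atlas d ->
    smooth_on (coord c @` (dom c `&` U `&` F @^-1` dom d))
              (coord d \o F \o param c).

Definition diffeomorphism (n m : nat) (M : smooth_manifold R n)
    (N : smooth_manifold R m) (U : set M) (V : set N) (F : M -> N)
    (G : N -> M) :=
  [/\ open U, open V,
      (forall x, U x -> V (F x) /\ G (F x) = x),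
      (forall y, V y -> U (G y) /\ F (G y) = y) &
      smooth_map_on U F /\ smooth_map_on V G].

End smooth_maps.

Section vector_fields.
Context {R : realType} {n : nat} (M : smooth_manifold R n).

(* Tangent vectors are derivations of the algebra of smooth functions and
   vector fields are derivations from this algebra to itself. Both are
   represented by operators on all functions [M -> R], of which only the
   values at smooth functions are meaningful. *)
Definition tvec := (M -> R) -> R.
Definition vfield := (M -> R) -> (M -> R).

Definition tangent_space (x : M) : set tvec := [set v |
  (forall a f g, smooth_fun f -> smooth_fun g ->
     v (fun z => a * f z + g z) = a * v f + v g) /\
  (forall f g, smooth_fun f -> smooth_fun g ->
     v (fun z => f z * g z) = v f * g x + f x * v g)].

Definition value (Z : vfield) (x : M) : tvec := fun f => Z f x.

Definition smooth_vfield (Z : vfield) :=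
  (forall f, smooth_fun f -> smooth_fun (Z f)) /\
  (forall x, tangent_space x (value Z x)).

Definition commutator (Z W : vfield) : vfield :=
  fun f x => Z (W f) x - W (Z f) x.

Definition lincomb (I : finType) (P : pred I) (c : I -> R) (B : I -> tvec) :
  tvec := fun f => \sum_(i | P i) c i * B i f.

Definition tvec_eq (v w : tvec) := forall f, smooth_fun f -> v f = w f.

Definition free_family (I : finType) (P : pred I) (B : I -> tvec) :=
  forall c : I -> R, tvec_eq (lincomb P c B) (fun _ => 0) ->
  forall i, P i -> c i = 0.

Definition span_tvec (S : set tvec) : set tvec := [set v |
  exists (N : nat) (c : 'I_N -> R) (B : 'I_N -> tvec),
    (forall k, S (B k)) /\ tvec_eq v (lincomb predT c B)].

(* The subfamily of [B] of indices satisfying [P] is a basis of [V]. *)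
Definition is_basis (I : finType) (P : pred I) (B : I -> tvec)
    (V : set tvec) :=
  free_family P B /\ span_tvec [set B i | i in [set i | P i]] = V.

Definition dim_tvec (V : set tvec) : nat :=
  xget 0%N [set m | exists B : 'I_m -> tvec, is_basis predT B V].

(* [gamma] is differentiable at [t] with derivative [v]. *)
Definition velocity (gamma : R -> M) (t : R) (v : tvec) :=
  forall f, smooth_fun f -> is_derive t 1 (f \o gamma) (v f).

(* [gamma] is Lipschitz in charts, locally on [I]; on a compact interval this
   amounts to being Lipschitz for any Riemannian distance. *)
Definition lipschitz_curve (I : set R) (gamma : R -> M) :=
  forall t c, I t -> atlas c -> dom c (gamma t) ->
  exists2 J : set R, nbhs t J &
    (forall s, (I `&` J) s -> dom c (gamma s)) /\
    [lipschitz coord c (gamma s) | s in I `&` J].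

End vector_fields.

Section carnot_caratheodory.
Context {R : realType} {n r : nat} {M : smooth_manifold R n}.
Variable X : 'I_r -> vfield M.

(* [[X_j1, [X_j2, ..., [X_jk-1, X_jk]...]]] for [s = [:: j1; ...; jk]] *)
Fixpoint iter_commutator (s : seq 'I_r) : vfield M :=
  match s with
  | [::] => fun _ _ => 0
  | [:: j] => X j
  | j :: s' => commutator (X j) (iter_commutator s')
  end.

Definition lie_flag (i : nat) (x : M) : set (tvec M) :=
  span_tvec [set value (iter_commutator s) x |
             s in [set s | (1 <= size s <= i)%N]].

Definition hormander := forall x,
  span_tvec [set value (iter_commutator s) x | s in [set s | (1 <= size s)%N]]
  = tangent_space x.

Definition cc_structure :=
  [/\ forall i, smooth_vfield (X i),
      forall x, free_family predT (fun i => value (X i) x) &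
      hormander].

(* [gamma] is a horizontal curve on the interval [I], with controls [h]. *)
Definition horizontal (I : set R) (gamma : R -> M) (h : R -> 'rV[R]_r) :=
  [/\ lipschitz_curve I gamma,
      forall i, measurable_fun I (fun t => h t ord0 i) /\
        exists K, {ae lebesgue_measure, forall t, I t -> `|h t ord0 i| <= K} &
      {ae lebesgue_measure, forall t, I t ->
        velocity gamma t
          (lincomb predT (h t ord0) (fun i => value (X i) (gamma t)))}].

Definition euclidean_norm (v : 'rV[R]_r) : R :=
  Num.sqrt (\sum_i v ord0 i ^+ 2).

Definition control_length (I : set R) (h : R -> 'rV[R]_r) : \bar R :=
  (\int[lebesgue_measure]_(t in I) (euclidean_norm (h t))%:E)%E.

Definition cc_dist (x y : M) : \bar R :=
  ereal_inf [set L | exists a b gamma h,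
    [/\ a <= b, horizontal `[a, b] gamma h, gamma a = x, gamma b = y &
        L = control_length `[a, b] h]].

Definition length_minimizer (a b : R) (gamma : R -> M) :=
  exists2 h, horizontal `[a, b] gamma h &
    control_length `[a, b] h = cc_dist (gamma a) (gamma b).

Definition arclength_parametrized (I : set R) (gamma : R -> M) :=
  exists2 h, horizontal I gamma h &
    {ae lebesgue_measure, forall t, I t -> euclidean_norm (h t) = 1}.

End carnot_caratheodory.

Section nilpotent_approximation.
Context {R : realType} {n r : nat} {M : smooth_manifold R n}.
Variables (X : 'I_r -> vfield M) (x : M) (Y : 'I_n -> vfield M).

(* The numbers [m_i]; the span [lie_flag X 0 x] of no vector has dimension 0. *)
Definition growth (i : nat) : nat := dim_tvec (lie_flag X i x).

Definition is_step (q : nat) :=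
  lie_flag X q x = tangent_space x /\
  forall i, (i < q)%N -> lie_flag X i x <> tangent_space x.

(* The family [Y] is an admissible choice in the construction of the nilpotent
   approximation at [x]; indices are shifted by one: [Y j] stands for
   Y_(j+1). *)
Definition adapted_frame :=
  (forall (i : 'I_r) (j : 'I_n), i = j :> nat -> Y j = X i) /\
  exists2 q, is_step q & forall i, (2 <= i <= q)%N ->
    (forall j : 'I_n, (growth i.-1 <= j < growth i)%N ->
       exists2 s, size s = i & Y j = iter_commutator X s) /\
    is_basis [pred j : 'I_n | (j < growth i)%N] (fun j => value (Y j) x)
      (lie_flag X i x).

Definition weight (j : 'I_n) : nat :=
  xget 0%N [set i | (growth i.-1 <= j < growth i)%N].

Definition dilation (l : R) (y : 'rV[R]_n) : 'rV[R]_n :=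
  \row_j (l ^+ weight j * y ord0 j).

(* [z] is the value at time one of the flow of \sum_j y_j Y_j starting at
   [x]. *)
Definition flow_time_one (y : 'rV[R]_n) (z : M) :=
  exists (e : R) (c : R -> M),
    [/\ 0 < e, c 0 = x, c 1 = z & forall t, - e < t < 1 + e ->
        velocity c t
          (lincomb predT (y ord0) (fun j => value (Y j) (c t)))].

(* The map \varphi; the value is [x] wherever the flow is not defined up to
   time one, which does not happen near 0. *)
Definition exp_map (y : 'rV[R]_n) : M := xget x [set z | flow_time_one y z].

(* The local inverse of \varphi, well defined as a germ at [x]. *)
Definition exp_map_inv : M -> 'rV[R]_n :=
  xget (fun _ => 0) [set psi | exists (V : set 'rV[R]_n) (W : set M),
    [/\ V 0, W x & @diffeomorphism R n n (euclidean R n) M V W exp_map psi]].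

(* Coefficients of [Z] in the coordinates \varphi: the row [a] such that
   (Z f)(\varphi(y)) = \sum_j a_j \partial_j (f \o \varphi)(y) for all smooth
   [f]. It exists and is unique for [y] near 0. *)
Definition coefficients (Z : vfield M) (y : 'rV[R]_n) : 'rV[R]_n :=
  xget 0 [set a : 'rV[R]_n | forall f, smooth_fun f ->
    Z f (exp_map y) =
    \sum_j a ord0 j * 'D_(delta_mx 0 j) (f \o exp_map) y].

Definition nilpotent_coefficient (i : 'I_r) (j : 'I_n) (y : 'rV[R]_n) : R :=
  lim (l ^ (1 - (weight j)%:Z) * coefficients (X i) (dilation l y) ord0 j
       @[l --> 0^'+]).

Definition nilpotent_field (i : 'I_r) : vfield (euclidean R n) :=
  fun f y => \sum_j nilpotent_coefficient i j y * 'D_(delta_mx 0 j) f y.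

End nilpotent_approximation.

Section tangent_cone.
Context {R : realType} {n r : nat} {M : smooth_manifold R n}.
Variables (X : 'I_r -> vfield M).

Definition tangent_cone (gamma : R -> M) (t : R) (Y : 'I_n -> vfield M) :
    set (R -> euclidean R n) :=
  [set kappa | exists eta : nat -> R,
    [/\ forall k, 0 < eta k, nonincreasing_seq eta, eta @ \oo --> 0 &
        {family compact, (fun k (tau : R) =>
           dilation X (gamma t) (eta k)^-1
             (exp_map_inv (gamma t) Y (gamma (t + eta k * tau)))) @ \oo
         --> (kappa : R -> 'rV[R]_n)}]].

Definition horizontal_line (x : M) (Y : 'I_n -> vfield M)
    (kappa : R -> euclidean R n) :=
  (exists tau, kappa tau = 0 :> 'rV[R]_n) /\
  exists c : 'rV[R]_r,
    horizontal (nilpotent_field X x Y) setT kappa (fun _ => c).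

End tangent_cone.

(* Main.v *)
From HB Require Import structures.
Require Import Defs.
From mathcomp Require Import all_boot all_order all_algebra.
From mathcomp Require Import all_classical all_reals all_analysis measurable_realfun.
From mathcomp Require Import ring lra zify.
Set Implicit Arguments.
Unset Strict Implicit.
Unset Printing Implicit Defensive.
Import Order.TTheory GRing.Theory Num.Theory.
Import numFieldNormedType.Exports.
Local Open Scope classical_set_scope.
Local Open Scope ring_scope.

(** A blow-up of a length minimizer at one of its points is again a minimizer,
  in a simpler space; iterated blow-ups end with a straight line; and a blow-up
  of a blow-up is a blow-up. The proof carries this out, not in the manifold,
  but on the path [x] in R^r obtained by integrating the controls of the
  minimizer.

  A 1-Lipschitz path [x] has a signature [g s t]: a group-like formal series in
  [r] noncommuting letters whose coefficients are the iterated integrals of [x]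
  over [[s, t]] ([lp], [lp_exists]). Up to words of length [N] this is a
  horizontal curve of the free nilpotent group of step [N], in which the
  competitors are the broken lines with a given signature ([reach]); [Nmin N g]
  says that [g] minimizes length there. In the exponential coordinates at
  [gamma t] the fields become bounded smooth fields of R^n and the minimizer a
  curve [z] driven by [x]. The Chen-Fliess expansion ([chen_fliess]) computes
  the increments of [z] over intervals of length [eta] from [g] up to an error
  of order [eta ^ q.+1], [q] being the step at the point, and Chow's theorem
  ([chow]) corrects such an error at a cost negligible with respect to [eta].
  Hence a shortcut, up to words of length [q], for a blow-up of [g] would give a
  shortcut for the minimizer: the blow-ups of [g] minimize length at step [q]
  ([minimal_tan]).

  The step is then lowered, following Hakavuori and Le Donne: a blow-up of a
  minimizer of step [N + 1] is a minimizer of step [N] ([step_reduction]). If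
  not, the original path has at small scales [eta] shortcuts gaining a length of
  order [eta], with an error of order [eta ^ N.+1] in the top layer only. This
  error is a Lie polynomial in the directions spanned by the increments of the
  path, therefore a sum of brackets of increments over finitely many fixed
  intervals with Lie polynomials of degree [N] ([spanning_grid], [lie_decomp]).
  Conjugating the corresponding pieces of the path by loops realizing these
  polynomials removes the error ([compensate]), and the length of these loops is
  of the order of the [N]-th root of [eta ^ N.+1], which is negligible with
  respect to [eta]. A minimizer of step 1 is a minimizer of the Euclidean space
  R^r, a straight line ([Nmin1_line]). So there are scales at which [x] itself
  is uniformly close to a line of some direction [c] ([blowup_line]).

  It remains to read this in the coordinates. They are privileged: the
  coordinate of weight [w] vanishes to order [w] at 0 ([iterZ_privileged]).
  Therefore the blow-ups of the coordinate of weight [w] of [z] only depend on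
  the iterated integrals of [x] of order [w], which are close to those of the
  line ([lp_near_line]); the limit is the [w]-th derivative of the coordinate in
  the direction [c], divided by the factorial of [w] ([ray], [control_blowup]).
  In exponential coordinates combinations of the frame with constant
  coefficients have straight lines as integral curves, so that this limit is
  [tau c] on the first [r] coordinates and 0 on the others ([ray_frame]). The
  same derivatives, through Taylor's formula, give the values of the nilpotent
  approximation on that ray, of which the ray is an integral curve with constant
  controls ([ray_horizontal]).

  Existence of curves, lifts and averages is obtained by limits along an
  ultrafilter of explicit discretizations: curves are characterized by estimates
  on their increments which pass to the limit, and are compared by summing these
  estimates along subdivisions ([sewing]). *)

(** * Noncommutative formal series *)

Section SeriesDef.
Context {R : realType} {r : nat}.

Definition ser := seq 'I_r -> R.

(** The concatenation product, by recursion on the word, so that the rule for the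
  coefficient of a word [i :: w] holds by computation. *)
Fixpoint smul (f g : ser) (w : seq 'I_r) : R :=
  if w is i :: u then f [::] * g w + smul (fun v => f (i :: v)) g u
  else f [::] * g [::].

Definition sone : ser := fun w => (w == [::])%:R.

Lemma smulE f g w :
  smul f g w = \sum_(k < (size w).+1) f (take k w) * g (drop k w).
Proof.
elim: w f => [|i u IH] f /=; first by rewrite big_ord_recl big_ord0 addr0.
by rewrite big_ord_recl /= IH.
Qed.

Lemma smul1l f : smul sone f = f.
Proof.
apply/funext => w; rewrite smulE big_ord_recl /= take0 drop0 mul1r.
rewrite big1 ?addr0// => k _; rewrite /sone; case: w k => [|i u] [k hk] //=.
by rewrite mul0r.
Qed.

Lemma smul1r f : smul f sone = f.
Proof.
apply/funext => w; rewrite smulE big_ord_recr /= take_size drop_size mulr1.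
rewrite big1 ?add0r// => k _; rewrite /sone.
have : size (drop k w) != 0%N by rewrite size_drop subn_eq0 -ltnNge.
by case: (drop k w) => //= *; rewrite mulr0.
Qed.

Lemma smulDl f g h : smul (f \+ g) h = smul f h \+ smul g h.
Proof.
apply/funext => w; rewrite !smulE /= !smulE -big_split /=.
by apply: eq_bigr => k _; rewrite mulrDl.
Qed.

Lemma smulDr f g h : smul f (g \+ h) = smul f g \+ smul f h.
Proof.
apply/funext => w; rewrite !smulE /= !smulE -big_split /=.
by apply: eq_bigr => k _; rewrite mulrDr.
Qed.

Lemma smulZl a f g w : smul (fun v => a * f v) g w = a * smul f g w.
Proof. by rewrite !smulE mulr_sumr; apply: eq_bigr => k _; rewrite mulrA. Qed.

Lemma smulA f g h : smul f (smul g h) = smul (smul f g) h.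
Proof.
apply/funext => w; elim: w f g => [|i u IH] f g /=; first by rewrite mulrA.
rewrite mulrDr -addrA mulrA; congr (_ + _).
rewrite IH -smulZl.
by rewrite -[RHS]/(smul ((fun v => f [::] * g (i :: v)) \+
  smul (fun v => f (i :: v)) g) h u) smulDl.
Qed.

End SeriesDef.
Arguments ser : clear implicits.

HB.instance Definition _ (R : realType) r := GRing.Lmodule.copy (ser R r) (seq 'I_r -> R).

Lemma sone_neq0 (R : realType) r : @sone R r != (0 : ser R r).
Proof.
apply/eqP => /(congr1 (fun F => F [::])) /eqP; rewrite /sone eqxx /=.
by rewrite oner_eq0.
Qed.

HB.instance Definition _ (R : realType) r :=
  GRing.Zmodule_isNzRing.Build (ser R r) (@smulA R r) (@smul1l R r)
    (@smul1r R r) (@smulDl R r) (@smulDr R r) (@sone_neq0 R r).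

Lemma ser_scaleAl (R : realType) r (a : R) (f g : ser R r) :
  a *: (f * g) = (a *: f) * g.
Proof. by apply/funext => w; rewrite -[RHS]/(smul _ _ _) smulZl. Qed.
HB.instance Definition _ (R : realType) r :=
  GRing.Lmodule_isLalgebra.Build R (ser R r) (@ser_scaleAl R r).
Lemma ser_scaleAr (R : realType) r (a : R) (f g : ser R r) :
  a *: (f * g) = f * (a *: g).
Proof.
apply/funext => w; rewrite -[LHS]/(a * smul _ _ _) -[RHS]/(smul _ _ _) !smulE.
by rewrite mulr_sumr; apply: eq_bigr => k _; rewrite mulrCA.
Qed.
HB.instance Definition _ (R : realType) r :=
  GRing.Lalgebra_isAlgebra.Build R (ser R r) (@ser_scaleAr R r).

Section Series.
Context {R : realType} {r : nat}.
Implicit Types (f g h z : ser R r) (w u v : seq 'I_r) (a b : 'rV[R]_r) (N k : nat).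
Local Notation ser := (ser R r).

(** The letter [i] removed on the left. *)
Definition sh (i : 'I_r) f : ser := fun w => f (i :: w).

Lemma serME f g w :
  (f * g) w = \sum_(k < (size w).+1) f (take k w) * g (drop k w).
Proof. exact: smulE. Qed.
Lemma serM_nil f g : (f * g) [::] = f [::] * g [::]. Proof. by []. Qed.
Lemma serM_cons f g i w :
  (f * g) (i :: w) = f [::] * g (i :: w) + (sh i f * g) w.
Proof. by []. Qed.
Lemma ser1E w : (1 : ser) w = (w == [::])%:R. Proof. by []. Qed.
Lemma serDE f g w : (f + g) w = f w + g w. Proof. by []. Qed.
Lemma serNE f w : (- f) w = - f w. Proof. by []. Qed.
Lemma serBE f g w : (f - g) w = f w - g w. Proof. by []. Qed.
Lemma serZE (c : R) f w : (c *: f) w = c * f w. Proof. by []. Qed.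
Lemma ser_sumE (I : Type) (s : seq I) (P : pred I) (F : I -> ser) w :
  (\sum_(i <- s | P i) F i) w = \sum_(i <- s | P i) F i w.
Proof. by elim/big_ind2 : _ => // x1 x2 y1 y2 <- <-. Qed.

Definition eqN N f g := forall w, (size w <= N)%N -> f w = g w.

Lemma eqN_refl N f : eqN N f f. Proof. by []. Qed.
Lemma eqN_sym N f g : eqN N f g -> eqN N g f.
Proof. by move=> h w hw; rewrite h. Qed.
Lemma eqN_trans N g f h : eqN N f g -> eqN N g h -> eqN N f h.
Proof. by move=> h1 h2 w hw; rewrite h1 ?h2. Qed.
Lemma eqN_mul N f f' g g' : eqN N f f' -> eqN N g g' -> eqN N (f * g) (f' * g').
Proof.
move=> hf hg w hw; rewrite !serME; apply: eq_bigr => k _.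
rewrite hf ?hg// ?size_drop ?size_take; last by case: ifP => ?; lia.
by rewrite (leq_trans (leq_subr _ _)).
Qed.

Lemma serM_low p q f g w : (forall v, (size v < p)%N -> f v = 0) ->
  (forall v, (size v < q)%N -> g v = 0) -> (size w < p + q)%N -> (f * g) w = 0.
Proof.
move=> hf hg hw; rewrite serME big1// => k _; have [kp|pk] := ltnP k p.
  by rewrite hf ?mul0r// size_take; case: ifP => ?; lia.
rewrite hg ?mulr0// size_drop.
have := ltn_ord k; lia.
Qed.

Lemma serM_low_eq p q f g w : (forall v, (size v < p)%N -> f v = 0) ->
  (forall v, (size v < q)%N -> g v = 0) -> size w = (p + q)%N ->
  (f * g) w = f (take p w) * g (drop p w).
Proof.
move=> hf hg hw; rewrite serME.
have pw : (p < (size w).+1)%N by lia.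
rewrite (bigD1 (Ordinal pw)) //= big1 ?addr0// => k /eqP kp.
have {}kp : k <> p :> nat by move=> e; apply: kp; exact/val_inj.
have [kp'|pk] := ltnP k p.
  by rewrite hf ?mul0r// size_take; case: ifP => ?; lia.
rewrite hg ?mulr0// size_drop.
have := ltn_ord k; lia.
Qed.

Definition mon a w : R := \prod_(i <- w) a 0 i.
(** The exponential of the linear form [vec a]: the signature of a segment. *)
Definition sexp a : ser := fun w => mon a w / (size w)`!%:R.
Definition lett (i : 'I_r) : ser := fun w => (w == [:: i])%:R.
Definition vec a : ser := \sum_i a 0 i *: lett i.

Lemma mon_nil a : mon a [::] = 1. Proof. exact: big_nil. Qed.
Lemma mon_cons a i w : mon a (i :: w) = a 0 i * mon a w.
Proof. exact: big_cons. Qed.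
Lemma monZ (t : R) a w : mon (t *: a) w = t ^+ size w * mon a w.
Proof.
elim: w => [|i w IH]; first by rewrite !mon_nil mulr1.
by rewrite !mon_cons IH mxE /= exprS; ring.
Qed.
Lemma mon_cat a w u : mon a (w ++ u) = mon a w * mon a u.
Proof. exact: big_cat. Qed.

Lemma fact_neq0 m : (m`!%:R : R) != 0.
Proof. by rewrite pnatr_eq0 -lt0n fact_gt0. Qed.

Lemma sexp_nil a : sexp a [::] = 1.
Proof. by rewrite /sexp mon_nil /= fact0 divr1. Qed.
Lemma sexp_one a i : sexp a [:: i] = a 0 i.
Proof. by rewrite /sexp mon_cons mon_nil mulr1 /= divr1. Qed.

Lemma sexpD (s t : R) a : sexp (s *: a) * sexp (t *: a) = sexp ((s + t) *: a).
Proof.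
apply/funext => w; rewrite serME /sexp monZ addrC exprDn.
rewrite mulr_suml mulr_suml; apply: eq_bigr => -[k hk] _ /=.
have kw : (k <= size w)%N by [].
rewrite !monZ size_drop size_takel//.
rewrite -mulr_natr.
have -> : mon a w = mon a (take k w) * mon a (drop k w) by rewrite -mon_cat cat_take_drop.
have := @bin_fact (size w) k kw => /(congr1 (fun n => n%:R : R)).
rewrite !natrM => <-.
have := fact_neq0 k; have := fact_neq0 (size w - k).
have : ('C(size w, k)%:R : R) != 0 by rewrite pnatr_eq0 -lt0n bin_gt0.
move=> c0 n0 k0; field.
by rewrite c0 n0 k0.
Qed.

Lemma sexp0 : sexp 0 = 1.
Proof.
apply/funext => -[|i w]; first by rewrite sexp_nil.
by rewrite /sexp mon_cons mxE !mul0r.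
Qed.

Lemma sexpNr a : sexp a * sexp (- a) = 1.
Proof. by rewrite -{1}(scale1r a) -scaleN1r sexpD subrr scale0r sexp0. Qed.
Lemma sexpNl a : sexp (- a) * sexp a = 1.
Proof. by rewrite -{2}(scale1r a) -scaleN1r sexpD addNr scale0r sexp0. Qed.

Lemma lettM_nil i f : (lett i * f) [::] = 0.
Proof. by rewrite serM_nil mul0r. Qed.
Lemma lettM_cons i f j w : (lett i * f) (j :: w) = (i == j)%:R * f w.
Proof.
rewrite serM_cons mul0r add0r.
rewrite (_ : sh j (lett i) = (i == j)%:R *: (1 : ser)); last first.
  apply/funext => v; rewrite /sh /lett /= eqseq_cons serZE ser1E eq_sym.
  by case: eqP; rewrite ?mul1r ?mul0r.
by rewrite -scalerAl mul1r.
Qed.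
Lemma vecM_nil a f : (vec a * f) [::] = 0.
Proof.
rewrite mulr_suml ser_sumE big1// => i _.
by rewrite -scalerAl serZE lettM_nil mulr0.
Qed.
Lemma vecM_cons a f j w : (vec a * f) (j :: w) = a 0 j * f w.
Proof.
rewrite mulr_suml ser_sumE (bigD1 j)//= big1 ?addr0.
  by rewrite -scalerAl serZE lettM_cons eqxx mul1r.
by move=> i /negbTE ij; rewrite -scalerAl serZE lettM_cons ij mul0r mulr0.
Qed.

Lemma sh_vecM a f i : sh i (vec a * f) = a 0 i *: f.
Proof. by apply/funext => w; rewrite /sh vecM_cons. Qed.

(** ** Iterated brackets and the Dynkin map *)

(** The right-nested bracket of the letters of [w]. *)
Fixpoint br w : ser := match w with
  | [::] => 0
  | [:: i] => lett i
  | i :: u => lett i * br u - br u * lett i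
  end.

Fixpoint words k : seq (seq 'I_r) :=
  if k is m.+1 then [seq i :: w | i <- enum 'I_r, w <- words m] else [:: [::]].

Lemma mem_words k w : (w \in words k) = (size w == k).
Proof.
elim: k w => [|k IH] w; first by rewrite inE; case: w.
apply/allpairsP/idP => [[[i u] /= [_ + ->]]|]; first by rewrite IH.
by case: w => // i u us; exists (i, u); rewrite mem_enum IH.
Qed.

Lemma big_words_recl k (F : seq 'I_r -> R) :
  \sum_(w <- words k.+1) F w = \sum_i \sum_(w <- words k) F (i :: w).
Proof. by rewrite big_allpairs_dep /= big_enum. Qed.

Lemma br_homog w v : size v != size w -> br w v = 0.
Proof.
elim: w v => [|i [|j u] IH] v; first by [].
  by rewrite /br /lett; case: (v =P [:: i]) => // ->; rewrite eqxx.
rewrite [br _]/= -/(br (j :: u)); move: (br (j :: u)) IH => b IH vw.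
rewrite serBE (_ : (lett i * b) v = 0); last first.
  case: v vw => [|l v] vw; first by rewrite lettM_nil.
  by rewrite lettM_cons IH ?mulr0.
rewrite (_ : (b * lett i) v = 0) ?subrr//.
rewrite serME big1// => k _; rewrite /lett.
have [/eqP|] := eqVneq (drop k v) [:: i]; last by rewrite mulr0.
move/eqP => dk; rewrite IH ?mul0r//; apply: contra vw => /eqP sz.
by have := cat_take_drop k v => <-; rewrite dk size_cat sz addn1.
Qed.

(** The Dynkin map: every word replaced by its right-nested bracket. *)
Definition dyn f : ser :=
  fun v => \sum_(w <- words (size v)) f w * br w v.

Lemma dyn_nil f : dyn f [::] = 0.
Proof. by rewrite /dyn /= big_seq1 mulr0. Qed.

Lemma dynZ c f : dyn (c *: f) = c *: dyn f.
Proof.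
by apply/funext => v; rewrite /dyn serZE mulr_sumr; apply: eq_bigr => w _; rewrite mulrA.
Qed.

Lemma serM_lettr_cong i f g w :
  (forall u, (size u).+1 = size w -> f u = g u) -> (f * lett i) w = (g * lett i) w.
Proof.
move=> fg; rewrite !serME; apply: eq_bigr => k _; rewrite /lett.
have [dk|] := eqVneq (drop k w) [:: i]; last by rewrite !mulr0.
by rewrite fg// -[in RHS](cat_take_drop k w) dk size_cat addn1.
Qed.

(** The recursive rule of [br], read on generating series. *)
Lemma dynE f : dyn f =
  \sum_i (lett i * dyn (sh i f) - dyn (sh i f) * lett i + f [:: i] *: lett i).
Proof.
apply/funext => v; rewrite ser_sumE.
case: v => [|j v].
  rewrite dyn_nil big1// => i _; rewrite serDE serBE lettM_nil serM_nil dyn_nil.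
  by rewrite mul0r subr0 add0r serZE /lett mulr0.
rewrite {1}/dyn [size _]/= big_words_recl; apply: eq_bigr => i _.
rewrite serDE serBE lettM_cons.
case: v => [|l v].
  rewrite /= big_seq1 dyn_nil mulr0 sub0r serM_cons /= serM_nil.
  rewrite /= dyn_nil mul0r add0r {1}/lett mulr0 oppr0 add0r serZE.
  by rewrite /lett.
have -> : (f [:: i] *: lett i) [:: j, l & v] = 0.
  by rewrite serZE /lett eqseq_cons andbF mulr0.
rewrite addr0.
rewrite (@serM_lettr_cong i _ (\sum_(w <- words (size (l :: v))) f (i :: w) *: br w)); last first.
  by move=> u [/= us]; rewrite /dyn ser_sumE us; apply: eq_bigr.
rewrite mulr_suml ser_sumE {1}/dyn mulr_sumr -sumrB big_seq [RHS]big_seq.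
apply: eq_bigr => w; rewrite mem_words => /eqP ws.
case: w ws => [//|m w] _; rewrite [br (i :: _)]/= -/(br (m :: w)) serBE lettM_cons.
by rewrite -scalerAl serZE /sh; ring.
Qed.

Lemma dyn_vecM a f : dyn (vec a * f) = vec a * dyn f - dyn f * vec a + f [::] *: vec a.
Proof.
rewrite dynE; under eq_bigr do rewrite sh_vecM dynZ vecM_cons.
rewrite /vec mulr_suml mulr_sumr scaler_sumr -sumrB -big_split; apply: eq_bigr => i _ /=.
by rewrite -!scalerAr -!scalerAl scalerA (mulrC (f [::])).
Qed.

Definition sdeg f : ser := fun w => (size w)%:R * f w.

(** Group-like series, characterized by Dynkin's identity. Contrary to the shuffle
  relations, it is a single equation between products, which passes to limits
  and shows at once that the leading part of [z] is a Lie polynomial. *)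
Definition GL z := z [::] = 1 /\ sdeg z = dyn z * z.

Lemma sdeg_vecM a f : sdeg (vec a * f) = vec a * f + vec a * sdeg f.
Proof.
apply/funext => -[|i w]; rewrite /sdeg serDE.
  by rewrite !vecM_nil mulr0 addr0.
by rewrite !vecM_cons /= -natr1; ring.
Qed.

(** ** Differentiating one-parameter families of series *)

(** [F'] is the derivative of [F], coefficient by coefficient. *)
Definition dser (F F' : R -> ser) :=
  forall w (t : R), is_derive t 1 (fun s : R => F s w : R^o) (F' t w).

Lemma is_derive_bigsum (I : Type) (s : seq I) (F : I -> R -> R) (F' : I -> R) (t : R) :
  (forall i, is_derive t 1 (F i : R -> R^o) (F' i)) ->
  is_derive t 1 (fun x => \sum_(i <- s) F i x : R^o) (\sum_(i <- s) F' i).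
Proof.
move=> h; elim: s => [|i s IH].
  rewrite big_nil; under [X in is_derive _ _ X]eq_fun do rewrite big_nil.
  exact: is_derive_cst.
rewrite big_cons; under [X in is_derive _ _ X]eq_fun do rewrite big_cons.
exact: is_deriveD.
Qed.

Lemma dserM F F' G G' : dser F F' -> dser G G' ->
  dser (fun t => F t * G t) (fun t => F' t * G t + F t * G' t).
Proof.
move=> dF dG w t; under [X in is_derive _ _ X]eq_fun do rewrite serME.
rewrite serDE !serME -big_split /=.
apply: is_derive_bigsum => k /=.
apply: is_derive_eq; first exact: (@is_deriveM _ _ _ _ _ _ _ _ (dF _ t) (dG _ t)).
by rewrite /GRing.scale /=; ring.
Qed.

Lemma dser_dyn F F' : dser F F' -> dser (fun t => dyn (F t)) (fun t => dyn (F' t)).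
Proof.
move=> dF w t; apply: is_derive_bigsum => v /=.
rewrite mulrC; under [X in is_derive _ _ X]eq_fun do rewrite mulrC.
exact: (@is_deriveZ _ _ _ (fun s : R => F s v : R^o) (br v w) t 1 _ (dF v t)).
Qed.

Lemma dser_sdeg F F' : dser F F' -> dser (fun t => sdeg (F t)) (fun t => sdeg (F' t)).
Proof.
move=> dF w t.
exact: (@is_deriveZ _ _ _ (fun s : R => F s w : R^o) (size w)%:R t 1 _ (dF w t)).
Qed.

Lemma dserB F F' G G' : dser F F' -> dser G G' ->
  dser (fun t => F t - G t) (fun t => F' t - G' t).
Proof.
move=> dF dG w t.
exact: (@is_deriveB _ _ _ (fun s : R => F s w : R^o) (fun s : R => G s w : R^o)
  t 1 _ _ (dF w t) (dG w t)).
Qed.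

Lemma dser_cst f : dser (fun=> f) (fun=> 0).
Proof. by move=> w t; exact: is_derive_cst. Qed.

Lemma dser_exp a : dser (fun t => sexp (t *: a)) (fun t => vec a * sexp (t *: a)).
Proof.
move=> w t; rewrite /sexp; under [X in is_derive _ _ X]eq_fun do rewrite monZ.
case: w => [|i w].
  rewrite vecM_nil mon_nil /= fact0.
  under [X in is_derive _ _ X]eq_fun do rewrite expr0 mul1r divr1.
  exact: is_derive_cst.
rewrite vecM_cons mon_cons monZ.
pose c := a 0 i * mon a w / (size (i :: w))`!%:R.
rewrite (_ : (fun s : R => _) = (c \*: (fun s : R => s ^+ (size w).+1 : R^o))%R); last first.
  by apply/funext => s; rewrite /c /GRing.scale [RHS]mulrC !mulrA.
have dX : is_derive t 1 (fun s : R => s ^+ (size w).+1 : R^o) ((size w).+1%:R * t ^+ size w).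
  by apply: DeriveDef; [exact: exprn_derivable|rewrite exp_derive /GRing.scale /= mulr1].
have := @is_deriveZ _ _ _ _ c t 1 _ dX.
rewrite (_ : c *: _ = a 0 i * (t ^+ size w * mon a w / (size w)`!%:R)) //.
rewrite /GRing.scale /= /c /= factS natrM.
have k0 : ((size w).+1%:R : R) != 0 by rewrite pnatr_eq0.
by rewrite invfM; move: (_.+1%:R) k0 => k k0; field; rewrite k0 fact_neq0.
Qed.

(** Group-like series are stable under left multiplication by exponentials: the
  defect in Dynkin's identity along [t |-> exp(ta) z] solves a linear equation
  with zero initial value, coefficient by coefficient. *)
Lemma GL_exp a z : GL z -> GL (sexp a * z).
Proof.
move=> [z1 zD]; split; first by rewrite serM_nil sexp_nil z1 mulr1.
pose Z t := sexp (t *: a) * z.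
pose Phi t := sdeg (Z t) - dyn (Z t) * Z t.
have dZ : dser Z (fun t => vec a * Z t).
  move=> w t; apply: is_derive_eq; first exact: (dserM (dser_exp a) (dser_cst z)).
  by rewrite mulr0 addr0 mulrA.
have Z1 t : Z t [::] = 1 by rewrite /Z serM_nil sexp_nil z1 mulr1.
have dPhi : dser Phi (fun t => vec a * Phi t).
  move=> w t; apply: is_derive_eq.
    exact: (dserB (dser_sdeg dZ) (dserM (dser_dyn dZ) dZ)).
  cbv beta; rewrite sdeg_vecM dyn_vecM Z1 scale1r /Phi; congr (_ w).
  rewrite !mulrDl mulrDr mulNr mulrN !mulrA.
  have aux (V : zmodType) (c b e d : V) : c + b - (d - e + c + e) = b - d.
    by rewrite (addrAC _ c) subrK (addrC c b) opprD addrACA subrr addr0.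
  exact: aux.
have Phi0 w t : Phi t w = 0.
  elim: w t => [|i w IH] t.
    by rewrite /Phi serBE serM_nil /sdeg mul0r dyn_nil mul0r subr0.
  have d0 (x : R) : is_derive x (1:R) (fun s : R => Phi s (i :: w) : R^o) 0.
    by apply: is_derive_eq; first exact: dPhi; rewrite vecM_cons IH mulr0.
  rewrite (@is_derive_0_is_cst _ _ t 0 d0) /Phi /Z scale0r sexp0 mul1r.
  by rewrite serBE zD subrr.
apply/funext => w; have := Phi0 w 1; rewrite /Phi /Z scale1r serBE.
by move/eqP; rewrite subr_eq0 => /eqP.
Qed.

Lemma GL1 : GL 1.
Proof.
split => //; apply/funext => w; rewrite mulr1 /sdeg ser1E.
case: w => [|i w]; first by rewrite mul0r dyn_nil.
rewrite mulr0 /dyn big_seq big1// => v; rewrite mem_words => /eqP vs.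
by case: v vs => // j v _; rewrite ser1E mul0r.
Qed.

(** Dynkin's identity in the lowest nontrivial degree: there [z] is the
  combination of brackets obtained from its own coefficients, a Lie
  polynomial. *)
Lemma GL_lie k z w : GL z -> eqN k z 1 -> size w = k.+1 ->
  z w = \sum_(v <- words k.+1) z v / k.+1%:R * br v w.
Proof.
move=> [z1 /(congr1 (fun F => F w))] + zk ws.
rewrite /sdeg ws.
rewrite (_ : (dyn z * z) w = dyn z w); last first.
  rewrite serME ws big_ord_recr /= -ws take_size drop_size z1 mulr1.
  rewrite big1 ?add0r// => -[j /= jk] _.
  rewrite (_ : dyn z _ = 0) ?mul0r// /dyn big_seq big1// => v.
  rewrite mem_words size_takel; last exact: ltnW.
  move=> /eqP vj; rewrite zk ?vj//; last by rewrite -ltnS -ws.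
  rewrite ser1E; case: v vj => [|i v]; last by rewrite mul0r.
  by rewrite mul1r /=.
rewrite /dyn ws => e.
have k0 : (k.+1%:R : R) != 0 by rewrite pnatr_eq0.
apply: (mulfI k0); rewrite e mulr_sumr; apply: eq_bigr => v _.
by rewrite mulrA mulrCA mulfV// mulr1.
Qed.

End Series.
Arguments words {r} k : simpl never.

(** * The Euclidean norm *)

Section Enorm.
Context {R : realType} {r : nat}.
Implicit Types (a b : 'rV[R]_r).
Local Notation enorm := (@euclidean_norm R r).

Definition dotp a b : R := \sum_i a ord0 i * b ord0 i.

Lemma dotpC a b : dotp a b = dotp b a.
Proof. by apply: eq_bigr => i _; rewrite mulrC. Qed.
Lemma dotpDl a b c : dotp (a + b) c = dotp a c + dotp b c.
Proof. by rewrite -big_split; apply: eq_bigr => i _ /=; rewrite mxE mulrDl. Qed.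
Lemma dotpZl (t : R) a b : dotp (t *: a) b = t * dotp a b.
Proof. by rewrite mulr_sumr; apply: eq_bigr => i _; rewrite mxE mulrA. Qed.
Lemma dotpDr a b c : dotp c (a + b) = dotp c a + dotp c b.
Proof. by rewrite dotpC dotpDl !(dotpC c). Qed.
Lemma dotpZr (t : R) a b : dotp b (t *: a) = t * dotp b a.
Proof. by rewrite dotpC dotpZl dotpC. Qed.

Lemma dotp_ge0 a : 0 <= dotp a a.
Proof. by apply: sumr_ge0 => i _; rewrite -expr2 sqr_ge0. Qed.

Lemma dotp_eq0 a : dotp a a = 0 -> a = 0.
Proof.
move=> h; apply/rowP => i; rewrite mxE; apply/eqP; rewrite -sqrf_eq0; apply/eqP.
move: h; rewrite /dotp (bigD1 i) //= => /eqP.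
rewrite paddr_eq0; first by case/andP => /eqP; rewrite -expr2.
- by rewrite -expr2 sqr_ge0.
- by apply: sumr_ge0 => j _; rewrite -expr2 sqr_ge0.
Qed.

Lemma enorm_sqr a : enorm a ^+ 2 = dotp a a.
Proof.
rewrite /euclidean_norm sqr_sqrtr; first by apply: eq_bigr => i _; rewrite expr2.
by apply: sumr_ge0 => i _; rewrite sqr_ge0.
Qed.

Lemma enorm_ge0 a : 0 <= enorm a. Proof. exact: sqrtr_ge0. Qed.

Lemma enorm_eq0 a : enorm a = 0 -> a = 0.
Proof. by move=> h; apply: dotp_eq0; rewrite -enorm_sqr h expr0n. Qed.

Lemma cauchy_schwarz a b : dotp a b <= enorm a * enorm b.
Proof.
have [/enorm_eq0 ->|b0] := eqVneq (enorm b) 0.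
  rewrite -(scale0r 0) dotpZr mul0r mulr_ge0 ?enorm_ge0//.
have B0 : 0 < enorm b by rewrite lt_def b0 enorm_ge0.
have := dotp_ge0 (enorm b ^+ 2 *: a - dotp a b *: b).
rewrite -scaleNr !dotpDl !dotpDr !dotpZl !dotpZr (dotpC b a) -!enorm_sqr.
set c := dotp a b; set A := enorm a; set B := enorm b => h.
have h2 : c ^+ 2 <= (A * B) ^+ 2.
  have e : B ^+ 2 * ((A * B) ^+ 2 - c ^+ 2) = B ^+ 2 * (B ^+ 2 * A ^+ 2) +
      B ^+ 2 * (- c * c) + (- c * (B ^+ 2 * c) + - c * (- c * B ^+ 2)) by ring.
  by move: h; rewrite -e pmulr_rge0 ?exprn_gt0// subr_ge0.
have [|c0] := leP c 0; first by move=> c0; apply: (le_trans c0); rewrite mulr_ge0 ?enorm_ge0.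
have AB0 : 0 <= A * B by rewrite mulr_ge0 ?enorm_ge0.
by move: h2; rewrite ler_pXn2r// nnegrE ltW.
Qed.

Lemma enormZ (t : R) a : enorm (t *: a) = `|t| * enorm a.
Proof.
apply/eqP; rewrite -(eqrXn2 (n := 2))// ?mulr_ge0 ?enorm_ge0//.
by rewrite enorm_sqr exprMn enorm_sqr dotpZl dotpZr mulrA -expr2 real_normK// num_real.
Qed.

Lemma enormN a : enorm (- a) = enorm a.
Proof. by rewrite -scaleN1r enormZ normrN1 mul1r. Qed.
Lemma enorm0 : enorm 0 = 0.
Proof. by rewrite -(scale0r 0) enormZ normr0 mul0r. Qed.

Lemma enormD a b : enorm (a + b) <= enorm a + enorm b.
Proof.
rewrite -(ler_pXn2r (n := 2))// ?nnegrE ?addr_ge0 ?enorm_ge0//.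
rewrite enorm_sqr dotpDl !dotpDr (dotpC b a) -!enorm_sqr.
have := cauchy_schwarz a b; nra.
Qed.

Lemma coord_le_enorm a i : `|a ord0 i| <= enorm a.
Proof.
rewrite -(ler_pXn2r (n := 2))// ?nnegrE ?enorm_ge0// enorm_sqr.
rewrite real_normK ?num_real// /dotp (bigD1 i)//= -expr2 lerDl.
by apply: sumr_ge0 => j _; rewrite -expr2 sqr_ge0.
Qed.

Lemma enorm_delta i : enorm (delta_mx 0 i) = 1.
Proof.
apply/eqP; rewrite -(eqrXn2 (n := 2))// ?enorm_ge0// enorm_sqr expr1n; apply/eqP.
rewrite /dotp (bigD1 i)//= big1 ?addr0 => [|j ji].
  by rewrite mxE eqxx mulr1.
by rewrite mxE eqxx (negbTE ji) mulr0.
Qed.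

End Enorm.

(** * Piecewise linear paths and their signatures *)

Section Paths.
Context {R : realType} {r : nat}.
Local Notation ser := (ser R r).
Local Notation enorm := (@euclidean_norm R r).
Implicit Types (f g h z : ser) (w u : seq 'I_r) (a b : 'rV[R]_r) (N k : nat)
  (v p q : seq 'rV[R]_r).

(** The signature of the broken line with successive steps [v]. *)
Definition sig v : ser := \prod_(a <- v) sexp a.
Definition len v : R := \sum_(a <- v) enorm a.
Definition inv v := rev [seq - a | a <- v].

Lemma sig_cat p q : sig (p ++ q) = sig p * sig q. Proof. exact: big_cat. Qed.
Lemma sig_cons a q : sig (a :: q) = sexp a * sig q. Proof. exact: big_cons. Qed.
Lemma sig_nil : sig [::] = 1. Proof. exact: big_nil. Qed.
Lemma len_cat p q : len (p ++ q) = len p + len q. Proof. exact: big_cat. Qed.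
Lemma len_cons a q : len (a :: q) = enorm a + len q. Proof. exact: big_cons. Qed.
Lemma len_nil : len [::] = 0. Proof. exact: big_nil. Qed.
Lemma len_ge0 v : 0 <= len v.
Proof. by apply: sumr_ge0 => a _; exact: enorm_ge0. Qed.

Lemma sig_nil1 v : sig v [::] = 1.
Proof.
by elim: v => [|a v IH]; rewrite ?sig_nil// sig_cons serM_nil sexp_nil IH mulr1.
Qed.

Lemma inv_cons a v : inv (a :: v) = inv v ++ [:: - a].
Proof. by rewrite /inv /= rev_cons cats1. Qed.

Lemma sig_invr v : sig v * sig (inv v) = 1.
Proof.
elim: v => [|a v IH]; first by rewrite !sig_nil mulr1.
rewrite inv_cons sig_cat !sig_cons sig_nil mulr1 mulrA -(mulrA (sexp a)) IH.
by rewrite mulr1 sexpNr.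
Qed.
Lemma sig_invl v : sig (inv v) * sig v = 1.
Proof.
elim: v => [|a v IH]; first by rewrite !sig_nil mulr1.
rewrite inv_cons sig_cat !sig_cons sig_nil mulr1 -mulrA (mulrA _ (sexp a)).
by rewrite sexpNl mul1r.
Qed.
Lemma len_inv v : len (inv v) = len v.
Proof.
elim: v => [//|a v IH]; rewrite inv_cons len_cat !len_cons len_nil addr0 enormN IH.
by rewrite addrC.
Qed.

Lemma GL_sigM v z : GL z -> GL (sig v * z).
Proof.
move=> gz; elim: v => [|a v IH]; first by rewrite sig_nil mul1r.
by rewrite sig_cons -mulrA; exact: GL_exp.
Qed.
Lemma GL_sig v : GL (sig v).
Proof. by rewrite -[sig v]mulr1; apply: GL_sigM; exact: GL1. Qed.

(** The growth of the signatures of paths of length [c]; it is multiplicative by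
  the binomial theorem. *)
Definition bnd (c : R) f := forall w, `|f w| <= c ^+ size w / (size w)`!%:R.

Lemma bnd_exp a : bnd (enorm a) (sexp a).
Proof.
move=> w; rewrite /sexp normrM normfV (ger0_norm (ler0n _ _)).
rewrite ler_pM2r ?invr_gt0 ?ltr0n ?fact_gt0//.
elim: w => [|i w IH]; first by rewrite mon_nil normr1 expr0.
by rewrite mon_cons normrM exprS ler_pM// coord_le_enorm.
Qed.

Lemma bndM c d f g : 0 <= c -> 0 <= d -> bnd c f -> bnd d g -> bnd (c + d) (f * g).
Proof.
move=> c0 d0 hf hg w; rewrite serME; apply: (le_trans (ler_norm_sum _ _ _)).
rewrite addrC exprDn mulr_suml; apply: ler_sum => -[k hk] _ /=.
have kw : (k <= size w)%N by [].
rewrite normrM; apply: (le_trans (ler_pM _ _ (hf _) (hg _))) => //.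
rewrite size_drop size_takel// -[_ *+ 'C(_, _)]mulr_natr.
have -> : (size w)`!%:R = 'C(size w, k)%:R * (k`!%:R * (size w - k)`!%:R) :> R.
  by rewrite -(bin_fact kw) !natrM.
have : ('C(size w, k)%:R : R) != 0 by rewrite pnatr_eq0 -lt0n bin_gt0.
have := @fact_neq0 R k; have := @fact_neq0 R (size w - k).
move: ('C(_, _)%:R) (k`!%:R) ((_ - _)`!%:R) => x y z x0 y0 z0.
rewrite le_eqVlt; apply/orP; left; apply/eqP; field.
by rewrite x0 y0 z0.
Qed.

Lemma bnd_sig v : bnd (len v) (sig v).
Proof.
elim: v => [|a v IH]; last first.
  by rewrite sig_cons len_cons; apply: bndM => //; rewrite ?enorm_ge0 ?len_ge0//; exact: bnd_exp.
move=> w; rewrite sig_nil len_nil ser1E; case: w => [|i w]; last first.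
  by rewrite normr0 exprS !mul0r.
by rewrite /= fact0 divr1 normr1.
Qed.

Lemma sig_le v w : `|sig v w| <= len v ^+ size w.
Proof.
apply: (le_trans (bnd_sig v w)); rewrite ler_pdivrMr ?ltr0n ?fact_gt0//.
by rewrite ler_peMr ?exprn_ge0 ?len_ge0// ler1n fact_gt0.
Qed.

(** ** Dilations and linear changes of letters *)

(** The automorphism induced by the dilation of ratio [t] of the letters. *)
Definition dil (t : R) f : ser := fun w => t ^+ size w * f w.

Lemma dilM t f g : dil t (f * g) = dil t f * dil t g.
Proof.
apply/funext => w; rewrite /dil !serME mulr_sumr; apply: eq_bigr => -[k hk] _ /=.
rewrite size_drop size_takel// -{1}(@subnKC k (size w))// exprD.
by ring.
Qed.
Lemma dil1 t : dil t 1 = 1.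
Proof.
apply/funext => w; rewrite /dil ser1E; case: w => [|i w]; first by rewrite mul1r.
by rewrite mulr0.
Qed.
Lemma dil_exp t a : dil t (sexp a) = sexp (t *: a).
Proof. by apply/funext => w; rewrite /dil /sexp monZ mulrA. Qed.
Definition scl (t : R) v := [seq t *: a | a <- v].
Lemma sig_scl t v : sig (scl t v) = dil t (sig v).
Proof.
elim: v => [|a v IH]; first by rewrite sig_nil dil1.
by rewrite /= !sig_cons IH dilM dil_exp.
Qed.
Lemma len_scl t v : len (scl t v) = `|t| * len v.
Proof.
elim: v => [|a v IH]; first by rewrite !len_nil mulr0.
by rewrite /= !len_cons IH enormZ mulrDr.
Qed.
Lemma eqN_dil t N f g : eqN N f g -> eqN N (dil t f) (dil t g).
Proof. by move=> h w hw; rewrite /dil h. Qed.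
Lemma dil_comp s t f : dil s (dil t f) = dil (s * t) f.
Proof. by apply/funext => w; rewrite /dil exprMn mulrA. Qed.
Lemma dil_id f : dil 1 f = f.
Proof. by apply/funext => w; rewrite /dil expr1n mul1r. Qed.

Section Push.
Variable P : 'M[R]_r.

Fixpoint push_rec f w : R :=
  if w is j :: u then \sum_i P i j * push_rec (sh i f) u else f [::].
(** The algebra endomorphism induced by the linear substitution [P] of the
  letters, computed letter by letter. *)
Definition push f : ser := push_rec f.

Lemma push_nil f : push f [::] = f [::]. Proof. by []. Qed.
Lemma push_cons f j u : push f (j :: u) = \sum_i P i j * push (sh i f) u.
Proof. by []. Qed.
Lemma pushD f g : push (f + g) = push f + push g.
Proof.
apply/funext => w; rewrite serDE; elim: w f g => [//|j u IH] f g.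
rewrite !push_cons -big_split; apply: eq_bigr => i _ /=.
by rewrite (_ : sh i (f + g) = sh i f + sh i g)// IH mulrDr.
Qed.
Lemma pushZ c f : push (c *: f) = c *: push f.
Proof.
apply/funext => w; rewrite serZE; elim: w f => [//|j u IH] f.
rewrite !push_cons mulr_sumr; apply: eq_bigr => i _ /=.
by rewrite (_ : sh i (c *: f) = c *: sh i f)// IH mulrCA.
Qed.
Lemma pushM f g : push (f * g) = push f * push g.
Proof.
apply/funext => w; elim: w f g => [//|j u IH] f g.
rewrite serM_cons !push_cons push_nil.
rewrite (_ : sh j (push f) = \sum_i P i j *: push (sh i f)); last first.
  by apply/funext => x; rewrite /sh push_cons ser_sumE.
rewrite mulr_suml ser_sumE mulr_sumr -big_split; apply: eq_bigr => i _ /=.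
rewrite (_ : sh i (f * g) = f [::] *: sh i g + sh i f * g); last first.
  by apply/funext => x; rewrite /sh serM_cons.
by rewrite pushD pushZ serDE serZE IH -scalerAl serZE; ring.
Qed.
Lemma push_mon (c : nat -> R) a :
  push (fun w => c (size w) * mon a w) = (fun w => c (size w) * mon (a *m P) w).
Proof.
apply/funext => w; elim: w c => [|j u IH] c; first by rewrite push_nil /= !mon_nil.
rewrite push_cons mon_cons mxE mulr_suml mulr_sumr; apply: eq_bigr => i _.
rewrite (_ : sh i _ = a 0 i *: ((fun w => c (size w).+1 * mon a w) : ser)); last first.
  by apply/funext => x; rewrite /sh serZE mon_cons /=; ring.
by rewrite pushZ serZE (IH (fun n => c n.+1)) /=; ring.
Qed.
Lemma push_exp a : push (sexp a) = sexp (a *m P).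
Proof.
transitivity (push (fun w => (fun n => n`!%:R^-1) (size w) * mon a w)).
  by congr push; apply/funext => w; rewrite /sexp mulrC.
apply: (etrans (push_mon (fun n => n`!%:R^-1) a)).
by apply/funext => w; rewrite /sexp mulrC.
Qed.
Lemma push1 : push 1 = 1.
Proof. by rewrite -sexp0 push_exp mul0mx. Qed.
Lemma sig_push v : sig [seq a *m P | a <- v] = push (sig v).
Proof.
elim: v => [|a v IH]; first by rewrite sig_nil push1.
by rewrite /= !sig_cons IH pushM push_exp.
Qed.
Lemma eqN_push N f g : eqN N f g -> eqN N (push f) (push g).
Proof.
move=> fg w wN; elim: w N f g wN fg => [|j u IH] N f g wN fg.
  by rewrite !push_nil fg.
case: N wN fg => // N wN fg.
rewrite !push_cons; apply: eq_bigr => i _; congr (_ * _); apply: (IH N) => //.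
by move=> x xN; apply: fg.
Qed.
Lemma push_lett i : push (lett i) = vec (row i P).
Proof.
apply/funext => w; rewrite -[RHS]/(vec _ w) -[vec _]mulr1.
case: w => [|j u]; first by rewrite vecM_nil push_nil.
rewrite vecM_cons mxE push_cons (bigD1 i)//= big1 => [|l li].
  rewrite addr0; congr (_ * _).
  rewrite (_ : sh i (lett i) = 1) ?push1//.
  by apply/funext => x; rewrite /sh /lett eqseq_cons eqxx.
have -> : sh l (lett i) = (0 : R) *: (1 : ser).
  by apply/funext => x; rewrite /sh /lett eqseq_cons (negbTE li) serZE mul0r.
by rewrite pushZ scale0r mulr0.
Qed.

End Push.

Lemma serM_recr f g w : (f * g) w =
  \sum_(k < size w) f (take k w) * g (drop k w) + f w * g [::].
Proof. by rewrite serME big_ord_recr /= take_size drop_size. Qed.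

(** ** Loops realizing iterated brackets *)

(** [z] is, up to words of length [N], the signature of a broken line of length at
  most [L]. *)
Definition reach N z (L : R) := exists2 v, eqN N (sig v) z & len v <= L.

Lemma reachM N z z' L L' : reach N z L -> reach N z' L' -> reach N (z * z') (L + L').
Proof.
move=> [v vz vL] [v' vz' vL']; exists (v ++ v'); last by rewrite len_cat lerD.
by rewrite sig_cat; apply: eqN_mul.
Qed.
Lemma reach_le N z L L' : L <= L' -> reach N z L -> reach N z L'.
Proof. by move=> LL [v vz vL]; exists v => //; apply: le_trans LL. Qed.
Lemma reach_dil N z L t : reach N z L -> reach N (dil t z) (`|t| * L).
Proof.
move=> [v vz vL]; exists (scl t v); first by rewrite sig_scl; exact: eqN_dil.
by rewrite len_scl ler_wpM2l.
Qed.

Lemma serM_low_cong (p q : nat) f f' g g' :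
  (forall u, (size u < p)%N -> f u = 0) -> (forall u, (size u < q)%N -> g u = 0) ->
  eqN p f f' -> eqN q g g' -> eqN (p + q) (f * g) (f' * g').
Proof.
move=> f0 g0 ff gg w; rewrite leq_eqVlt => /orP[/eqP ws|ws].
  have f0' u : (size u < p)%N -> f' u = 0 by move=> vp; rewrite -ff ?f0// ltnW.
  have g0' u : (size u < q)%N -> g' u = 0 by move=> vp; rewrite -gg ?g0// ltnW.
  rewrite (serM_low_eq f0 g0)// (serM_low_eq f0' g0')// ff ?gg//.
    by rewrite size_drop ws; lia.
  by rewrite size_take; case: ifP => //; lia.
rewrite (serM_low f0 g0)// (serM_low (p := p) (q := q))//.
- by move=> v vp; rewrite -ff ?f0// ltnW.
- by move=> v vp; rewrite -gg ?g0// ltnW.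
Qed.

(** The group commutator of an exponential with a group-like series [1 + y + ..],
  [y] homogeneous of degree [k], has leading term the bracket with [y]. *)
Lemma comm_lead k i (s : R) f f' (y : ser) : (0 < k)%N -> f * f' = 1 ->
  (forall u, size u != k -> y u = 0) -> eqN k f (1 + y) ->
  eqN k.+1 (sexp (s *: delta_mx 0 i) * (f * (sexp (- (s *: delta_mx 0 i)) * f')))
    (1 + s *: (lett i * y - y * lett i)).
Proof.
move=> k0 ff' yk fy; set a := s *: delta_mx 0 i; set E := sexp a.
set E' := sexp (- a).
have EE' : E * E' = 1 by exact: sexpNr.
pose d := E * f - f * E.
have dE : d = (E - 1) * (f - 1) - (f - 1) * (E - 1).
  have -> : (E - 1) * (f - 1) = E * f - (E + f - 1).
    by rewrite mulrBl mulrBr mul1r mulr1 -addrA -opprD addrA.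
  have -> : (f - 1) * (E - 1) = f * E - (E + f - 1).
    by rewrite mulrBl mulrBr mul1r mulr1 -addrA -opprD addrA (addrC f E).
  have aux (V : zmodType) (x x' o : V) : x - x' = x - o - (x' - o).
    by rewrite opprB addrA subrK.
  exact: aux.
have flow (v : seq 'I_r) : (size v < k)%N -> (f - 1) v = 0.
  move=> vk; have fv : f v = (1 + y) v by apply: fy; exact: ltnW.
  have yv : y v = 0 by apply: yk; rewrite neq_ltn vk.
  by rewrite serBE fv serDE yv addr0 subrr.
have fy' : eqN k (f - 1) y.
  move=> v vk; have fv : f v = (1 + y) v by exact: fy.
  by rewrite serBE fv serDE addrC addKr.
have Elow (v : seq 'I_r) : (size v < 1)%N -> (E - 1) v = 0.
  by case: v => // _; rewrite serBE /E sexp_nil ser1E subrr.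
have El : eqN 1 (E - 1) (s *: lett i).
  case=> [|j [|//]] _; first by rewrite Elow// serZE /lett mulr0.
  rewrite serBE /E sexp_one ser1E subr0 /a mxE mxE eqxx serZE /lett /=.
  by rewrite eqseq_cons eqxx andbT.
have d1 : eqN k.+1 d (s *: (lett i * y - y * lett i)).
  move=> w wk; rewrite dE serBE (serM_low_cong Elow flow El fy' wk).
  rewrite (serM_low_cong flow Elow fy' El); last by rewrite addn1.
  by rewrite scalerBr serBE -scalerAl -scalerAr.
have dlow (v : seq 'I_r) : (size v < k.+1)%N -> d v = 0.
  move=> vk; rewrite (d1 v (ltnW vk)) serZE.
  rewrite serBE (_ : (lett i * y) v = 0).
    have -> : (y * lett i) v = 0; last by rewrite subrr mulr0.
    apply: (@serM_low _ _ k 1); last by rewrite addn1.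
      by move=> u uk; apply: yk; rewrite neq_ltn uk.
    by case.
  case: v vk => [|j v] vk; first by rewrite lettM_nil.
  by rewrite lettM_cons yk ?mulr0 // neq_ltn -ltnS vk.
have -> : E * (f * (E' * f')) = 1 + d * (E' * f').
  rewrite /d mulrBl !mulrA -(mulrA f E) EE' mulr1 ff'.
  by rewrite addrC subrK.
move=> w wk; rewrite !serDE; congr (_ + _).
rewrite -(d1 w wk) serM_recr serM_nil /E' sexp_nil.
have f'1 : f' [::] = 1.
  have f1 : f [::] = 1.
    have -> : f [::] = (1 + y) [::] by exact: fy.
    by rewrite serDE ser1E yk ?addr0// neq_ltn k0.
  have := congr1 (fun F => F [::]) ff'; rewrite serM_nil f1 ser1E mul1r; exact.
rewrite f'1 !mulr1 [X in X + _]big1 ?add0r// => -[j jw] _.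
have tk : size (take j w) = j by apply: size_takel; exact: ltnW.
have dj : d (take j w) = 0 by apply: dlow; rewrite tk; exact: leq_trans jw wk.
by rewrite dj mul0r.
Qed.

(** The nested commutator loop whose signature has [br w] as leading part. *)
Fixpoint cpath (w : seq 'I_r) (s : R) : seq 'rV[R]_r := match w with
  | [::] => [::]
  | [:: i] => [:: s *: delta_mx 0 i]
  | i :: u => (s *: delta_mx 0 i) ::
      (cpath u s ++ (- (s *: delta_mx 0 i)) :: inv (cpath u s))
  end.

Lemma cpath_sig w (s : R) : (0 < size w)%N ->
  eqN (size w) (sig (cpath w s)) (1 + s ^+ size w *: br w).
Proof.
elim: w => [//|i [|j u] IH] _.
  move=> [|j [|//]] _; rewrite [cpath _ _]/= sig_cons sig_nil mulr1.
    by rewrite sexp_nil serDE ser1E serZE /lett mulr0 addr0.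
  rewrite sexp_one serDE ser1E serZE !mxE eqxx add0r expr1 /= /lett.
  by rewrite eqseq_cons eqxx andbT.
rewrite [cpath _ _]/= -/(cpath (j :: u) s) [br _]/= -/(br (j :: u)).
rewrite sig_cons sig_cat sig_cons.
have := IH isT; move: (j :: u) (isT : 0 < size (j :: u))%N => {IH} {}u u0 IH.
have yk (v : seq 'I_r) : size v != size u -> (s ^+ size u *: br u) v = 0.
  by move=> vu; rewrite serZE br_homog ?mulr0.
have := comm_lead i s u0 (sig_invr (cpath u s)) yk IH.
rewrite -scalerAr -scalerAl -scalerBr scalerA -exprS; exact.
Qed.

Lemma cpath_len w (s : R) : len (cpath w s) <= 4 ^+ size w * `|s|.
Proof.
elim: w => [|i [|j u] IH]; first by rewrite len_nil mul1r.
  by rewrite len_cons len_nil addr0 enormZ enorm_delta mulr1 expr1 ler_peMl// ler1n.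
rewrite [cpath _ _]/= -/(cpath (j :: u) s).
rewrite len_cons len_cat len_cons len_inv enormN enormZ enorm_delta mulr1.
rewrite [size _]/= exprS -mulrA.
have h : `|s| <= 4 ^+ size (j :: u) * `|s| by rewrite ler_peMl// exprn_ege1// ler1n.
rewrite -[(size u).+1]/(size (j :: u)).
set A := (_ ^+ _ * _) in h IH *.
have -> : 4 * A = A + (A + (A + A)) by ring.
by rewrite !lerD.
Qed.

Lemma sig_inv_lead k (y : ser) v : (0 < k)%N -> (forall u, size u != k -> y u = 0) ->
  eqN k (sig v) (1 + y) -> eqN k (sig (inv v)) (1 - y).
Proof.
move=> k0 yk vy.
have : eqN k (sig (inv v) * (sig v * (1 - y))) (sig (inv v) * 1).
  apply: eqN_mul => // w wk.
  rewrite (eqN_mul vy (eqN_refl (1 - y)) wk).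
  rewrite mulrDl mul1r mulrBr mulr1 addrA subrK serBE.
  rewrite (@serM_low _ _ k k) ?subr0//.
  - by move=> u uk; rewrite yk// neq_ltn uk.
  - by move=> u uk; rewrite yk// neq_ltn uk.
  - lia.
by rewrite mulrA sig_invl mul1r mulr1; exact: eqN_sym.
Qed.

Lemma exists_root k (c : R) : 0 <= c -> exists2 s : R, 0 <= s & s ^+ k.+1 = c.
Proof.
move=> c0; exists (c `^ k.+1%:R^-1); first exact: powR_ge0.
by rewrite -powR_mulrn ?powR_ge0// -powRrM mulVf ?pnatr_eq0// powRr1.
Qed.

Lemma brs_homog k (c : seq 'I_r -> R) (ws : seq (seq 'I_r)) (u : seq 'I_r) :
  (forall w, w \in ws -> size w = k) -> size u != k ->
  (\sum_(w <- ws) c w *: br w) u = 0.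
Proof.
move=> hk uk; rewrite ser_sumE big_seq big1// => x xws.
by rewrite serZE br_homog ?mulr0// (hk _ xws).
Qed.

(** The loops [cpath], scaled by roots of the coefficients and run one after the
  other: a homogeneous Lie polynomial is the leading part of the signature of a
  loop whose length is of the order of the root of its size. *)
Lemma lie_reach k (c : seq 'I_r -> R) (L : R) (ws : seq (seq 'I_r)) :
  0 <= L -> (forall w, w \in ws -> size w = k.+1) ->
  (forall w, w \in ws -> `|c w| <= L ^+ k.+1) ->
  exists2 v, eqN k.+1 (sig v) (1 + \sum_(w <- ws) c w *: br w) &
    len v <= (size ws)%:R * (4 ^+ k.+1 * L).
Proof.
move=> L0; elim: ws => [|w ws IH] hk hc.
  exists [::]; first by rewrite sig_nil big_nil addr0.
  by rewrite len_nil mul0r.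
have [||v vs vl] := IH.
- by move=> u uws; apply: hk; rewrite inE uws orbT.
- by move=> u uws; apply: hc; rewrite inE uws orbT.
have wk : size w = k.+1 by apply: hk; rewrite inE eqxx.
have [s s0 sc] := exists_root k (normr_ge0 (c w)).
have sL : s <= L.
  rewrite -(ler_pXn2r (n := k.+1))// ?nnegrE// sc; apply: hc.
  by rewrite inE eqxx.
have yk (v' : seq 'I_r) : size v' != k.+1 -> (`|c w| *: br w) v' = 0.
  by move=> h; rewrite serZE br_homog ?mulr0// wk.
have wsz : (0 < size w)%N by rewrite wk.
have cs : eqN k.+1 (sig (cpath w s)) (1 + `|c w| *: br w).
  by have := cpath_sig s wsz; rewrite wk sc.
have lc : len (cpath w s) <= 4 ^+ k.+1 * L.
  apply: (le_trans (cpath_len w s)); rewrite wk ger0_norm// ler_pM2l// exprn_gt0.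
have [p ps pl] : exists2 p, eqN k.+1 (sig p) (1 + c w *: br w) & len p <= 4 ^+ k.+1 * L.
  have [c0|c0] := leP 0 (c w).
    by exists (cpath w s) => //; rewrite -[c w in X in eqN _ _ X]ger0_norm.
  exists (inv (cpath w s)); last by rewrite len_inv.
  have := sig_inv_lead (ltn0Sn k) yk cs.
  by rewrite ltr0_norm// scaleNr opprK.
exists (p ++ v); last first.
  by rewrite len_cat [size _]/= -natr1 mulrDl mul1r addrC lerD.
move=> u uk; rewrite sig_cat (eqN_mul ps vs uk) big_cons.
rewrite mulrDl mul1r mulrDr mulr1 addrA.
rewrite serDE (@serM_low _ _ k.+1 k.+1) ?addr0; [by rewrite addrAC -addrA| | |lia].
- by move=> v' vk; rewrite serZE br_homog ?mulr0// wk neq_ltn vk.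
- move=> v' vk; apply: (@brs_homog k.+1) => [x xws|]; last by rewrite neq_ltn vk.
  by apply: hk; rewrite inE xws orbT.
Qed.

(** ** Group-like series close to 1 are reached by short paths *)

(** The lowest nontrivial layer of [z] is a Lie polynomial, small with [z], so that
  it is cancelled by a short loop; this leaves a series trivial up to one more
  degree, and small because the loop is short. Conclude by induction on the
  number [m] of layers left. *)
Lemma free_chow_aux N m (e : R) : 0 < e -> exists2 d : R, 0 < d &
  forall z, GL z -> eqN (N - m) z 1 ->
  (forall w, (0 < size w <= N)%N -> `|z w| <= d) -> reach N z e.
Proof.
elim: m e => [|m IH] e e0.
  exists 1 => // z _ z1 _; exists [::]; last by rewrite len_nil ltW.
  by rewrite sig_nil; apply: eqN_sym; rewrite subn0 in z1.
have [Nm|mN] := leqP N m.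
  have [d d0 hd] := IH e e0; exists d => // z gz z1; apply: hd => //.
  by rewrite (_ : N - m = 0)%N; [rewrite (_ : N - m.+1 = 0)%N in z1 => //; lia|lia].
have e20 : 0 < e / 2 by rewrite divr_gt0.
have [d' d'0 hd] := IH _ e20.
pose k := (N - m.+1)%N; have kN : (N - m = k.+1)%N by rewrite /k; lia.
pose K : R := (size (@words r k.+1))%:R * 4 ^+ k.+1.
have K0 : 0 <= K by rewrite mulr_ge0 ?exprn_ge0 ?ler0n.
pose l := Num.min 1 (Num.min (e / 2) (d' / 2)).
have l0 : 0 < l by rewrite !lt_min e20 ltr01 divr_gt0.
pose L := l / (K + 1).
have K1 : 0 < K + 1 by rewrite ltr_wpDl.
have L0 : 0 < L by rewrite divr_gt0.
have KL : K * L <= l.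
  by rewrite /L mulrCA ler_piMr ?(ltW l0)// ler_pdivrMr// mul1r lerDl.
pose d := Num.min 1 (Num.min (L ^+ k.+1) (d' / 2 / N.+1%:R)).
have d0 : 0 < d by rewrite !lt_min ltr01 exprn_gt0//= !divr_gt0// ltr0n.
exists d => // z gz z1 zd.
(* the degree in [sdeg] turns the leading part of [z] into [k.+1] times itself *)
pose c w := - (z w / k.+1%:R).
have [||q qs ql] := @lie_reach k c L (@words r k.+1) (ltW L0).
- by move=> w; rewrite mem_words => /eqP.
- move=> w; rewrite mem_words => /eqP wk; rewrite /c normrN normrM normfV.
  rewrite ler_pdivrMr ?normr_gt0 ?pnatr_eq0//.
  apply: (@le_trans _ _ d); first by apply: zd; rewrite wk -kN leq_subr kN.
  apply: (@le_trans _ _ (L ^+ k.+1)); first by rewrite !ge_min lexx orbT.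
  by rewrite ler_peMr ?exprn_ge0 ?(ltW L0)// ger0_norm// ler1n.
have {}ql : len q <= l by apply: le_trans ql _; rewrite mulrA.
have [l1 [le ld]] : l <= 1 /\ l <= e / 2 /\ l <= d' / 2.
  by rewrite /l !ge_min !lexx !orbT.
have gz' : GL (sig q * z) by exact: GL_sigM.
have [||v' vs vl] := hd _ gz'.
- rewrite kN => w wk; rewrite (eqN_mul qs (eqN_refl z) wk).
  move: wk; rewrite leq_eqVlt => /orP[/eqP wk|wk].
    rewrite mulrDl mul1r serDE (GL_lie gz z1 wk).
    rewrite (_ : (_ * z) w = \sum_(i <- words k.+1) c i * br i w); last first.
      rewrite serM_recr gz.1 mulr1.
      rewrite ser_sumE [X in X + _]big1 ?add0r// => -[j jw] _.
      have tk : size (take j w) = j by apply: size_takel; exact: ltnW.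
      rewrite (@brs_homog k.+1) ?mul0r//; first by move=> x; rewrite mem_words => /eqP.
      by rewrite tk -wk neq_ltn jw.
    rewrite -big_split big1 /=; first by rewrite ser1E; case: w wk.
    by move=> x _; rewrite /c; ring.
  rewrite mulrDl mul1r serDE z1; last by rewrite -ltnS.
  rewrite (@serM_low _ _ k.+1 0) ?addr0 ?addn0//.
  move=> v' vk; apply: (@brs_homog k.+1) => [x|]; last by rewrite neq_ltn vk.
  by rewrite mem_words => /eqP.
- move=> w /andP[w0 wN]; rewrite serM_recr gz.1 mulr1.
  apply: (le_trans (ler_normD _ _)); rewrite (splitr d') lerD//.
    apply: (le_trans (ler_norm_sum _ _ _)).
    apply: (@le_trans _ _ (\sum_(i < size w) d)).
      apply: ler_sum => -[j /= jw] _; rewrite normrM -[d]mul1r ler_pM//.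
        apply: (le_trans (sig_le _ _)); rewrite exprn_ile1 ?len_ge0//.
        exact: le_trans ql _.
      by apply: zd; rewrite size_drop subn_gt0 jw /= (leq_trans (leq_subr _ _)).
    rewrite sumr_const card_ord.
    apply: (@le_trans _ _ (N.+1%:R * d)).
      by rewrite -[d *+ _]mulr_natl ler_wpM2r ?(ltW d0)// ler_nat ltnW// ltnS.
    by rewrite mulrC -ler_pdivlMr ?ltr0n// !ge_min lexx !orbT.
  apply: (le_trans (sig_le _ _)); apply: (le_trans _ ld); apply: (le_trans _ ql).
  have q1 : len q <= 1 := le_trans ql l1.
  case: w w0 wN => // i w _ _ /=.
  by rewrite exprS ler_piMr ?len_ge0// exprn_ile1 ?len_ge0.
exists (inv q ++ v').
  rewrite sig_cat; apply: eqN_trans (eqN_mul (eqN_refl _) vs) _.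
  by rewrite mulrA sig_invl mul1r.
by rewrite len_cat len_inv (splitr e) lerD// (le_trans ql).
Qed.

Lemma free_chow N (e : R) : 0 < e -> exists2 d : R, 0 < d & forall z, GL z ->
  (forall w, (0 < size w <= N)%N -> `|z w| <= d) -> reach N z e.
Proof.
move=> e0; have [d d0 hd] := free_chow_aux N N e0; exists d => // z gz; apply: hd => //.
rewrite subnn => -[|//] _; by rewrite gz.1.
Qed.

End Paths.

(** * Limits along ultrafilters *)

Section Ultra.
Context {R : realType}.

(** Bounded real families converge along an ultrafilter, by compactness of
  segments; this replaces the extraction of subsequences. *)
Lemma ultra_cvg (T : Type) (U : set_system T) (f : T -> R) (K : R) :
  UltraFilter U -> (\forall n \near U, `|f n| <= K) -> cvg (f n @[n --> U]).
Proof.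
move=> UU fK.
have PF : ProperFilter (f n @[n --> U]) by exact: fmap_proper_filter.
have cK : compact (`[- K, K]%classic : set R) by exact: segment_compact.
have [|p [_ clp]] := cK (f n @[n --> U]) PF.
  by apply: filterS fK => n /=; rewrite in_itv /= ler_norml.
apply/cvg_ex; exists p => A pA /=.
have [//|nA] := in_ultra_setVsetC (f @^-1` A) UU.
have [q [/= qA' qA]] := clp (~` A) A nA pA.
by [].
Qed.

Lemma near_seq (T : Type) (F : set_system T) {FF : Filter F} (I : eqType)
    (s : seq I) (P : I -> T -> Prop) :
  (forall i, \forall n \near F, P i n) ->
  \forall n \near F, forall i, i \in s -> P i n.
Proof.
move=> h; elim: s => [|i s IH]; first by apply: nearW.
apply: filterS2 (h i) IH => n Pi Ps j; rewrite inE => /orP[/eqP ->//|]; exact: Ps.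
Qed.

Lemma cvg_seqsum (T : Type) (F : set_system T) {FF : Filter F} (I : Type) (s : seq I)
    (f : T -> I -> R) (l : I -> R) :
  (forall i, f n i @[n --> F] --> l i) ->
  \sum_(i <- s) f n i @[n --> F] --> \sum_(i <- s) l i.
Proof.
move=> h; elim: s => [|i s IH].
  rewrite big_nil; under eq_fun do rewrite big_nil.
  exact: cvg_cst.
rewrite big_cons; under eq_fun do rewrite big_cons.
exact: cvgD.
Qed.

Lemma ge0_expr_le (x L : R) k : 0 <= L -> (forall e, 0 < e -> x <= (L + e) ^+ k) ->
  x <= L ^+ k.
Proof.
move=> L0 h.
have c : (L + e) ^+ k @[e --> 0^'+] --> L ^+ k.
  apply: cvg_at_right_filter.
  apply: (@cvg_comp _ _ _ (fun e : R => L + e) (fun y : R => y ^+ k) _ (nbhs L)).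
    have : (L + e) @[e --> (0 : R)] --> L + 0 by apply: cvgD; [exact: cvg_cst|exact: cvg_id].
    by rewrite addr0.
  exact: exprn_continuous.
rewrite -(cvg_lim _ c)//; apply: limr_ge; first by apply/cvg_ex; exists (L ^+ k).
near=> e; apply: h; near: e; exact: nbhs_right_gt.
Unshelve. all: by end_near. Qed.

(** A function whose increments are additive up to a quadratic error has its
  Lipschitz constant given by the linear part: subdivide and let the mesh go
  to 0. *)
Lemma sewing (F : R -> R) (a b A C : R) : a <= b ->
  (forall s t, a <= s -> s <= t -> t <= b ->
    `|F t - F s| <= A * (t - s) + C * (t - s) ^+ 2) ->
  `|F b - F a| <= A * (b - a).
Proof.
move=> ab h.
have hm m : `|F b - F a| <= A * (b - a) + C * (b - a) ^+ 2 / m.+1%:R.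
  pose d := (b - a) / m.+1%:R.
  have m0 : (m.+1%:R : R) != 0 by rewrite pnatr_eq0.
  have d0 : 0 <= d by rewrite divr_ge0 ?subr_ge0.
  pose p (i : nat) := a + i%:R * d.
  have pb : p m.+1 = b by rewrite /p /d mulrC divfK// addrC subrK.
  have pm i j : (i <= j)%N -> p i <= p j.
    by move=> ij; rewrite lerD2l ler_wpM2r// ler_nat.
  have pa : p 0%N = a by rewrite /p mul0r addr0.
  have hk k : (k <= m.+1)%N ->
      `|F (p k) - F a| <= k%:R * (A * d + C * d ^+ 2).
    elim: k => [|k IH] km; first by rewrite pa subrr normr0 mul0r.
    rewrite -(subrKA (F (p k))) (le_trans (ler_normD _ _))//.
    rewrite -natr1 mulrDl mul1r addrC lerD//; first exact: IH (ltnW km).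
    have e : p k.+1 - p k = d by rewrite /p -natr1; ring.
    rewrite -e; apply: h; last by rewrite -pb; exact: pm.
      by rewrite -pa; exact: pm.
    exact: pm.
  have := hk m.+1 (leqnn _); rewrite pb => /le_trans; apply.
  rewrite le_eqVlt; apply/orP; left; apply/eqP; rewrite /d; field.
  by rewrite addrC natr1.
apply/ler_addgt0Pr => e e0.
have [C0|C0] := leP (C * (b - a) ^+ 2) 0.
  apply: (le_trans (hm 0%N)); rewrite lerD2l divr1 (le_trans C0)// ltW//.
have [m /ltW mh] := ltr_add_invr (y := 0) (divr_gt0 e0 C0).
apply: (le_trans (hm m)); rewrite lerD2l -ler_pdivlMl//.
by move: mh; rewrite add0r [_^-1 * _]mulrC.
Qed.

End Ultra.

(** * Lifted paths *)

Section LiftedPaths.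
Context {R : realType} {r : nat}.
Local Notation ser := (ser R r).
Local Notation enorm := (@euclidean_norm R r).
Implicit Types (g : R -> R -> ser) (N : nat) (s t u : R).

(** The increments of a path of length at most [t - s] in the free nilpotent
  groups of all steps at once. *)
Definition lp g :=
  (forall s t u, s <= t -> t <= u -> g s u = g s t * g t u) /\
  (forall s t, s <= t -> forall N e, 0 < e -> reach N (g s t) (t - s + e)).

Lemma eqN_dyn N (f f' : ser) : eqN N f f' -> eqN N (dyn f) (dyn f').
Proof.
move=> ff w wN; rewrite /dyn big_seq [RHS]big_seq; apply: eq_bigr => v.
by rewrite mem_words => /eqP vw; rewrite ff// vw.
Qed.

Lemma GL_approx (z : ser) : (forall N, exists v, eqN N (sig v) z) -> GL z.
Proof.
move=> h; split; first by have [v <-//] := h 0%N; rewrite sig_nil1.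
apply/funext => w; have [v vz] := h (size w).
have [_ /(congr1 (fun F => F w))] := GL_sig v.
rewrite /sdeg vz// => ->.
by apply: (@eqN_mul _ _ (size w)) => //; exact: eqN_dyn.
Qed.

(** The increment of the underlying path of R^r. *)
Definition incr g s t : 'rV[R]_r := \row_i g s t [:: i].

Lemma sig_one (v : seq 'rV[R]_r) i : sig v [:: i] = (\sum_(a <- v) a) 0 i.
Proof.
elim: v => [|a v IH]; first by rewrite sig_nil big_nil mxE ser1E.
rewrite sig_cons serM_cons serM_nil /sh sexp_nil sexp_one sig_nil1 IH big_cons.
by rewrite mxE mul1r mulr1 addrC.
Qed.

Lemma enorm_sum_len (v : seq 'rV[R]_r) : enorm (\sum_(a <- v) a) <= len v.
Proof.
elim: v => [|a v IH]; first by rewrite big_nil enorm0 len_nil.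
by rewrite big_cons len_cons (le_trans (enormD _ _))// lerD2l.
Qed.

Section LP.
Variable g : R -> R -> ser.
Hypothesis hg : lp g.

Lemma lp_GL s t : s <= t -> GL (g s t).
Proof.
by move=> st; apply: GL_approx => N; have [v vz _] := hg.2 s t st N 1 ltr01; exists v.
Qed.

Lemma lp_nil s t : s <= t -> g s t [::] = 1.
Proof. by move=> st; have [] := lp_GL st. Qed.

Lemma lp_bound s t w : s <= t -> `|g s t w| <= (t - s) ^+ size w.
Proof.
move=> st; apply: ge0_expr_le; first by rewrite subr_ge0.
move=> e e0; have [v vz vl] := hg.2 s t st (size w) e e0.
rewrite -vz//; apply: (le_trans (sig_le _ _)); rewrite lerXn2r ?nnegrE ?len_ge0//.
by rewrite addr_ge0 ?subr_ge0// ltW.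
Qed.

Lemma lp_incr s t : s <= t -> enorm (incr g s t) <= t - s.
Proof.
move=> st; apply/ler_addgt0Pr => e e0.
have [v vz vl] := hg.2 s t st 1%N e e0.
rewrite (_ : incr g s t = \sum_(a <- v) a).
  exact: le_trans (enorm_sum_len _) vl.
by apply/rowP => i; rewrite mxE -vz// sig_one.
Qed.

Lemma lp_incrD s t u : s <= t -> t <= u -> incr g s u = incr g s t + incr g t u.
Proof.
move=> st tu; apply/rowP => i; rewrite !mxE (hg.1 s t u)//.
rewrite serM_cons serM_nil /sh !lp_nil// mul1r mulr1 addrC.
by [].
Qed.

Lemma lp_diag s : g s s = 1.
Proof.
apply/funext => w; case: w => [|i w]; first by rewrite lp_nil.
have := @lp_bound s s (i :: w) (lexx s).
by rewrite subrr /= exprS mul0r normr_le0 => /eqP ->.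
Qed.

End LP.

Lemma additive_sq (D : R -> R -> R) (C : R) s t : s <= t ->
  (forall a b c, s <= a -> a <= b -> b <= c -> c <= t -> D a c = D a b + D b c) ->
  (forall a b, s <= a -> a <= b -> b <= t -> `|D a b| <= C * (b - a) ^+ 2) ->
  D s t = 0.
Proof.
move=> st Dadd Db.
have Dss : D s s = 0.
  by have := Db s s (lexx s) (lexx s) st; rewrite subrr expr0n /= mulr0 normr_le0 => /eqP.
have := @sewing R (D s) s t 0 C st; rewrite mul0r Dss subr0 normr_le0 => h.
apply/eqP/h => a b sa ab bt.
rewrite (Dadd s a b)// addrC addKr mul0r add0r; exact: Db.
Qed.

(** The difference of the coefficients at a word of length at least 2 is additive,
  by Chen's identity and induction on the length, and quadratically small, hence
  zero. *)
Lemma lp_unique g g' : lp g -> lp g' ->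
  (forall s t, s <= t -> incr g s t = incr g' s t) ->
  forall s t, s <= t -> g s t = g' s t.
Proof.
move=> hg hg' h1 s t st; apply/funext => w.
have [m] := ubnP (size w); elim: m w s t st => // m IH w s t st wm.
case: w wm => [|i [|j w]] wm; first by rewrite !lp_nil.
  by have /rowP/(_ i) := h1 s t st; rewrite !mxE.
set W := [:: i, j & w] in wm *.
apply/eqP; rewrite -subr_eq0; apply/eqP.
apply: (@additive_sq (fun a b => g a b W - g' a b W) (2 * (t - s) ^+ size w)) => //.
- move=> a b c sa ab bc ct.
  rewrite (hg.1 a b c)// (hg'.1 a b c)//.
  rewrite (serM_cons (g a b)) (serM_cons (g' a b)) !serM_recr !lp_nil// !mulr1 !mul1r.
  rewrite (eq_bigr (fun k : 'I_(size (j :: w)) => sh i (g' a b) (take k (j :: w)) * g' b c (drop k (j :: w)))).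
    by rewrite /sh; ring.
  move=> [k kw] _; congr (_ * _); rewrite /sh; apply: IH => //.
    rewrite -[size _]/((size (take k (j :: w))).+1) size_takel; last exact: ltnW.
    by move: wm kw; clear; rewrite /=; lia.
  by rewrite size_drop (leq_ltn_trans (leq_subr _ _)).
- move=> a b sa ab bt; rewrite (le_trans (ler_normB _ _))//.
  have bb := lp_bound hg W ab; have bb' := lp_bound hg' W ab.
  have X : (b - a) ^+ size W <= (t - s) ^+ size w * (b - a) ^+ 2.
    rewrite (_ : size W = size w + 2)%N; last by rewrite addnC.
    rewrite exprD ler_wpM2r ?sqr_ge0// lerXn2r ?nnegrE ?subr_ge0//; last exact: lerB.
  apply: (le_trans (lerD bb bb')); apply: (le_trans (lerD X X)).
  by rewrite -mulrA mulr_natl mulr2n.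
Qed.

Lemma lp_push g (P : 'M[R]_r) : (forall a, enorm (a *m P) <= enorm a) -> lp g ->
  lp (fun s t => push P (g s t)).
Proof.
move=> hP [g1 g2]; split=> [s t u st tu|s t st N e e0].
  by rewrite (g1 s t u)// pushM.
have [v vz vl] := g2 s t st N e e0.
exists [seq a *m P | a <- v]; first by rewrite sig_push; exact: eqN_push.
apply: le_trans vl; rewrite /len big_map; exact: ler_sum.
Qed.

(** The path seen at the scale [eta], with the letters rescaled accordingly so that
  lengths remain comparable to time. *)
Definition rescale (eta : R) g : R -> R -> ser :=
  fun s t => dil eta^-1 (g (eta * s) (eta * t)).

Lemma lp_rescale eta g : 0 < eta -> lp g -> lp (rescale eta g).
Proof.
move=> e0 [g1 g2]; split=> [s t u st tu|s t st N e eg0].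
  by rewrite /rescale (g1 _ (eta * t)) ?ler_pM2l// dilM.
have st' : eta * s <= eta * t by rewrite ler_pM2l.
have := reach_dil eta^-1 (g2 _ _ st' N (eta * e) (mulr_gt0 e0 eg0)).
rewrite gtr0_norm ?invr_gt0//; apply: reach_le.
by rewrite -mulrBr -mulrDr mulKf// gt_eqF.
Qed.

Lemma lp_line (c : 'rV[R]_r) : enorm c <= 1 -> lp (fun s t => sexp ((t - s) *: c)).
Proof.
move=> c1; split=> [s t u st tu|s t st N e e0].
  by rewrite sexpD; congr (sexp (_ *: _)); ring.
exists [:: (t - s) *: c]; first by rewrite sig_cons sig_nil mulr1.
rewrite len_cons len_nil addr0 enormZ ger0_norm ?subr_ge0//.
by rewrite (@le_trans _ _ (t - s)) ?ler_piMr ?subr_ge0// lerDl ltW.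
Qed.

Definition wordsle N : seq (seq 'I_r) := flatten [seq words k | k <- iota 0 N.+1].
Lemma mem_wordsle N w : (w \in wordsle N) = (size w <= N)%N.
Proof.
apply/flatten_mapP/idP => [[k]|wN].
  by rewrite mem_iota mem_words add0n => /andP[_ kN] /eqP ->.
by exists (size w); rewrite ?mem_iota ?mem_words.
Qed.

Section Limit.
Variables (T : Type) (U : set_system T).
Hypothesis UU : UltraFilter U.
Local Instance PFU : ProperFilter U := @ultra_proper _ _ UU.

(** Coefficientwise convergence. *)
Definition scvg (z : T -> ser) (l : ser) := forall w, z n w @[n --> U] --> l w.

Lemma scvgM z l z' l' : scvg z l -> scvg z' l' -> scvg (fun n => z n * z' n) (l * l').
Proof.
move=> h h' w; rewrite serME; under eq_fun do rewrite serME.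
by apply: cvg_seqsum => k; apply: cvgM.
Qed.
Lemma scvg_cst f : scvg (fun=> f) f.
Proof. by move=> w; exact: cvg_cst. Qed.
Lemma scvg_dyn z l : scvg z l -> scvg (fun n => dyn (z n)) (dyn l).
Proof.
move=> h w; apply: cvg_seqsum => v.
by apply: cvgM; [exact: h|exact: cvg_cst].
Qed.
Lemma scvg_unique z l l' : scvg z l -> scvg z l' -> l = l'.
Proof.
by move=> h h'; apply/funext => w; apply: (cvg_unique _ (h w) (h' w)).
Qed.
Lemma scvg_GL z l : (\forall n \near U, GL (z n)) -> scvg z l -> GL l.
Proof.
move=> gz zl; split.
  apply: (cvg_unique _ (zl [::])) => //.
  apply: cvg_near_cst; apply: filterS gz => n gn; exact: gn.1.
apply/funext => w.
have h1 : sdeg (z n) w @[n --> U] --> sdeg l w.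
  by apply: cvgM; [exact: cvg_cst|exact: zl].
have h2 : (dyn (z n) * z n) w @[n --> U] --> (dyn l * l) w by exact: (scvgM (scvg_dyn zl) zl).
apply: (cvg_unique _ h1) => //.
apply: (cvg_trans _ h2); apply: near_eq_cvg.
by apply: filterS gz => n gn; rewrite gn.2.
Qed.

(** A path reaching a nearby series is completed by a short one given by
  [free_chow], since the discrepancy is group-like and small. *)
Lemma reach_lim z l N L : scvg z l -> (\forall n \near U, GL (z n)) ->
  (\forall n \near U, reach N (z n) L) -> forall e, 0 < e -> reach N l (L + e).
Proof.
move=> zl gz rz e e0.
have [d d0 hd] := @free_chow R r N e e0.
pose K := (L + 1) ^+ N * N.+1%:R + 1.
have [n0 [v0 _ vl0]] : exists n, reach N (z n) L by exact: (@filter_ex _ U _ _ rz).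
have L0 : 0 <= L by exact: le_trans (len_ge0 v0) vl0.
have K0 : 0 < K.
  by rewrite ltr_wpDl// mulr_ge0 ?exprn_ge0 ?ler0n// addr_ge0.
have near_z : \forall n \near U, forall w, w \in wordsle N -> `|l w - z n w| <= d / K.
  apply: near_seq => w; have /cvgrPdist_le := zl w; apply.
  by rewrite divr_gt0.
have [n [[v vz vl] nz]] : exists n, reach N (z n) L /\
    (forall w, w \in wordsle N -> `|l w - z n w| <= d / K).
  by apply: (@filter_ex _ U); apply: filterS2 rz near_z.
have gl : GL l by exact: scvg_GL gz zl.
(* the discrepancy between the path and the limit *)
pose E := sig (inv v) * l.
have [||q qE ql] := hd E.
- exact: GL_sigM.
- move=> w /andP[w0 wN].
  have -> : E w = (sig (inv v) * (l - z n)) w.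
    rewrite mulrBr serBE (_ : (_ * z n) w = 0) ?subr0//.
    rewrite (eqN_mul (eqN_refl (sig (inv v))) (eqN_sym vz) wN) sig_invl ser1E.
    by case: w w0 wN.
  rewrite serME (le_trans (ler_norm_sum _ _ _))//.
  apply: (@le_trans _ _ (\sum_(k < (size w).+1) (L + 1) ^+ N * (d / K))).
    apply: ler_sum => -[k kw] _; rewrite normrM ler_pM//.
      apply: (le_trans (sig_le _ _)); rewrite len_inv.
      apply: (@le_trans _ _ ((L + 1) ^+ size (take k w))).
        rewrite lerXn2r ?nnegrE ?len_ge0 ?addr_ge0//.
        by rewrite (le_trans vl)// lerDl.
      apply: ler_weXn2l; first by rewrite lerDr.
      by apply: leq_trans wN; rewrite size_take; case: ifP => // /ltnW.
    rewrite serBE; apply: nz; rewrite mem_wordsle size_drop.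
    by rewrite (leq_trans (leq_subr _ _)).
  rewrite sumr_const card_ord -mulr_natl mulrA mulrA ler_pdivrMr//.
  rewrite mulrC ler_pM2l// /K.
  rewrite ler_wpDr// mulrC ler_wpM2l ?exprn_ge0 ?addr_ge0//.
  by rewrite ler_nat ltnS.
exists (v ++ q); last by rewrite len_cat lerD.
rewrite sig_cat; apply: eqN_trans (eqN_mul (eqN_refl _) qE) _.
by rewrite /E mulrA sig_invr mul1r.
Qed.

Definition slim (z : T -> ser) : ser := fun w => lim (z n w @[n --> U]).

Lemma reach_cvg z (L : R) : (forall N, \forall n \near U, reach N (z n) L) -> scvg z (slim z).
Proof.
move=> h w; apply: (ultra_cvg (K := L ^+ size w)) => //.
apply: filterS (h (size w)) => n [v vz vl].
rewrite -vz//; apply: (le_trans (sig_le _ _)).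
by rewrite lerXn2r ?nnegrE ?len_ge0// (le_trans (len_ge0 v)).
Qed.

(** The lengths bound the coefficients, so that limits exist; Chen's identity
  passes to the limit, and lengths do by [reach_lim]. *)
Lemma lp_lim (g : T -> R -> R -> ser) :
  (forall n s t u, s <= t -> t <= u -> g n s u = g n s t * g n t u) ->
  (forall s t, s <= t -> \forall n \near U, GL (g n s t)) ->
  (forall s t, s <= t -> forall N e, 0 < e -> \forall n \near U, reach N (g n s t) (t - s + e)) ->
  lp (fun s t => slim (fun n => g n s t)) /\
  (forall s t, s <= t -> scvg (fun n => g n s t) (slim (fun n => g n s t))).
Proof.
move=> gM gG gr.
have gc s t : s <= t -> scvg (fun n => g n s t) (slim (fun n => g n s t)).
  by move=> st; apply: (@reach_cvg _ (t - s + 1)) => N; exact: gr.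
split=> //; split=> [s t u st tu|s t st N e e0].
  apply: (scvg_unique (gc s u (le_trans st tu))) => w.
  under eq_fun do rewrite (gM _ s t u)//.
  exact: (scvgM (gc s t st) (gc t u tu)).
rewrite (splitr e) addrA; apply: (reach_lim (gc s t st) (gG s t st)); last by rewrite divr_gt0.
by apply: gr => //; rewrite divr_gt0.
Qed.

End Limit.

(** ** Blow-ups *)

Section Tangent.
Variable U : set_system R.
Hypothesis UU : UltraFilter U.
Hypothesis U0 : 0^'+ `<=` U.

(** Blow-ups only depend on small positive scales; the other values are replaced by
  1 to have lifted paths at all scales. *)
Definition pos (eta : R) := if 0 < eta then eta else 1.
Lemma pos_gt0 eta : 0 < pos eta.
Proof. by rewrite /pos; case: ifP. Qed.

Lemma near_lt (e : R) : 0 < e -> \forall eta \near U, 0 < pos eta < e.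
Proof.
move=> e0; apply: U0; near=> eta; rewrite /pos.
have h : 0 < eta by near: eta; exact: nbhs_right_gt.
rewrite h h /=; near: eta; exact: nbhs_right_lt.
Unshelve. all: by end_near. Qed.

(** The blow-up at time 0 along the ultrafilter of scales [U]. *)
Definition tan g : R -> R -> ser :=
  fun s t => slim U (fun eta => rescale (pos eta) g s t).

Lemma tanP g : lp g -> lp (tan g) /\
  (forall s t, s <= t -> scvg U (fun eta => rescale (pos eta) g s t) (tan g s t)).
Proof.
move=> hg; apply: lp_lim => [n s t u st tu|s t st|s t st N e e0].
- by have [h _] := lp_rescale (pos_gt0 n) hg; apply: h.
- by apply: nearW => n; apply: lp_GL st; exact: lp_rescale (pos_gt0 n) hg.
- by apply: nearW => n; have [_ h] := lp_rescale (pos_gt0 n) hg; apply: h.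
Qed.

End Tangent.

(** ** Lifting Lipschitz paths *)

Lemma ultra_oo : exists2 U : set_system nat, UltraFilter U & \oo `<=` U.
Proof. by have [U [UU h]] := @ultraFilterLemma nat \oo _; exists U. Qed.

(** A limit of signatures of inscribed polygons. *)
Lemma lp_exists (x : R -> 'rV[R]_r) :
  (forall s t, s <= t -> enorm (x t - x s) <= t - s) ->
  exists2 g, lp g & forall s t, s <= t -> incr g s t = x t - x s.
Proof.
move=> x1.
have [U UU Uoo] := ultra_oo.
(* [g m] is the signature of the polygon inscribed in [x] at the points of the
   grid of step [m.+1^-1], [fl m s] being the index of the last one before [s] *)
pose fl (m : nat) s := Num.floor (m.+1%:R * s).
pose y (m : nat) (k : int) := x (k%:~R / m.+1%:R).
pose cells m (i : int) n := [seq y m (i + k.+1%:Z) - y m (i + k%:Z) | k <- iota 0 n].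
have m0 (m : nat) : 0 < (m.+1%:R : R) by rewrite ltr0n.
have flle m s t : s <= t -> fl m s <= fl m t.
  by move=> st; rewrite /fl le_floor// ler_pM2l.
have cells_cat m i a b : cells m i (a + b)%N = cells m i a ++ cells m (i + a%:Z) b.
  rewrite /cells iotaD map_cat add0n; congr (_ ++ _).
  rewrite -{1}[a]addn0 iotaDl -map_comp; apply: eq_map => k /=.
  by congr (y _ _ - y _ _); lia.
pose g m s t := sig (cells m (fl m s) `|fl m t - fl m s|%N).
have gM m s t u : s <= t -> t <= u -> g m s u = g m s t * g m t u.
  move=> st tu; rewrite /g -sig_cat; congr sig.
  have h1 := flle m _ _ st; have h2 := flle m _ _ tu.
  move: (fl m s) (fl m t) (fl m u) h1 h2 => i j k h1 h2.
  have [a ja] : exists a : nat, j = i + a%:Z by exists `|j - i|%N; lia.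
  have [b kb] : exists b : nat, k = j + b%:Z by exists `|k - j|%N; lia.
  rewrite kb ja (_ : `|_|%N = (a + b)%N); last lia.
  by rewrite cells_cat; congr (cells _ _ _ ++ cells _ _ _); lia.
have csum m i n : \sum_(a <- cells m i n) a = y m (i + n%:Z) - y m i.
  elim: n => [|n IH]; first by rewrite /cells /= big_nil addr0 subrr.
  rewrite -(addn1 n) cells_cat big_cat /= IH /cells /= big_seq1 addr0.
  rewrite [RHS](_ : _ = y m (i + n%:Z) - y m i + (y m (i + n%:Z + 1) - y m (i + n%:Z))) //.
  by rewrite PoszD addrA [RHS]addrC subrKA.
have clen m i n : len (cells m i n) <= n%:R / m.+1%:R.
  elim: n => [|n IH]; first by rewrite /cells /= len_nil mul0r.
  rewrite -(addn1 n) cells_cat len_cat natrD mulrDl lerD// /cells /= len_cons len_nil !addr0.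
  rewrite mul1r /y; apply: (le_trans (x1 _ _ _)).
    by rewrite ler_pM2r ?invr_gt0// ler_int; lia.
  by rewrite -mulrBl -intrB addrC addKr mul1r.
have glen m s t : s <= t -> (`|fl m t - fl m s|%N)%:R / m.+1%:R <= t - s + m.+1%:R^-1.
  move=> st; rewrite ler_pdivrMr// mulrDl mulVf ?gt_eqF//.
  have := flle m _ _ st; rewrite -subr_ge0 => h.
  rewrite natr_absz ger0_norm// intrB.
  have h1 := floor_le (m.+1%:R * t); have h2 := floorD1_gt (m.+1%:R * s).
  rewrite -/(fl m t) -/(fl m s) intrD in h1 h2.
  by rewrite mulrBl mulrC (mulrC s); lra.
have near_m (e : R) : 0 < e -> \forall m \near U, m.+1%:R^-1 < e.
  by move=> e0; apply: Uoo; exact: (near_infty_natSinv_lt (PosNum e0)).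
have [|||gl gc] := @lp_lim _ U UU g.
- exact: gM.
- by move=> s t st; apply: nearW => m; exact: GL_sig.
- move=> s t st N e e0; apply: filterS (near_m e e0) => m me.
  exists (cells m (fl m s) `|fl m t - fl m s|%N) => //.
  apply: (le_trans (clen _ _ _)); apply: (le_trans (glen _ _ _ st)).
  by rewrite lerD2l ltW.
exists (fun s t => slim U (fun n => g n s t)) => // s t st.
apply/rowP => i; rewrite mxE.
have xfl u i0 : x ((fl n u)%:~R / n.+1%:R) 0 i0 @[n --> U] --> x u 0 i0.
  apply/cvgrPdist_le => e e0; apply: filterS (near_m e e0) => m me.
  have h1 := floor_le (m.+1%:R * u); have h2 := floorD1_gt (m.+1%:R * u).
  rewrite -/(fl m u) intrD in h1 h2.
  have fu : (fl m u)%:~R / m.+1%:R <= u by rewrite ler_pdivrMr// mulrC.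
  have := coord_le_enorm (x u - x ((fl m u)%:~R / m.+1%:R)) i0.
  rewrite !mxE => /le_trans; apply; apply: (le_trans (x1 _ _ fu)).
  apply: le_trans (ltW me); rewrite lerBlDr -[X in _ <= X + _]mul1r -mulrDl.
  by rewrite ler_pdivlMr// mulrC addrC ltW.
apply: (cvg_unique _ (gc s t st [:: i])) => //.
have -> : (fun n => g n s t [:: i]) = (fun n => x ((fl n t)%:~R / n.+1%:R) 0 i - x ((fl n s)%:~R / n.+1%:R) 0 i).
  apply/funext => m; rewrite /g sig_one csum /y !mxE.
  have := flle m _ _ st; move: (fl m s) (fl m t) => a b ab.
  by rewrite (_ : a + _ = b)//; lia.
by rewrite !mxE; apply: cvgB; exact: xfl.
Qed.

(** ** Continuity of the lift at straight lines *)

(** Adding a letter on the right amounts to integrate against the last increment,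
  up to a quadratic error. *)
Lemma lp_step g (K : R) w i : lp g -> 0 <= K ->
  forall a b : R, 0 <= a -> a <= b -> b <= K ->
  `|g 0 b (rcons w i) - g 0 a (rcons w i) - g 0 a w * g a b [:: i]| <=
   (size w)%:R * (K + 1) ^+ (size w).+1 * (b - a) ^+ 2.
Proof.
move=> hg K0 a b a0 ab bK; rewrite (hg.1 0 a b)// serM_recr size_rcons big_ord_recr /=.
rewrite -cats1 take_size_cat// drop_size_cat// (lp_nil hg ab) mulr1 cats1.
rewrite addrK addrK (le_trans (ler_norm_sum _ _ _))//.
have aK := le_trans ab bK.
apply: (@le_trans _ _ (\sum_(k < size w) (K + 1) ^+ (size w).+1 * (b - a) ^+ 2)).
  apply: ler_sum => -[k kw] _ /=.
  rewrite normrM.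
  have h1 := lp_bound hg (take k (rcons w i)) a0; have h2 := lp_bound hg (drop k (rcons w i)) ab.
  apply: (le_trans (ler_pM _ _ h1 h2)) => //.
  have -> : size (take k (rcons w i)) = k.
    by apply: size_takel; rewrite size_rcons; exact: leqW (ltnW kw).
  rewrite size_drop size_rcons subr0.
  have -> : ((size w).+1 - k = (size w - k.+1) + 2)%N by lia.
  rewrite exprD mulrA ler_wpM2r ?sqr_ge0//.
  apply: (@le_trans _ _ ((K + 1) ^+ k * (K + 1) ^+ (size w - k.+1))).
    have h3 : a <= K + 1 by lra.
    have h4 : b - a <= K + 1 by lra.
    have h5 : 0 <= b - a by lra.
    by apply: ler_pM; rewrite ?exprn_ge0//; rewrite lerXn2r ?nnegrE//; lra.
  rewrite -exprD; apply: ler_weXn2l; [lra|lia].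
by rewrite sumr_const card_ord -[_ *+ size w]mulr_natl mulrA.
Qed.

(** The iterated integrals up to time [K] are determined, continuously for the
  uniform distance, by the path: by induction on the word, [lp_step] is summed
  along a subdivision fine enough for the quadratic errors to be small. The
  distance [d] does not depend on the path. *)
Lemma lp_near_line (K eps : R) (w : seq 'I_r) : 0 <= K -> 0 < eps ->
  exists2 d : R, 0 < d & forall g c, lp g -> enorm c <= 1 ->
    (forall t i, 0 <= t -> t <= K -> `|g 0 t [:: i] - t * c 0 i| <= d) ->
    forall t, 0 <= t -> t <= K -> `|g 0 t w - sexp (t *: c) w| <= eps.
Proof.
move=> K0; elim/last_ind: w eps => [|w i IH] eps e0.
  exists 1 => // g c hg _ _ t t0 tK; rewrite lp_nil// sexp_nil subrr normr0 ltW//.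
pose e1 := eps / 3 / (K + 1).
have K1 : 0 < K + 1 by lra.
have e10 : 0 < e1 by rewrite !divr_gt0.
have [d' d'0 hd] := IH e1 e10.
pose C := 2 * ((size w)%:R * (K + 1) ^+ (size w).+1).
have C0 : 0 <= C by rewrite !mulr_ge0 ?exprn_ge0// ltW.
pose A := (K + 1) ^+ size w * 2.
have A0 : 0 < A by rewrite mulr_gt0 ?exprn_gt0.
(* [m] makes the sum of the quadratic errors small, and [d], depending on [m],
   that of the errors at the points of the subdivision *)
have [m hm] : exists m : nat, C * K ^+ 2 / m.+1%:R <= eps / 3.
  have B0 : 0 < C * K ^+ 2 + 1 by rewrite ltr_wpDl// mulr_ge0 ?sqr_ge0.
  have [m] := ltr_add_invr (y := 0) (divr_gt0 (divr_gt0 e0 (ltr0Sn R 2)) B0).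
  rewrite add0r => /ltW mh; exists m; rewrite mulrC.
  apply: (@le_trans _ _ (m.+1%:R^-1 * (C * K ^+ 2 + 1))).
    by rewrite ler_wpM2l ?invr_ge0// lerDl.
  by rewrite -ler_pdivlMr.
pose d := Num.min d' (eps / 3 / A / m.+1%:R).
have m0 : 0 < (m.+1%:R : R) by rewrite ltr0n.
exists d => [|g c hg c1 gd t t0 tK]; first by rewrite lt_min d'0 !divr_gt0.
have hl := lp_line c1; set l := (fun s t => _) in hl.
have l0 u : l 0 u = sexp (u *: c) by rewrite /l subr0.
have dd' : d <= d' by rewrite ge_min lexx.
have IHw u : 0 <= u -> u <= K -> `|g 0 u w - l 0 u w| <= e1.
  move=> u0 uK; rewrite l0; apply: hd => // s j s0 sK.
  exact: le_trans (gd s j s0 sK) dd'.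
pose D u := g 0 u (rcons w i) - l 0 u (rcons w i).
have stepD a b : 0 <= a -> a <= b -> b <= K ->
    `|D b - D a| <= e1 * (b - a) + A * d + C * (b - a) ^+ 2.
  move=> a0 ab bK; have aK := le_trans ab bK; have b0 := le_trans a0 ab.
  have h1 := lp_step w i hg K0 a0 ab bK; have h2 := lp_step w i hl K0 a0 ab bK.
  have h3 : `|g 0 a w * g a b [:: i] - l 0 a w * l a b [:: i]| <= e1 * (b - a) + A * d.
    have -> : g 0 a w * g a b [:: i] - l 0 a w * l a b [:: i] =
       (g 0 a w - l 0 a w) * g a b [:: i] + l 0 a w * (g a b [:: i] - l a b [:: i]) by ring.
    rewrite (le_trans (ler_normD _ _))// normrM [X in _ + X]normrM lerD//.
      apply: ler_pM => //; first exact: IHw.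
      exact: (lp_bound hg [:: i] ab).
    rewrite /A -mulrA; apply: ler_pM => //.
      apply: (le_trans (lp_bound hl w a0)); rewrite subr0 lerXn2r ?nnegrE//; lra.
    have gi := lp_incrD hg a0 ab; have li := lp_incrD hl a0 ab.
    move/rowP/(_ i) : gi; move/rowP/(_ i) : li; rewrite !mxE => li gi.
    have ga := gd a i a0 aK; have gb := gd b i b0 bK.
    have la : l 0 a [:: i] = a * c 0 i by rewrite l0 sexp_one mxE.
    have lb : l 0 b [:: i] = b * c 0 i by rewrite l0 sexp_one mxE.
    rewrite (_ : _ - _ = (g 0 b [:: i] - b * c 0 i) - (g 0 a [:: i] - a * c 0 i)).
      by rewrite (le_trans (ler_normB _ _))// mulr2n mulrDl mul1r lerD.
    by rewrite -la -lb li gi; ring.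
  rewrite (_ : D b - D a = (g 0 b (rcons w i) - g 0 a (rcons w i) - g 0 a w * g a b [:: i])
    - (l 0 b (rcons w i) - l 0 a (rcons w i) - l 0 a w * l a b [:: i])
    + (g 0 a w * g a b [:: i] - l 0 a w * l a b [:: i])); last by rewrite /D; ring.
  rewrite (le_trans (ler_normD _ _))// addrC lerD//.
  rewrite (le_trans (ler_normB _ _))// (le_trans (lerD h1 h2))//.
  by rewrite le_eqVlt; apply/orP; left; apply/eqP; rewrite /C; ring.
pose p (k : nat) := k%:R * (t / m.+1%:R).
have p0 k : 0 <= p k by rewrite mulr_ge0 ?divr_ge0.
have pm : p m.+1 = t by rewrite /p mulrC divfK// gt_eqF.
have pS k : p k.+1 - p k = t / m.+1%:R by rewrite /p -natr1; ring.
have pK k : (k <= m.+1)%N -> p k <= K.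
  by move=> km; apply: le_trans tK; rewrite -pm ler_wpM2r ?divr_ge0// ler_nat.
have D0 : D 0 = 0.
  by rewrite /D !lp_diag// subrr.
have hk k : (k <= m.+1)%N ->
    `|D (p k)| <= k%:R * (e1 * (t / m.+1%:R) + A * d + C * (t / m.+1%:R) ^+ 2).
  elim: k => [|k IHk] km; first by rewrite /p mul0r D0 normr0 mul0r.
  rewrite -(subrK (D (p k)) (D _)) (le_trans (ler_normD _ _))//.
  rewrite -natr1 mulrDl mul1r addrC lerD//; first exact: IHk (ltnW km).
  rewrite -(pS k); apply: stepD; [exact: p0| |exact: pK].
  by rewrite -subr_ge0 pS divr_ge0.
have := hk m.+1 (leqnn _); rewrite pm /D l0 => /le_trans; apply.
have -> : m.+1%:R * (e1 * (t / m.+1%:R) + A * d + C * (t / m.+1%:R) ^+ 2) =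
    e1 * t + (m.+1%:R * A * d) + C * t ^+ 2 / m.+1%:R.
  by move: (m.+1%:R) m0 => M M0; field; rewrite gt_eqF.
have b1 : e1 * t <= eps / 3.
  have e1K : e1 * (K + 1) = eps / 3 by rewrite /e1 divfK// gt_eqF.
  rewrite -e1K ler_pM2l//; lra.
have b2 : m.+1%:R * A * d <= eps / 3.
  have : d <= eps / 3 / A / m.+1%:R by rewrite ge_min lexx orbT.
  by rewrite ler_pdivlMr// ler_pdivlMr// => h; apply: le_trans h; rewrite le_eqVlt; apply/orP; left; apply/eqP; ring.
have b3 : C * t ^+ 2 / m.+1%:R <= eps / 3.
  apply: le_trans hm; rewrite ler_wpM2r ?invr_ge0// ler_wpM2l//.
  by rewrite lerXn2r ?nnegrE.
apply: (le_trans (lerD (lerD b1 b2) b3)); clear -e0; lra.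
Qed.

End LiftedPaths.

(** * Orthogonal projections *)

Section Projection.
Context {R : realType} {r : nat}.
Local Notation enorm := (@euclidean_norm R r).

Lemma dotp_mx (a b : 'rV[R]_r) : dotp a b = (a *m b^T) 0 0.
Proof. by rewrite !mxE; apply: eq_bigr => i _; rewrite !mxE. Qed.

(** The orthogonal projection onto the row space does not increase lengths, so that
  competitors may be projected to the span of the increments of a path. *)
Lemma orth_proj m (X : 'M[R]_(m, r)) : exists P : 'M[R]_r, [/\ (P <= X)%MS,
  forall a : 'rV[R]_r, (a <= X)%MS -> a *m P = a &
  forall a : 'rV[R]_r, enorm (a *m P) <= enorm a].
Proof.
have Bf := row_base_free X; have BE := eq_row_base X.
move: (row_base X) Bf BE => B Bf BE; pose G := B *m B^T.
have Gu : G \in unitmx.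
  rewrite -row_free_unit; apply/row_freeP.
  have : kermx G = 0.
    apply/row_matrixP => i; rewrite row0.
    have kG : row i (kermx G) *m G = 0 by rewrite -row_mul mulmx_ker row0.
    set u := row i _ in kG *.
    have : dotp (u *m B) (u *m B) = 0.
      have e : (u *m B) *m (u *m B)^T = 0 by rewrite trmx_mul mulmxA -(mulmxA u) -/G kG mul0mx.
      by rewrite dotp_mx e mxE.
    move/dotp_eq0 => uB.
    have /row_freeP[B' BB'] := Bf.
    by rewrite -[u]mulmx1 -BB' mulmxA uB mul0mx.
  move/eqP; rewrite kermx_eq0 => /row_freeP; exact.
pose P := B^T *m invmx G *m B.
have PT : P^T = P.
  have GT : G^T = G by rewrite /G trmx_mul trmxK.
  by rewrite /P !trmx_mul trmxK trmx_inv GT mulmxA.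
have PP : P *m P = P.
  rewrite /P -!mulmxA; congr (_ *m _); rewrite !mulmxA -(mulmxA (invmx G)).
  by rewrite mulVmx// mul1mx.
have PX : (P <= X)%MS by apply: submx_trans (submxMl _ _) _; rewrite BE.
have Pfix (a : 'rV_r) : (a <= X)%MS -> a *m P = a.
  rewrite -BE => /submxP[D ->].
  rewrite /P -!mulmxA; congr (_ *m _); rewrite !mulmxA -/G.
  by rewrite mulmxV// mul1mx.
clearbody P; exists P; split=> // a.
rewrite -(ler_pXn2r (n := 2))// ?nnegrE ?enorm_ge0// !enorm_sqr.
have h1 : dotp (a *m P) (a *m P) = dotp a (a *m P).
  by rewrite !dotp_mx (trmx_mul a P) PT !mulmxA -(mulmxA a P) PP.
have := dotp_ge0 (a - a *m P); rewrite -scaleN1r.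
rewrite !(dotpDl, dotpDr, dotpZl, dotpZr) (dotpC _ a) h1; lra.
Qed.

End Projection.

(** * Minimizing lifted paths and their blow-ups *)

Section Minimizers.
Context {R : realType} {r : nat}.
Local Notation ser := (ser R r).
Local Notation enorm := (@euclidean_norm R r).
Implicit Types (g : R -> R -> ser) (N : nat) (s t : R).

(** [g] is a length minimizer of the free nilpotent group of step [N], at speed 1. *)
Definition Nmin N g := forall s t (v : seq 'rV[R]_r), s <= t ->
  eqN N (sig v) (g s t) -> t - s <= len v.

(** The distance from the origin to [z] in the free nilpotent group of step [N] is
  at most [L]; the infimum defining it need not be attained by broken lines. *)
Definition app N (z : ser) (L : R) := forall e, 0 < e -> reach N z (L + e).

Lemma appM N (z z' : ser) L L' : app N z L -> app N z' L' -> app N (z * z') (L + L').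
Proof.
move=> h h' e e0; rewrite (_ : L + L' + e = (L + e / 2) + (L' + e / 2)); last first.
  by rewrite addrACA -splitr.
by apply: reachM; [apply: h|apply: h']; rewrite divr_gt0.
Qed.
Lemma app_le N (z : ser) L L' : app N z L -> L <= L' -> app N z L'.
Proof. by move=> h le ee ee0; apply: reach_le (h ee ee0); rewrite lerD2r. Qed.
Lemma app_reach N (z : ser) L : reach N z L -> app N z L.
Proof. by move=> h e e0; apply: reach_le h; rewrite lerDl ltW. Qed.
Lemma app_lp N g s t : lp g -> s <= t -> app N (g s t) (t - s).
Proof. by move=> [_ h] st e e0; exact: h. Qed.
Lemma Nmin_app N g s t z L : Nmin N g -> s <= t -> eqN N z (g s t) -> app N z L -> t - s <= L.
Proof.
move=> hm st zg hz; apply/ler_addgt0Pr => e e0; have [v vz vl] := hz e e0.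
by apply: le_trans vl; apply: hm => //; exact: eqN_trans vz zg.
Qed.
Lemma app1 N : app N 1 0.
Proof. by apply: app_reach; exists [::]; rewrite ?sig_nil// len_nil. Qed.

(** The path of R^r normalized to vanish at time 0. *)
Lemma lp_x g : lp g -> exists x : R -> 'rV[R]_r, [/\ x 0 = 0,
  forall s t, s <= t -> incr g s t = x t - x s &
  forall s t, s <= t -> enorm (x t - x s) <= t - s].
Proof.
move=> hg; pose x t := if 0 <= t then incr g 0 t else - incr g t 0.
have i0 : incr g 0 0 = 0.
  by have := lp_incrD hg (lexx 0) (lexx 0); rewrite -{1}[incr g 0 0]addr0 => /addrI <-.
have xE s t : s <= t -> incr g s t = x t - x s.
  move=> st; rewrite /x; have [t0|t0] := leP 0 t; have [s0|s0] := leP 0 s.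
  - by rewrite (lp_incrD hg s0 st) addrC addKr.
  - by rewrite opprK addrC (lp_incrD hg (ltW s0) t0).
  - by have := le_lt_trans (le_trans s0 st) t0; rewrite ltxx.
  - by rewrite opprK addrC (lp_incrD hg st (ltW t0)) addrK.
exists x; split => //; first by rewrite /x lexx.
by move=> s t st; rewrite -xE//; exact: lp_incr.
Qed.

(** The increments over finitely many disjoint intervals avoiding 0 already
  span all the increments: the rank stabilizes along dyadic grids. *)
Lemma spanning_grid (x : R -> 'rV[R]_r) : x 0 = 0 ->
  (forall s t, s <= t -> enorm (x t - x s) <= t - s) ->
  exists (d : R) (K : nat) (P : 'M[R]_r) (A B : 'M[R]_(r, K)), [/\ 0 < d,
    forall a, enorm (a *m P) <= enorm a,
    forall t, x t *m P = x t &
    P = A *m (\matrix_(c < K) (x (- (c.+1%:R * d)) - x (- (c.+2%:R * d)))) +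
        B *m (\matrix_(c < K) (x (c.+2%:R * d) - x (c.+1%:R * d)))].
Proof.
move=> x0 x1.
pose dl (j : nat) : R := 2 ^- j.
have dl0 j : 0 < dl j by rewrite invr_gt0 exprn_gt0.
have dlS j : dl j = 2 * dl j.+1.
  by rewrite /dl exprS invfM mulrA divff// mul1r.
pose Xn j : 'M[R]_(4 ^ j, r) :=
  \matrix_(c < 4 ^ j) (x (- (c.+1%:R * dl j)) - x (- (c.+2%:R * dl j))).
pose Xp j : 'M[R]_(4 ^ j, r) :=
  \matrix_(c < 4 ^ j) (x (c.+2%:R * dl j) - x (c.+1%:R * dl j)).
pose X j := col_mx (Xn j) (Xp j).
have rn j c : row c (Xn j) = x (- (c.+1%:R * dl j)) - x (- (c.+2%:R * dl j)).
  by apply/rowP => i; rewrite !mxE.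
have rp j c : row c (Xp j) = x (c.+2%:R * dl j) - x (c.+1%:R * dl j).
  by apply/rowP => i; rewrite !mxE.
have subn_ j c : (row c (Xn j) <= X j)%MS.
  by apply: submx_trans (row_sub _ _) _; rewrite /X -addsmxE addsmxSl.
have subp_ j c : (row c (Xp j) <= X j)%MS.
  by apply: submx_trans (row_sub _ _) _; rewrite /X -addsmxE addsmxSr.
have lt4 j (c : 'I_(4 ^ j)) e : (e <= 2)%N -> (c.*2 + e < 4 ^ j.+1)%N.
  by move=> e2; have := ltn_ord c; rewrite expnS -muln2; move: (4 ^ j)%N (nat_of_ord c) => z k; lia.
have monoS j : (X j <= X j.+1)%MS.
  rewrite /X col_mx_sub; apply/andP; split; apply/row_subP => c.
    rewrite rn dlS.
    have h1 := subn_ j.+1 (Ordinal (lt4 j c 1 isT)).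
    have h2 := subn_ j.+1 (Ordinal (lt4 j c 2 isT)).
    have := addmx_sub h1 h2; rewrite !rn /=.
    rewrite (_ : x _ - x _ + _ = x (- (c.+1%:R * (2 * dl j.+1))) - x (- (c.+2%:R * (2 * dl j.+1))))//.
    rewrite !mulrA -!natrM.
    by rewrite addn1 addn2 subrKA; congr (x (- (_%:R * _)) - x (- (_%:R * _))); lia.
  rewrite rp dlS.
  have h1 := subp_ j.+1 (Ordinal (lt4 j c 1 isT)).
  have h2 := subp_ j.+1 (Ordinal (lt4 j c 2 isT)).
  have := addmx_sub h2 h1; rewrite !rp /=.
  rewrite (_ : x _ - x _ + _ = x (c.+2%:R * (2 * dl j.+1)) - x (c.+1%:R * (2 * dl j.+1)))//.
  rewrite !mulrA -!natrM.
  by rewrite addn1 addn2 subrKA; congr (x (_%:R * _) - x (_%:R * _)); lia.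
have mono j i : (j <= i)%N -> (X j <= X i)%MS.
  move=> /subnK <-; elim: (i - j)%N => [//|k IH].
  exact: submx_trans IH (monoS _).
(* a grid of maximal rank spans the increments over the cells of all the grids *)
have [j0 hj0] : exists j0, forall j, (X j <= X j0)%MS.
  have ex : exists m, `[< exists j, \rank (X j) = m >] by exists (\rank (X 0%N)); apply/asboolP; exists 0%N.
  have ub m : `[< exists j, \rank (X j) = m >] -> (m <= r)%N.
    by move/asboolP => [j <-]; exact: rank_leq_col.
  have [m /asboolP[j0 jm] mmax] := ex_maxnP ex ub.
  exists j0 => j; have [jj|/ltnW jj] := leqP j j0; first exact: mono.
  rewrite -(geq_leqif (mxrank_leqif_sup (mono _ _ jj))) jm; apply: mmax.
  by apply/asboolP; exists j.
have [P [PX Pfix Pc]] := orth_proj (X j0).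
have XP j (a : 'rV_r) : (a <= X j)%MS -> a *m P = a.
  by move=> aX; apply: Pfix; exact: submx_trans aX (hj0 j).
pose DD := P *m pinvmx (X j0).
have PE : P = DD *m X j0 by rewrite /DD mulmxKpV.
exists (dl j0), (4 ^ j0)%N, P, (lsubmx DD), (rsubmx DD); split=> //; last first.
  by rewrite {1}PE -{1}(hsubmxK DD) mul_row_col.
have diffb (a : 'rV[R]_r) : enorm (a - a *m P) <= 2 * enorm a.
  by rewrite (le_trans (enormD _ _))// enormN; have := Pc a; lra.
(* the cell next to 0 and the last incomplete one are negligible on fine grids *)
have key (y : R -> 'rV[R]_r) : y 0 = 0 ->
   (forall s t, 0 <= s -> s <= t -> enorm (y t - y s) <= t - s) ->
   (forall j (c : 'I_(4 ^ j)), (y (c.+2%:R * dl j) - y (c.+1%:R * dl j)) *m P =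
       y (c.+2%:R * dl j) - y (c.+1%:R * dl j)) ->
   forall t, 0 <= t -> y t *m P = y t.
  move=> y0 y1 yP t t0; apply/esym/eqP; rewrite -subr_eq0; apply/eqP/enorm_eq0.
  apply/eqP; rewrite eq_le enorm_ge0 andbT; apply/ler_addgt0Pr => e e0; rewrite add0r.
  have [j [tj ej]] : exists j : nat, t <= 2 ^+ j /\ dl j * 4 <= e.
    have [m /ltW mt] : exists m : nat, Num.max t (4 / e) < m%:R by exists (Num.truncn (Num.max t (4 / e))).+1; exact: truncnS_gt.
    have m2 : (m%:R : R) <= 2 ^+ m by rewrite -natrX ler_nat ltnW// ltn_expl.
    exists m; split.
      by apply: le_trans m2; apply: le_trans mt; rewrite le_max lexx.
    rewrite /dl mulrC ler_pdivrMr ?exprn_gt0// mulrC -ler_pdivrMr//.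
    by apply: le_trans m2; apply: le_trans mt; rewrite le_max lexx orbT.
  pose k := Num.truncn (t / dl j).
  have td0 : 0 <= t / dl j by rewrite divr_ge0// ltW.
  have /andP[k1 k2] := truncn_itv td0; rewrite -/k in k1 k2.
  rewrite ler_pdivlMr// in k1; rewrite ltr_pdivrMr// in k2.
  have kK : (k <= 4 ^ j)%N.
    rewrite -(ler_nat R) -(ler_pM2r (dl0 j)); apply: (le_trans k1); apply: (le_trans tj).
    rewrite /dl -[4%N]/(2 * 2)%N expnMn natrM !natrX mulrK// unitfE expf_neq0//.
  have yk i : (i <= 4 ^ j)%N -> (y (i.+1%:R * dl j) - y (dl j)) *m P = y (i.+1%:R * dl j) - y (dl j).
    elim: i => [|i IH] ik; first by rewrite mul1r subrr mul0mx.
    rewrite -(subrKA (y (i.+1%:R * dl j))) mulmxDl IH ?(ltnW ik)//.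
    by rewrite (yP j (Ordinal ik)).
  have [a [b [ab abd abP]]] : exists a b, [/\ y t = a + b, enorm b <= dl j * 2 & a *m P = a].
    case: (posnP k) => [kz|kp].
      exists 0, (y t); split; rewrite ?add0r ?mul0mx//.
      have := y1 0 t (lexx 0) t0; rewrite y0 !subr0 => /le_trans; apply.
      rewrite kz mul1r in k2; have := dl0 j; lra.
    exists (y (k%:R * dl j) - y (dl j)), ((y t - y (k%:R * dl j)) + y (dl j)); split.
    - by rewrite addrA (addrC (y (k%:R * _) - _)) subrKA subrK.
    - rewrite (le_trans (enormD _ _))//.
      have h1 := y1 (k%:R * dl j) t (mulr_ge0 (ler0n _ _) (ltW (dl0 j))) k1.
      have := y1 0 (dl j) (lexx 0) (ltW (dl0 j)); rewrite y0 !subr0 => h2.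
      move: k2; rewrite -natr1 mulrDl mul1r => k2; lra.
    - by rewrite -(prednK kp); apply: yk; rewrite (leq_trans (leq_pred k)).
  rewrite ab mulmxDl abP opprD addrACA subrr add0r.
  by apply: (le_trans (diffb b)); lra.
move=> t; have [t0|t0] := leP 0 t.
  apply: (key x) => //; first by move=> s u _; exact: x1.
  by move=> j c; apply: (XP j); rewrite -rp; exact: subp_.
rewrite -{2}(opprK t) -{1}(opprK t).
have := key (fun s => x (- s)); rewrite oppr0; apply=> //; last by rewrite oppr_ge0 ltW.
- by move=> s u _ su; rewrite -enormN opprB; apply: le_trans (x1 _ _ _) _; rewrite ?lerN2//; lra.
- move=> j c; rewrite -[_ - _]opprB mulNmx; congr (- _).
  by apply: (XP j); rewrite -rn; exact: subn_.
Qed.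

(** ** Products of perturbed factors *)

(** [z] starts in degree [M]; modulo degrees above [M] such series add up in
  products with series of constant term 1. *)
Definition lowz M (z : ser) := forall w, (size w < M)%N -> z w = 0.

Lemma lowz_mull M (f z : ser) : f [::] = 1 -> lowz M z -> eqN M (f * z) z.
Proof.
move=> f1 zl w wM; rewrite serME big_ord_recl take0 drop0 f1 mul1r big1 ?addr0// => k _.
rewrite zl ?mulr0// size_drop lift0; have := ltn_ord k; lia.
Qed.
Lemma lowz_mulr M (f z : ser) : f [::] = 1 -> lowz M z -> eqN M (z * f) z.
Proof.
move=> f1 zl w wM; rewrite serM_recr f1 mulr1 big1 ?add0r// => -[k kw] _.
rewrite zl ?mul0r// size_takel ?(ltnW kw)//; exact: leq_trans kw wM.
Qed.

Lemma eqND M (f f' g g' : ser) : eqN M f f' -> eqN M g g' -> eqN M (f + g) (f' + g').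
Proof. by move=> h h' w wM; rewrite !serDE h ?h'. Qed.
Lemma eqNN M (f f' : ser) : eqN M f f' -> eqN M (- f) (- f').
Proof. by move=> h w wM; rewrite !serNE h. Qed.

Lemma perturb_mul M (Z Z' G G' z z' : ser) : (0 < M)%N -> G [::] = 1 -> G' [::] = 1 ->
  lowz M z -> lowz M z' -> eqN M Z (G + z) -> eqN M Z' (G' + z') ->
  eqN M (Z * Z') (G * G' + (z + z')).
Proof.
move=> M0 G1 G1' zl zl' h h'.
apply: (eqN_trans (eqN_mul h h')).
have -> : (G + z) * (G' + z') = G * G' + (z * (G' + z') + G * z').
  by rewrite mulrDl mulrDr -addrA [G * z' + _]addrC.
apply: eqND => //; apply: eqND; last exact: lowz_mull.
by apply: lowz_mulr => //; rewrite serDE G1' zl' ?addr0.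
Qed.

Lemma perturb_prod M (s : seq nat) (Z G z : nat -> ser) : (0 < M)%N ->
  (forall c, G c [::] = 1) -> (forall c, lowz M (z c)) ->
  (forall c, c \in s -> eqN M (Z c) (G c + z c)) ->
  eqN M (\prod_(c <- s) Z c) (\prod_(c <- s) G c + \sum_(c <- s) z c).
Proof.
move=> M0 G1 zl; elim: s => [|c s IH] h; first by rewrite !big_nil addr0.
rewrite !big_cons; apply: perturb_mul => //.
- by elim: (s) => [|d s' IHs]; rewrite ?big_nil// big_cons serM_nil G1 IHs mulr1.
- by move=> w wM; rewrite ser_sumE big1// => i _; exact: zl.
- by apply: h; rewrite inE eqxx.
- by apply: IH => d ds; apply: h; rewrite inE ds orbT.
Qed.

Lemma app_prod N (s : seq nat) (Z : nat -> ser) (L : nat -> R) :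
  (forall c, c \in s -> app N (Z c) (L c)) -> app N (\prod_(c <- s) Z c) (\sum_(c <- s) L c).
Proof.
elim: s => [|c s IH] h; first by rewrite !big_nil; exact: app1.
rewrite !big_cons; apply: appM; first by apply: h; rewrite inE eqxx.
by apply: IH => d ds; apply: h; rewrite inE ds orbT.
Qed.

Lemma lp_prod g (p : nat -> R) n : lp g -> (forall i j, (i <= j)%N -> p i <= p j) ->
  \prod_(c <- iota 0 n) g (p c) (p c.+1) = g (p 0%N) (p n).
Proof.
move=> hg pm; elim: n => [|n IH]; first by rewrite big_nil lp_diag.
rewrite -(addn1 n) iotaD big_cat /= big_seq1 IH add0n addn1.
by rewrite -(hg.1 _ (p n))// pm.
Qed.

(** Conjugating a factor by [Y = 1 + y + ..], [y] of degree [N], multiplies it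
  by the bracket of [y] with its degree one part, up to degree [N + 1]. *)
Lemma conj_perturb N (q : seq 'rV[R]_r) (G y : ser) : (0 < N)%N -> G [::] = 1 ->
  (forall x : seq 'I_r, size x != N -> y x = 0) -> eqN N (sig q) (1 + y) ->
  eqN N.+1 (sig q * G * sig (inv q))
    (G + (y * vec (\row_i G [:: i]) - vec (\row_i G [:: i]) * y)).
Proof.
move=> N0 G1 yh qy; set a := \row_i _.
pose f := sig q.
have dE : f * G * sig (inv q) = G + (f * G - G * f) * sig (inv q).
  by rewrite mulrBl -(mulrA G) sig_invr mulr1 addrC subrK.
rewrite dE; apply: eqND => //.
have dE' : f * G - G * f = (f - 1) * (G - 1) - (G - 1) * (f - 1).
  have -> : (f - 1) * (G - 1) = f * G - (G + f - 1).
    by rewrite mulrBl mulrBr mul1r mulr1 -addrA -opprD addrA (addrC f).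
  have -> : (G - 1) * (f - 1) = G * f - (G + f - 1).
    by rewrite mulrBl mulrBr mul1r mulr1 -addrA -opprD addrA.
  have aux (V : zmodType) (x x' o : V) : x - x' = x - o - (x' - o).
    by rewrite opprB addrA subrK.
  exact: aux.
have flow : lowz N (f - 1).
  move=> v vk; have fv : f v = (1 + y) v by apply: qy; exact: ltnW.
  have yv : y v = 0 by apply: yh; rewrite neq_ltn vk.
  by rewrite serBE fv serDE yv addr0 subrr.
have fy' : eqN N (f - 1) y.
  move=> v vk; have fv : f v = (1 + y) v by exact: qy.
  by rewrite serBE fv serDE addrC addKr.
have Glow : lowz 1 (G - 1).
  by case=> // _; rewrite serBE G1 ser1E subrr.
have Gl : eqN 1 (G - 1) (vec a).
  case=> [|j [|//]] _; first by rewrite Glow// -[vec a]mulr1 vecM_nil.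
  by rewrite -[vec a]mulr1 vecM_cons mxE ser1E mulr1 serBE ser1E subr0.
have d1 : eqN N.+1 (f * G - G * f) (y * vec a - vec a * y).
  rewrite dE'; apply: eqND; last apply: eqNN.
    by rewrite -addn1; exact: (serM_low_cong flow Glow fy' Gl).
  by rewrite -add1n; exact: (serM_low_cong Glow flow Gl fy').
have dlow : lowz N.+1 (f * G - G * f).
  move=> v vk; rewrite dE' serBE (serM_low flow Glow) ?addn1// (serM_low Glow flow) ?subrr//.
apply: eqN_trans d1; apply: lowz_mulr => //; exact: sig_nil1.
Qed.

(** ** The step reduction *)

Lemma push_dil (P : 'M[R]_r) (t : R) (f : ser) : push P (dil t f) = dil t (push P f).
Proof.
apply/funext => w; rewrite /dil; elim: w f => [|j u IH] f; first by rewrite !push_nil.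
rewrite !push_cons mulr_sumr; apply: eq_bigr => i _.
rewrite (_ : sh i (fun w => _) = t *: dil t (sh i f)); last first.
  by apply/funext => v; rewrite /sh serZE /dil /= exprS mulrA.
by rewrite pushZ serZE IH /= exprS; ring.
Qed.

Lemma push_sum (P : 'M[R]_r) (I : Type) (s : seq I) (F : I -> ser) :
  push P (\sum_(i <- s) F i) = \sum_(i <- s) push P (F i).
Proof.
elim: s => [|i s IH]; last by rewrite !big_cons pushD IH.
by rewrite !big_nil -[0 in LHS](scale0r (0 : ser)) pushZ scale0r.
Qed.
Lemma push_homog (P : 'M[R]_r) k (y : ser) :
  (forall x : seq 'I_r, size x != k -> y x = 0) ->
  forall x : seq 'I_r, size x != k -> push P y x = 0.
Proof.
move=> h u; elim: u k y h => [|j u IH] k y h uk; first by rewrite push_nil h.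
rewrite push_cons big1// => i _; case: k h uk => [|k] h uk.
  have -> : sh i y = (0 : R) *: (1 : ser).
    by apply/funext => v; rewrite serZE mul0r; apply: h.
  by rewrite pushZ serZE mul0r mulr0.
by rewrite (IH k) ?mulr0// => v vk; apply: h.
Qed.

Lemma lp_push_id g (P : 'M[R]_r) : lp g -> (forall a, enorm (a *m P) <= enorm a) ->
  (forall s t, s <= t -> incr g s t *m P = incr g s t) ->
  forall s t, s <= t -> push P (g s t) = g s t.
Proof.
move=> hg Pc Pg; apply: lp_unique => //; first exact: lp_push.
move=> s t st; rewrite -[RHS]Pg//; apply/rowP => j.
rewrite !mxE push_cons; apply: eq_bigr => i _; rewrite push_nil /sh mxE mulrC.
by [].
Qed.

Lemma scvg_push (T : Type) (V : set_system T) (VV : UltraFilter V) (P : 'M[R]_r)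
  (z : T -> ser) l : scvg V z l -> scvg V (fun n => push P (z n)) (push P l).
Proof.
move=> zl w; elim: w z l zl => [|j u IH] z l zl; first exact: zl.
rewrite push_cons; under eq_fun do rewrite push_cons.
have FV : Filter V by apply: PFU.
apply: cvg_seqsum => i; apply: cvgM; first exact: cvg_cst.
by apply: (IH (fun n => sh i (z n))) => v; exact: zl.
Qed.

Lemma big_words_ser k (F : seq 'I_r -> ser) :
  \sum_(w <- words k.+1) F w = \sum_i \sum_(w <- words k) F (i :: w).
Proof. by rewrite [LHS]big_allpairs_dep /= big_enum. Qed.

Lemma lp_prod_rev g (p : nat -> R) n : lp g -> (forall i j, (i <= j)%N -> p j <= p i) ->
  \prod_(c <- rev (iota 0 n)) g (p c.+1) (p c) = g (p n) (p 0%N).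
Proof.
move=> hg pm; elim: n => [|n IH]; first by rewrite big_nil lp_diag.
rewrite -(addn1 n) iotaD rev_cat big_cat /= big_seq1 IH add0n addn1.
by rewrite -(hg.1 _ (p n))// pm.
Qed.

Lemma sum_cst_seq (s : seq nat) (a : R) : \sum_(c <- s) a = (size s)%:R * a.
Proof.
elim: s => [|c s IH]; first by rewrite big_nil mul0r.
by rewrite big_cons IH /= -natr1 mulrDl mul1r addrC.
Qed.

(** The coefficients [c] of a Lie polynomial [xi] of degree [N + 1] whose letters
  all lie in the span of the rows of [X] turn it into a sum of brackets of the
  rows of [X] with Lie polynomials of degree [N]. *)
Lemma lie_decomp N m (P : 'M[R]_r) (A : 'M[R]_(r, m)) (X : 'M[R]_(m, r))
    (c : seq 'I_r -> R) : (0 < N)%N -> P = A *m X ->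
  push P (\sum_(w <- words N.+1) c w *: br w) =
  \sum_(k < m) (vec (row k X) * push P (\sum_(u <- words N) (\sum_i A i k * c (i :: u)) *: br u)
    - push P (\sum_(u <- words N) (\sum_i A i k * c (i :: u)) *: br u) * vec (row k X)).
Proof.
move=> N0 PA; rewrite big_words_ser.
have vecD (a b : 'rV[R]_r) : vec (a + b) = vec a + vec b.
  by rewrite /vec -big_split; apply: eq_bigr => i _ /=; rewrite mxE scalerDl.
have vecZ (t : R) (a : 'rV[R]_r) : vec (t *: a) = t *: vec a.
  by rewrite /vec scaler_sumr; apply: eq_bigr => i _; rewrite mxE scalerA.
have vec0 : vec (0 : 'rV[R]_r) = 0 by rewrite -(scale0r 0) vecZ scale0r.
have rowP i : row i P = \sum_k A i k *: row k X.
  apply/rowP => j; rewrite PA !mxE summxE; apply: eq_bigr => k _; by rewrite !mxE.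
have vecP i : vec (row i P) = \sum_k A i k *: vec (row k X).
  rewrite rowP; elim/big_rec2 : _ => [|k y1 y2 _ IH]; first exact: vec0.
  by rewrite vecD vecZ IH.
pose B (u : seq 'I_r) := push P (br u).
transitivity (\sum_i \sum_(u <- words N) c (i :: u) *: (vec (row i P) * B u - B u * vec (row i P))).
  rewrite push_sum; apply: eq_bigr => i _; rewrite push_sum big_seq [RHS]big_seq.
  apply: eq_bigr => u; rewrite mem_words => /eqP us; rewrite pushZ; congr (_ *: _).
  case: u us => [|j u] us; first by rewrite -us in N0.
  rewrite [br _]/= -/(br (j :: u)) pushD -scaleN1r pushZ scaleN1r !pushM push_lett.
  by [].
have pE k : push P (\sum_(u <- words N) (\sum_i A i k * c (i :: u)) *: br u) =
    \sum_i \sum_(u <- words N) (A i k * c (i :: u)) *: B u.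
  rewrite push_sum exchange_big /=; apply: eq_bigr => u _.
  by rewrite pushZ scaler_suml.
under [RHS]eq_bigr do rewrite pE.
have e1 : \sum_(k < m) vec (row k X) * (\sum_i \sum_(u <- words N) (A i k * c (i :: u)) *: B u)
   = \sum_i \sum_(u <- words N) c (i :: u) *: (vec (row i P) * B u).
  under eq_bigr do rewrite mulr_sumr.
  rewrite exchange_big /=; apply: eq_bigr => i _.
  under eq_bigr do rewrite mulr_sumr.
  rewrite exchange_big /=; apply: eq_bigr => u _.
  rewrite vecP mulr_suml scaler_sumr; apply: eq_bigr => k _.
  by rewrite -scalerAr -scalerAl scalerA mulrC.
have e2 : \sum_(k < m) (\sum_i \sum_(u <- words N) (A i k * c (i :: u)) *: B u) * vec (row k X)
   = \sum_i \sum_(u <- words N) c (i :: u) *: (B u * vec (row i P)).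
  under eq_bigr do rewrite mulr_suml.
  rewrite exchange_big /=; apply: eq_bigr => i _.
  under eq_bigr do rewrite mulr_suml.
  rewrite exchange_big /=; apply: eq_bigr => u _.
  rewrite vecP mulr_sumr scaler_sumr; apply: eq_bigr => k _.
  by rewrite -scalerAr -scalerAl scalerA mulrC.
rewrite [RHS]big_split /= sumrN e1 e2 -sumrB; apply: eq_bigr => i _.
by rewrite -sumrB; apply: eq_bigr => u _; rewrite scalerBr.
Qed.

Section Step.
Variable U : set_system R.
Hypothesis UU : UltraFilter U.
Hypothesis U0 : 0^'+ `<=` U.

(** Replacing the piece [g (- d) d] by [m] makes an error in the top layer, which
  is central. Being a Lie polynomial in the span of the increments of [g], it is
  a sum of brackets of the increments over the cells of a fixed grid outside of
  [[- d, d]] with Lie polynomials of degree [N], by [lie_decomp]; conjugating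
  each cell by a loop of length [O(e)] produces these brackets. *)
Lemma compensate N g : (0 < N)%N -> lp g ->
  exists (P : 'M[R]_r) (d C : R) (L : nat), 0 < C /\
  [/\ 0 < d, P *m P = P, forall a, enorm (a *m P) <= enorm a,
  forall s t, s <= t -> incr g s t *m P = incr g s t &
  forall (c : seq 'I_r -> R) (e mL : R) (m : ser), 0 <= e ->
    (forall w, size w = N.+1 -> `|c w| <= e ^+ N) ->
    app N.+1 m mL -> m [::] = 1 ->
    eqN N.+1 m (g (- d) d - push P (\sum_(w <- words N.+1) c w *: br w)) ->
    exists2 Z, eqN N.+1 Z (g (- (L.+1%:R * d)) (L.+1%:R * d)) &
      app N.+1 Z (2 * (L%:R * d) + mL + C * e)].
Proof.
case: N => [//|n] _ hg; have N0 : (0 < n.+1)%N by [].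
set N := n.+1 in N0 *; have [x [x0 xg x1]] := lp_x hg.
have [d [K [P [A [B [d0 Pc xP PE]]]]]] := spanning_grid x0 x1.
pose Xn : 'M[R]_(K, r) := \matrix_(c < K) (x (- (c.+1%:R * d)) - x (- (c.+2%:R * d))).
pose Xp : 'M[R]_(K, r) := \matrix_(c < K) (x (c.+2%:R * d) - x (c.+1%:R * d)).
rewrite -/Xn -/Xp in PE.
have incP s t : s <= t -> incr g s t *m P = incr g s t.
  by move=> st; rewrite xg// mulmxBl !xP.
pose a0 : R := 1 + \sum_i \sum_k `|A i k| + \sum_i \sum_k `|B i k|.
have SA0 : 0 <= \sum_i \sum_k `|A i k| by do 2![apply: sumr_ge0 => ? _].
have SB0 : 0 <= \sum_i \sum_k `|B i k| by do 2![apply: sumr_ge0 => ? _].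
have a01 : 1 <= a0 by rewrite /a0 -addrA lerDl addr_ge0.
have a00 : 0 < a0 by exact: lt_le_trans a01.
pose W : R := (size (@words r N))%:R * 4 ^+ N.
have W0 : 0 <= W by rewrite mulr_ge0 ?exprn_ge0.
pose kap (e : R) := W * (a0 * e).
pose C := 2 * (K%:R * (2 * (W * a0))) + 1.
have C0 : 0 < C by rewrite ltr_wpDl// !mulr_ge0// ltW.
exists P, d, C, K; split=> //; split => //.
  have fixX (X : 'M[R]_(K, r)) : (forall k, row k X *m P = row k X) -> X *m P = X.
    by move=> h; apply/row_matrixP => k; rewrite row_mul h.
  rewrite {1}PE mulmxDl -!mulmxA !fixX -?PE// => k.
    by rewrite (_ : row k Xp = x (k.+2%:R * d) - x (k.+1%:R * d)) ?mulmxBl ?xP//;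
       apply/rowP => i; rewrite !mxE.
  by rewrite (_ : row k Xn = x (- (k.+1%:R * d)) - x (- (k.+2%:R * d))) ?mulmxBl ?xP//;
     apply/rowP => i; rewrite !mxE.
move=> c e mL m e0 ce hm m1 mE.
pose Q (f : 'I_r -> R) := push P (\sum_(u <- words N) (\sum_i f i * c (i :: u)) *: br u).
pose zeta f s t := vec (incr g s t) * Q f - Q f * vec (incr g s t).
have Qh f (u : seq 'I_r) : size u != N -> Q f u = 0.
  apply: push_homog => v vN; apply: (@brs_homog _ _ N) => // w; by rewrite mem_words => /eqP.
have veclow (a : 'rV[R]_r) : lowz 1 (vec a) by case=> // _; rewrite -[vec a]mulr1 vecM_nil.
have Qlow f : lowz N (Q f) by move=> u uN; rewrite Qh// neq_ltn uN.
have zlow f s t : lowz N.+1 (zeta f s t).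
  move=> u uN; rewrite /zeta serBE (serM_low (veclow _) (Qlow f)) ?add1n//.
  by rewrite (serM_low (Qlow f) (veclow _)) ?addn1// subrr.
(* a cell conjugated by a projected loop realizing [- Q f] *)
have cell f s t : s <= t -> \sum_i `|f i| <= a0 -> exists Z,
    eqN N.+1 Z (g s t + zeta f s t) /\ app N.+1 Z (t - s + 2 * kap e).
  move=> st fa.
  have [||| q qs ql] := @lie_reach R r n (fun u => - \sum_i f i * c (i :: u)) (a0 * e) (words N).
  - by rewrite mulr_ge0// ltW.
  - by move=> w; rewrite mem_words => /eqP.
  - move=> w; rewrite mem_words => /eqP wn; rewrite normrN.
    apply: (le_trans (ler_norm_sum _ _ _)).
    apply: (@le_trans _ _ (\sum_i `|f i| * e ^+ N)).
      by apply: ler_sum => i _; rewrite normrM ler_wpM2l// ce//= wn.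
    rewrite -mulr_suml exprMn ler_wpM2r ?exprn_ge0//.
    by apply: (le_trans fa); rewrite exprS ler_peMr ?(ltW a00) ?exprn_ege1.
  pose q' := [seq a *m P | a <- q].
  have lq' : len q' <= kap e.
    rewrite /kap /W -mulrA; apply: le_trans ql; rewrite /len big_map; exact: ler_sum.
  have qs' : eqN N (sig q') (1 + (- Q f)).
    rewrite /q' sig_push; apply: (eqN_trans (eqN_push P qs)); rewrite pushD push1.
    rewrite /Q -scaleN1r -pushZ scaler_sumr.
    by under [in X in eqN _ _ X]eq_bigr do rewrite scalerA mulN1r.
  exists (sig q' * g s t * sig (inv q')); split.
    have Qh' (u : seq 'I_r) : size u != N -> (- Q f) u = 0.
      by move=> un; rewrite serNE Qh ?oppr0.
    have := conj_perturb N0 (lp_nil hg st) Qh' qs'.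
    by rewrite -/(incr g s t) mulNr mulrN opprK /zeta [- _ + _]addrC.
  have lq1 : app N.+1 (sig q') (kap e) by apply: app_reach; exists q'.
  have lq2 : app N.+1 (sig (inv q')) (kap e) by apply: app_reach; exists (inv q') => //; rewrite len_inv.
  have := appM (appM lq1 (app_lp N.+1 hg st)) lq2.
  by rewrite (_ : kap e + (t - s) + kap e = t - s + 2 * kap e)//; ring.
pose fA (M : 'M[R]_(r, K)) (j : nat) i := if (insub j : option 'I_K) is Some k then M i k else 0.
have fAs (M : 'M[R]_(r, K)) j : \sum_i \sum_k `|M i k| <= a0 -> \sum_i `|fA M j i| <= a0.
  move=> h; apply: le_trans h; rewrite /fA; case: insubP => [k _ _|_].
    by apply: ler_sum => i _; rewrite (bigD1 k)//= lerDl sumr_ge0.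
  by apply: ler_sum => i _; rewrite normr0 sumr_ge0.
have Aa : \sum_i \sum_k `|A i k| <= a0 by rewrite /a0 addrAC lerDr addr_ge0.
have Ba : \sum_i \sum_k `|B i k| <= a0 by rewrite /a0 lerDr addr_ge0.
have ptS j : j.+1%:R * d <= j.+2%:R * d by rewrite ler_pM2r// ler_nat.
have ptN j : - (j.+2%:R * d) <= - (j.+1%:R * d) by rewrite lerN2.
have [Zn hZn] := boolp.choice (fun j => cell _ _ _ (ptN j) (fAs A j Aa)).
have [Zp hZp] := boolp.choice (fun j => cell _ _ _ (ptS j) (fAs B j Ba)).
pose Gn j := g (- (j.+2%:R * d)) (- (j.+1%:R * d)).
pose Gp j := g (j.+1%:R * d) (j.+2%:R * d).
pose zn j := zeta (fA A j) (- (j.+2%:R * d)) (- (j.+1%:R * d)).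
pose zp j := zeta (fA B j) (j.+1%:R * d) (j.+2%:R * d).
have Gn1 j : Gn j [::] = 1 by apply: lp_nil.
have Gp1 j : Gp j [::] = 1 by apply: lp_nil.
have Pn := @perturb_prod N.+1 (rev (iota 0 K)) Zn Gn zn (ltn0Sn N) Gn1
  (fun j => zlow _ _ _) (fun j _ => (hZn j).1).
have Pp := @perturb_prod N.+1 (iota 0 K) Zp Gp zp (ltn0Sn N) Gp1
  (fun j => zlow _ _ _) (fun j _ => (hZp j).1).
have GnE : \prod_(j <- rev (iota 0 K)) Gn j = g (- (K.+1%:R * d)) (- d).
  have := @lp_prod_rev g (fun i => - (i.+1%:R * d)) K hg; rewrite /= mul1r; apply.
  by move=> i j ij; rewrite lerN2 ler_pM2r// ler_nat.
have GpE : \prod_(j <- iota 0 K) Gp j = g d (K.+1%:R * d).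
  have := @lp_prod g (fun i => i.+1%:R * d) K hg; rewrite /= mul1r; apply.
  by move=> i j ij; rewrite ler_pM2r// ler_nat.
have dK : d <= K.+1%:R * d by rewrite ler_peMl ?(ltW d0) ?ler1n.
have dd : - d <= d by rewrite (@le_trans _ _ 0) ?oppr_le0 ?(ltW d0).
have KdN : - (K.+1%:R * d) <= - d by rewrite lerN2.
have znE : \sum_(j <- rev (iota 0 K)) zn j + \sum_(j <- iota 0 K) zp j =
    push P (\sum_(w <- words N.+1) c w *: br w).
  have PE' : P = row_mx A B *m col_mx Xn Xp by rewrite mul_row_col.
  rewrite (lie_decomp c N0 PE') big_split_ord /=; congr (_ + _).
    rewrite (perm_big (iota 0 K)) /=; last by rewrite perm_rev.
    transitivity (\sum_(0 <= j < K) zn j); first by rewrite /index_iota subn0.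
    rewrite big_mkord; apply: eq_bigr => k _; rewrite rowKu.
    have fE i : fA A k i = row_mx A B i (lshift K k) by rewrite /fA valK row_mxEl.
    have rE : row k Xn = incr g (- (k.+2%:R * d)) (- (k.+1%:R * d)).
      by rewrite xg//; apply/rowP => i; rewrite !mxE.
    have QE : Q (fA A k) = push P (\sum_(u <- words N) (\sum_i row_mx A B i (lshift K k) * c (i :: u)) *: br u).
      rewrite /Q; congr (push P _); apply: eq_bigr => u _; congr (_ *: _).
      by apply: eq_bigr => i _; rewrite fE.
    by rewrite rE /zn /zeta QE.
  transitivity (\sum_(0 <= j < K) zp j); first by rewrite /index_iota subn0.
  rewrite big_mkord; apply: eq_bigr => k _; rewrite rowKd.
  have fE i : fA B k i = row_mx A B i (rshift K k) by rewrite /fA valK row_mxEr.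
  have rE : row k Xp = incr g (k.+1%:R * d) (k.+2%:R * d).
    by rewrite xg//; apply/rowP => i; rewrite !mxE.
  have QE : Q (fA B k) = push P (\sum_(u <- words N) (\sum_i row_mx A B i (rshift K k) * c (i :: u)) *: br u).
      rewrite /Q; congr (push P _); apply: eq_bigr => u _; congr (_ *: _).
      by apply: eq_bigr => i _; rewrite fE.
    by rewrite rE /zp /zeta QE.
have zslow (s : seq nat) (z : nat -> ser) : (forall j, lowz N.+1 (z j)) -> lowz N.+1 (\sum_(j <- s) z j).
  by move=> h w wM; rewrite ser_sumE big1// => j _; exact: h.
pose xi := push P (\sum_(w <- words N.+1) c w *: br w).
have xilow : lowz N.+1 (- xi).
  move=> w wN; rewrite serNE /xi (@push_homog P N.+1) ?oppr0 ?neq_ltn ?wN//.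
  by move=> v vN; apply: (@brs_homog _ _ N.+1) => // u; rewrite mem_words => /eqP.
exists (\prod_(j <- rev (iota 0 K)) Zn j * m * \prod_(j <- iota 0 K) Zp j).
  rewrite GnE in Pn; rewrite GpE in Pp.
  have h1 := perturb_mul (ltn0Sn N) (lp_nil hg KdN) (lp_nil hg dd)
    (zslow _ _ (fun j => zlow _ _ _)) xilow Pn mE.
  have n1 : (g (- (K.+1%:R * d)) (- d) * g (- d) d) [::] = 1.
    by rewrite serM_nil !lp_nil// mulr1.
  have zl2 : lowz N.+1 (\sum_(j <- rev (iota 0 K)) zn j + - xi).
    by move=> w wN; rewrite serDE (zslow _ _ (fun j => zlow _ _ _))// xilow// addr0.
  have h2 := perturb_mul (ltn0Sn N) n1 (lp_nil hg dK) zl2 (zslow _ _ (fun j => zlow _ _ _)) h1 Pp.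
  apply: (eqN_trans h2).
  rewrite (addrAC _ (- xi)) znE subrr addr0 -(hg.1 _ (- d))//.
  by rewrite -(hg.1 _ d)// (le_trans KdN dd).
have an := app_prod (fun j (_ : j \in rev (iota 0 K)) => (hZn j).2).
have ap := app_prod (fun j (_ : j \in iota 0 K) => (hZp j).2).
have := appM (appM an hm) ap.
have d1 j : - (j.+1%:R * d) - - (j.+2%:R * d) + 2 * kap e = d + 2 * kap e.
  by rewrite -(natr1 j.+1); ring.
have d2 j : j.+2%:R * d - j.+1%:R * d + 2 * kap e = d + 2 * kap e.
  by rewrite -(natr1 j.+1); ring.
rewrite (eq_bigr _ (fun j _ => d1 j)) (eq_bigr _ (fun j _ => d2 j)).
rewrite !sum_cst_seq size_rev size_iota.
move=> h; apply: app_le h _.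
rewrite /kap /C -subr_ge0.
rewrite (_ : _ - _ = e) //; ring.
Qed.

(** Blow-ups of minimizers of step [N + 1] are minimizers of step [N]: a
  competitor at step [N] for the blow-up yields, at a small scale [eta], a
  shortcut saving a length of order [eta] with a defect of order [eta ^ N.+1] in
  the top layer, which is compensated at the cost of a small fraction of
  [eta]. *)
Lemma step_reduction N g : (0 < N)%N -> lp g -> Nmin N.+1 g -> Nmin N (tan U g).
Proof.
move=> N0 hg hm a b v ab vz; rewrite leNgt; apply/negP => vl.
have [P [d [C [L [C0 [d0 PP Pc gP comp]]]]]] := compensate N0 hg.
have [ht cv] := tanP UU hg.
have pg := lp_push_id hg Pc gP.
pose G eta := rescale (pos eta) g a b.
have pga eta : push P (G eta) = G eta.
  by rewrite /G /rescale push_dil pg// ler_pM2l// pos_gt0.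
have pt : push P (tan U g a b) = tan U g a b.
  have sp : scvg U (fun eta => push P (G eta)) (push P (tan U g a b)).
    by have := @scvg_push _ U UU P (fun eta => rescale (pos eta) g a b) _ (cv a b ab).
  have gG : (fun eta => push P (G eta)) = G by apply/funext => eta; exact: pga.
  rewrite gG in sp; exact: (scvg_unique UU sp (cv a b ab)).
(* the competitor and the correction are projected to the span of the increments *)
pose v' := [seq x *m P | x <- v].
have v'z : eqN N (sig v') (tan U g a b).
  by rewrite -pt /v' sig_push; exact: eqN_push.
have v'l : len v' <= len v by rewrite /len big_map; exact: ler_sum.
have pv' : push P (sig (inv v')) = sig (inv v').
  rewrite -sig_push; congr sig; rewrite /inv map_rev -!map_comp; congr rev.
  by apply: eq_map => x /=; rewrite mulNmx -mulmxA PP.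
pose rho := (b - a - len v) / 3.
have rho0 : 0 < rho by rewrite divr_gt0// subr_gt0.
have [de de0 chow] := @free_chow R r N rho rho0.
pose D := (rho + len v + (b - a + 1)) ^+ N.+1.
have Db0 : 0 <= rho + len v + (b - a + 1).
  by have := len_ge0 v; have := subr_ge0 a b; rewrite ab => h1 h2; lra.
have D0 : 0 <= D by rewrite exprn_ge0.
pose ep := rho / C.
have ep0 : 0 < ep by rewrite divr_gt0.
pose eta1 := Num.min (d / (`|a| + `|b| + 1)) (ep ^+ N / (D + 1)).
have ab1 : 0 < `|a| + `|b| + 1 by rewrite ltr_wpDl// addr_ge0.
have eta10 : 0 < eta1 by rewrite lt_min !divr_gt0// ?exprn_gt0// ltr_wpDl.
have near1 := near_lt U0 eta10.
pose l := sig (inv v') * tan U g a b.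
have Ecv : scvg U (fun eta => sig (inv v') * G eta) l.
  by have := @scvgM _ _ _ U UU (fun=> sig (inv v')) _ (fun eta => rescale (pos eta) g a b) _ (@scvg_cst _ _ _ U UU _) (cv a b ab).
have near2 : \forall eta \near U, forall w, w \in @wordsle r N -> `|l w - (sig (inv v') * G eta) w| <= de.
  have FU : Filter U by apply: PFU.
  by apply: near_seq => w; have /cvgrPdist_le := Ecv w; apply.
have [eta' [/andP[e0 e1] near2']] : exists eta, 0 < pos eta < eta1 /\
    (forall w, w \in @wordsle r N -> `|l w - (sig (inv v') * G eta) w| <= de).
  by apply: (@filter_ex _ U (PFU UU)); have FU : Filter U by [apply: PFU]; apply: filterS2 near1 near2.
move: near2' (pga eta'); rewrite /G; set eta := pos eta' in e0 e1 *; set Gx := rescale eta g a b.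
move=> near2' pG.
have hgr := lp_rescale e0 hg.
pose E1 := sig (inv v') * Gx.
have gE1 : GL E1 by apply: GL_sigM; exact: lp_GL hgr _ _ ab.
have l1 : eqN N l 1.
  by rewrite /l -(sig_invl v'); apply: eqN_mul => //; exact: eqN_sym.
have [w0|w0 w0z w0l] := chow E1 gE1.
  move=> /andP[w00 w0N]; have := near2' w0; rewrite mem_wordsle => /(_ w0N).
  rewrite l1// ser1E (_ : w0 == [::] = false); last by case: (w0) w00.
  by rewrite sub0r normrN.
pose w := [seq x *m P | x <- w0].
have pE1 : push P E1 = E1 by rewrite /E1 pushM pv' pG.
have wz : eqN N (sig w) E1 by rewrite /w sig_push -pE1; exact: eqN_push.
have wl : len w <= rho.
  by apply: le_trans w0l; rewrite /len big_map; exact: ler_sum.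
have pw : push P (sig (inv w)) = sig (inv w).
  rewrite -sig_push; congr sig; rewrite /inv map_rev -!map_comp; congr rev.
  by apply: eq_map => x /=; rewrite mulNmx -mulmxA PP.
(* the defect is now trivial up to degree [N], hence [1 + xi] in degree [N + 1] *)
pose E2 := sig (inv w) * E1.
have gE2 : GL E2 by exact: GL_sigM.
have E21 : eqN N E2 1.
  by rewrite /E2 -(sig_invl w); apply: eqN_mul => //; exact: eqN_sym.
have pE2 : push P E2 = E2 by rewrite /E2 pushM pw pE1.
pose S := sig (v' ++ w).
have GE : Gx = S * E2.
  by rewrite /S /E2 /E1 sig_cat -!mulrA (mulrA (sig w)) sig_invr mul1r mulrA sig_invr mul1r.
pose c0 (u : seq 'I_r) := E2 u / N.+1%:R.
pose xi := \sum_(u <- words N.+1) c0 u *: br u.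
have xih (u : seq 'I_r) : size u != N.+1 -> xi u = 0.
  by apply: brs_homog => x; rewrite mem_words => /eqP.
have xilow : lowz N.+1 xi by move=> u uN; rewrite xih// neq_ltn uN.
have E2xi : eqN N.+1 E2 (1 + xi).
  move=> u; rewrite leq_eqVlt => /orP[/eqP uN|uN].
    rewrite (GL_lie gE2 E21 uN) serDE ser1E /xi ser_sumE.
    by case: (u) uN => //= i u' _; rewrite add0r.
  by rewrite serDE xilow// addr0 E21.
(* being invariant under the projection, [xi] lies in the span of the increments *)
have pxi : eqN N.+1 xi (push P xi).
  have : eqN N.+1 (1 + xi) (1 + push P xi).
    apply: eqN_trans (eqN_sym E2xi) _; rewrite -{1}pE2.
    by apply: (eqN_trans (eqN_push P E2xi)); rewrite pushD push1.
  by move=> h u uN; have := h u uN; rewrite !serDE => /addrI.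
have S1 : S [::] = 1 by exact: sig_nil1.
have SE : eqN N.+1 S (Gx - xi).
  have h : eqN N.+1 Gx (S + xi).
    rewrite GE; apply: (eqN_trans (eqN_mul (eqN_refl S) E2xi)).
    by rewrite mulrDr mulr1; apply: eqND => //; exact: lowz_mull.
  by move=> u uN; rewrite serBE h// serDE addrK.
pose c u := eta ^+ N.+1 * c0 u.
have dxi : dil eta xi = \sum_(u <- words N.+1) c u *: br u.
  apply/funext => x; rewrite /dil /xi !ser_sumE mulr_sumr big_seq [RHS]big_seq.
  apply: eq_bigr => u; rewrite mem_words => /eqP uN; rewrite !serZE /c.
  have [xu|xu] := eqVneq (size x) (size u); last by rewrite br_homog// !mulr0.
  by rewrite xu uN mulrA.
have dG : dil eta Gx = g (eta * a) (eta * b).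
  by rewrite /Gx /rescale dil_comp mulfV ?gt_eqF// dil_id.
have eab : eta * a <= eta * b by rewrite ler_pM2l.
have [ea eb] : - d <= eta * a /\ eta * b <= d.
  have h : eta * (`|a| + `|b| + 1) <= d.
    rewrite -ler_pdivlMr//; apply: (le_trans (ltW e1)); by rewrite ge_min lexx.
  have ha : eta * `|a| <= d by apply: le_trans h; rewrite ler_pM2l// -addrA lerDl addr_ge0.
  have hb : eta * `|b| <= d by apply: le_trans h; rewrite ler_pM2l// addrAC lerDr addr_ge0.
  split; last by apply: le_trans hb; rewrite ler_pM2l// ler_norm.
  rewrite -[leRHS]opprK lerN2 -mulrN; apply: le_trans ha.
  by rewrite ler_pM2l// -normrN ler_norm.
(* the path with the shortcut on [[eta a, eta b]] *)
pose m := g (- d) (eta * a) * dil eta S * g (eta * b) d.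
pose mL := (eta * a - - d) + eta * (len v' + len w) + (d - eta * b).
have hmm : app N.+1 m mL.
  apply: appM; last exact: app_lp.
  apply: appM; first exact: app_lp.
  apply: app_reach; exists (scl eta (v' ++ w)); first by rewrite sig_scl.
  by rewrite len_scl len_cat gtr0_norm.
have m1 : m [::] = 1.
  by rewrite /m !serM_nil (lp_nil hg ea) (lp_nil hg eb) /dil S1 !mulr1.
pose z1 := dil eta xi.
have z1low : lowz N.+1 (- z1) by move=> u uN; rewrite serNE /z1 /dil xilow// mulr0 oppr0.
have low0 : lowz N.+1 (0 : ser) by [].
have dS : eqN N.+1 (dil eta S) (g (eta * a) (eta * b) + - z1).
  apply: (eqN_trans (eqN_dil eta SE)); rewrite -dG /z1 => u _.
  by rewrite serBE /dil !serBE mulrBr.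
have mE : eqN N.+1 m (g (- d) d - push P (\sum_(u <- words N.+1) c u *: br u)).
  have r1 (h : ser) : eqN N.+1 h (h + 0) by rewrite addr0.
  have h1 := perturb_mul (ltn0Sn N) (lp_nil hg ea) (lp_nil hg eab) low0 z1low (r1 _) dS.
  have n1 : (g (- d) (eta * a) * g (eta * a) (eta * b)) [::] = 1.
    by rewrite serM_nil (lp_nil hg ea) (lp_nil hg eab) mulr1.
  rewrite add0r in h1.
  have h2 := perturb_mul (ltn0Sn N) n1 (lp_nil hg eb) z1low low0 h1 (r1 _).
  rewrite addr0 -(hg.1 _ (eta * a))// -(hg.1 _ (eta * b)) ?(le_trans ea)// in h2.
  apply: (eqN_trans h2); apply: eqND => //; apply: eqNN.
  rewrite /z1 -dxi push_dil; exact: eqN_dil.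
have cb (u : seq 'I_r) : size u = N.+1 -> `|c u| <= (ep * eta) ^+ N.
  move=> uN; have etaN : 0 <= eta ^+ N.+1 by rewrite exprn_ge0// ltW.
  have E2D : `|E2 u| <= D.
    have [q qz ql] := hgr.2 a b ab N.+1 1 ltr01.
    have -> : E2 u = sig (inv w ++ inv v' ++ q) u.
      rewrite !sig_cat /E2 /E1; apply: (eqN_mul (eqN_refl _) (eqN_mul (eqN_refl _) (eqN_sym qz))).
      by rewrite uN.
    apply: (le_trans (sig_le _ _)); rewrite uN lerXn2r ?nnegrE ?len_ge0//.
    rewrite !len_cat !len_inv addrA; apply: lerD ql.
    by apply: lerD => //.
  have cE : `|c u| <= eta ^+ N.+1 * D.
    rewrite /c /c0 normrM (ger0_norm etaN) ler_wpM2l// normrM normfV.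
    apply: le_trans E2D; rewrite ler_pdivrMr ?normr_gt0 ?pnatr_eq0//.
    by rewrite ler_peMr// ger0_norm// ler1n.
  apply: (le_trans cE); rewrite exprMn exprS mulrAC.
  rewrite ler_wpM2r ?exprn_ge0 ?(ltW e0)//.
  have h : eta * (D + 1) <= ep ^+ N.
    by rewrite -ler_pdivlMr ?ltr_wpDl//; apply: (le_trans (ltW e1)); rewrite ge_min lexx orbT.
  by apply: le_trans h; rewrite ler_pM2l// lerDl.
have ee0 : 0 <= ep * eta by rewrite mulr_ge0// ltW.
have [Z ZE ZL] := comp c (ep * eta) mL m ee0 cb hmm m1 mE.
have LL : - (L.+1%:R * d) <= L.+1%:R * d.
  by rewrite (@le_trans _ _ 0)// ?oppr_le0 mulr_ge0// ltW.
have := Nmin_app hm LL ZE ZL.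
rewrite /mL -(natr1 L) opprK => fin.
have Cep : C * (ep * eta) = eta * rho by rewrite /ep; field; rewrite gt_eqF.
rewrite Cep in fin.
have : eta * (b - a) <= eta * (len v' + len w + rho).
  by rewrite !mulrDr mulrN; rewrite mulrDr in fin; lra.
rewrite ler_pM2l// leNgt => /negP; apply.
rewrite (@le_lt_trans _ _ (len v + rho + rho))//; first by rewrite !lerD.
by rewrite /rho; lra.
Qed.

End Step.

(** ** Minimizers of step one are straight lines *)

(** The triangle inequality in the Euclidean space R^r is an equality along [g], so
  that successive increments are positively proportional. *)
Lemma Nmin1_line g : lp g -> Nmin 1 g -> exists2 c : 'rV[R]_r, enorm c = 1 &
  forall s t, s <= t -> incr g s t = (t - s) *: c.
Proof.
move=> hg hm.
have nE s t : s <= t -> enorm (incr g s t) = t - s.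
  move=> st; apply/eqP; rewrite eq_le (lp_incr hg st)/=.
  have := hm s t [:: incr g s t] st; rewrite len_cons len_nil addr0; apply.
  rewrite sig_cons sig_nil mulr1 => -[|i [|//]] _.
    by rewrite sexp_nil (lp_nil hg st).
  by rewrite sexp_one mxE.
(* the equality case of the triangle inequality *)
have prop s t u : s <= t -> t <= u -> (u - t) *: incr g s t = (t - s) *: incr g t u.
  move=> st tu; have e1 := nE _ _ st; have e2 := nE _ _ tu.
  have e3 := nE _ _ (le_trans st tu); rewrite (lp_incrD hg st tu) in e3.
  set p := incr g s t in e1 e3 *; set q := incr g t u in e2 e3 *.
  apply/eqP; rewrite -subr_eq0; apply/eqP/dotp_eq0.
  have := congr1 (fun x => x ^+ 2) e3; rewrite enorm_sqr !(dotpDl, dotpDr) (dotpC q p).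
  have := congr1 (fun x => x ^+ 2) e1; have := congr1 (fun x => x ^+ 2) e2.
  rewrite /= !enorm_sqr => h1 h2 h3.
  rewrite -scaleNr !(dotpDl, dotpDr, dotpZl, dotpZr) (dotpC q p) h1 h2.
  have -> : dotp p q = (u - t) * (t - s) by rewrite h1 h2 in h3; lra.
  ring.
have c1 := nE 0 1 ler01; rewrite subr0 in c1.
exists (incr g 0 1) => // s t st.
have key a b : a <= 0 -> 1 <= b -> incr g a b = (b - a) *: incr g 0 1.
  move=> a0 b1; have b0 : 0 <= b by apply: le_trans b1.
  have h1 := prop a 0 1 a0 ler01; have h2 := prop 0 1 b ler01 b1.
  rewrite !subr0 scale1r in h1; rewrite subr0 scale1r in h2.
  rewrite (lp_incrD hg a0 b0) (lp_incrD hg ler01 b1) h1 -h2.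
  by rewrite -{2}[incr g 0 1]scale1r -!scalerDl; congr (_ *: _); ring.
pose a := Num.min s 0; pose b := Num.max t 1.
have as_ : a <= s by rewrite ge_min lexx.
have tb : t <= b by rewrite le_max lexx.
have a0 : a <= 0 by rewrite ge_min lexx orbT.
have b1 : 1 <= b by rewrite le_max lexx orbT.
have kab := key a b a0 b1.
have sb := le_trans st tb.
rewrite (lp_incrD hg as_ sb) (lp_incrD hg st tb) in kab.
have h1 := prop a s t as_ st; have h2 := prop s t b st tb.
have ba : 0 < b - a by lra.
apply: (scalerI (lt0r_neq0 ba)).
rewrite [RHS]scalerA mulrC -scalerA -kab !scalerDr h1 -h2 -!scalerDl.
by congr (_ *: _); ring.
Qed.

End Minimizers.

(** ** Iterated blow-ups *)

Section Blowup.
Context {R : realType} {r : nat}.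
Local Notation ser := (ser R r).
Local Notation enorm := (@euclidean_norm R r).
Implicit Types (g : R -> R -> ser) (N : nat) (s t : R).

Lemma incr_rescale eta g s t :
  incr (rescale eta g) s t = eta^-1 *: incr g (eta * s) (eta * t).
Proof. by apply/rowP => i; rewrite !mxE /rescale /dil expr1. Qed.

Lemma enorm_le_sum (a : 'rV[R]_r) : enorm a <= \sum_i `|a 0 i|.
Proof.
rewrite {1}[a]row_sum_delta; elim/big_rec2 : _ => [|i x y _ xy]; first by rewrite enorm0.
by rewrite (le_trans (enormD _ _))// lerD// enormZ enorm_delta mulr1.
Qed.

Section Uniform.
Variables (U : set_system R) (UU : UltraFilter U).

(** Pointwise convergence at the points of a grid is uniform on bounded intervals,
  the paths being 1-Lipschitz. *)
Lemma tan_unif g (K de : R) : lp g -> 0 <= K -> 0 < de ->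
  \forall eta \near U, forall s t, - K <= s -> s <= t -> t <= K ->
    enorm (incr (rescale (pos eta) g) s t - incr (tan U g) s t) <= de.
Proof.
move=> hg K0 de0; have [ht cv] := tanP UU hg.
have FU : Filter U by apply: PFU.
pose h := de / 6; have h0 : 0 < h by rewrite divr_gt0.
pose p (i : nat) := - K + i%:R * h.
have pK i : - K <= p i by rewrite lerDl mulr_ge0 ?ler0n ?(ltW h0).
pose m := Num.truncn (2 * K / h).
have near1 : \forall eta \near U, forall i, i \in iota 0 m.+1 ->
    enorm (incr (rescale (pos eta) g) (- K) (p i) - incr (tan U g) (- K) (p i)) <= h.
  apply: near_seq => i.
  have r0 : 0 < h / r.+1%:R by rewrite divr_gt0.
  have near2 : \forall eta \near U, forall j : 'I_r, j \in enum 'I_r ->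
      `|tan U g (- K) (p i) [:: j] - rescale (pos eta) g (- K) (p i) [:: j]| <= h / r.+1%:R.
    apply: near_seq => j; have /cvgrPdist_le := cv (- K) (p i) (pK i) [:: j]; exact.
  apply: filterS near2 => eta hj; apply: (le_trans (enorm_le_sum _)).
  apply: (@le_trans _ _ (\sum_(j < r) (h / r.+1%:R))).
    by apply: ler_sum => j _; rewrite !mxE distrC; apply: hj; rewrite mem_enum.
  by rewrite sumr_const card_ord -[leLHS]mulr_natr mulrAC ler_pdivrMr ?ltr0n// ler_pM2l// ler_nat.
apply: filterS near1 => eta near1 s t Ks st tK.
have hr := lp_rescale (pos_gt0 eta) hg.
set G := rescale (pos eta) g in hr near1 *; set H := tan U g in ht near1 *.
pose D u := incr G (- K) u - incr H (- K) u.
have DE a b : - K <= a -> a <= b -> incr G a b - incr H a b = D b - D a.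
  move=> Ka ab; rewrite /D (lp_incrD hr Ka ab) (lp_incrD ht Ka ab).
  move: (incr G _ _) (incr H _ _) (incr G _ _) (incr H _ _) => x1 x2 x3 x4.
  by apply/rowP => i; rewrite !mxE; ring.
have Db u : - K <= u -> u <= K -> enorm (D u) <= 3 * h.
  move=> Ku uK; pose i := Num.truncn ((u + K) / h).
  have uh : 0 <= (u + K) / h by rewrite divr_ge0 ?(ltW h0)//; lra.
  have /andP[i1 i2] := truncn_itv uh; rewrite -/i in i1 i2.
  rewrite ler_pdivlMr// in i1; rewrite ltr_pdivrMr// in i2.
  have im : (i <= m)%N by apply: le_truncn; rewrite ler_pM2r ?invr_gt0//; lra.
  have pu : p i <= u by rewrite /p; lra.
  have up : u - p i <= h by rewrite /p -natr1 mulrDl mul1r in i2 *; lra.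
  have e1 := DE _ _ (pK i) pu.
  have -> : D u = D (p i) + (incr G (p i) u - incr H (p i) u) by rewrite e1 addrC subrK.
  have h1 := near1 i; rewrite mem_iota add0n ltnS im in h1.
  have h2 := lp_incr hr pu; have h3 := lp_incr ht pu.
  have h4 := enormD (D (p i)) (incr G (p i) u - incr H (p i) u).
  have h5 := enormD (incr G (p i) u) (- incr H (p i) u); rewrite enormN in h5.
  have h6 : enorm (D (p i)) <= h by exact: h1.
  lra.
rewrite DE//; apply: (le_trans (enormD _ _)); rewrite enormN.
have h1 := Db t (le_trans Ks st) tK; have h2 := Db s Ks (le_trans st tK).
by apply: (le_trans (lerD h1 h2)); rewrite /h; lra.
Qed.

End Uniform.

(** [g] has the line of direction [c] among its blow-ups. *)
Definition blowup_to g (c : 'rV[R]_r) :=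
  forall e K : R, 0 < e -> 0 <= K -> exists2 eta : R, 0 < eta < e &
    forall s t, - K <= s -> s <= t -> t <= K ->
      enorm (incr (rescale eta g) s t - (t - s) *: c) <= e.

(** Blowing up [tan U g] at a fixed scale [eta1] is a limit of blow-ups of [g] at
  the scales [pos eta * eta1]. *)
Lemma blowup_tan (U : set_system R) g c : UltraFilter U -> 0^'+ `<=` U ->
  lp g -> blowup_to (tan U g) c -> blowup_to g c.
Proof.
move=> UU U0 hg hc e K e0 K0.
have e2 : 0 < Num.min 1 (e / 2) by rewrite lt_min; apply/andP; split; lra.
have [eta1 /andP[eta10 eta1e] h1] := hc _ K e2 K0.
move: eta1e; rewrite lt_min => /andP[eta11 eta1e].
have d0 : 0 < eta1 * (e / 2) by rewrite mulr_gt0//; lra.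
have K1 : 0 <= eta1 * K by rewrite mulr_ge0// ltW.
have near1 := tan_unif UU hg K1 d0; have near2 := near_lt U0 e0.
have [eta [hu /andP[p0 pe]]] : exists eta, (forall s t, - (eta1 * K) <= s -> s <= t -> t <= eta1 * K ->
    enorm (incr (rescale (pos eta) g) s t - incr (tan U g) s t) <= eta1 * (e / 2)) /\ 0 < pos eta < e.
  by apply: (@filter_ex _ U (PFU UU)); have FU : Filter U by [apply: PFU]; exact: filterI.
exists (pos eta * eta1); first by rewrite mulr_gt0//= -[ltRHS]mulr1 ltr_pM// ltW.
move=> s t Ks st tK.
have -> : incr (rescale (pos eta * eta1) g) s t =
    eta1^-1 *: incr (rescale (pos eta) g) (eta1 * s) (eta1 * t).
  by rewrite !incr_rescale scalerA -invfM -!mulrA mulrC.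
have h2 := h1 s t Ks st tK.
have h3 : enorm (incr (rescale (pos eta) g) (eta1 * s) (eta1 * t) -
    incr (tan U g) (eta1 * s) (eta1 * t)) <= eta1 * (e / 2).
  by apply: hu; rewrite ?ler_pM2l// -mulrN ler_pM2l.
rewrite incr_rescale in h2.
set a := incr (rescale _ _) _ _ in h3 *; set b := incr (tan _ _) _ _ in h2 h3.
rewrite -(subrKA (eta1^-1 *: b)) -scalerBr.
have h4 := enormD (eta1^-1 *: (a - b)) (eta1^-1 *: b - (t - s) *: c).
apply: (le_trans h4); rewrite (splitr e); apply: lerD.
  rewrite enormZ ger0_norm ?invr_ge0 ?(ltW eta10)//.
  by rewrite mulrC ler_pdivrMr// mulrC.
by apply: (le_trans h2); rewrite ge_min lexx orbT.
Qed.

(** A minimizer at some step has a straight line among its blow-ups: by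
  [step_reduction] the iterated blow-ups end with a minimizer of step one, and a
  blow-up of a blow-up is approximated by rescalings of the original path. *)
Theorem blowup_line g N : (0 < N)%N -> lp g -> Nmin N g ->
  exists2 c : 'rV[R]_r, enorm c = 1 & blowup_to g c.
Proof.
have [U [UU U0]] := @ultraFilterLemma R (0^'+) _.
elim: N g => [//|N IH] g _ hg hm; have [N0|N0] := posnP N.
  move: hm; rewrite N0 => hm; have [c c1 hc] := Nmin1_line hg hm.
  exists c => // e K e0 K0; exists (e / 2); first by apply/andP; split; lra.
  move=> s t _ st _; have e2 : 0 < e / 2 by lra.
  rewrite incr_rescale hc ?ler_pM2l// -mulrBr -(scalerA (e / 2)) scalerK ?gt_eqF//.
  by rewrite subrr enorm0 ltW.
have hm' := step_reduction UU U0 N0 hg hm.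
have [ht _] := tanP UU hg.
have [c c1 hc] := IH _ N0 ht hm'; exists c => //; exact: blowup_tan hc.
Qed.

End Blowup.

(** * Paths made of segments *)

Section Polygons.
Context {R : realType} {r : nat}.
Local Notation ser := (ser R r).
Local Notation enorm := (@euclidean_norm R r).
Implicit Types (v : seq 'rV[R]_r) (s t : R).

(** The broken line [v] run at speed 1 until the time [t]. *)
Fixpoint cut v t : seq 'rV[R]_r :=
  if v is a :: u then
    if t <= 0 then [::] else if t < enorm a then [:: (t / enorm a) *: a]
    else a :: cut u (t - enorm a)
  else [::].

Lemma cut_le0 v t : t <= 0 -> cut v t = [::].
Proof. by case: v => //= a u ->. Qed.

(** Between times [s] and [t] the broken line runs a broken line of length at most
  [t - s], which makes [v] a lifted path. *)
Lemma cut_mid v s t : s <= t -> exists2 u, sig (cut v t) = sig (cut v s) * sig u & len u <= t - s.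
Proof.
elim: v s t => [|a v IH] s t st /=.
  by exists [::]; rewrite ?len_nil ?subr_ge0// sig_nil mulr1.
have [s0|s0] := leP s 0; have [t0|t0] := leP t 0.
- by exists [::]; rewrite ?len_nil ?subr_ge0// sig_nil mulr1.
- case: ifPn => [ta|]; last rewrite -leNgt => ta.
    exists [:: (t / enorm a) *: a]; first by rewrite sig_nil mul1r.
    have a0 : 0 < enorm a by apply: lt_trans ta.
    rewrite len_cons len_nil addr0 enormZ ger0_norm ?divr_ge0 ?(ltW t0) ?(ltW a0)//.
    by rewrite divfK ?gt_eqF// lerDl oppr_ge0.
  have [u hu lu] := IH 0 (t - enorm a) (ltac:(by rewrite subr_ge0)).
  rewrite (cut_le0 v (lexx 0)) sig_nil mul1r in hu.
  exists (a :: u); first by rewrite !sig_cons sig_nil mul1r hu.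
  by rewrite len_cons; rewrite subr0 in lu; lra.
- by have := lt_le_trans s0 (le_trans st t0); rewrite ltxx.
- have [sa|sa] := ltP s (enorm a); have [ta|ta] := ltP t (enorm a).
  + have a0 : 0 < enorm a by apply: lt_trans ta.
    exists [:: ((t - s) / enorm a) *: a].
      rewrite !sig_cons !sig_nil !mulr1 sexpD.
      by rewrite -mulrDl addrC subrK.
    rewrite len_cons len_nil addr0 enormZ ger0_norm ?divr_ge0 ?subr_ge0 ?(ltW a0)//.
    by rewrite divfK ?gt_eqF.
  + have a0 : 0 < enorm a by apply: lt_trans sa.
    have [u hu lu] := IH 0 (t - enorm a) (ltac:(by rewrite subr_ge0)).
    rewrite (cut_le0 v (lexx 0)) sig_nil mul1r in hu; rewrite subr0 in lu.
    exists (((1 - s / enorm a) *: a) :: u).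
      rewrite !sig_cons !sig_nil !mulr1 mulrA sexpD hu.
      by rewrite addrC subrK scale1r.
    have sa1 : s / enorm a <= 1 by rewrite ler_pdivrMr// mul1r ltW.
    rewrite len_cons enormZ ger0_norm ?subr_ge0// mulrBl mul1r divfK ?gt_eqF//; lra.
  + by have := lt_le_trans ta (le_trans sa st); rewrite ltxx.
  + have [u hu lu] := IH (s - enorm a) (t - enorm a) (ltac:(by rewrite lerD2r)).
    by exists u; [rewrite !sig_cons hu mulrA|lra].
Qed.

Lemma cut_full v : sig (cut v (len v)) = sig v.
Proof.
elim: v => [|a v IH] /=; first by [].
rewrite len_cons; have [h|h] := leP (enorm a + len v) 0.
  have l0 := len_ge0 v; have a0 := enorm_ge0 a.
  have az : enorm a = 0 by lra. have lz : len v = 0 by lra.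
  by rewrite sig_cons -IH lz cut_le0// (enorm_eq0 az) sexp0 mul1r.
by rewrite ltNge lerDl len_ge0 /= addrC addKr !sig_cons IH.
Qed.

Lemma lp_polygon v : exists2 g, lp g & g 0 (len v) = sig v.
Proof.
exists (fun s t => sig (inv (cut v s)) * sig (cut v t)).
  split=> [s t u _ _|s t st N e e0].
    by rewrite -mulrA (mulrA (sig (cut v t))) sig_invr mul1r.
  have [u hu lu] := cut_mid v st.
  exists u; first by rewrite hu mulrA sig_invl mul1r.
  by apply: (le_trans lu); rewrite lerDl ltW.
by rewrite cut_full cut_le0// sig_nil mul1r.
Qed.

End Polygons.

(** * Control systems on R^n *)

Section Norms.
Context {R : realType} {n : nat}.

Lemma mnorm_le (a : 'rV[R]_n) (c : R) : 0 <= c -> (forall j, `|a 0 j| <= c) -> `|a| <= c.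
Proof.
move=> c0 h; rewrite /Num.norm /= mx_normrE; apply: bigmax_le => // -[i j] _ /=.
by rewrite ord1.
Qed.

Lemma coord_le_mnorm (a : 'rV[R]_n) j : `|a 0 j| <= `|a|.
Proof.
by rewrite [leRHS]/Num.norm /= mx_normrE; apply: (le_trans _ (le_bigmax _ _ (0, j))).
Qed.

Lemma mnorm_le_enorm (a : 'rV[R]_n) : `|a| <= euclidean_norm a.
Proof. by apply: mnorm_le => [|j]; [exact: enorm_ge0|exact: coord_le_enorm]. Qed.

Lemma enorm_le_mnorm (a : 'rV[R]_n) : euclidean_norm a <= n%:R * `|a|.
Proof.
apply: (le_trans (enorm_le_sum a)).
apply: (@le_trans _ _ (\sum_(j < n) `|a|)); first by apply: ler_sum => j _; exact: coord_le_mnorm.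
by rewrite sumr_const card_ord mulr_natl.
Qed.

Lemma vsewing (F : R -> 'rV[R]_n) (a b A C : R) : a <= b -> 0 <= A ->
  (forall s t, a <= s -> s <= t -> t <= b ->
    `|F t - F s| <= A * (t - s) + C * (t - s) ^+ 2) ->
  `|F b - F a| <= A * (b - a).
Proof.
move=> ab A0 h; apply: mnorm_le => [|j]; first by rewrite mulr_ge0// subr_ge0.
have := @sewing R (fun t => F t 0 j) a b A C ab; rewrite !mxE; apply => s t sa st tb.
by apply: le_trans (h s t sa st tb); have := coord_le_mnorm (F t - F s) j; rewrite !mxE.
Qed.

Lemma vlim (T : Type) (U : set_system T) (f : T -> 'rV[R]_n) (K : R) :
  UltraFilter U -> (\forall k \near U, `|f k| <= K) ->
  exists l, forall e, 0 < e -> \forall k \near U, `|f k - l| <= e.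
Proof.
move=> UU fK; have FU : Filter U by apply: PFU.
pose l := \row_j lim (f k 0 j @[k --> U]).
exists l => e e0.
have : \forall k \near U, forall j : 'I_n, j \in enum 'I_n -> `|l 0 j - f k 0 j| <= e.
  apply: near_seq => j; rewrite mxE.
  have /cvgrPdist_le : cvg (f k 0 j @[k --> U]).
    apply: (ultra_cvg (K := K) UU); apply: filterS fK => k; apply: le_trans.
    exact: coord_le_mnorm.
  exact.
apply: filterS => k hk; apply: mnorm_le => [|j]; first exact: ltW.
by rewrite !mxE distrC; have := hk j; rewrite mem_enum mxE; exact.
Qed.

End Norms.

(** ** Curves driven by Lipschitz paths *)

Section Control.
Context {R : realType} {n r : nat}.
Local Notation ser := (ser R r).
Local Notation enorm := (@euclidean_norm R r).
Local Notation state := 'rV[R]_n.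
Implicit Types (x : R -> 'rV[R]_r) (Y : R -> state) (a : 'rV[R]_r) (y : state) (s t : R).

Definition lip1 x := forall s t, s <= t -> enorm (x t - x s) <= t - s.

Variable Phi : seq 'I_r -> state -> state.

(** [Phi] collects the coordinates ([Phi [::]]), the fields ([Phi [:: i]]) and the
  iterated derivatives of the coordinates along the fields; only the estimates
  they satisfy are used. *)
Definition drift a y : state := \sum_i a 0 i *: Phi [:: i] y.

Lemma driftD a b y : drift (a + b) y = drift a y + drift b y.
Proof. by rewrite /drift -big_split; apply: eq_bigr => i _ /=; rewrite mxE scalerDl. Qed.
Lemma driftZ (c : R) a y : drift (c *: a) y = c *: drift a y.
Proof. by rewrite /drift scaler_sumr; apply: eq_bigr => i _; rewrite mxE scalerA. Qed.
Lemma driftN a y : drift (- a) y = - drift a y.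
Proof. by rewrite -scaleN1r driftZ scaleN1r. Qed.
Lemma driftB a b y : drift (a - b) y = drift a y - drift b y.
Proof. by rewrite driftD driftN. Qed.
Lemma drift0 y : drift 0 y = 0.
Proof. by rewrite -(scale0r 0) driftZ scale0r. Qed.

Record bounded_drift (B La : R) : Prop := BoundedDrift {
  bd_B : 0 <= B; bd_La : 0 <= La;
  bd_le : forall a y, `|drift a y| <= B * enorm a;
  bd_lip : forall a y y', `|drift a y' - drift a y| <= La * enorm a * `|y' - y| }.

Variables (B La : R) (HB : bounded_drift B La).
Let B0 := bd_B HB. Let La0 := bd_La HB. Let dB := bd_le HB. Let dL := bd_lip HB.

(** [Y] solves the differential equation [dY = drift (dx) Y] on [[a, b]]; for a
  Lipschitz [x] the integral equation is equivalent to this estimate on the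
  increments. *)
Definition driven (C : R) x Y (a b : R) := forall s t, a <= s -> s <= t -> t <= b ->
  `|Y t - Y s - drift (x t - x s) (Y s)| <= C * (t - s) ^+ 2.

Let C0 := La * B.

Lemma driven_lip C x Y (a b : R) : lip1 x -> driven C x Y a b ->
  forall s t, a <= s -> s <= t -> t <= b -> `|Y t - Y s| <= B * (t - s).
Proof.
move=> x1 hY s t as_ st tb; apply: (vsewing (C := C) st B0) => u v su uv vt.
have h := hY u v (le_trans as_ su) uv (le_trans vt tb).
rewrite -(subrK (drift (x v - x u) (Y u)) (Y v - Y u)) addrC.
apply: (le_trans (ler_normD _ _)); apply: lerD h.
by apply: (le_trans (dB _ _)); rewrite ler_wpM2l// x1.
Qed.

Lemma driven_lip' C x Y (a b : R) : lip1 x -> driven C x Y a b ->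
  forall s t, a <= s -> s <= b -> a <= t -> t <= b -> `|Y t - Y s| <= B * `|t - s|.
Proof.
move=> x1 hY s t as_ sb at_ tb; have [st|/ltW ts] := leP s t.
  by rewrite ger0_norm ?subr_ge0//; exact: (driven_lip x1 hY).
by rewrite distrC ler0_norm ?subr_le0// opprB; exact: (driven_lip x1 hY).
Qed.

(** Along Euler's scheme the increments over several steps satisfy the estimate
  defining driven curves with a constant independent of the step, by summing the
  defects of the first order expansion. *)
Lemma euler_step (d : R) x (e : nat -> state) : 0 <= d -> lip1 x ->
  (forall k, e k.+1 = e k + drift (x (k.+1%:R * d) - x (k%:R * d)) (e k)) ->
  forall k j, `|e (k + j)%N - e k| <= B * (j%:R * d) /\
    `|e (k + j)%N - e k - drift (x ((k + j)%:R * d) - x (k%:R * d)) (e k)|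
      <= C0 * (j%:R * d) ^+ 2.
Proof.
move=> d0 x1 he k; have xd i : enorm (x (i.+1%:R * d) - x (i%:R * d)) <= d.
  apply: (le_trans (x1 _ _ _)); first by rewrite ler_wpM2r// ler_nat.
  by rewrite -mulrBl -natr1 addrAC subrr add0r mul1r.
elim=> [|j [IH1 IH2]].
  by rewrite addn0 !subrr drift0 subrr normr0 mul0r expr0n/= !mulr0.
rewrite addnS he; set z := x (_.+1%:R * d); set w := x ((k + j)%:R * d) in IH2 *.
have zw : enorm (z - w) <= d by exact: xd.
split.
  rewrite addrAC -natr1 mulrDl mul1r mulrDr; apply: (le_trans (ler_normD _ _)).
  by apply: lerD IH1 _; apply: (le_trans (dB _ _)); rewrite ler_wpM2l.
have -> : drift (z - x (k%:R * d)) (e k) = drift (z - w) (e k) + drift (w - x (k%:R * d)) (e k).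
  by rewrite -driftD subrKA.
set p := e (k + j)%N in IH1 IH2 *; set q := e k in IH1 IH2 *.
have -> : p + drift (z - w) p - q - (drift (z - w) q + drift (w - x (k%:R * d)) q) =
   (p - q - drift (w - x (k%:R * d)) q) + (drift (z - w) p - drift (z - w) q).
  move: (drift _ p) (drift _ q) (drift _ q) => u1 u2 u3.
  by apply/rowP => i; rewrite !mxE; ring.
apply: (le_trans (ler_normD _ _)).
have h : `|drift (z - w) p - drift (z - w) q| <= La * d * (B * (j%:R * d)).
  apply: (le_trans (dL _ _ _)); apply: ler_pM => //.
    by rewrite mulr_ge0// enorm_ge0.
  by rewrite ler_wpM2l.
apply: (le_trans (lerD IH2 h)).
have -> : C0 * (j%:R * d) ^+ 2 + La * d * (B * (j%:R * d)) =
  C0 * ((j%:R * d) ^+ 2 + j%:R * d ^+ 2) by rewrite /C0; ring.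
have C00 : 0 <= C0 by rewrite mulr_ge0.
rewrite ler_wpM2l// -natr1 -subr_ge0.
have j0 : 0 <= (j%:R : R) by [].
have -> : ((j%:R + 1) * d) ^+ 2 - ((j%:R * d) ^+ 2 + j%:R * d ^+ 2) = (j%:R + 1) * d ^+ 2 by ring.
by rewrite mulr_ge0 ?sqr_ge0// addr_ge0.
Qed.

(** Driven curves are obtained as limits of approximations: the estimate defining
  them involves finitely many values of the curves. *)
Lemma driven_lim (T : Type) (U : set_system T) (Yk : T -> R -> state) (xk : T -> R -> 'rV[R]_r)
   Y x (s t : R) (dk : T -> R -> R) : UltraFilter U -> s <= t ->
  (forall u e, u = s \/ u = t -> 0 < e -> \forall k \near U,
     [/\ `|Yk k u - Y u| <= e, enorm (xk k u - x u) <= e & `|dk k u - u| <= e]) ->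
  (\forall k \near U, dk k s <= dk k t -> `|Yk k t - Yk k s -
     drift (xk k t - xk k s) (Yk k s)| <= C0 * (dk k t - dk k s) ^+ 2) ->
  (forall k, dk k s <= dk k t) -> enorm (x t - x s) <= t - s ->
  `|Y t - Y s - drift (x t - x s) (Y s)| <= C0 * (t - s) ^+ 2.
Proof.
move=> UU st hU hk dd xst; have FU : Filter U by apply: PFU.
pose K := 1 + 1 + B * (1 + 1) + La * (t - s) + C0 * (4 * (t - s) + 4).
have ts0 : 0 <= t - s by rewrite subr_ge0.
have C00 : 0 <= C0 by rewrite mulr_ge0.
have K0 : 0 < K.
  have h1 : 0 <= La * (t - s) by rewrite mulr_ge0.
  have h2 : 0 <= C0 * (4 * (t - s) + 4) by rewrite mulr_ge0//; lra.
  by rewrite /K; move: B0; lra.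
apply/ler_addgt0Pr => e e0.
pose e1 := Num.min 1 (e / K).
have e10 : 0 < e1 by rewrite lt_min ltr01 divr_gt0.
have e11 : e1 <= 1 by rewrite ge_min lexx.
have e1e : K * e1 <= e by rewrite mulrC -ler_pdivlMr// ge_min lexx orbT.
have [k [[h1 h2 h3] [h4 h5 h6] h7]] : exists k, [/\
    [/\ `|Yk k s - Y s| <= e1, enorm (xk k s - x s) <= e1 & `|dk k s - s| <= e1],
    [/\ `|Yk k t - Y t| <= e1, enorm (xk k t - x t) <= e1 & `|dk k t - t| <= e1] &
    `|Yk k t - Yk k s -
     drift (xk k t - xk k s) (Yk k s)| <= C0 * (dk k t - dk k s) ^+ 2].
  apply: (@filter_ex _ U (PFU UU)).
  have n1 := hU s e1 (or_introl erefl) e10; have n2 := hU t e1 (or_intror erefl) e10.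
  by apply: filterS3 n1 n2 hk => k a1 a2 a3; split=> //; exact: a3.
move: h1 h2 h3 h4 h5 h6 h7 (dd k).
move: (dk k s) (dk k t) => u v.
move: (Yk k s) (Yk k t) (xk k s) (xk k t) => p q a b h1 h2 h3 h4 h5 h6 h7 uv.
have -> : Y t - Y s - drift (x t - x s) (Y s) = (q - p - drift (b - a) p)
   + (Y t - q) + (p - Y s) + drift ((b - x t) - (a - x s)) p
   + (drift (x t - x s) p - drift (x t - x s) (Y s)).
  rewrite !driftB; move: (drift _ _) (drift _ _) (drift _ _) (drift _ _) (drift _ _) (drift _ _) => *.
  by apply/rowP => i; rewrite !mxE; ring.
have g1 : `|Y t - q| <= e1 by rewrite distrC.
have g2 : `|drift ((b - x t) - (a - x s)) p| <= B * (e1 + e1).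
  apply: (le_trans (dB _ _)); rewrite ler_wpM2l//; apply: (le_trans (enormD _ _)).
  by rewrite enormN lerD.
have g3 : `|drift (x t - x s) p - drift (x t - x s) (Y s)| <= La * (t - s) * e1.
  by apply: (le_trans (dL _ _ _)); apply: ler_pM => //; rewrite ?ler_wpM2l// mulr_ge0// enorm_ge0.
have g4 : C0 * (v - u) ^+ 2 <= C0 * (t - s) ^+ 2 + C0 * (4 * (t - s) + 4) * e1.
  rewrite -mulrA -mulrDr ler_wpM2l//.
  have uv2 : v - u <= t - s + 2 * e1.
    by move: h3 h6; rewrite !ler_norml => /andP[? ?] /andP[? ?]; lra.
  apply: (@le_trans _ _ ((t - s + 2 * e1) ^+ 2)).
    by rewrite lerXn2r ?nnegrE//; [rewrite subr_ge0|lra].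
  rewrite -subr_ge0 (_ : _ - _ = 4 * e1 * (1 - e1)); first by rewrite !mulr_ge0 ?(ltW e10)// subr_ge0.
  ring.
apply: (le_trans (ler_normD _ _)); apply: (@le_trans _ _ (C0 * (t - s) ^+ 2 + K * e1)); last by rewrite lerD2l.
have g5 := ler_normD (q - p - drift (b - a) p + (Y t - q) + (p - Y s)) (drift ((b - x t) - (a - x s)) p).
have g6 := ler_normD (q - p - drift (b - a) p + (Y t - q)) (p - Y s).
have g7 := ler_normD (q - p - drift (b - a) p) (Y t - q).
apply: (le_trans (lerD (le_trans g5 (lerD (le_trans g6 (lerD (le_trans g7
  (lerD (le_trans h7 g4) g1)) h1)) g2)) g3)).
by rewrite le_eqVlt; apply/orP; left; apply/eqP; rewrite /K; ring.
Qed.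

(** Euler's method. The broken lines are bounded, hence converge along an
  ultrafilter. *)
Lemma driven_exists x (y0 : state) : lip1 x ->
  exists2 Y, Y 0 = y0 & forall L, driven C0 x Y 0 L.
Proof.
move=> x1; have [U UU Uoo] := ultra_oo.
have FU : Filter U by apply: PFU.
pose d (m : nat) : R := m.+1%:R^-1.
have d0 m : 0 < d m by rewrite invr_gt0.
pose e m := fix e k : state := if k is k'.+1 then
  e k' + drift (x (k'.+1%:R * d m) - x (k'%:R * d m)) (e k') else y0.
have es m := euler_step (e := e m) (ltW (d0 m)) x1 (fun k => erefl).
pose fl m t := Num.truncn (t / d m).
have fP m t : 0 <= t -> (fl m t)%:R * d m <= t /\ t <= (fl m t)%:R * d m + d m.
  move=> t0; have t1 : 0 <= t / d m by rewrite divr_ge0// ltW.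
  have /andP[] := truncn_itv t1; rewrite -/(fl m t) ler_pdivlMr// ltr_pdivrMr//.
  by rewrite -natr1 mulrDl mul1r => h1 /ltW h2.
have bnd t : 0 <= t -> exists l, forall ee, 0 < ee -> \forall m \near U, `|e m (fl m t) - l| <= ee.
  move=> t0; apply: (vlim (K := `|y0| + B * t) UU); apply: nearW => m.
  have [h _] := es m 0%N (fl m t); rewrite add0n in h.
  rewrite -(subrK y0 (e m _)) addrC; apply: (le_trans (ler_normD _ _)); rewrite lerD2l.
  by apply: (le_trans h); rewrite ler_wpM2l//; have [] := fP m t t0.
pose Y t := if 0 <= t then xget y0 [set l : state | forall ee : R, 0 < ee ->
   \forall m \near U, `|e m (fl m t) - l| <= ee] else y0.
have YP t : 0 <= t -> forall ee : R, 0 < ee -> \forall m \near U, `|e m (fl m t) - Y t| <= ee.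
  move=> t0 ee ee0; rewrite /Y t0; case: xgetP => [l _ hl|no]; first exact: hl.
  by have [l hl] := bnd t t0; have := no l.
have near_d (ee : R) : 0 < ee -> \forall m \near U, d m <= ee.
  move=> ee0; apply: Uoo; near=> m; rewrite /d -[ee]invrK lef_pV2 ?posrE ?invr_gt0//.
  rewrite (@le_trans _ _ m%:R) ?ler_nat//.
  by near: m; exact: nbhs_infty_ger.
exists Y.
  apply/eqP; rewrite -subr_eq0 -normr_eq0 eq_le normr_ge0 andbT; apply/ler_addgt0Pr => ee ee0.
  rewrite add0r; have [m] := @filter_ex _ U (PFU UU) _ (YP 0 (lexx 0) ee ee0).
  by rewrite /fl mul0r truncn0 /= distrC.
move=> L s t s0 st _; have t0 := le_trans s0 st.
pose dk m u := (fl m u)%:R * d m.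
apply: (@driven_lim nat U (fun m u => e m (fl m u)) (fun m u => x (dk m u)) Y x s t dk UU st).
- move=> u ee hu ee0; have u0 : 0 <= u by case: hu => ->.
  apply: filterS2 (YP u u0 ee ee0) (near_d ee ee0) => m h1 h2; rewrite /dk.
  have [f1 f2] := fP m u u0; split=> //; last by rewrite ler_norml; apply/andP; split; lra.
  by rewrite -enormN opprB; apply: (le_trans (x1 _ _ f1)); lra.
- apply: nearW => m _; rewrite /dk.
  have fst_ : (fl m s <= fl m t)%N by apply: le_truncn; rewrite ler_pM2r ?invr_gt0.
  have [_] := es m (fl m s) (fl m t - fl m s)%N; rewrite subnKC//.
  by rewrite natrB// mulrBl.
- move=> m; rewrite /dk ler_pM2r// ler_nat; apply: le_truncn; by rewrite ler_pM2r ?invr_gt0.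
- exact: x1.
Unshelve. all: by end_near. Qed.

(** ** Points joined by driven curves of given length *)

Definition conn y y' (L : R) := exists x Y,
  [/\ 0 <= L, lip1 x, driven C0 x Y 0 L, Y 0 = y & Y L = y'].

Lemma conn_refl y (L : R) : 0 <= L -> conn y y L.
Proof.
have C00 : 0 <= C0 by rewrite mulr_ge0.
move=> L0; exists (fun=> 0), (fun=> y); split => // s t; first by rewrite subr0 enorm0 subr_ge0.
by move=> _ st _; rewrite !subrr drift0 subr0 normr0 mulr_ge0// sqr_ge0.
Qed.

Lemma conn_trans y y' y'' (L L' : R) : conn y y' L -> conn y' y'' L' -> conn y y'' (L + L').
Proof.
have C00 : 0 <= C0 by rewrite mulr_ge0.
move=> [x [Y [L0 x1 hY Y0 YL]]] [x' [Y' [L0' x1' hY' Y0' YL']]].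
pose X t := if t <= L then x t else x L + (x' (t - L) - x' 0).
pose Z t := if t <= L then Y t else Y' (t - L).
have XL t : L <= t -> X t = x L + (x' (t - L) - x' 0).
  by rewrite /X le_eqVlt => /orP[/eqP <-|]; [rewrite lexx !subrr addr0|rewrite leNgt => ->].
have ZL t : L <= t -> Z t = Y' (t - L).
  by rewrite /Z le_eqVlt => /orP[/eqP <-|]; [rewrite lexx subrr Y0' YL|rewrite leNgt => ->].
have Xl t : t <= L -> X t = x t by rewrite /X => ->.
have Zl t : t <= L -> Z t = Y t by rewrite /Z => ->.
exists X, Z; split.
- exact: addr_ge0.
- move=> s t st; have [tL|/ltW tL] := leP t L.
    by rewrite !Xl// ?(le_trans st tL)//; exact: x1.
  have [sL|/ltW sL] := leP s L; last first.
    rewrite !XL// opprD addrACA subrr add0r opprB addrA subrK.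
    by apply: (le_trans (x1' _ _ _)); lra.
  rewrite XL// Xl// addrAC; apply: (le_trans (enormD _ _)).
  have h1 := x1 s L sL; have h2 : enorm (x' (t - L) - x' 0) <= t - L - 0 by apply: x1'; lra.
  lra.
- move=> s t s0 st tL; have [tl|/ltW tl] := leP t L.
    by rewrite !Xl ?Zl// ?(le_trans st tl)//; exact: hY.
  have [sl|/ltW sl] := leP s L; last first.
    rewrite !XL// !ZL// opprD addrACA subrr add0r opprB addrA subrK.
    have := hY' (s - L) (t - L); rewrite (_ : t - L - (s - L) = t - s); last by ring.
    by apply; lra.
  rewrite XL// Xl// ZL// Zl//.
  have h1 := hY s L s0 sl (lexx L).
  have h2 : `|Y' (t - L) - Y' 0 - drift (x' (t - L) - x' 0) (Y' 0)| <= C0 * (t - L - 0) ^+ 2.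
    by apply: hY'; lra.
  have h3 : enorm (x' (t - L) - x' 0) <= t - L by rewrite -[leRHS]subr0; apply: x1'; lra.
  set d' := x' (t - L) - x' 0 in h2 h3 *.
  have h4 : `|drift d' (Y L) - drift d' (Y s)| <= La * (t - L) * (B * (L - s)).
    apply: (le_trans (dL _ _ _)); apply: ler_pM => //; rewrite ?ler_wpM2l ?mulr_ge0 ?enorm_ge0//.
    exact: (driven_lip x1 hY).
  rewrite Y0' in h2.
  have -> : Y' (t - L) - Y s - drift (x L + d' - x s) (Y s) =
     (Y' (t - L) - y' - drift d' y') + (Y L - Y s - drift (x L - x s) (Y s)) +
     (drift d' (Y L) - drift d' (Y s)).
    rewrite (_ : x L + d' - x s = (x L - x s) + d'); last by rewrite addrAC.
    rewrite driftD YL.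
    by move: (drift _ _) (drift _ _) (drift _ _) => *; apply/rowP => i; rewrite !mxE; ring.
  apply: (le_trans (ler_normD _ _)); apply: (le_trans (lerD (ler_normD _ _) (lexx _))).
  apply: (le_trans (lerD (lerD h2 h1) h4)); rewrite -subr_ge0.
  have -> : C0 * (t - s) ^+ 2 - (C0 * (t - L - 0) ^+ 2 + C0 * (L - s) ^+ 2 + La * (t - L) * (B * (L - s)))
    = C0 * ((t - L) * (L - s)) by rewrite /C0; ring.
  by rewrite !mulr_ge0// subr_ge0.
- by rewrite Zl.
- by rewrite ZL ?lerDl// addrC addKr.
Qed.

Lemma conn_le y y' (L L' : R) : L <= L' -> conn y y' L -> conn y y' L'.
Proof.
by move=> LL h; rewrite -(subrK L L') addrC; apply: (conn_trans h); apply: conn_refl; rewrite subr_ge0.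
Qed.

Lemma conn_ge0 y y' (L : R) : conn y y' L -> 0 <= L.
Proof. by move=> [x [Y []]]. Qed.

Lemma conn_dist y y' (L : R) : conn y y' L -> `|y' - y| <= B * L.
Proof.
move=> [x [Y [L0 x1 hY <- <-]]]; rewrite -[X in B * X]subr0; exact: (driven_lip x1 hY).
Qed.

(** The driving paths and the driven curves converge along an ultrafilter, and the
  estimates on their increments pass to the limit. *)
Lemma conn_lim y (yk : nat -> state) y' (L : R) : (forall k, conn y (yk k) L) ->
  (forall e : R, 0 < e -> exists m, forall k, (m <= k)%N -> `|yk k - y'| <= e) -> conn y y' L.
Proof.
move=> hc hl; have [U UU Uoo] := ultra_oo; have FU : Filter U by apply: PFU.
have L0 := conn_ge0 (hc 0%N).
have [xk hxk] := boolp.choice hc; have [Yk hk] := boolp.choice hxk.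
have lx k : lip1 (xk k) by case: (hk k).
have dk k : driven C0 (xk k) (Yk k) 0 L by case: (hk k).
have Yk0 k : Yk k 0 = y by case: (hk k).
have YkL k : Yk k L = yk k by case: (hk k).
have lx' k t : enorm (xk k t - xk k 0) <= `|t|.
  have [t0|/ltW t0] := leP 0 t; first by rewrite ger0_norm// -{2}[t]subr0; exact: lx.
  by rewrite -enormN opprB ler0_norm// -[leRHS]add0r; exact: lx.
have ex t : exists l, forall e, 0 < e -> \forall k \near U, `|xk k t - xk k 0 - l| <= e.
  apply: (vlim (K := `|t|) UU); apply: nearW => k.
  by apply: (le_trans (mnorm_le_enorm _)).
have [x hx] := boolp.choice ex.
have eY t : exists l, 0 <= t -> t <= L -> forall e, 0 < e -> \forall k \near U, `|Yk k t - l| <= e.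
  have [/andP[t0 tL]|nt] := boolP (0 <= t <= L); last first.
    by exists 0 => t0 tL; rewrite t0 tL in nt.
  have hb : \forall k \near U, `|Yk k t| <= `|y| + B * L.
    apply: nearW => k.
    have := driven_lip (lx k) (dk k) (lexx 0) t0 tL; rewrite Yk0 subr0 => h.
    rewrite -(subrK y (Yk k t)) addrC; apply: (le_trans (ler_normD _ _)); rewrite lerD2l.
    by apply: (le_trans h); rewrite ler_wpM2l.
  by have [l hl'] := vlim UU hb; exists l.
have [Y hY] := boolp.choice eY.
have xe t e : 0 < e -> \forall k \near U, enorm (xk k t - xk k 0 - x t) <= e.
  move=> e0; have e1 : 0 < e / r.+1%:R by rewrite divr_gt0.
  apply: filterS (hx t _ e1) => k h; apply: (le_trans (enorm_le_mnorm _)).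
  apply: (le_trans (ler_wpM2l (ler0n _ _) h)).
  by rewrite mulrC mulrAC ler_pdivrMr// ler_pM2l// ler_nat.
have xl : lip1 x.
  move=> s t st; apply/ler_addgt0Pr => e e0; have e2 : 0 < e / 2 by lra.
  have [k [h1 h2]] : exists k, enorm (xk k s - xk k 0 - x s) <= e / 2 /\ enorm (xk k t - xk k 0 - x t) <= e / 2.
    by apply: (@filter_ex _ U (PFU UU)); exact: filterI (xe s _ e2) (xe t _ e2).
  have -> : x t - x s = (xk k t - xk k s) + ((xk k s - xk k 0 - x s) - (xk k t - xk k 0 - x t)).
    by move: (xk k s) (xk k t) (xk k 0) => *; apply/rowP => i; rewrite !mxE; ring.
  apply: (le_trans (enormD _ _)); apply: lerD; first exact: lx.
  by apply: (le_trans (enormD _ _)); rewrite enormN (splitr e); exact: lerD.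
exists x, Y; split => //.
- move=> s t s0 st tL; apply: (@driven_lim nat U Yk (fun k u => xk k u - xk k 0) Y x s t (fun _ u => u) UU st).
  + move=> u e hu e0; have [u0 uL] : 0 <= u /\ u <= L.
      by case: hu => ->; split=> //; [exact: le_trans st tL|exact: le_trans s0 st].
    by apply: filterS2 (hY u u0 uL e e0) (xe u e e0) => k h1 h2; split=> //; rewrite subrr normr0 ltW.
  + apply: nearW => k _.
    by rewrite opprB addrA subrK; exact: dk.
  + by [].
  + exact: xl.
- apply/eqP; rewrite -subr_eq0 -normr_eq0 eq_le normr_ge0 andbT; apply/ler_addgt0Pr => e e0.
  rewrite add0r; have [k] := @filter_ex _ U (PFU UU) _ (hY 0 (lexx 0) L0 e e0).
  by rewrite Yk0 distrC.
- apply/eqP; rewrite -subr_eq0 -normr_eq0 eq_le normr_ge0 andbT; apply/ler_addgt0Pr => e e0.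
  rewrite add0r; have e2 : 0 < e / 2 by lra.
  have [m hm] := hl _ e2.
  have nm : \forall k \near U, (m <= k)%N by apply: Uoo; exact: nbhs_infty_ge.
  have [k [h1 h2]] : exists k, `|Yk k L - Y L| <= e / 2 /\ (m <= k)%N.
    by apply: (@filter_ex _ U (PFU UU)); exact: filterI (hY L L0 (lexx L) _ e2) nm.
  rewrite YkL in h1; have h3 := hm k h2.
  rewrite -(subrKA (yk k)) (splitr e); apply: (le_trans (ler_normD _ _)).
  by apply: lerD => //; rewrite distrC.
Qed.

(** ** Chen-Fliess expansions *)

Lemma seq_bound (I : eqType) (s : seq I) (P : I -> R -> Prop) :
  (forall i c c', c <= c' -> P i c -> P i c') -> (forall i, exists2 c, 0 <= c & P i c) ->
  exists2 c, 0 <= c & forall i, i \in s -> P i c.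
Proof.
move=> mono ex; elim: s => [|i s [c c0 hc]]; first by exists 0.
have [c' c'0 hc'] := ex i; exists (Num.max c c'); first by rewrite le_max c0.
move=> j; rewrite inE => /orP[/eqP ->|js].
  by apply: mono hc'; rewrite le_max lexx orbT.
by apply: mono (hc j js); rewrite le_max lexx.
Qed.

(** The counterpart of [lp_step] for the first letter, which governs the dependence
  of the signature on its starting time. *)
Lemma lp_head (g : R -> R -> ser) s u t i w : lp g -> s <= u -> u <= t -> t - s <= 1 ->
  `|g s t (i :: w) - g u t (i :: w) - g s u [:: i] * g u t w| <= (size w)%:R * (u - s) ^+ 2.
Proof.
move=> hg su ut ts1; rewrite (hg.1 s u t)// serM_cons (lp_nil hg su) mul1r.
rewrite [g u t _ + _]addrC addrK serME big_ord_recl /= take0 drop0 /sh addrC addKr.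
apply: (le_trans (ler_norm_sum _ _ _)).
apply: (@le_trans _ _ (\sum_(k < size w) (u - s) ^+ 2)); last first.
  by rewrite sumr_const card_ord mulr_natl.
apply: ler_sum => -[k kw] _ /=; rewrite normrM.
have h1 := lp_bound hg (i :: take (bump 0 k) w) su; have h2 := lp_bound hg (drop (bump 0 k) w) ut.
rewrite -[leRHS]mulr1; apply: ler_pM => //.
  apply: (le_trans h1); rewrite /= size_takel; last by rewrite /bump.
  by apply: ler_wiXn2l; rewrite ?subr_ge0//; lra.
by apply: (le_trans h2); apply: exprn_ile1; rewrite ?subr_ge0//; lra.
Qed.

Hypothesis H0 : forall y, Phi [::] y = y.
(** First order Taylor expansions of the iterated derivatives, uniform in R^n. *)
Definition jet_estimates := forall I : seq 'I_r, exists2 C : R, 0 <= C &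
  (I != [::] -> forall y, `|Phi I y| <= C) /\
  forall y y' a, `|Phi I y' - Phi I y - \sum_i a 0 i *: Phi (i :: I) y| <=
    C * (`|y' - y - drift a y| + `|y' - y| ^+ 2).
Hypothesis HP : jet_estimates.

Lemma big_words_recl_state k (F : seq 'I_r -> state) :
  \sum_(w <- words k.+1) F w = \sum_(w <- words k) \sum_i F (i :: w).
Proof. by rewrite big_allpairs_dep /= big_enum exchange_big. Qed.

(** For fixed [t], the expansion at time [u] is a function [E] of [u] with
  [E t = Phi I (Y t)]. Differentiating in [u], the contributions of the words of
  length at most [N] telescope, as in Taylor's formula with integral remainder,
  and only the words of length [N] contribute an error, of order
  [(t - s) ^ N] per unit of time. *)
Lemma chen_fliess (CY : R) N (I : seq 'I_r) : 0 <= CY -> exists2 C, 0 <= C &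
  forall (g : R -> R -> ser) x Y s t, lp g -> lip1 x -> s <= t -> t - s <= 1 -> driven CY x Y s t ->
  (forall a b : R, s <= a -> a <= b -> b <= t -> incr g a b = x b - x a) ->
  `|Phi I (Y t) - \sum_(k < N.+1) \sum_(w <- words k) g s t w *: Phi (w ++ I) (Y s)|
    <= C * (t - s) ^+ N.+1.
Proof.
move=> CY0.
have [C1 C10 hC] : exists2 C, 0 <= C & forall w, w \in @wordsle r N.+1 ->
    ((w ++ I) != [::] -> forall y, `|Phi (w ++ I) y| <= C) /\
    forall y y' a, `|Phi (w ++ I) y' - Phi (w ++ I) y - \sum_i a 0 i *: Phi (i :: w ++ I) y| <=
    C * (`|y' - y - drift a y| + `|y' - y| ^+ 2).
  apply: seq_bound => [w c c' cc [h1 h2]|w]; last exact: HP.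
  split=> [h y|y y' a]; first exact: le_trans (h1 h y) cc.
  apply: (le_trans (h2 y y' a)); rewrite ler_wpM2r// addr_ge0// exprn_ge0//.
exists ((size (@words r N))%:R * (r%:R * C1)); first by rewrite !mulr_ge0.
move=> g x Y s t hg x1 st ts1 hY gx.
pose E u : state := \sum_(k < N.+1) \sum_(w <- words k) g u t w *: Phi (w ++ I) (Y u).
have Et : E t = Phi I (Y t).
  rewrite /E big_ord_recl /= big_seq1 lp_diag// ser1E eqxx scale1r big1 ?addr0// => k _.
  rewrite big_seq big1// => w; rewrite mem_words => /eqP; case: w => // i w _.
  by rewrite ser1E scale0r.
rewrite -Et -/(E s) exprSr [leRHS]mulrA.
pose Q : R := \sum_(k < N.+1) \sum_(w <- @words r k) (C1 * (CY + B ^+ 2)) +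
   \sum_(k < N) \sum_(w <- @words r k) \sum_(i < r) ((size w)%:R * C1).
apply: (vsewing (C := Q) st); first by rewrite !mulr_ge0// exprn_ge0// subr_ge0.
move=> u v su uv vt.
have uv0 : 0 <= v - u by rewrite subr_ge0.
have vt0 : 0 <= t - v by rewrite subr_ge0.
pose a := x v - x u.
have aE i : a 0 i = g u v [:: i] by rewrite /a -(gx u v)// mxE.
have G1 (w : seq 'I_r) : `|g v t w| <= 1.
  by apply: (le_trans (lp_bound hg w vt)); apply: exprn_ile1 => //; lra.
have t2 := driven_lip x1 hY su uv vt.
have t1 := hY u v su uv vt.
have YB : `|Y v - Y u - drift a (Y u)| + `|Y v - Y u| ^+ 2 <= (CY + B ^+ 2) * (v - u) ^+ 2.
  by rewrite mulrDl; apply: lerD t1 _; rewrite -exprMn lerXn2r ?nnegrE// mulr_ge0.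
pose T1 := \sum_(k < N.+1) \sum_(w <- words k) g v t w *:
  (Phi (w ++ I) (Y v) - Phi (w ++ I) (Y u) - \sum_i a 0 i *: Phi (i :: w ++ I) (Y u)).
pose A k := \sum_(w <- words k) g v t w *: (\sum_i a 0 i *: Phi (i :: w ++ I) (Y u)).
pose rho i (w : seq 'I_r) := g u t (i :: w) - g v t (i :: w) - g u v [:: i] * g v t w.
pose T2 := \sum_(k < N) \sum_(w <- words k) \sum_i rho i w *: Phi (i :: w ++ I) (Y u).
have EE : E v - E u = A N + T1 - T2.
  have e1 : E v - E u = T1 + \sum_(k < N.+1) A k - \sum_(k < N.+1) \sum_(w <- words k)
      (g u t w - g v t w) *: Phi (w ++ I) (Y u).
    rewrite /E /T1 /A -big_split /= -!sumrB; apply: eq_bigr => k _.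
    rewrite -big_split /= -!sumrB; apply: eq_bigr => w _.
    rewrite -scalerDr subrK scalerBl scalerBr opprB addrA subrK //.
  have e2 : \sum_(k < N.+1) \sum_(w <- words k) (g u t w - g v t w) *: Phi (w ++ I) (Y u) =
      \sum_(k < N) A k + T2.
    rewrite big_ord_recl /= big_seq1 !(lp_nil hg)// ?(le_trans uv vt)//.
    rewrite subrr scale0r add0r -big_split; apply: eq_bigr => k _.
    rewrite [LHS]big_words_recl_state -big_split; apply: eq_bigr => w _ /=.
    rewrite scaler_sumr -big_split; apply: eq_bigr => i _ /=.
    rewrite /rho aE scalerA -scalerDl; congr (_ *: _); ring.
  rewrite e1 e2 big_ord_recr /=; clear e2 e1; clearbody T1 T2; move: (\sum_(k < N) A k) (A N) => *.
  by apply/rowP => i; rewrite !mxE; ring.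
have T1b : `|T1| <= \sum_(k < N.+1) \sum_(w <- @words r k) (C1 * (CY + B ^+ 2)) * (v - u) ^+ 2.
  apply: (le_trans (ler_norm_sum _ _ _)); apply: ler_sum => -[k kN] _ /=.
  apply: (le_trans (ler_norm_sum _ _ _)); rewrite big_seq [leRHS]big_seq.
  apply: ler_sum => w; rewrite mem_words => /eqP wk; rewrite normrZ -[leRHS]mul1r.
  have [|_ h] := hC w; first by rewrite mem_wordsle wk leqW// -ltnS.
  apply: ler_pM; [exact: normr_ge0|exact: normr_ge0|exact: G1|].
  by apply: (le_trans (h _ _ _)); rewrite -mulrA ler_wpM2l.
have Pb i (w : seq 'I_r) : (size w <= N)%N -> `|Phi (i :: w ++ I) (Y u)| <= C1.
  by move=> wN; have [|h _] := hC (i :: w); [rewrite mem_wordsle|exact: h].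
have T2b : `|T2| <= \sum_(k < N) \sum_(w <- @words r k) \sum_(i < r) ((size w)%:R * C1) * (v - u) ^+ 2.
  apply: (le_trans (ler_norm_sum _ _ _)); apply: ler_sum => -[k kN] _ /=.
  apply: (le_trans (ler_norm_sum _ _ _)); rewrite big_seq [leRHS]big_seq.
  apply: ler_sum => w; rewrite mem_words => /eqP wk.
  apply: (le_trans (ler_norm_sum _ _ _)); apply: ler_sum => i _.
  rewrite normrZ mulrAC; apply: ler_pM; [exact: normr_ge0|exact: normr_ge0| |].
    by apply: lp_head => //; lra.
  by apply: Pb; rewrite wk ltnW.
have Ab : `|A N| <= (size (@words r N))%:R * (r%:R * C1) * (t - s) ^+ N * (v - u).
  apply: (le_trans (ler_norm_sum _ _ _)).
  apply: (@le_trans _ _ (\sum_(w <- @words r N) ((t - s) ^+ N * (r%:R * C1 * (v - u))))); last first.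
    by rewrite big_const_seq count_predT iter_addr_0 -[X in X <= _]mulr_natl le_eqVlt; apply/orP; left; apply/eqP; ring.
  rewrite big_seq [leRHS]big_seq; apply: ler_sum => w; rewrite mem_words => /eqP wN.
  rewrite normrZ; apply: ler_pM; [exact: normr_ge0|exact: normr_ge0| |].
    apply: (le_trans (lp_bound hg w vt)); rewrite wN lerXn2r ?nnegrE ?subr_ge0//; lra.
  apply: (le_trans (ler_norm_sum _ _ _)).
  apply: (@le_trans _ _ (\sum_(i < r) (C1 * (v - u)))); last first.
    by rewrite sumr_const card_ord -mulrA mulr_natl.
  apply: ler_sum => i _; rewrite normrZ mulrC.
  apply: ler_pM; [exact: normr_ge0|exact: normr_ge0|by apply: Pb; rewrite wN|].
  by apply: (le_trans (coord_le_enorm _ _)); exact: x1.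
rewrite EE; apply: (le_trans (ler_normB _ _)); apply: (le_trans (lerD (ler_normD _ _) (lexx _))).
rewrite -addrA; apply: lerD Ab _; rewrite /Q mulrDl; apply: lerD.
  apply: (le_trans T1b); rewrite mulr_suml; apply: ler_sum => k _; by rewrite mulr_suml.
apply: (le_trans T2b); rewrite mulr_suml; apply: ler_sum => k _; rewrite mulr_suml.
by apply: ler_sum => w _; rewrite mulr_suml.
Qed.

(** ** The endpoint of a broken line *)

(** Up to order [N], the displacement along a broken line depends only on its
  signature. *)
Lemma conn_sig N : exists2 C, 0 <= C & forall v y, len v <= 1 -> exists2 y',
  conn y y' (len v) &
  `|y' - \sum_(k < N.+1) \sum_(w <- words k) sig v w *: Phi w y| <= C * len v ^+ N.+1.
Proof.
have C00 : 0 <= C0 by rewrite mulr_ge0.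
have [C CC hC] := chen_fliess N [::] C00; exists C => // v y v1.
have [g hg gv] := lp_polygon v.
have [x [x0 gx x1]] := lp_x hg.
have [Y Y0 hY] := driven_exists y x1.
have l0 := len_ge0 v.
exists (Y (len v)); first by exists x, Y.
have := hC g x Y 0 (len v) hg x1 l0; rewrite subr0 => /(_ v1 (hY _)).
rewrite H0 Y0 gv => /(_ (fun (a b : R) _ ab _ => gx a b ab)).
by under eq_bigr do under eq_bigr do rewrite cats0.
Qed.

(** ** Quantitative accessibility *)

Variable q : nat.
Variable bw : 'I_n -> seq 'I_r.
Hypothesis bw_size : forall k, (0 < size (bw k) <= q)%N.
Let bfield k y : state := \sum_(w <- words (size (bw k))) br (bw k) w *: Phi w y.
Hypothesis bw_frame : forall k, bfield k 0 = delta_mx 0 k.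

(** The brackets form the standard frame at 0, and an almost standard one nearby. *)
Lemma bfield_lip : exists2 C, 0 <= C & forall k y, `|y| <= 1 -> `|bfield k y - delta_mx 0 k| <= C * `|y|.
Proof.
have [C CC hC] : exists2 C, 0 <= C & forall w, w \in @wordsle r q ->
    forall y : state, `|y| <= 1 -> `|Phi w y - Phi w 0| <= C * `|y|.
  apply: seq_bound => [w c c' cc h y y1|w].
    by apply: (le_trans (h y y1)); rewrite ler_wpM2r.
  have [C CC [_ h]] := HP w; exists (C * 2) => [|y y1]; first by rewrite mulr_ge0.
  have := h 0 y 0; rewrite drift0 big1 ?subr0 => [|i _]; last by rewrite mxE scale0r.
  move=> /le_trans; apply; rewrite -mulrA ler_wpM2l// mulrDl mul1r lerD2l.
  by rewrite expr2 ler_piMl.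
pose D : R := \sum_k \sum_(w <- words (size (bw k))) (`|br (bw k) w| * C).
have D0 k : 0 <= \sum_(w <- words (size (bw k))) (`|br (bw k) w| * C).
  by apply: sumr_ge0 => w _; rewrite mulr_ge0.
exists D => [|k y y1]; first by apply: sumr_ge0 => k _.
apply: (@le_trans _ _ ((\sum_(w <- words (size (bw k))) (`|br (bw k) w| * C)) * `|y|)); last first.
  by rewrite ler_wpM2r// /D (bigD1 k)//= lerDl sumr_ge0.
rewrite -bw_frame /bfield -sumrB; apply: (le_trans (ler_norm_sum _ _ _)).
rewrite mulr_suml big_seq [leRHS]big_seq; apply: ler_sum => w; rewrite mem_words => /eqP wk.
rewrite -scalerBr normrZ -mulrA ler_wpM2l//; apply: hC => //.
by rewrite mem_wordsle wk; have /andP[] := bw_size k.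
Qed.

(** Moving along one bracket: the length spent on a displacement of size
  [e ^ q] is of order [e]. *)
Lemma bracket_move : exists2 C, 0 <= C & forall k (c e : R) y, 0 <= e -> `|c| <= e ^+ q -> C * e <= 1 -> e <= 1 ->
  exists2 y', conn y y' (C * e) & `|y' - y - c *: bfield k y| <= C * e ^+ q.+1.
Proof.
have [D DD hD] : exists2 D, 0 <= D & forall m, m \in iota 0 q.+1 ->
    forall v y, len v <= 1 -> exists2 y', conn y y' (len v) &
    `|y' - \sum_(k < m.+1) \sum_(w <- words k) sig v w *: Phi w y| <= D * len v ^+ m.+1.
  apply: seq_bound => [m c c' cc h v y v1|m]; last exact: conn_sig.
  have [y' h1 h2] := h v y v1; exists y' => //; apply: (le_trans h2).
  by rewrite ler_wpM2r// exprn_ge0// len_ge0.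
pose A : R := 4 ^+ q.
have A0 : 0 <= A by rewrite exprn_ge0.
have A1 : 1 <= A by rewrite exprn_ege1// ler1n.
exists (A + D * A ^+ q.+1).
  by rewrite addr_ge0// mulr_ge0// exprn_ge0.
move=> k c e y e0 ce Ce1 e1; have /andP[w0 wq] := bw_size k.
set w := bw k in w0 wq *.
have [s s0 sc] := exists_root (size w).-1 (normr_ge0 c); rewrite prednK// in sc.
have se : s <= e.
  rewrite -(ler_pXn2r (n := size w))// ?nnegrE// sc; apply: (le_trans ce).
  by apply: ler_wiXn2l.
have [v vs vl] : exists2 v, eqN (size w) (sig v) (1 + c *: br w) & len v <= A * s.
  have cl : len (cpath w s) <= A * s.
    apply: (le_trans (cpath_len w s)); rewrite (ger0_norm s0) ler_wpM2r//.
    by apply: ler_weXn2l => //; rewrite ler1n.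
  have [c0|c0] := leP 0 c.
    by exists (cpath w s) => //; have := cpath_sig s w0; rewrite sc ger0_norm.
  exists (inv (cpath w s)); last by rewrite len_inv.
  have yk (u : seq 'I_r) : size u != size w -> (`|c| *: br w) u = 0.
    by move=> h; rewrite serZE br_homog ?mulr0.
  have cs := cpath_sig s w0; rewrite sc in cs.
  by have := sig_inv_lead w0 yk cs; rewrite ltr0_norm// scaleNr opprK.
have vA : len v <= A * e by apply: (le_trans vl); rewrite ler_wpM2l.
have AC : A * e <= (A + D * A ^+ q.+1) * e.
  by rewrite mulrDl lerDl !mulr_ge0// exprn_ge0.
have v1 : len v <= 1 by apply: (le_trans vA); apply: (le_trans AC).
have wi : size w \in iota 0 q.+1 by rewrite mem_iota.
have [y' h1 h2] := hD _ wi v y v1.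
exists y'; first exact: conn_le (le_trans vA AC) h1.
have sE : \sum_(k0 < (size w).+1) \sum_(u <- words k0) sig v u *: Phi u y = y + c *: bfield k y.
  rewrite big_ord_recr /= (bigD1 (Ordinal w0)) //= big_seq1 (vs [::])// big1 ?addr0 => [|i i0].
    rewrite serDE serZE br_homog; last by rewrite eq_sym -lt0n.
    rewrite mulr0 addr0 ser1E scale1r H0; congr (_ + _).
    rewrite /bfield scaler_sumr big_seq [RHS]big_seq; apply: eq_bigr => u; rewrite mem_words => /eqP uw.
    rewrite vs ?uw// serDE ser1E serZE scalerA.
    by case: (u) uw => [uw|? ? _]; [rewrite -uw in w0|rewrite add0r].
  rewrite big_seq big1// => u; rewrite mem_words => /eqP uw.
  have ul : (size u < size w)%N by rewrite uw.
  rewrite vs; last exact: ltnW.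
  rewrite serDE ser1E serZE br_homog ?mulr0 ?addr0; last by rewrite ltn_eqF.
  case: (u) uw => [uw|? ? _]; last by rewrite scale0r.
  by move: i0; rewrite -val_eqE /= -uw.
rewrite sE opprD addrA in h2.
apply: (le_trans h2).
have lv0 := len_ge0 v.
have h3 : len v ^+ (size w).+1 <= A ^+ (size w) .+1 * (s ^+ (size w).+1).
  by rewrite -exprMn lerXn2r ?nnegrE// mulr_ge0.
have h4 : A ^+ (size w).+1 <= A ^+ q.+1 by apply: ler_weXn2l.
have h5 : s ^+ (size w).+1 <= e ^+ q.+1.
  by rewrite !exprS sc; apply: ler_pM => //.
apply: (@le_trans _ _ (D * (A ^+ q.+1 * e ^+ q.+1))).
  rewrite ler_wpM2l//; apply: (le_trans h3); apply: ler_pM => //; exact: exprn_ge0.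
by rewrite mulrA ler_wpM2r ?exprn_ge0// lerDr.
Qed.

Hypothesis q0 : (0 < q)%N.

(** Correct the error one coordinate after another by [bracket_move]. The moves
  interact, but their total error is [e ^ q] times a quantity that is small for
  small [e] and [rho]. *)
Lemma chow_round : exists C e0 rho : R, [/\ 0 <= C, 0 < e0 <= 1, 0 < rho &
  forall (e : R) y ys, 0 <= e -> e <= e0 -> `|y| <= rho -> `|ys - y| <= e ^+ q ->
  exists2 y1, conn y y1 (C * e) & `|ys - y1| <= (e / 2) ^+ q].
Proof.
have [C CC hC] := bracket_move; have [D DD hD] := bfield_lip.
pose nn : R := n%:R; have nn0 : 0 <= nn by [].
pose E := B * (nn * C); have E0 : 0 <= E by rewrite !mulr_ge0.
pose K1 := nn * (C + D * E); have K10 : 0 <= K1 by rewrite mulr_ge0// addr_ge0// mulr_ge0.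
pose K2 := nn * D; have K20 : 0 <= K2 by rewrite mulr_ge0.
pose h : R := 2 ^- q; have h0 : 0 < h by rewrite invr_gt0 exprn_gt0.
pose rho := Num.min (2^-1) (h / 2 / (K2 + 1)).
have rho0 : 0 < rho by rewrite lt_min invr_gt0 ltr0n /= !divr_gt0//; lra.
pose e0 := Num.min (Num.min 1 (C + 1)^-1) (Num.min ((2 * (E + 1))^-1) (h / 2 / (K1 + 1))).
have e00 : 0 < e0.
  by rewrite !lt_min ltr01 !invr_gt0 !divr_gt0//=; try lra; rewrite andbT; apply/andP; split; lra.
have e0a : e0 <= 1 by rewrite !ge_min lexx.
have e0b : C * e0 <= 1.
  have : e0 <= (C + 1)^-1 by rewrite !ge_min lexx orbT.
  rewrite -[_^-1]div1r ler_pdivlMr; last lra.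
  by move: e00 => + h1; rewrite mulrDr mulr1 mulrC in h1 *; lra.
have e0c : E * e0 <= 2^-1.
  have : e0 <= (2 * (E + 1))^-1 by rewrite !ge_min lexx !orbT.
  rewrite -[_^-1]div1r ler_pdivlMr; last lra.
  by move=> h1; have : e0 * (2 * (E + 1)) = 2 * (E * e0) + 2 * e0 by [ring]; lra.
have e0d : K1 * e0 <= h / 2.
  have : e0 <= h / 2 / (K1 + 1) by rewrite !ge_min lexx !orbT.
  rewrite ler_pdivlMr; last lra.
  by move=> h1; have : e0 * (K1 + 1) = K1 * e0 + e0 by [ring]; lra.
have ra : rho <= 2^-1 by rewrite ge_min lexx.
have rd : K2 * rho <= h / 2.
  have : rho <= h / 2 / (K2 + 1) by rewrite !ge_min lexx !orbT.
  rewrite ler_pdivlMr; last lra.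
  by move=> h1; have : rho * (K2 + 1) = K2 * rho + rho by [ring]; lra.
exists (nn * C), e0, rho; split=> //; first by rewrite mulr_ge0.
  by rewrite e00.
move=> e y ys ege ele yr dist.
have Ce : C * e <= 1 by apply: le_trans e0b; rewrite ler_wpM2l.
have e1 : e <= 1 by apply: le_trans e0a.
have eq0 : 0 <= e ^+ q by rewrite exprn_ge0.
pose d := ys - y.
pose err := e ^+ q * (C * e + D * (rho + E * e)).
have [y1 c1 h1] : exists2 y1, conn y y1 ((size (enum 'I_n))%:R * (C * e)) &
    `|y1 - y - \sum_(k <- enum 'I_n) d 0 k *: delta_mx 0 k| <= (size (enum 'I_n))%:R * err.
  have : (size (enum 'I_n) <= n)%N by rewrite size_enum_ord.
  elim/last_ind: (enum 'I_n) => [_|s k IH].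
    exists y; first by rewrite mul0r; exact: conn_refl.
    by rewrite subrr big_nil subrr normr0 mul0r.
  rewrite size_rcons => sn; have [z cz hz] := IH (ltnW sn).
  have zy := conn_dist cz.
  have zb : `|z| <= rho + E * e.
    rewrite -(subrK y z) addrC; apply: (le_trans (ler_normD _ _)); apply: lerD => //.
    apply: (le_trans zy); rewrite /E -!mulrA ler_wpM2l// ler_wpM2r ?mulr_ge0//.
    by rewrite ler_nat ltnW.
  have z1 : `|z| <= 1.
    apply: (le_trans zb); have : E * e <= E * e0 by rewrite ler_wpM2l.
    by lra.
  have dk : `|d 0 k| <= e ^+ q by apply: (le_trans (coord_le_mnorm _ _)).
  have [z' c' h'] := hC k (d 0 k) e z ege dk Ce e1.
  exists z'; first by rewrite -natr1 mulrDl mul1r; exact: conn_trans cz c'.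
  rewrite -cats1 big_cat big_seq1 /= -natr1 mulrDl mul1r.
  set S := \sum_(_ <- s) _ in hz *.
  have -> : z' - y - (S + d 0 k *: delta_mx 0 k) = (z - y - S) +
     ((z' - z - d 0 k *: bfield k z) + d 0 k *: (bfield k z - delta_mx 0 k)).
    rewrite scalerBr; move: (d 0 k *: bfield k z) (d 0 k *: delta_mx 0 k) => *.
    by apply/rowP => i; rewrite !mxE; ring.
  apply: (le_trans (ler_normD _ _)); apply: lerD hz _.
  apply: (le_trans (ler_normD _ _)); rewrite /err mulrDr; apply: lerD.
    by apply: (le_trans h'); rewrite exprS le_eqVlt; apply/orP; left; apply/eqP; ring.
  rewrite normrZ; apply: ler_pM; [exact: normr_ge0|exact: normr_ge0|exact: dk|].
  by apply: (le_trans (hD _ _ z1)); rewrite ler_wpM2l.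
rewrite size_enum_ord -/nn in c1 h1.
exists y1; first by rewrite -mulrA.
rewrite big_enum /= -row_sum_delta in h1.
have -> : ys - y1 = - (y1 - y - d) by rewrite /d; apply/rowP => i; rewrite !mxE; ring.
rewrite normrN; apply: (le_trans h1).
have -> : (e / 2) ^+ q = e ^+ q * h by rewrite exprMn exprVn.
have -> : nn * err = e ^+ q * (K1 * e + K2 * rho) by rewrite /err /K1 /K2; ring.
rewrite ler_wpM2l//.
have : K1 * e <= K1 * e0 by rewrite ler_wpM2l.
by lra.
Qed.

(** Chow's theorem near the origin, with the (non optimal) Hoelder exponent [q]:
  the defect is reduced by a factor [2 ^ q] by moves along the brackets, whose
  lengths form a geometric progression. *)
Lemma chow : exists C e0 rho : R, [/\ 0 <= C, 0 < e0, 0 < rho &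
  forall (e : R) y ys, 0 <= e -> e <= e0 -> `|ys| <= rho -> `|ys - y| <= e ^+ q ->
  conn y ys (C * e)].
Proof.
have [C [e0 [rho [CC /andP[e00 e01] rho0 hC]]]] := chow_round.
pose e1 := Num.min e0 (rho / 2); have e10 : 0 < e1 by rewrite lt_min e00 divr_gt0.
have r2 : 0 < rho / 2 by rewrite divr_gt0.
exists (2 * C), e1, (rho / 2); split => //; first by rewrite mulr_ge0.
move=> e y ys ege; rewrite le_min => /andP[ele elr] ysr dist.
have /boolp.choice [F hF] (p : R * state) : exists y1 : state, 0 <= p.1 -> p.1 <= e0 -> `|p.2| <= rho ->
    `|ys - p.2| <= p.1 ^+ q -> conn p.2 y1 (C * p.1) /\ `|ys - y1| <= (p.1 / 2) ^+ q.
  case: (pselect (exists2 y1 : state, conn p.2 y1 (C * p.1) & `|ys - y1| <= (p.1 / 2) ^+ q)).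
    by case=> y1 *; exists y1.
  by move=> no; exists 0 => a b c d; case: no; exact: hC.
pose ek (k : nat) : R := e / 2 ^+ k.
have p2 (k : nat) : 0 < 2 ^+ k :> R by rewrite exprn_gt0.
have ek0 k : 0 <= ek k by rewrite divr_ge0// ltW.
have eke k : ek k <= e by rewrite ler_pdivrMr// ler_peMr// exprn_ege1// ler1n.
have ekq k : ek k ^+ q <= ek k.
  rewrite -[leRHS]expr1; apply: ler_wiXn2l => //; apply: (le_trans (eke k)).
  exact: le_trans e01.
pose yk := fix yk k := if k is k'.+1 then F (ek k', yk k') else y.
have hk k : `|ys - yk k| <= ek k ^+ q /\ conn y (yk k) (2 * C * (e - ek k)).
  elim: k => [|k [IH1 IH2]].
    rewrite /ek expr0 divr1 subrr mulr0; split=> //; exact: conn_refl.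
  have ykr : `|yk k| <= rho.
    have -> : yk k = ys - (ys - yk k) by rewrite opprB addrC subrK.
    apply: (le_trans (ler_normB _ _)); have := eke k; have := ekq k; lra.
  have [c h] := hF (ek k, yk k) (ek0 k) (le_trans (eke k) ele) ykr IH1.
  have ekS : ek k.+1 = ek k / 2 by rewrite /ek exprS invfM mulrCA mulrC.
  split; first by rewrite ekS.
  have -> : 2 * C * (e - ek k.+1) = 2 * C * (e - ek k) + C * ek k by rewrite ekS; field.
  exact: conn_trans IH2 c.
apply: (conn_lim (yk := yk)) => [k|ee ee0].
  have [_ c] := hk k; apply: conn_le c; rewrite ler_wpM2l ?mulr_ge0//.
  by rewrite lerBlDr lerDl.
have ge0 : 0 <= e / ee by rewrite divr_ge0// ltW.
exists (Num.truncn (e / ee)).+1 => k mk.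
rewrite distrC; apply: (le_trans (hk k).1); apply: (le_trans (ekq k)).
rewrite /ek ler_pdivrMr// mulrC -ler_pdivrMr//.
have h1 := ltW (truncnS_gt (e / ee)); apply: (le_trans h1).
rewrite -natrX ler_nat; apply: (leq_trans mk); exact: ltnW (ltn_expl _ _).
Qed.

End Control.

(** * Minimizers of control systems *)

Section MinimizersControl.
Context {R : realType} {n r : nat}.
Local Notation ser := (ser R r).
Local Notation enorm := (@euclidean_norm R r).
Local Notation state := 'rV[R]_n.
Variable Phi : seq 'I_r -> state -> state.
Variables (B La : R) (HB : bounded_drift Phi B La).
Hypothesis H0 : forall y, Phi [::] y = y.
Hypothesis HP : jet_estimates Phi.
Variable q : nat.
Variable bw : 'I_n -> seq 'I_r.
Hypothesis bw_size : forall k, (0 < size (bw k) <= q)%N.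
Hypothesis bw_frame : forall k,
  \sum_(w <- words (size (bw k))) br (bw k) w *: Phi w 0 = delta_mx 0 k :> state.
Hypothesis q0 : (0 < q)%N.

(** A shortcut for a blow-up of the lifted path, up to order [q], gives at a
  small scale [eta] a driven curve ending at distance [O(eta ^ q.+1)] of the
  minimizer, which [chow] closes up at the cost of a small fraction of [eta]. *)
Lemma minimal_tan (U : set_system R) (g : R -> R -> ser) (CY T : R) x Y :
  UltraFilter U -> 0^'+ `<=` U -> lp g -> lip1 x -> 0 < T -> 0 <= CY ->
  (forall s t, s <= t -> incr g s t = x t - x s) -> Y 0 = 0 ->
  driven Phi CY x Y (- T) T ->
  (forall s t L, - T <= s -> s <= t -> t <= T -> conn Phi B La (Y s) (Y t) L -> t - s <= L) ->
  Nmin q (tan U g).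
Proof.
move=> UU U0 hg x1 T0 CY0 gx Y0 hY hmin s t v st vz; rewrite leNgt; apply/negP => vl.
have [ht cv] := tanP UU hg; have FU : Filter U by apply: PFU.
have [C1 C10 hC1] := conn_sig HB H0 HP q.
have [C2 C20 hC2] := chen_fliess HB HP q [::] CY0.
have [C3 [e0 [rho0 [C30 e00 rho00 hC3]]]] := chow HB H0 HP bw_size bw_frame q0.
have B0 := bd_B HB.
pose rho := (t - s - len v) / 3; have rho1 : 0 < rho by rewrite divr_gt0// subr_gt0.
have [de de0 fchow] := @free_chow R r q rho rho1.
pose ka := rho / (C3 + 1); have ka0 : 0 < ka by rewrite divr_gt0//; lra.
have kaC : C3 * ka <= rho.
  rewrite /ka mulrCA ler_piMr ?(ltW rho1)// ler_pdivrMr; lra.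
pose W := (C1 + C2) * (t - s) ^+ q.+1.
have W0 : 0 <= W by rewrite mulr_ge0 ?addr_ge0// exprn_ge0// subr_ge0.
pose m := Num.min (Num.min T 1) (rho0 / (B + 1)).
have B1 : 0 < B + 1 by lra.
have m0 : 0 < m by rewrite !lt_min T0 ltr01 divr_gt0.
pose S := `|s| + `|t| + 1; have S0 : 0 < S by rewrite ltr_wpDl// addr_ge0.
pose eta1 := Num.min (m / S) (Num.min (e0 / ka) (ka ^+ q / (W + 1))).
have W1 : 0 < W + 1 by lra.
have eta10 : 0 < eta1.
  by rewrite !lt_min (divr_gt0 m0 S0) (divr_gt0 e00 ka0) (divr_gt0 (exprn_gt0 q ka0) W1).
pose l := sig (inv v) * tan U g s t.
have Ecv : scvg U (fun eta => sig (inv v) * rescale (pos eta) g s t) l.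
  exact: (@scvgM _ _ _ U UU (fun=> sig (inv v)) _ (fun eta => rescale (pos eta) g s t) _ (@scvg_cst _ _ _ U UU _) (cv s t st)).
have near1 := near_lt U0 eta10.
have near2 : \forall eta \near U, forall w, w \in @wordsle r q ->
    `|l w - (sig (inv v) * rescale (pos eta) g s t) w| <= de.
  by apply: near_seq => w; have /cvgrPdist_le := Ecv w; apply.
have [eta' [/andP[eta0 etae] near2']] := @filter_ex _ U (PFU UU) _ (filterI near1 near2).
move: eta0 etae near2'; set eta := pos eta' => eta0 etae near2'; set G := rescale eta g s t in near2'.
have hgr := lp_rescale eta0 hg.
have l1 : eqN q l 1.
  by rewrite /l -(sig_invl v); apply: eqN_mul => //; exact: eqN_sym.
have [w0|w0 w0z w0l] := fchow (sig (inv v) * G) (GL_sigM _ (lp_GL hgr st)).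
  move=> /andP[w00 w0N]; have := near2' w0; rewrite mem_wordsle => /(_ w0N).
  rewrite l1// ser1E (_ : w0 == [::] = false); last by case: (w0) w00.
  by rewrite sub0r normrN.
pose v' := v ++ w0.
(* the competitor with a short correction has the signature of [G] up to degree [q] *)
have v'G : eqN q (sig v') G.
  have e1 : G = sig v * (sig (inv v) * G) by rewrite mulrA sig_invr mul1r.
  by rewrite /v' sig_cat e1; apply: eqN_mul.
have v'l : len v' <= len v + rho by rewrite len_cat lerD2l.
have v'ts : len v' <= t - s by rewrite (le_trans v'l)// /rho; lra.
have l0 := len_ge0 v'.
have etaS : eta * S <= m.
  by rewrite -ler_pdivlMr//; apply: (le_trans (ltW etae)); rewrite ge_min lexx.
have etam : eta * `|s| <= m /\ eta * `|t| <= m.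
  by split; apply: le_trans etaS; rewrite ler_pM2l// /S -addrA; [rewrite lerDl addr_ge0|rewrite addrCA lerDl addr_ge0].
have ets1 : eta * (t - s) <= 1.
  apply: (@le_trans _ _ (eta * S)).
    rewrite ler_pM2l// /S; have := ler_norm t; have := ler_norm (- s); rewrite normrN; lra.
  by apply: (le_trans etaS); rewrite !ge_min lexx orbT.
have ekae : ka * eta <= e0.
  by rewrite mulrC -ler_pdivlMr//; apply: (le_trans (ltW etae)); rewrite !ge_min lexx !orbT.
have eW : W * eta <= ka ^+ q.
  have : eta * (W + 1) <= ka ^+ q.
    by rewrite -ler_pdivlMr//; apply: (le_trans (ltW etae)); rewrite !ge_min lexx !orbT.
  by rewrite mulrDr mulr1 mulrC; lra.
have mT : m <= T by rewrite !ge_min lexx.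
have abT (u : R) : eta * `|u| <= m -> - T <= eta * u /\ eta * u <= T.
  move=> h; have := le_trans h mT; rewrite -(gtr0_norm eta0) -normrM ler_norml (gtr0_norm eta0).
  by move=> /andP.
have [sT1 sT2] := abT s etam.1; have [tT1 tT2] := abT t etam.2.
have est : eta * s <= eta * t by rewrite ler_pM2l.
pose y := Y (eta * s).
have lse : len (scl eta v') = eta * len v' by rewrite len_scl gtr0_norm.
have ls1 : len (scl eta v') <= 1 by rewrite lse (le_trans _ ets1)// ler_pM2l.
have [y' cy' hy'] := hC1 (scl eta v') y ls1.
have ets1' : eta * t - eta * s <= 1 by rewrite -mulrBr.
have hYst : driven Phi CY x Y (eta * s) (eta * t).
  by move=> a b sa ab bt; apply: hY => //; [exact: le_trans sT1 sa|exact: le_trans bt tT2].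
have := hC2 g x Y (eta * s) (eta * t) hg x1 est ets1' hYst (fun (a b : R) _ ab _ => gx a b ab).
rewrite H0 -/y => hz.
have sE : \sum_(k < q.+1) \sum_(w <- words k) g (eta * s) (eta * t) w *: Phi (w ++ [::]) y =
    \sum_(k < q.+1) \sum_(w <- words k) sig (scl eta v') w *: Phi w y.
  apply: eq_bigr => k _; rewrite big_seq [RHS]big_seq; apply: eq_bigr => w; rewrite mem_words => /eqP wk.
  rewrite cats0 sig_scl /dil v'G; last by rewrite wk -ltnS.
  by rewrite /G /rescale /dil mulrA -exprMn mulfV ?gt_eqF// expr1n mul1r.
rewrite sE in hz.
have dist : `|Y (eta * t) - y'| <= (ka * eta) ^+ q.
  rewrite -(subrKA (\sum_(k < q.+1) \sum_(w <- words k) sig (scl eta v') w *: Phi w y)).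
  apply: (le_trans (ler_normD _ _)).
  apply: (@le_trans _ _ (W * eta ^+ q.+1)).
    rewrite /W mulrAC mulrDl mulrDl addrC; apply: lerD.
      rewrite distrC; apply: (le_trans hy'); rewrite -mulrA ler_wpM2l// -exprMn lse.
      by rewrite lerXn2r ?nnegrE ?mulr_ge0 ?(ltW eta0) ?subr_ge0// ler_pM2l.
    by apply: (le_trans hz); rewrite -mulrBr exprMn -mulrA.
  by rewrite exprMn exprS mulrA ler_wpM2r// exprn_ge0// ltW.
have Yr : `|Y (eta * t)| <= rho0.
  have := driven_lip' HB x1 hY (s := 0) (t := eta * t); rewrite oppr_le0 Y0 !subr0 => h.
  apply: (le_trans (h (ltW T0) (ltW T0) tT1 tT2)).
  rewrite normrM (gtr0_norm eta0); apply: (@le_trans _ _ (B * m)); first by rewrite ler_wpM2l// etam.2.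
  have : m * (B + 1) <= rho0 by rewrite -ler_pdivlMr// ge_min lexx orbT.
  by rewrite mulrDr mulr1 mulrC; lra.
have ek0 : 0 <= ka * eta by rewrite mulr_ge0// ltW.
have c2 := hC3 (ka * eta) y' (Y (eta * t)) ek0 ekae Yr dist.
have c3 := conn_trans HB cy' c2.
have := hmin _ _ _ sT1 est tT2 c3; rewrite lse -mulrBr mulrA => fin.
have : eta * (t - s) <= eta * (len v' + rho).
  apply: (le_trans fin); rewrite mulrDr lerD2l [leRHS]mulrC ler_pM2r//.
rewrite ler_pM2l// leNgt => /negP; apply.
rewrite (@le_lt_trans _ _ (len v + rho + rho))// ?lerD2r//.
by rewrite /rho; lra.
Qed.

Variable wt : 'I_n -> nat.
Hypothesis privileged : forall j (w : seq 'I_r), (size w < wt j)%N -> Phi w 0 0 j = 0.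

(** The coordinate [j], to the order given by its weight, along the constant control
  [c]. *)
Definition ray (c : 'rV[R]_r) j := \sum_(w <- words (wt j)) sexp c w * Phi w 0 0 j.

(** By [chen_fliess] and privilegedness, [eta ^- wt j] times the coordinate is, up to
  [O(eta)], a combination of iterated integrals of order [wt j] of the rescaled
  path, to which [lp_near_line] applies. *)
Lemma ray_limit_coord (CY e K : R) j : 0 <= CY -> 0 < e -> 0 <= K -> exists2 d : R, 0 < d &
  forall eta x c Y, 0 < eta -> eta <= d -> lip1 x -> enorm c <= 1 ->
    driven Phi CY x Y 0 (eta * K) -> Y 0 = 0 ->
    (forall t, 0 <= t -> t <= K -> enorm (x (eta * t) - x 0 - (eta * t) *: c) <= eta * d) ->
  forall t, 0 <= t -> t <= K -> `|eta ^- wt j * Y (eta * t) 0 j - ray (t *: c) j| <= e.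
Proof.
move=> CY0 e0 K0; set k := wt j.
have [C CC hC] := chen_fliess HB HP k [::] CY0.
pose S : R := \sum_(w <- words k) `|Phi w 0 0 j|.
have S0 : 0 <= S by apply: sumr_ge0.
pose eps := e / 2 / (S + 1).
have eps0 : 0 < eps by rewrite !divr_gt0//; lra.
have [d1 d10 hd1] : exists2 d : R, 0 < d & forall w, w \in @words r k ->
    forall (g : R -> R -> ser) (c : 'rV_r), lp g -> enorm c <= 1 ->
    (forall t (i : 'I_r), 0 <= t -> t <= K -> `|g 0 t [:: i] - t * c 0 i| <= d) ->
    forall t, 0 <= t -> t <= K -> `|g 0 t w - sexp (t *: c) w| <= eps.
  elim: (@words r k) => [|w s [d d0 hd]]; first by exists 1.
  have [d' d'0 hd'] := lp_near_line w K0 eps0.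
  exists (Num.min d d'); first by rewrite lt_min d0.
  move=> w'; rewrite inE => /orP[/eqP ->|ws] g c hg c1 h.
    by apply: hd' => // t i t0 tK; apply: (le_trans (h t i t0 tK)); rewrite ge_min lexx orbT.
  by apply: (hd w' ws) => // t i t0 tK; apply: (le_trans (h t i t0 tK)); rewrite ge_min lexx.
have CK0 : 0 <= C * K ^+ k.+1 by rewrite mulr_ge0// exprn_ge0.
pose d := Num.min d1 (Num.min (K + 1)^-1 (e / 2 / (C * K ^+ k.+1 + 1))).
exists d; first by rewrite !lt_min d10 invr_gt0 !divr_gt0//; [rewrite andbT|]; lra.
move=> eta x c Y eta0 etad x1 c1 hY Y0 hx t t0 tK.
have [g hg gx] := lp_exists x1.
have etat0 : 0 <= eta * t by rewrite mulr_ge0// ltW.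
have etatK : eta * t <= eta * K by rewrite ler_pM2l.
have eK1 : eta * K <= 1.
  have : eta <= (K + 1)^-1 by apply: (le_trans etad); rewrite !ge_min lexx orbT.
  rewrite -[_^-1]div1r ler_pdivlMr; last lra.
  by rewrite mulrDr mulr1; lra.
have hYt : driven Phi CY x Y 0 (eta * t).
  by move=> a b a0 ab bt; apply: hY => //; exact: le_trans etatK.
have := hC g x Y 0 (eta * t) hg x1 etat0; rewrite subr0 => /(_ (le_trans etatK eK1) hYt (fun (a b : R) _ ab _ => gx a b ab)).
rewrite H0 Y0 => hz.
pose V : state := \sum_(k0 < k.+1) \sum_(w <- words k0) g 0 (eta * t) w *: Phi (w ++ [::]) 0.
have sj : V 0 j = \sum_(w <- words k) g 0 (eta * t) w * Phi w 0 0 j.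
  rewrite /V summxE big_ord_recr /= big1 ?add0r => [|i _].
    by rewrite summxE; apply: eq_bigr => w _; rewrite cats0 mxE.
  rewrite summxE big_seq big1// => w; rewrite mem_words => /eqP wi.
  by rewrite cats0 mxE privileged ?mulr0// wi; exact: ltn_ord.
have hzj : `|Y (eta * t) 0 j - \sum_(w <- words k) g 0 (eta * t) w * Phi w 0 0 j| <= C * (eta * t) ^+ k.+1.
  rewrite -sj; apply: le_trans hz; rewrite -/V.
  by have := coord_le_mnorm (Y (eta * t) - V) j; rewrite mxE [X in _ + X]mxE.
have ek0 : 0 < eta ^+ k by rewrite exprn_gt0.
have rE w : w \in @words r k -> rescale eta g 0 t w = eta ^- k * g 0 (eta * t) w.
  by rewrite mem_words => /eqP wk; rewrite /rescale /dil mulr0 wk exprVn.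
have hr := lp_rescale eta0 hg.
have hl : forall u (i : 'I_r), 0 <= u -> u <= K -> `|rescale eta g 0 u [:: i] - u * c 0 i| <= d1.
  move=> u i u0 uK; have -> : rescale eta g 0 u [:: i] - u * c 0 i =
     eta^-1 * (x (eta * u) - x 0 - (eta * u) *: c) 0 i.
    have -> : rescale eta g 0 u [:: i] = incr (rescale eta g) 0 u 0 i by rewrite mxE.
    rewrite incr_rescale mulr0 gx ?mulr_ge0 ?(ltW eta0)// !mxE; field; by rewrite gt_eqF.
  rewrite normrM gtr0_norm ?invr_gt0// mulrC ler_pdivrMr//.
  apply: (le_trans (coord_le_enorm _ i)); apply: (le_trans (hx u u0 uK)).
  by rewrite mulrC ler_pM2r// ge_min lexx.
have -> : eta ^- k * Y (eta * t) 0 j - ray (t *: c) j =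
   eta ^- k * (Y (eta * t) 0 j - \sum_(w <- words k) g 0 (eta * t) w * Phi w 0 0 j) +
   \sum_(w <- words k) (rescale eta g 0 t w - sexp (t *: c) w) * Phi w 0 0 j.
  have -> : \sum_(w <- words k) (rescale eta g 0 t w - sexp (t *: c) w) * Phi w 0 0 j =
    eta ^- k * (\sum_(w <- words k) g 0 (eta * t) w * Phi w 0 0 j) - ray (t *: c) j.
    rewrite /ray mulr_sumr -sumrB big_seq [RHS]big_seq.
    by apply: eq_bigr => w wk /=; rewrite (rE w wk); ring.
  ring.
apply: (le_trans (ler_normD _ _)); rewrite (splitr e); apply: lerD.
  rewrite normrM gtr0_norm ?invr_gt0// mulrC ler_pdivrMr//; apply: (le_trans hzj).
  rewrite exprMn exprSr.
  have h1 : eta * (C * K ^+ k.+1 + 1) <= e / 2.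
    rewrite -ler_pdivlMr; last lra.
    by apply: (le_trans etad); rewrite !ge_min lexx !orbT.
  have tk : t ^+ k.+1 <= K ^+ k.+1 by rewrite lerXn2r ?nnegrE.
  have -> : C * (eta ^+ k * eta * t ^+ k.+1) = (eta * (C * t ^+ k.+1)) * eta ^+ k by ring.
  rewrite ler_pM2r//; apply: le_trans h1; rewrite ler_pM2l//.
  apply: (@le_trans _ _ (C * K ^+ k.+1)); first by rewrite ler_wpM2l.
  by rewrite lerDl.
apply: (le_trans (ler_norm_sum _ _ _)); apply: (@le_trans _ _ (eps * S)).
  rewrite /S mulr_sumr big_seq [leRHS]big_seq; apply: ler_sum => w wk.
  by rewrite normrM ler_wpM2r//; exact: (hd1 w wk _ _ hr c1 hl).
rewrite /eps mulrAC ler_pdivrMr; last lra.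
by rewrite ler_wpM2l ?lerDl//; lra.
Qed.

Lemma ray_limit (CY e K : R) : 0 <= CY -> 0 < e -> 0 <= K -> exists2 d : R, 0 < d &
  forall eta x c Y, 0 < eta -> eta <= d -> lip1 x -> enorm c <= 1 ->
    driven Phi CY x Y 0 (eta * K) -> Y 0 = 0 ->
    (forall t, 0 <= t -> t <= K -> enorm (x (eta * t) - x 0 - (eta * t) *: c) <= eta * d) ->
  forall t j, 0 <= t -> t <= K -> `|eta ^- wt j * Y (eta * t) 0 j - ray (t *: c) j| <= e.
Proof.
move=> CY0 e0 K0.
suff [d d0 hd] : exists2 d : R, 0 < d & forall j, j \in enum 'I_n ->
  forall eta x c Y, 0 < eta -> eta <= d -> lip1 x -> enorm c <= 1 ->
    driven Phi CY x Y 0 (eta * K) -> Y 0 = 0 ->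
    (forall t, 0 <= t -> t <= K -> enorm (x (eta * t) - x 0 - (eta * t) *: c) <= eta * d) ->
  forall t, 0 <= t -> t <= K -> `|eta ^- wt j * Y (eta * t) 0 j - ray (t *: c) j| <= e.
  exists d => // eta x c Y h1 h2 h3 h4 h5 h6 h7 t j; apply: (hd j _ eta x c Y) => //.
  by rewrite mem_enum.
elim: (enum 'I_n) => [|j s [d d0 hd]]; first by exists 1.
have [d' d'0 hd'] := ray_limit_coord j CY0 e0 K0.
exists (Num.min d d'); first by rewrite lt_min d0.
move=> j'; rewrite inE => js eta x c Y h1; rewrite le_min => /andP[h2 h2'] h3 h4 h5 h6 h7.
have h7' t : 0 <= t -> t <= K -> enorm (x (eta * t) - x 0 - (eta * t) *: c) <= eta * d.
  by move=> t0 tK; apply: (le_trans (h7 t t0 tK)); rewrite ler_pM2l// ge_min lexx.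
have h7'' t : 0 <= t -> t <= K -> enorm (x (eta * t) - x 0 - (eta * t) *: c) <= eta * d'.
  by move=> t0 tK; apply: (le_trans (h7 t t0 tK)); rewrite ler_pM2l// ge_min lexx orbT.
case/orP: js => [/eqP ->|js]; first exact: (hd' eta x c Y).
exact: (hd j' js eta x c Y).
Qed.

(** Reversing time reduces negative times to positive ones, for which the expansion
  starts at the base point. *)
Lemma driven_rev (CY T : R) x Y : lip1 x -> driven Phi CY x Y (- T) T ->
  lip1 (fun t => x (- t)) /\ driven Phi (CY + La * B) (fun t => x (- t)) (fun t => Y (- t)) (- T) T.
Proof.
move=> x1 hY; split=> [s t st|s t Ts st tT].
  by rewrite -enormN opprB; apply: (le_trans (x1 _ _ _)); rewrite ?lerN2//; lra.
have := hY (- t) (- s); rewrite !lerN2 => /(_ tT st).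
have sT : - s <= T by rewrite lerNl.
move=> /(_ sT); set rh := Y (- s) - _ - _ => hr.
have -> : Y (- t) - Y (- s) - drift Phi (x (- t) - x (- s)) (Y (- s)) =
   - rh + (drift Phi (x (- t) - x (- s)) (Y (- t)) - drift Phi (x (- t) - x (- s)) (Y (- s))).
  rewrite /rh -[x (- s) - x (- t)]opprB (driftN _ _ (Y (- t))).
  move: (drift _ _ _) (drift _ _ _) => *; apply/rowP => i; rewrite !mxE; ring.
apply: (le_trans (ler_normD _ _)); rewrite normrN mulrDl.
have ts : - s - - t = t - s by ring.
rewrite ts in hr; apply: lerD hr _.
apply: (le_trans (bd_lip HB _ _ _)).
have La0 := bd_La HB.
have e1 : enorm (x (- t) - x (- s)) <= t - s.
  by rewrite -enormN opprB -ts; apply: x1; rewrite lerN2.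
have e2 : `|Y (- t) - Y (- s)| <= B * (t - s).
  by rewrite distrC -ts; apply: (driven_lip HB x1 hY) => //; rewrite lerN2.
have -> : La * B * (t - s) ^+ 2 = La * (t - s) * (B * (t - s)) by ring.
apply: ler_pM; [by rewrite mulr_ge0// enorm_ge0|exact: normr_ge0|by rewrite ler_wpM2l|exact: e2].
Qed.

(** The direction [c] comes from [blowup_line], applied to a blow-up of the lift,
  which is a minimizer by [minimal_tan]; [ray_limit] reads the corresponding
  blow-ups of [x] in the privileged coordinates. *)
Theorem control_blowup (CY T : R) x Y : lip1 x -> 0 < T -> 0 <= CY -> Y 0 = 0 ->
  driven Phi CY x Y (- T) T ->
  (forall s t L, - T <= s -> s <= t -> t <= T -> conn Phi B La (Y s) (Y t) L -> t - s <= L) ->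
  exists2 c : 'rV[R]_r, enorm c = 1 & forall e K : R, 0 < e -> 0 <= K ->
    exists2 eta : R, 0 < eta < e & forall t j, - K <= t -> t <= K ->
      `|eta ^- wt j * Y (eta * t) 0 j - ray (t *: c) j| <= e.
Proof.
move=> x1 T0 CY0 Y0 hY hmin.
have [g hg gx] := lp_exists x1.
have [U [UU U0]] := @ultraFilterLemma R (0^'+) _.
have hN := minimal_tan UU U0 hg x1 T0 CY0 gx Y0 hY hmin.
have [ht _] := tanP UU hg.
have [c c1 hc] := blowup_line q0 ht hN.
exists c => // e K e0 K0.
have [x1' hY'] := driven_rev x1 hY.
have CY'0 : 0 <= CY + La * B by rewrite addr_ge0// mulr_ge0 ?(bd_B HB) ?(bd_La HB).
have [d d0 hd] := ray_limit CY'0 e0 K0.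
have K1 : 0 < K + 1 by lra.
pose d1 := Num.min (Num.min d e) (T / (K + 1)).
have d10 : 0 < d1 by rewrite !lt_min d0 e0 divr_gt0.
have [eta /andP[eta0 etad] h] := blowup_tan UU U0 hg hc d10 K0.
exists eta; first by rewrite eta0 (lt_le_trans etad)// !ge_min lexx orbT.
have etad' : eta <= d by rewrite (le_trans (ltW etad))// !ge_min lexx.
have d1d : d1 <= d by rewrite !ge_min lexx.
have eKT : eta * K <= T.
  have : eta * (K + 1) <= T.
    by rewrite -ler_pdivlMr//; apply: (le_trans (ltW etad)); rewrite !ge_min lexx orbT.
  by rewrite mulrDr mulr1; lra.
have TT : - T <= 0 by rewrite oppr_le0 ltW.
have eKT' (u : R) : u <= eta * K -> u <= T by move=> /le_trans; apply.
move=> t j Kt tK; have [t0|/ltW t0] := leP 0 t.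
  apply: (hd eta x c Y) => //; first by rewrite c1.
    move=> a b a0 ab bK; apply: (le_trans (hY a b _ ab (eKT' _ bK))); first exact: le_trans a0.
    by rewrite ler_wpM2r ?sqr_ge0// lerDl mulr_ge0 ?(bd_B HB) ?(bd_La HB).
  move=> u u0 uK; have := h 0 u; rewrite oppr_le0 => /(_ K0 u0 uK).
  rewrite incr_rescale mulr0 subr0 gx ?mulr_ge0 ?(ltW eta0)// => hu.
  have -> : x (eta * u) - x 0 - (eta * u) *: c = eta *: (eta^-1 *: (x (eta * u) - x 0) - u *: c).
    by rewrite scalerBr scalerA mulfV ?gt_eqF// scale1r scalerA.
  by rewrite enormZ gtr0_norm// ler_pM2l// (le_trans hu).
have := hd eta (fun u => x (- u)) (- c) (fun u => Y (- u)) eta0 etad' x1'.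
rewrite enormN c1 lexx oppr0 => /(_ erefl).
have hr : driven Phi (CY + La * B) (fun u => x (- u)) (fun u => Y (- u)) 0 (eta * K).
  by move=> a b a0 ab bK; apply: hY' => //; [exact: le_trans a0|exact: eKT'].
move=> /(_ hr Y0) hd'.
have := hd' _ (- t) j; rewrite oppr_ge0 lerNl => /(_ _ t0 Kt).
rewrite mulrN opprK scalerN scaleNr opprK; apply.
move=> u u0 uK; have := h (- u) 0; rewrite oppr_le0 lerN2 => /(_ uK u0 K0).
rewrite incr_rescale mulr0 sub0r opprK mulrN gx; last by rewrite oppr_le0 mulr_ge0// ltW.
move=> hu.
have -> : x (- (eta * u)) - x 0 - (eta * u) *: - c = - (eta *: (eta^-1 *: (x 0 - x (- (eta * u))) - u *: c)).
  rewrite scalerBr scalerA mulfV ?gt_eqF// scale1r scalerA.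
  by apply/rowP => i; rewrite !mxE; ring.
by rewrite enormN enormZ gtr0_norm// ler_pM2l// (le_trans hu).
Qed.

End MinimizersControl.

(** * Calculus in R^n *)

Section Derivatives.
Context {R : realType}.

(** The first order expansion, in the form in which derivatives are estimated and
  recovered from the increments of driven curves. *)
Lemma is_deriveP (f : R -> R) (t d : R) : is_derive t 1 f d <->
  forall e : R, 0 < e -> exists2 de : R, 0 < de & forall h, `|h| < de ->
    `|f (t + h) - f t - h * d| <= e * `|h|.
Proof.
have E h : h != 0 -> `|d - h^-1 *: (f (h *: (1 : R^o) + t) - f t)| * `|h| = `|f (t + h) - f t - h * d|.
  move=> h0; rewrite distrC -normrM mulrBl; congr `|_|.
  rewrite [h *: _]mulr1 (addrC h) -[_ *: _]/(_ * _) mulrAC mulVf// mul1r; ring.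
split=> [[df dv] e e0|hf].
  have : h^-1 *: (f (h *: (1 : R^o) + t) - f t) @[h --> 0^'] --> d by rewrite -dv.
  move=> /cvgrPdist_le /(_ e e0); rewrite near_withinE => /nbhs_ballP[/= de de0 hd].
  exists de => // h hde; have [->|h0] := eqVneq h 0.
    by rewrite addr0 subrr mul0r subrr normr0 mulr0.
  by rewrite -E// ler_wpM2r//; apply: hd => //; rewrite /ball /= sub0r normrN.
have cv : h^-1 *: (f (h *: (1 : R^o) + t) - f t) @[h --> 0^'] --> d.
  apply/cvgrPdist_le => e e0; have [de de0 hd] := hf e e0.
  rewrite near_withinE; near=> h => h0.
  have hp : 0 < `|h| by rewrite normr_gt0.
  rewrite -(ler_pM2r hp) E//; apply: hd; near: h.
  by apply: (@nbhs0_lt _ R^o).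
split; first by apply/cvg_ex; exists d.
exact/cvg_lim.
Unshelve. all: by end_near. Qed.

Lemma is_derive_continuous (f : R -> R) (t d : R) : is_derive t 1 f d -> {for t, continuous f}.
Proof. by move=> [df _]; apply: differentiable_continuous; apply/derivable1_diffP. Qed.

Context {n : nat}.
Local Notation vec := 'rV[R]_n.
Local Notation "''d_' j f" := (fun y => 'D_(delta_mx 0 j : vec) f y) (at level 10, j at level 2, f at level 9).

Lemma line_growth (f : vec -> R) (y v : vec) (s : R) :
  (fun h : R => h^-1 *: (f ((h *: (1 : R^o) + s) *: v + y) - f (s *: v + y))) =
  (fun h : R => h^-1 *: (f (h *: v + (s *: v + y)) - f (s *: v + y))).
Proof. by apply/funext => h; rewrite [h *: _]mulr1 scalerDl addrA. Qed.

Lemma is_derive_line (f : vec -> R) (y v : vec) (s d : R) :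
  is_derive (s *: v + y) v f d <-> is_derive s 1 (fun u => f (u *: v + y)) d.
Proof.
by split=> -[df dv]; split; move: df dv; rewrite /derivable /derive line_growth.
Qed.

Lemma mvt_line (f : vec -> R) (y v : vec) (a : R) :
  (forall s, `|s| <= `|a| -> derivable f (s *: v + y) v) ->
  exists2 s, `|s| <= `|a| & f (a *: v + y) - f y = a * 'D_v f (s *: v + y).
Proof.
move=> hd; pose F u := f (u *: v + y).
have dF (s : R) : `|s| <= `|a| -> is_derive s 1 F ('D_v f (s *: v + y)).
  by move=> sa; apply/is_derive_line/derivableP/hd.
have cF (b c : R) : (forall s, b <= s <= c -> `|s| <= `|a|) -> {within `[b, c], continuous F}.
  move=> bc; apply: derivable_within_continuous => s; rewrite in_itv /= => /bc/dF[]//.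
have [a0|/ltW a0] := leP 0 a.
  have sa s : 0 <= s <= a -> `|s| <= `|a| by move=> /andP[s0 sa]; rewrite !ger0_norm.
  have dF' (s : R) : s \in `]0, a[ -> is_derive s 1 F ('D_v f (s *: v + y)).
    by rewrite in_itv /= => /andP[/ltW s0 /ltW s1]; apply/dF/sa; rewrite s0.
  have [s] := MVT_segment a0 dF' (cF 0 a sa); rewrite in_itv /= => sI.
  by rewrite /F scale0r add0r subr0 => e; exists s; [exact: sa|rewrite e mulrC].
have sa s : a <= s <= 0 -> `|s| <= `|a| by move=> /andP[s0 sa]; rewrite !ler0_norm// lerN2.
have dF' (s : R) : s \in `]a, 0[ -> is_derive s 1 F ('D_v f (s *: v + y)).
  by rewrite in_itv /= => /andP[/ltW s0 /ltW s1]; apply/dF/sa; rewrite s0.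
have [s] := MVT_segment a0 dF' (cF a 0 sa); rewrite in_itv /= => sI.
rewrite /F scale0r add0r sub0r => e; exists s; first exact: sa.
by rewrite -opprB e mulrN opprK mulrC.
Qed.

(** Increments along the edges of a box, in the maximum norm. *)
Lemma grad_mvt (f : vec -> R) (y v : vec) :
  (forall z, `|z - y| <= `|v| -> forall j, derivable f z (delta_mx 0 j)) ->
  exists2 xi : 'I_n -> vec, forall j, `|xi j - y| <= `|v| &
    f (y + v) - f y = \sum_j v 0 j * 'd_j f (xi j).
Proof.
move=> hd; pose p (k : nat) : vec := \row_l (if (l < k)%N then y 0 l + v 0 l else y 0 l).
have pv (z : vec) : (forall l, z 0 l = y 0 l \/ `|z 0 l - y 0 l| <= `|v 0 l|) -> `|z - y| <= `|v|.
  move=> hz; apply: mnorm_le => // l; rewrite !mxE; case: (hz l) => [->|h]; first by rewrite subrr normr0.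
  by apply: (le_trans h); exact: coord_le_mnorm.
have ex (j : 'I_n) : exists2 xi : vec, `|xi - y| <= `|v| & f (p j.+1) - f (p j) = v 0 j * 'd_j f xi.
  have pS : p j.+1 = v 0 j *: delta_mx 0 j + p j.
    apply/rowP => l; rewrite !mxE eqxx /=; have [->|lj] := eqVneq l j.
      by rewrite ltnSn ltnn mulr1 addrC.
    by rewrite mulr0 add0r ltnS leq_eqVlt (negbTE (_ : nat_of_ord l != j)).
  have sb s : `|s| <= `|v 0 j| -> `|s *: delta_mx 0 j + p j - y| <= `|v|.
    move=> sv; apply: pv => l; rewrite !mxE eqxx /=; have [->|lj] := eqVneq l j.
      by right; rewrite ltnn mulr1 addrK.
    rewrite mulr0 add0r; case: ifP => _; [right|by left].
    by rewrite addrC addKr.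
  have [s sv e] := mvt_line (fun s sv => hd _ (sb s sv) j).
  by exists (s *: delta_mx 0 j + p j); [exact: sb|rewrite pS e].
have /boolp.choice[xi hxi] : forall j : 'I_n, exists xi : vec, `|xi - y| <= `|v| /\
    f (p j.+1) - f (p j) = v 0 j * 'd_j f xi by move=> j; have [xi] := ex j; exists xi.
exists xi => [j|]; first by case: (hxi j).
have -> : y + v = p n by apply/rowP => l; rewrite !mxE ltn_ord.
have {1}-> : y = p 0%N by apply/rowP => l; rewrite !mxE.
rewrite -(telescope_sumr (fun k => f (p k)))// big_mkord; apply: eq_bigr => j _.
by case: (hxi j).
Qed.

(** Continuous differentiability at a point, by partial derivatives, uniformly in
  the direction. *)
Definition C1at (f : vec -> R) y := forall e : R, 0 < e -> exists2 d : R, 0 < d &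
  forall z, `|z - y| <= d -> forall j, derivable f z (delta_mx 0 j) /\ `|'d_j f z - 'd_j f y| <= e.

Lemma C1_approx (f : vec -> R) y : C1at f y -> forall e : R, 0 < e -> exists2 d : R, 0 < d &
  forall v, `|v| <= d -> `|f (y + v) - f y - \sum_j v 0 j * 'd_j f y| <= e * `|v|.
Proof.
move=> hf e e0; have e1 : 0 < e / n.+1%:R by rewrite divr_gt0.
have [d d0 hd] := hf _ e1; exists d => // v vd.
have [|xi hxi ->] := @grad_mvt f y v.
  by move=> z zv j; case: (hd z (le_trans zv vd) j).
rewrite -sumrB; apply: (le_trans (ler_norm_sum _ _ _)).
apply: (@le_trans _ _ (\sum_(j < n) `|v| * (e / n.+1%:R))).
  apply: ler_sum => j _; rewrite -mulrBr normrM; apply: ler_pM; rewrite ?normr_ge0 ?coord_le_mnorm//.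
  by case: (hd (xi j) (le_trans (hxi j) vd) j).
rewrite sumr_const card_ord -mulrnAr -(mulr_natr (e / _)) mulrC ler_wpM2r//.
by rewrite mulrAC ler_pdivrMr ?ltr0n// ler_wpM2l ?ler_nat// ltW.
Qed.

Lemma C1at_near (f : vec -> R) y : (forall j, {for y, continuous ('d_j f)}) ->
  (\forall z \near y, forall j, derivable f z (delta_mx 0 j)) -> C1at f y.
Proof.
move=> cf df e e0.
have /nbhs_normP[d d0 hd] : \forall z \near y, forall j : 'I_n, `|'d_j f y - 'd_j f z| <= e.
  have hj (j : 'I_n) : \forall z \near y, `|'d_j f y - 'd_j f z| <= e.
    by have /cvgrPdist_le := cf j; exact.
  exact: filter_forall hj.
have /nbhs_normP[d' d'0 hd'] := df.
have m0 : 0 < Num.min d d' by rewrite lt_min; apply/andP.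
have h2 (x : R) : 0 < x -> x / 2 < x by move=> x0; lra.
exists (Num.min d d' / 2); first by rewrite divr_gt0.
move=> z zy j; have hz : `|y - z| < Num.min d d' by rewrite distrC (le_lt_trans zy)// h2.
move: hz; rewrite lt_min => /andP[z1 z2]; split; first exact: hd'.
by rewrite distrC; apply: hd.
Qed.

Lemma chain_curve (f : vec -> R) (u : R -> vec) (t : R) (du : vec) :
  C1at f (u t) -> (forall j, is_derive t 1 (fun s => u s 0 j) (du 0 j)) ->
  is_derive t 1 (f \o u) (\sum_j du 0 j * 'd_j f (u t)).
Proof.
move=> hf hu; apply/is_deriveP => e e0.
pose A := \sum_j `|'d_j f (u t)|; have A0 : 0 <= A by apply: sumr_ge0.
pose D := `|du| + 1; have D0 : 0 < D by rewrite ltr_wpDl.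
have e1 : 0 < e / 2 / D by rewrite !divr_gt0.
have [d1 d10 h1] := C1_approx hf e1.
pose e2 := Num.min 1 (e / 2 / (A + 1)).
have A1 : 0 < A + 1 by rewrite ltr_wpDl.
have e20 : 0 < e2 by rewrite lt_min ltr01 !divr_gt0.
have [d2 d20 h2] : exists2 d : R, 0 < d & forall j, j \in enum 'I_n -> forall h, `|h| < d ->
    `|u (t + h) 0 j - u t 0 j - h * du 0 j| <= e2 * `|h|.
  elim: (enum 'I_n) => [|j s [d d0 hd]]; first by exists 1.
  have /is_deriveP/(_ e2 e20)[d' d'0 hd'] := hu j.
  exists (Num.min d d'); first by rewrite lt_min d0.
  move=> j'; rewrite inE => js h; rewrite lt_min => /andP[hd1 hd2].
  by case/orP: js => [/eqP ->|js]; [exact: hd'|exact: hd].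
exists (Num.min d2 (d1 / D)); first by rewrite lt_min d20 divr_gt0.
move=> h; rewrite lt_min => /andP[hh1 hh2].
pose v := u (t + h) - u t.
have vb : `|v - h *: du| <= e2 * `|h|.
  apply: mnorm_le => [|j]; first by rewrite mulr_ge0// ltW.
  by rewrite !mxE; apply: h2 => //; rewrite mem_enum.
have vD : `|v| <= D * `|h|.
  rewrite -(subrK (h *: du) v); apply: (le_trans (ler_normD _ _)).
  rewrite /D mulrDl mul1r addrC; apply: lerD; first by rewrite normrZ mulrC.
  by apply: (le_trans vb); rewrite ler_piMl// ge_min lexx.
have vd1 : `|v| <= d1.
  by apply: (le_trans vD); rewrite mulrC -ler_pdivlMr// ltW.
have -> : (f \o u) (t + h) - (f \o u) t - h * \sum_j du 0 j * 'd_j f (u t) =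
  (f (u t + v) - f (u t) - \sum_j v 0 j * 'd_j f (u t)) + \sum_j (v - h *: du) 0 j * 'd_j f (u t).
  rewrite /= [u t + v]addrC subrK -[RHS]addrA; congr (_ + _); rewrite -sumrN -big_split mulr_sumr -sumrN.
  by apply: eq_bigr => j _ /=; rewrite !mxE; ring.
apply: (le_trans (ler_normD _ _)); rewrite (splitr e) mulrDl; apply: lerD.
  apply: (le_trans (h1 v vd1)); rewrite mulrAC ler_pdivrMr// -[leRHS]mulrA.
  by rewrite ler_wpM2l ?divr_ge0 ?(ltW e0)// mulrC.
apply: (le_trans (ler_norm_sum _ _ _)); apply: (@le_trans _ _ (e2 * `|h| * A)).
  rewrite /A mulr_sumr; apply: ler_sum => j _; rewrite normrM ler_wpM2r//.
  by apply: le_trans vb; exact: coord_le_mnorm.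
rewrite mulrAC ler_wpM2r//; apply: (@le_trans _ _ (e / 2 / (A + 1) * A)).
  by rewrite ler_wpM2r// ge_min lexx orbT.
by rewrite mulrAC ler_pdivrMr// ler_wpM2l// ?lerDl// divr_ge0// ltW.
Qed.

End Derivatives.

(** ** Functions of class C^k *)

Section CkRules.
Context {R : realType} {n : nat}.
Local Notation vec := 'rV[R]_n.
Local Notation e_ j := (delta_mx 0 j : vec).
Implicit Types (U : set vec) (f g : vec -> R).

Lemma Ck_cont (V : normedModType R) k U (f : vec -> V) : Ck k U f -> continuous_on U f.
Proof. by case: k => [|k] []. Qed.

Lemma CkW (V : normedModType R) k U (f : vec -> V) : Ck k.+1 U f -> Ck k U f.
Proof.
elim: k f => [|k IH] f; first by move=> [].
move=> [cf hf]; split=> // j; have [df ckf] := hf j; split=> //; exact: IH.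
Qed.

Lemma smooth_onS (V : normedModType R) U (f : vec -> V) j : smooth_on U f ->
  (forall x, U x -> derivable f x (e_ j)) /\ smooth_on U (fun x => 'D_(e_ j) f x).
Proof. by move=> hf; split=> [|k]; [case: (hf 1%N) => _ /(_ j)[]|case: (hf k.+1) => _ /(_ j)[]]. Qed.

Lemma Ck_ext (V : normedModType R) k U (f g : vec -> V) :
  (forall x, U x -> \near x, f x = g x) -> Ck k U f -> Ck k U g.
Proof.
have ce (f' g' : vec -> V) : (forall x, U x -> \near x, f' x = g' x) ->
    continuous_on U f' -> continuous_on U g'.
  move=> fg cf x Ux; have h := fg x Ux.
  have e : f' x = g' x by exact: (nbhs_singleton h).
  rewrite /prop_for /continuous_at -e; apply: cvg_trans (cf x Ux).
  have h' : \near x, g' x = f' x by apply: filterS h => z ->.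
  by first [exact: (near_eq_cvg h) | exact: (near_eq_cvg h')].
elim: k f g => [|k IH] f g fg; first by move=> [cf _]; split=> //; exact: ce cf.
move=> [cf hf]; split; first exact: ce cf.
move=> j; have [df ckf] := hf j; split=> [x Ux|].
  exact: near_eq_derivable (fg x Ux) (df x Ux).
apply: IH ckf => x Ux; have := nbhs_interior (fg x Ux).
by apply: filterS => z hz; exact: near_eq_derive hz.
Qed.

Lemma Ck_local (V : normedModType R) k U (f : vec -> V) :
  (forall x, U x -> exists2 U', U' x & Ck k U' f) -> Ck k U f.
Proof.
elim: k f => [|k IH] f h.
  by split=> // x Ux; have [U' U'x [cf _]] := h x Ux; exact: cf.
split=> [x Ux|j]; first by have [U' U'x [cf _]] := h x Ux; exact: cf.
split=> [x Ux|]; first by have [U' U'x [_ /(_ j)[df _]]] := h x Ux; exact: df.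
by apply: IH => x Ux; have [U' U'x [_ /(_ j)[_ ckf]]] := h x Ux; exists U'.
Qed.

Lemma Ck_add k U f g : open U -> Ck k U f -> Ck k U g -> Ck k U (fun x => f x + g x).
Proof.
move=> oU; elim: k f g => [|k IH] f g.
  by move=> [cf _] [cg _]; split=> // x Ux; apply: continuousD; [exact: cf|exact: cg].
move=> [cf hf] [cg hg]; split=> [x Ux|j].
  by apply: continuousD; [exact: cf|exact: cg].
have [df kf] := hf j; have [dg kg] := hg j; split=> [x Ux|].
  by apply: derivableD; [exact: df|exact: dg].
apply: Ck_ext (IH _ _ kf kg) => x Ux; have := open_nbhs_nbhs (conj oU Ux).
by apply: filterS => z Uz; rewrite -deriveD; [|exact: df|exact: dg].
Qed.

Lemma Ck_mul k U f g : open U -> Ck k U f -> Ck k U g -> Ck k U (fun x => f x * g x).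
Proof.
move=> oU; elim: k f g => [|k IH] f g.
  by move=> [cf _] [cg _]; split=> // x Ux; apply: continuousM; [exact: cf|exact: cg].
move=> hf hg; have [cf hf'] := hf; have [cg hg'] := hg; split=> [x Ux|j].
  by apply: continuousM; [exact: cf|exact: cg].
have [df kf] := hf' j; have [dg kg] := hg' j; split=> [x Ux|].
  by apply: derivableM; [exact: df|exact: dg].
have h1 := IH _ _ (CkW hf) kg; have h2 := IH _ _ (CkW hg) kf.
apply: Ck_ext (Ck_add oU h1 h2) => x Ux; have := open_nbhs_nbhs (conj oU Ux).
by apply: filterS => z Uz; exact: esym (deriveM (df z Uz) (dg z Uz)).
Qed.

Lemma Ck_cst k U (a : R) : Ck k U (fun=> a). Proof. exact: smooth_on_cst. Qed.

Lemma Ck_sum k U (I : Type) (s : seq I) (F : I -> vec -> R) : open U ->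
  (forall i, Ck k U (F i)) -> Ck k U (fun x => \sum_(i <- s) F i x).
Proof.
move=> oU hF; elim: s => [|i s IH].
  by under eq_fun do rewrite big_nil; exact: Ck_cst.
by under eq_fun do rewrite big_cons; exact: Ck_add.
Qed.

Lemma smooth_sum U (I : Type) (s : seq I) (F : I -> vec -> R) : open U ->
  (forall i, smooth_on U (F i)) -> smooth_on U (fun x => \sum_(i <- s) F i x).
Proof. by move=> oU hF k; apply: Ck_sum => // i; exact: hF. Qed.

Lemma smooth_mul U f g : open U -> smooth_on U f -> smooth_on U g -> smooth_on U (fun x => f x * g x).
Proof. by move=> oU hf hg k; exact: Ck_mul. Qed.

Lemma smooth_add U f g : open U -> smooth_on U f -> smooth_on U g -> smooth_on U (fun x => f x + g x).
Proof. by move=> oU hf hg k; exact: Ck_add. Qed.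

Lemma derive_coord (h : vec -> vec) x (v : vec) l : derivable h x v ->
  derivable (fun y => h y 0 l) x v /\ 'D_v (fun y => h y 0 l) x = ('D_v h x) 0 l.
Proof.
by move=> dh; split; [apply: (derivable_mxP _ _ _).1 dh 0 l|rewrite derive_mx// mxE].
Qed.

Lemma coord_cont (l : 'I_n) : continuous (fun y : vec => y 0 l).
Proof. exact: coord_continuous. Qed.

Lemma Ck_coord k U (h : vec -> vec) l : open U -> Ck k U h -> Ck k U (fun x => h x 0 l).
Proof.
move=> oU; have cc (f : vec -> vec) : continuous_on U f -> continuous_on U (fun x => f x 0 l).
  by move=> cf x Ux; apply: (@continuous_comp _ _ _ f (fun y : vec => y 0 l)); [exact: cf|exact: coord_cont].
elim: k h => [|k IH] h; first by move=> [ch _]; split=> //; exact: cc.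
move=> [ch hh]; split=> [|j]; first exact: cc.
have [dh kh] := hh j; split=> [x Ux|]; first by have [] := derive_coord l (dh x Ux).
apply: Ck_ext (IH _ kh) => x Ux; have := open_nbhs_nbhs (conj oU Ux).
by apply: filterS => z Uz; have [_ ->] := derive_coord l (dh z Uz).
Qed.

Lemma Ck_C1at k U f x : open U -> Ck k.+1 U f -> U x -> C1at f x.
Proof.
move=> oU [cf hf] Ux; apply: C1at_near => [j|]; first by have [_ /Ck_cont] := hf j; exact.
have := open_nbhs_nbhs (conj oU Ux); apply: filterS => z Uz j.
by have [df _] := hf j; exact: df.
Qed.

Lemma is_derive_at_line (f : vec -> R) x v (d : R) :
  is_derive x v f d <-> is_derive (0 : R) 1 (fun s => f (s *: v + x)) d.
Proof. by rewrite -is_derive_line scale0r add0r. Qed.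

Lemma derive_comp (G : vec -> R) (h : vec -> vec) x (v : vec) : C1at G (h x) -> derivable h x v ->
  is_derive x v (G \o h) (\sum_l ('D_v h x) 0 l * 'D_(e_ l) G (h x)).
Proof.
move=> hG dh; apply/is_derive_at_line.
have -> : (fun s => (G \o h) (s *: v + x)) = G \o (fun s : R => h (s *: v + x)) by [].
have := @chain_curve R n G (fun s : R => h (s *: v + x)) 0 ('D_v h x).
rewrite scale0r add0r; apply=> // j.
apply/(is_derive_at_line (fun y => h y 0 j)).
have [d1 d2] := derive_coord j dh; rewrite -d2; exact/derivableP.
Qed.

Lemma Ck_comp k U U' (G : vec -> R) (h : vec -> vec) : open U -> open U' ->
  (forall x, U x -> U' (h x)) -> Ck k U h -> Ck k U' G -> Ck k U (G \o h).
Proof.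
move=> oU oU' UU'; elim: k G => [|k IH] G hh hG.
  split=> // x Ux; apply: continuous_comp; first exact: (Ck_cont hh).
  by apply: (Ck_cont hG); exact: UU'.
split=> [x Ux|j].
  apply: continuous_comp; first exact: (Ck_cont hh).
  by apply: (Ck_cont hG); exact: UU'.
have hh' := CkW hh; move: (hh) (hG) => [_ /(_ j)[dh kh]] [_ hG'].
have dc x : U x -> is_derive x (e_ j) (G \o h) (\sum_l ('D_(e_ j) h x) 0 l * 'D_(e_ l) G (h x)).
  by move=> Ux; apply: derive_comp; [apply: (Ck_C1at oU' hG); exact: UU'|exact: dh].
split=> [x /dc[]//|].
suff hs : Ck k U (fun x => \sum_l ('D_(e_ j) h x) 0 l * 'D_(e_ l) G (h x)).
  apply: Ck_ext hs => x Ux; have := open_nbhs_nbhs (conj oU Ux).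
  by apply: filterS => z /dc[_ ->].
apply: Ck_sum => // l; apply: Ck_mul => //; first exact: Ck_coord.
by have [_ kG] := hG' l; exact: (IH (fun y => 'D_(e_ l) G y)).
Qed.

Lemma Ck_comp1 k m U f (rho : nat -> R -> R) : open U ->
  (forall m (t : R), is_derive t 1 (rho m) (rho m.+1 t)) -> Ck k U f -> Ck k U (rho m \o f).
Proof.
move=> oU hr; elim: k m f => [|k IH] m f hf.
  split=> // x Ux; apply: continuous_comp; first exact: (Ck_cont hf).
  exact: is_derive_continuous (hr m _).
split=> [x Ux|j].
  apply: continuous_comp; first exact: (Ck_cont hf).
  exact: is_derive_continuous (hr m _).
move: (hf) => [_ /(_ j)[df kf]].
have dc x : U x -> is_derive x (e_ j) (rho m \o f) (rho m.+1 (f x) * 'D_(e_ j) f x).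
  move=> Ux; apply/is_derive_at_line.
  have -> : (fun s => (rho m \o f) (s *: e_ j + x)) = rho m \o (fun s : R => f (s *: e_ j + x)) by [].
  have h1 := @is_derive1_comp R (rho m) (fun s : R => f (s *: e_ j + x)) 0.
  have := h1 _ _ (hr m _) ((is_derive_at_line _ _ _ _).1 (derivableP (df x Ux))).
  by rewrite scale0r add0r mulrC.
split=> [x /dc[]//|].
suff hs : Ck k U (fun x => (rho m.+1 \o f) x * 'D_(e_ j) f x).
  apply: Ck_ext hs => x Ux; have := open_nbhs_nbhs (conj oU Ux).
  by apply: filterS => z /dc[_ ->].
by apply: Ck_mul => //; apply: IH; exact: CkW.
Qed.

Lemma Ck_inv k U f : open U -> (forall x, U x -> f x != 0) -> Ck k U f -> Ck k U (fun x => (f x)^-1).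
Proof.
move=> oU f0; elim: k => [|k IH] hf.
  by split=> // x Ux; apply: continuousV; [exact: f0|exact: (Ck_cont hf)].
split=> [x Ux|j]; first by apply: continuousV; [exact: f0|exact: (Ck_cont hf)].
have hi := IH (CkW hf); move: (hf) => [_ /(_ j)[df kf]].
split=> [x Ux|]; first by apply: derivableV; [exact: f0|exact: df].
have hs : Ck k U (fun x => (-1 * ((f x)^-1 * (f x)^-1)) * 'D_(e_ j) f x).
  by do ?apply: Ck_mul => //; exact: Ck_cst.
apply: Ck_ext hs => x Ux; have := open_nbhs_nbhs (conj oU Ux).
apply: filterS => z Uz; rewrite deriveV; [|exact: f0|exact: df].
by rewrite mulN1r -expr2 exprVn.
Qed.

Lemma smooth_coord U (l : 'I_n) : open U -> smooth_on U (fun y : vec => y 0 l).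
Proof. by move=> oU k; apply: (Ck_coord (h := id)) => //; exact: smooth_on_id. Qed.

End CkRules.

(** ** Smooth functions with bounded derivatives *)

Section BoundedSmooth.
Context {R : realType} {n : nat}.
Local Notation vec := 'rV[R]_n.
Local Notation e_ j := (delta_mx 0 j : vec).
Implicit Types (f g : vec -> R).

Fixpoint Bk k f : Prop := (exists C : R, forall y, `|f y| <= C) /\
  if k is k'.+1 then forall j, (forall y, derivable f y (e_ j)) /\ Bk k' (fun y => 'D_(e_ j) f y)
  else True.

(** Smooth functions on R^n all of whose partial derivatives are bounded. A smooth
  compactly supported function is one; contrary to compact supports, the class is
  stable under the averages of Hadamard's lemma. *)
Definition Bsm f := forall k, Bk k f.

Lemma Bsm_d f j : Bsm f -> Bsm (fun y => 'D_(e_ j) f y).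
Proof. by move=> h k; have [_ /(_ j)[]] := h k.+1. Qed.

Lemma Bsm_bound f : Bsm f -> exists2 C : R, 0 <= C & forall y, `|f y| <= C.
Proof.
move=> h; have [[C hC] _] := h 0%N; exists (Num.max 0 C); first by rewrite le_max lexx.
by move=> y; rewrite le_max hC orbT.
Qed.

Lemma Bsm_derivable f y j : Bsm f -> derivable f y (e_ j).
Proof. by move=> h; have [_ /(_ j)[]] := h 1%N. Qed.

Lemma Bsm_dbound f : Bsm f -> exists2 C : R, 0 <= C & forall y j, `|'D_(e_ j) f y| <= C.
Proof.
move=> h.
have [C C0 hC] := @seq_bound R 'I_n (enum 'I_n) (fun j C => forall y, `|'D_(e_ j) f y| <= C)
  (fun j c c' cc hc y => le_trans (hc y) cc) (fun j => Bsm_bound (Bsm_d j h)).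
by exists C => // y j; apply: hC; rewrite mem_enum.
Qed.

Lemma Bsm_lip f : Bsm f -> exists2 C : R, 0 <= C & forall y v, `|f (y + v) - f y| <= C * `|v|.
Proof.
move=> h; have [C C0 hC] := Bsm_dbound h.
exists (n%:R * C) => [|y v]; first by rewrite mulr_ge0.
have [|xi _ ->] := @grad_mvt R n f y v; first by move=> z _ j; exact: Bsm_derivable.
apply: (le_trans (ler_norm_sum _ _ _)); apply: (@le_trans _ _ (\sum_(j < n) `|v| * C)).
  by apply: ler_sum => j _; rewrite normrM; apply: ler_pM; rewrite ?normr_ge0 ?coord_le_mnorm.
by rewrite sumr_const card_ord -[leLHS]mulr_natl mulrA mulrAC.
Qed.

Lemma Bsm_taylor f : Bsm f -> exists2 C : R, 0 <= C & forall y v,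
  `|f (y + v) - f y - \sum_j v 0 j * 'D_(e_ j) f y| <= C * `|v| ^+ 2.
Proof.
move=> h.
have [C C0 hC] := @seq_bound R 'I_n (enum 'I_n) (fun j C => forall y v, `|'D_(e_ j) f (y + v) - 'D_(e_ j) f y| <= C * `|v|)
  (fun j c c' cc hc y v => le_trans (hc y v) (ler_wpM2r (normr_ge0 _) cc)) (fun j => Bsm_lip (Bsm_d j h)).
exists (n%:R * C) => [|y v]; first by rewrite mulr_ge0.
have [|xi hxi ->] := @grad_mvt R n f y v; first by move=> z _ j; exact: Bsm_derivable.
rewrite -sumrB; apply: (le_trans (ler_norm_sum _ _ _)).
apply: (@le_trans _ _ (\sum_(j < n) `|v| * (C * `|v|))).
  apply: ler_sum => j _; rewrite -mulrBr normrM; apply: ler_pM; rewrite ?normr_ge0 ?coord_le_mnorm//.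
  have := hC j _ y (xi j - y); rewrite mem_enum [y + _]addrC subrK => /(_ isT) /le_trans; apply.
  by rewrite ler_wpM2l.
rewrite sumr_const card_ord -[X in X <= _]mulr_natl expr2 le_eqVlt; apply/orP; left; apply/eqP; ring.
Qed.

Lemma Bsm_coind (P : (vec -> R) -> Prop) :
  (forall f, P f -> (exists C : R, forall y, `|f y| <= C) /\ forall j, (forall y, derivable f y (e_ j)) /\
     P (fun y => 'D_(e_ j) f y)) -> forall f, P f -> Bsm f.
Proof.
move=> hP f Pf k; elim: k f Pf => [|k IH] f Pf; have [b hd] := hP f Pf; split=> // j.
by have [d pd] := hd j; split=> //; exact: IH.
Qed.

Lemma Bsm_cst (a : R) : Bsm (fun=> a).
Proof.
apply: (@Bsm_coind (fun f => exists a : R, f = fun=> a)); last by exists a.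
move=> _ [b ->]; split; first by exists `|b|.
move=> j; split=> [y|]; first exact: derivable_cst.
by exists 0; apply/funext => y; exact: derive_cst.
Qed.

Lemma Bsm_add f g : Bsm f -> Bsm g -> Bsm (fun y => f y + g y).
Proof.
move=> hf hg; apply: (@Bsm_coind (fun F => exists f g, [/\ Bsm f, Bsm g & F = fun y => f y + g y])).
  move=> _ [a [b [ha hb ->]]]; split.
    have [C _ hC] := Bsm_bound ha; have [D _ hD] := Bsm_bound hb.
    by exists (C + D) => y; apply: (le_trans (ler_normD _ _)); exact: lerD.
  move=> j; split=> [y|]; first by apply: derivableD; exact: Bsm_derivable.
  exists (fun y => 'D_(e_ j) a y), (fun y => 'D_(e_ j) b y); split; [exact: Bsm_d|exact: Bsm_d|].
  by apply/funext => y; apply: deriveD; exact: Bsm_derivable.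
by exists f, g.
Qed.

Lemma Bsm_sum (I : Type) (s : seq I) (F : I -> vec -> R) :
  (forall i, Bsm (F i)) -> Bsm (fun y => \sum_(i <- s) F i y).
Proof.
move=> hF; elim: s => [|i s IH].
  by have -> : (fun y => \sum_(i <- [::]) F i y) = fun=> 0 by [apply/funext => y; rewrite big_nil]; exact: Bsm_cst.
have -> : (fun y => \sum_(j <- i :: s) F j y) = fun y => F i y + \sum_(j <- s) F j y.
  by apply/funext => y; rewrite big_cons.
exact: Bsm_add.
Qed.

Lemma Bsm_mul f g : Bsm f -> Bsm g -> Bsm (fun y => f y * g y).
Proof.
move=> hf hg k; elim: k f g hf hg => [|k IH] f g hf hg; (split;
  [have [C _ hC] := Bsm_bound hf; have [D _ hD] := Bsm_bound hg;
   by exists (C * D) => y; rewrite normrM; apply: ler_pM|]) => // j.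
split=> [y|]; first by apply: derivableM; exact: Bsm_derivable.
have -> : (fun y => 'D_(e_ j) (fun z => f z * g z) y) =
    fun y => f y * 'D_(e_ j) g y + g y * 'D_(e_ j) f y.
  by apply/funext => y; apply: deriveM; exact: Bsm_derivable.
have Bkadd k' h1 h2 : Bk k' h1 -> Bk k' h2 -> Bk k' (fun y => h1 y + h2 y).
  elim: k' h1 h2 => [|k' IHk] h1 h2 b1 b2; (split;
    [have [[C hC] _] := b1; have [[D hD] _] := b2;
     by exists (C + D) => y; apply: (le_trans (ler_normD _ _)); exact: lerD|]) => // i.
  have [_ /(_ i)[d1 p1]] := b1; have [_ /(_ i)[d2 p2]] := b2.
  split=> [y|]; first by apply: derivableD.
  have -> : (fun y => 'D_(e_ i) (fun z => h1 z + h2 z) y) =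
      fun y => 'D_(e_ i) h1 y + 'D_(e_ i) h2 y by apply/funext => y; apply: deriveD.
  exact: IHk.
by apply: Bkadd; apply: IH => //; exact: Bsm_d.
Qed.

Lemma dist_continuous (c : vec) : continuous (fun y : vec => `|y - c|).
Proof.
move=> y; apply: (@continuous_comp _ _ _ (fun y : vec => y - c) (fun z : vec => `|z|)).
  by apply: continuousB; [exact: cvg_id|exact: cst_continuous].
exact: norm_continuous.
Qed.

Lemma mball_compact (c : vec) (d : R) : compact [set y : vec | `|y - c| <= d].
Proof.
apply: bounded_closed_compact.
  exists (d + `|c|); split; first exact: num_real.
  move=> x dx y /= yd; apply: ltW; apply: le_lt_trans dx.
  by rewrite -{1}(subrK c y); apply: (le_trans (ler_normD _ _)); rewrite lerD2r.
rewrite [X in closed X](_ : _ = (fun y : vec => `|y - c|) @^-1` [set x : R | x <= d])//.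
apply: closed_comp; last exact: closed_le.
by move=> y _; exact: dist_continuous.
Qed.

Lemma support_bounded f (c : vec) (d : R) : continuous_on setT f ->
  (forall y, d < `|y - c| -> f y = 0) -> exists C : R, forall y, `|f y| <= C.
Proof.
move=> cf sf; pose K := [set y : vec | `|y - c| <= d].
have cK : compact K by exact: mball_compact.
have : compact (f @` K).
  apply: continuous_compact => //; apply: continuous_subspaceT => y; exact: cf.
move=> /compact_bounded[C [_ hC]].
exists (Num.max 0 (C + 1)) => y; have [yd|yd] := ltP d `|y - c|.
  by rewrite sf// normr0 le_max lexx.
by rewrite le_max; apply/orP; right; apply: hC; [rewrite ltrDl|exists y].
Qed.

Lemma smooth_support_Bsm f (c : vec) (d : R) : smooth_on setT f ->
  (forall y, d < `|y - c| -> f y = 0) -> Bsm f.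
Proof.
move=> hf sf; apply: (@Bsm_coind (fun f => smooth_on setT f /\ forall y, d < `|y - c| -> f y = 0)) => //.
move=> {hf sf}f [hf sf]; split; first by apply: support_bounded sf; exact: (Ck_cont (hf 0%N)).
move=> j; have [dj sj] := smooth_onS j hf; split=> [y|]; first exact: dj.
split=> // y yd; have nz : \near y, f y = cst 0 y.
  have op : open [set y : vec | d < `|y - c|].
    have -> : [set y : vec | d < `|y - c|] = (fun y : vec => `|y - c|) @^-1` [set x : R | d < x] by [].
    apply: open_comp; last exact: open_gt.
    by move=> z _; exact: dist_continuous.
  by have := open_nbhs_nbhs (conj op yd); apply: filterS => z /sf.
by rewrite (near_eq_derive _ nz) derive_cst.
Qed.

(** ** Limits of families with uniformly bounded derivatives *)

Section UniformLimits.
Variables (T : Type) (U : set_system T) (UU : UltraFilter U).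

Fixpoint UBk k (F : T -> vec -> R) : Prop := (exists C : R, forall m y, `|F m y| <= C) /\
  if k is k'.+1 then forall j, (forall m y, derivable (F m) y (e_ j)) /\
    UBk k' (fun m y => 'D_(e_ j) (F m) y)
  else True.

Definition ulim (F : T -> vec -> R) : vec -> R := fun y => lim (F m y @[m --> U]).

Lemma ulimP (F : T -> vec -> R) (C : R) : (forall m y, `|F m y| <= C) ->
  forall y e, 0 < e -> \forall m \near U, `|F m y - ulim F y| <= e.
Proof.
move=> hF y e e0.
have /cvgrPdist_le/(_ e e0) : cvg (F m y @[m --> U]).
  by apply: (ultra_cvg (K := C) UU); have FU : Filter U by [apply: PFU]; apply: nearW => m.
by have FU : Filter U by [apply: PFU]; apply: filterS => m; rewrite distrC.
Qed.

(** The uniform bound on second derivatives makes the first order expansions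
  uniform along the family, so that they pass to the limit; the limits of the
  derivatives form a family of the same kind. *)
Lemma ulim_Bsm (F : T -> vec -> R) : (forall k, UBk k F) -> Bsm (ulim F).
Proof.
move=> hF; have FU : Filter U by apply: PFU.
apply: (@Bsm_coind (fun f => exists2 F : T -> vec -> R, (forall k, UBk k F) & f = ulim F)); last by exists F.
move=> _ {hF} [{}F hF ->]; have [[C hC] _] := hF 0%N; split.
  exists C => y; apply/ler_addgt0Pr => e e0.
  have [m hm] := @filter_ex _ U (PFU UU) _ (ulimP hC y e0).
  rewrite -(subrK (F m y) (ulim F y)); apply: (le_trans (ler_normD _ _)).
  by rewrite addrC distrC; exact: lerD.
move=> j; pose dF m y := 'D_(e_ j) (F m) y.
have dk k : UBk k dF by have [_ /(_ j)[]] := hF k.+1.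
have dd m y : derivable (F m) y (e_ j) by have [_ /(_ j)[h _]] := hF 1%N; exact: h.
have [[D hD] _] := dk 0%N; have [_ /(_ j)[ddd [[E hE] _]]] := dk 1%N.
have E0 (y : vec) (m : T) : 0 <= E by have := hE m y; apply: le_trans; exact: normr_ge0.
have est m y s : `|F m (s *: e_ j + y) - F m y - s * dF m y| <= E * `|s| ^+ 2.
  have [s' s's ->] := @mvt_line R n (F m) y (e_ j) s (fun u _ => dd m _).
  rewrite -mulrBr normrM.
  have [s'' ss'' ->] := @mvt_line R n (dF m) y (e_ j) s' (fun u _ => ddd m _).
  apply: (@le_trans _ _ (`|s| * (`|s| * E))); last by rewrite mulrA -expr2 mulrC.
  by rewrite ler_wpM2l// normrM; apply: ler_pM.
have isd y : is_derive y (e_ j) (ulim F) (ulim dF y).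
  apply/is_derive_at_line/is_deriveP => e e0.
  have [m0 _] := @filter_ex _ U (PFU UU) _ (ulimP hC y e0).
  have E1 : 0 < E + 1 by exact: ltr_wpDl (E0 y m0) ltr01.
  exists (e / (E + 1)); first by rewrite divr_gt0.
  move=> h hh; rewrite add0r scale0r add0r.
  have h0 := normr_ge0 h.
  apply: (@le_trans _ _ (E * `|h| ^+ 2)); last first.
    rewrite expr2 mulrA ler_wpM2r//.
    have : `|h| * (E + 1) <= e by rewrite -ler_pdivlMr// ltW.
    by apply: le_trans; rewrite mulrC ler_wpM2l// lerDl.
  apply/ler_addgt0Pr => e' e'0.
  have e3 : 0 < e' / (2 + `|h|) by rewrite divr_gt0//; exact: ltr_wpDr h0 (ltr0n _ 2).
  have [m [h1 h2 h3]] : exists m, [/\ `|F m (h *: e_ j + y) - ulim F (h *: e_ j + y)| <= e' / (2 + `|h|),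
     `|F m y - ulim F y| <= e' / (2 + `|h|) & `|dF m y - ulim dF y| <= e' / (2 + `|h|)].
    apply: (@filter_ex _ U (PFU UU)).
    apply: filterS3 (ulimP hC (h *: e_ j + y) e3) (ulimP hC y e3) (ulimP hD y e3) => m a1 a2 a3; by split.
  have -> : ulim F (h *: e_ j + y) - ulim F y - h * ulim dF y =
    (F m (h *: e_ j + y) - F m y - h * dF m y) +
    (- (F m (h *: e_ j + y) - ulim F (h *: e_ j + y)) + (F m y - ulim F y) + h * (dF m y - ulim dF y)) by ring.
  apply: (le_trans (ler_normD _ _)); apply: lerD; first exact: est.
  apply: (le_trans (ler_normD _ _)); apply: (le_trans (lerD (ler_normD _ _) (lexx _))).
  rewrite normrN normrM; apply: (le_trans (lerD (lerD h1 h2) (ler_wpM2l h0 h3))).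
  have h20 : 0 < 2 + `|h| by exact: ltr_wpDr h0 (ltr0n _ 2).
  by rewrite -mulr2n -[_ *+ 2]mulr_natl -mulrDl mulrC divfK ?gt_eqF.
split=> [y|]; first by case: (isd y).
by exists dF => //; apply/funext => y; case: (isd y).
Qed.

End UniformLimits.

Lemma derive_dilate f (y c : vec) (a : R) j : (forall z, derivable f z (e_ j)) ->
  is_derive y (e_ j) (fun z => f (a *: (z - c) + c)) (a * 'D_(e_ j) f (a *: (y - c) + c)).
Proof.
move=> df; apply/is_derive_at_line.
have -> : (fun s : R => f (a *: (s *: e_ j + y - c) + c)) =
   (fun u => f (u *: e_ j + (a *: (y - c) + c))) \o (fun s => a * s).
  by apply/funext => s /=; rewrite -addrA scalerDr scalerA addrA.
have h1 : is_derive (a * 0) (1 : R) (fun u => f (u *: e_ j + (a *: (y - c) + c))) ('D_(e_ j) f (a *: (y - c) + c)).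
  by rewrite mulr0; apply/is_derive_at_line/derivableP.
have h2 : is_derive (0 : R) (1 : R) (fun s : R => a * s) a.
  apply/is_deriveP => e e0; exists 1 => // h _.
  by rewrite add0r mulr0 subr0 mulrC subrr normr0 mulr_ge0// ltW.
by rewrite mulrC; exact: (is_derive1_comp h1 h2).
Qed.

(** Hadamard's lemma: a function vanishing at [c] is a combination of the
  coordinates centered at [c], with the averages of the partial derivatives
  along the segments from [c] as coefficients; the averages are limits of
  Riemann sums. *)
Lemma hadamard f (c : vec) : Bsm f -> exists2 G : 'I_n -> vec -> R,
  forall l, Bsm (G l) /\ G l c = 'D_(e_ l) f c &
  forall y, f y - f c = \sum_l (y - c) 0 l * G l y.
Proof.
move=> hf; have [U UU Uoo] := ultra_oo; have FU : Filter U by apply: PFU.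
pose a (m k : nat) : R := k%:R / m.+1%:R.
have a01 m k : (k <= m.+1)%N -> 0 <= a m k <= 1.
  by move=> km; rewrite divr_ge0//= ler_pdivrMr// mul1r ler_nat.
pose RS p (g : vec -> R) m y := m.+1%:R^-1 * \sum_(k < m.+1) (a m k ^+ p * g (a m k *: (y - c) + c)).
have RSb p g C : (forall y, `|g y| <= C) -> forall m y, `|RS p g m y| <= C.
  move=> gC m y; have m0 : 0 < (m.+1%:R : R) by [].
  rewrite /RS normrM gtr0_norm ?invr_gt0// mulrC ler_pdivrMr//.
  apply: (le_trans (ler_norm_sum _ _ _)); apply: (@le_trans _ _ (\sum_(k < m.+1) C)).
    apply: ler_sum => k _; rewrite normrM -[leRHS]mul1r; apply: ler_pM => //.
    have /andP[a0 a1] := a01 m k (ltnW (ltn_ord k)).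
    by rewrite ger0_norm ?exprn_ge0// exprn_ile1.
  by rewrite sumr_const card_ord mulr_natr.
have RSd p g j m y : Bsm g -> is_derive y (e_ j) (RS p g m) (RS p.+1 (fun z => 'D_(e_ j) g z) m y).
  move=> hg.
  have hk (k : 'I_m.+1) : is_derive y (e_ j) (fun y => a m k ^+ p * g (a m k *: (y - c) + c))
      (a m k ^+ p * (a m k * 'D_(e_ j) g (a m k *: (y - c) + c))).
    have [d1 d2] := derive_dilate y c (a m k) (fun z => @Bsm_derivable g z j hg).
    have hc : is_derive y (e_ j) (cst (a m k ^+ p) : vec -> R) 0 by exact: is_derive_cst.
    have [c1 c2] := hc; apply: DeriveDef; first exact: (derivableM c1 d1).
    have e1 := deriveM c1 d1; rewrite c2 d2 scaler0 addr0 in e1; exact: e1.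
  have hs : is_derive y (e_ j) (fun y => \sum_(k < m.+1) (a m k ^+ p * g (a m k *: (y - c) + c)))
      (\sum_(k < m.+1) (a m k ^+ p * (a m k * 'D_(e_ j) g (a m k *: (y - c) + c)))).
    rewrite -fct_sumE; exact: is_derive_sum.
  have [d1 d2] := hs.
  apply: DeriveDef.
    have := @derivableZ _ _ _ _ m.+1%:R^-1 _ _ d1; exact.
  have := deriveZ m.+1%:R^-1 d1; rewrite d2 => e1.
  transitivity (m.+1%:R^-1 * \sum_(k < m.+1) (a m k ^+ p * (a m k * 'D_(e_ j) g (a m k *: (y - c) + c)))); first exact: e1.
  by rewrite /RS; congr (_ * _); apply: eq_bigr => k _; rewrite exprSr mulrA.
have RSU k p g : Bsm g -> UBk k (RS p g).
  elim: k p g => [|k IH] p g hg; (split; [have [C _ hC] := Bsm_bound hg; exists C; exact: RSb|]) => // j.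
  split=> [m y|]; first by case: (RSd p g j m y hg).
  have -> : (fun m y => 'D_(e_ j) (RS p g m) y) = RS p.+1 (fun z => 'D_(e_ j) g z).
    by apply/funext => m; apply/funext => y; case: (RSd p g j m y hg).
  by apply: IH; exact: Bsm_d.
pose G l := ulim U (RS 0 (fun z => 'D_(e_ l) f z)).
have GP l y e : 0 < e -> \forall m \near U, `|RS 0 (fun z => 'D_(e_ l) f z) m y - G l y| <= e.
  by have [C _ hC] := Bsm_bound (Bsm_d l hf); move=> e0; exact: (ulimP UU (RSb 0%N _ C hC)).
exists G => [l|y].
  split; first by apply: ulim_Bsm => // k; apply: RSU; exact: Bsm_d.
  apply/eqP; rewrite -subr_eq0 -normr_eq0 eq_le normr_ge0 andbT; apply/ler_addgt0Pr => e e0.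
  rewrite add0r; have [m] := @filter_ex _ U (PFU UU) _ (GP l c e e0).
  rewrite /RS subrr; under eq_bigr do rewrite scaler0 add0r expr0 mul1r.
  by rewrite sumr_const card_ord -[X in _ * X - _]mulr_natl mulKf ?pnatr_eq0// distrC.
apply/eqP; rewrite -subr_eq0 -normr_eq0 eq_le normr_ge0 andbT; apply/ler_addgt0Pr => e e0.
rewrite add0r; have [C C0 hC] := Bsm_taylor hf.
pose v := y - c.
have rem (m : nat) : `|f y - f c - \sum_l v 0 l * RS 0 (fun z => 'D_(e_ l) f z) m y| <= C * `|v| ^+ 2 / m.+1%:R.
  have m0 : 0 < (m.+1%:R : R) by [].
  have -> : f y - f c = \sum_(k < m.+1) (f (a m k.+1 *: v + c) - f (a m k *: v + c)).
    rewrite -(big_mkord xpredT (fun k => f (a m k.+1 *: v + c) - f (a m k *: v + c))).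
    rewrite (telescope_sumr (fun k => f (a m k *: v + c)))// /a mul0r scale0r add0r.
    by rewrite divff ?gt_eqF// scale1r subrK.
  have -> : \sum_l v 0 l * RS 0 (fun z => 'D_(e_ l) f z) m y =
     \sum_(k < m.+1) \sum_l ((m.+1%:R^-1 *: v) 0 l * 'D_(e_ l) f (a m k *: v + c)).
    rewrite exchange_big; apply: eq_bigr => l _; rewrite /RS mulrCA !mulr_sumr.
    by apply: eq_bigr => k _; rewrite expr0 mul1r !mxE; ring.
  rewrite -sumrB; apply: (le_trans (ler_norm_sum _ _ _)).
  apply: (@le_trans _ _ (\sum_(k < m.+1) (C * `|m.+1%:R^-1 *: v| ^+ 2))).
    apply: ler_sum => k _; have := hC (a m k *: v + c) (m.+1%:R^-1 *: v).
    by rewrite [_ + c + _]addrAC -scalerDl /a -(natr1 k) mulrDl mul1r.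
  rewrite sumr_const card_ord normrZ gtr0_norm ?invr_gt0// -[leLHS]mulr_natl le_eqVlt.
  by apply/orP; left; apply/eqP; field; rewrite gt_eqF.
have V0 : 0 <= C * `|v| ^+ 2 by rewrite mulr_ge0// exprn_ge0.
pose A := \sum_l `|v 0 l|; have A0 : 0 <= A by apply: sumr_ge0.
have A1 : 0 < A + 1 by lra.
have e2 : 0 < e / 2 / (A + 1) by rewrite !divr_gt0.
have n1 : \forall m \near U, forall l : 'I_n, `|RS 0 (fun z => 'D_(e_ l) f z) m y - G l y| <= e / 2 / (A + 1).
  by apply: filter_forall => l; exact: GP.
have n2 : \forall m \near U, C * `|v| ^+ 2 / m.+1%:R <= e / 2.
  apply: Uoo; exists (Num.truncn (C * `|v| ^+ 2 / (e / 2))).+1 => // m /= mN.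
  rewrite ler_pdivrMr// [leRHS]mulrC -ler_pdivrMr ?divr_gt0//.
  have hN : ((Num.truncn (C * `|v| ^+ 2 / (e / 2))).+1%:R : R) <= m.+1%:R by rewrite ler_nat leqW.
  exact: le_trans (ltW (truncnS_gt _)) hN.
have [m [h1 h2]] := @filter_ex _ U (PFU UU) _ (filterI n1 n2).
have -> : f y - f c - \sum_l (y - c) 0 l * G l y =
  (f y - f c - \sum_l v 0 l * RS 0 (fun z => 'D_(e_ l) f z) m y) +
  \sum_l v 0 l * (RS 0 (fun z => 'D_(e_ l) f z) m y - G l y).
  have -> : \sum_l v 0 l * (RS 0 (fun z => 'D_(e_ l) f z) m y - G l y) =
      \sum_l v 0 l * RS 0 (fun z => 'D_(e_ l) f z) m y - \sum_l v 0 l * G l y.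
    by rewrite -sumrB; apply: eq_bigr => l _; rewrite mulrBr.
  by rewrite -/v addrA subrK.
apply: (le_trans (ler_normD _ _)); rewrite (splitr e); apply: lerD; first exact: le_trans (rem m) h2.
apply: (le_trans (ler_norm_sum _ _ _)); apply: (@le_trans _ _ (A * (e / 2 / (A + 1)))).
  by rewrite /A mulr_suml; apply: ler_sum => l _; rewrite normrM ler_wpM2l.
by rewrite mulrCA ler_piMr ?divr_ge0 ?(ltW e0)// ler_pdivrMr// mul1r lerDl.
Qed.

End BoundedSmooth.

(** ** Control systems defined by bounded smooth vector fields *)

Section Jets.
Context {R : realType} {n r : nat}.
Local Notation vec := 'rV[R]_n.
Local Notation e_ j := (delta_mx 0 j : vec).
Variable F : 'I_r -> 'I_n -> vec -> R.
Hypothesis hF : forall i l, Bsm (F i l).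

(** The iterated derivatives of the coordinates along the fields [F i]. *)
Fixpoint jet (I : seq 'I_r) : vec -> vec :=
  if I is i :: J then fun y => \row_j \sum_l F i l y * 'D_(e_ l) (fun z => jet J z 0 j) y
  else id.

Lemma derive_coordE (l j : 'I_n) (y : vec) : 'D_(e_ l) (fun z : vec => z 0 j) y = (l == j)%:R.
Proof.
have [_ h] := derive_coord j (@derivable_id R _ y (e_ l)).
by rewrite [LHS]h derive_id mxE eqxx eq_sym.
Qed.

Lemma jet1 i y j : jet [:: i] y 0 j = F i j y.
Proof.
rewrite mxE (bigD1 j)//= derive_coordE eqxx mulr1 big1 ?addr0// => l lj.
by rewrite derive_coordE (negbTE lj) mulr0.
Qed.

Lemma jet_Bsm I j : I != [::] -> Bsm (fun y => jet I y 0 j).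
Proof.
elim: I j => [//|i [|i' J] IH] j _.
  by rewrite (_ : (fun y => _) = F i j) //; apply/funext => y; rewrite jet1.
have -> : (fun y => jet [:: i, i' & J] y 0 j) =
    fun y => \sum_l F i l y * 'D_(e_ l) (fun z => jet (i' :: J) z 0 j) y.
  by apply/funext => y; rewrite mxE.
by apply: Bsm_sum => l; apply: Bsm_mul => //; apply: Bsm_d; exact: IH.
Qed.

Lemma drift_jetE a y l : drift jet a y 0 l = \sum_i a 0 i * F i l y.
Proof. by rewrite /drift summxE; apply: eq_bigr => i _; rewrite mxE jet1. Qed.

(** For words other than [::], by the second order Taylor bound for functions with
  bounded derivatives; for [::], the defect is the first term of
  the bound. *)
Lemma jet_estimatesP : jet_estimates jet.
Proof.
move=> I; case: I => [|i0 J].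
  exists 1 => //; split=> // y y' a; rewrite mul1r -[X in X <= _]addr0.
  by apply: lerD; [|exact: sqr_ge0].
set I := i0 :: J; have I0 : I != [::] by [].
have [C1 C10 h1] := @seq_bound R 'I_n (enum 'I_n) (fun j C => forall y, `|jet I y 0 j| <= C)
  (fun j c c' cc hc y => le_trans (hc y) cc) (fun j => Bsm_bound (jet_Bsm j I0)).
have [C2 C20 h2] := @seq_bound R 'I_n (enum 'I_n) (fun j C => forall y v,
   `|jet I (y + v) 0 j - jet I y 0 j - \sum_l v 0 l * 'D_(e_ l) (fun z => jet I z 0 j) y| <= C * `|v| ^+ 2)
  (fun j c c' cc hc y v => le_trans (hc y v) (ler_wpM2r (exprn_ge0 _ (normr_ge0 _)) cc))
  (fun j => Bsm_taylor (jet_Bsm j I0)).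
have [C3 C30 h3] := @seq_bound R 'I_n (enum 'I_n) (fun j C => forall y l, `|'D_(e_ l) (fun z => jet I z 0 j) y| <= C)
  (fun j c c' cc hc y l => le_trans (hc y l) cc) (fun j => Bsm_dbound (jet_Bsm j I0)).
pose C := C1 + C2 + n%:R * C3.
have nC3 : 0 <= n%:R * C3 by rewrite mulr_ge0.
have C0 : 0 <= C by rewrite !addr_ge0.
exists C => //; split=> [_ y|y y' a].
  apply: mnorm_le => // j; apply: (le_trans (h1 j _ y)); first by rewrite mem_enum.
  by rewrite /C -addrA lerDl addr_ge0.
set v := y' - y; have y'E : y' = y + v by rewrite addrC subrK.
apply: mnorm_le => [|j].
  by rewrite mulr_ge0// addr_ge0// exprn_ge0.
have mj : j \in enum 'I_n by rewrite mem_enum.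
have -> : (jet I y' - jet I y - \sum_i a 0 i *: jet (i :: I) y) 0 j =
   (jet I (y + v) 0 j - jet I y 0 j - \sum_l v 0 l * 'D_(e_ l) (fun z => jet I z 0 j) y) +
   \sum_l (v - drift jet a y) 0 l * 'D_(e_ l) (fun z => jet I z 0 j) y.
  have aux (u1 u2 u3 : vec) : (u1 - u2 - u3) 0 j = u1 0 j - u2 0 j - u3 0 j by rewrite !mxE.
  have -> : \sum_l (v - drift jet a y) 0 l * 'D_(e_ l) (fun z => jet I z 0 j) y =
      \sum_l v 0 l * 'D_(e_ l) (fun z => jet I z 0 j) y -
      \sum_l (drift jet a y) 0 l * 'D_(e_ l) (fun z => jet I z 0 j) y.
    rewrite -sumrB; apply: eq_bigr => l _; rewrite -mulrBl; congr (_ * _).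
    by rewrite mxE [X in _ + X]mxE.
  have SE : (\sum_i a 0 i *: jet (i :: I) y) 0 j =
      \sum_l (drift jet a y) 0 l * 'D_(e_ l) (fun z => jet I z 0 j) y.
    rewrite summxE; under [RHS]eq_bigr => l _ do rewrite drift_jetE mulr_suml.
    rewrite exchange_big; apply: eq_bigr => i _.
    rewrite mxE; have -> : jet (i :: I) y 0 j = \sum_l F i l y * 'D_(e_ l) (fun z => jet I z 0 j) y by rewrite mxE.
    by rewrite mulr_sumr; apply: eq_bigr => l _; rewrite mulrA.
  by rewrite aux SE -y'E addrA subrK.
apply: (le_trans (ler_normD _ _)); rewrite mulrDr addrC; apply: lerD.
  apply: (@le_trans _ _ (\sum_(l < n) `|v - drift jet a y| * C3)).
    apply: (le_trans (ler_norm_sum _ _ _)); apply: ler_sum => l _; rewrite normrM.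
    by apply: ler_pM; rewrite ?normr_ge0 ?coord_le_mnorm// h3.
  rewrite sumr_const card_ord -[X in X <= _]mulr_natl mulrCA mulrC ler_wpM2r//.
  by rewrite /C lerDr addr_ge0.
apply: (le_trans (h2 j mj y v)); rewrite ler_wpM2r ?exprn_ge0//.
by rewrite /C addrAC lerDr addr_ge0.
Qed.

Lemma bounded_driftP : exists B La, bounded_drift jet B La.
Proof.
pose s := [seq (i, l) | i <- enum 'I_r, l <- enum 'I_n].
have ms i l : (i, l) \in s by apply/allpairsP; exists (i, l); rewrite !mem_enum.
have [C1 C10 h1] := @seq_bound R _ s (fun p C => forall y, `|F p.1 p.2 y| <= C)
  (fun j c c' cc hc y => le_trans (hc y) cc) (fun p => Bsm_bound (hF p.1 p.2)).
have [C2 C20 h2] := @seq_bound R _ s (fun p C => forall y v, `|F p.1 p.2 (y + v) - F p.1 p.2 y| <= C * `|v|)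
  (fun j c c' cc hc y v => le_trans (hc y v) (ler_wpM2r (normr_ge0 _) cc)) (fun p => Bsm_lip (hF p.1 p.2)).
exists (r%:R * C1), (r%:R * C2).
have sr (a : 'rV[R]_r) (u : 'I_r -> R) D : 0 <= D -> (forall i, `|u i| <= D) ->
    `|\sum_i a 0 i * u i| <= r%:R * D * euclidean_norm a.
  move=> D0 hu; apply: (le_trans (ler_norm_sum _ _ _)).
  apply: (@le_trans _ _ (\sum_(i < r) euclidean_norm a * D)).
    by apply: ler_sum => i _; rewrite normrM; apply: ler_pM; rewrite ?normr_ge0 ?coord_le_enorm.
  rewrite sumr_const card_ord -[X in X <= _]mulr_natl le_eqVlt; apply/orP; left; apply/eqP; ring.
split=> [||a y|a y y']; rewrite ?mulr_ge0//.
  apply: mnorm_le => [|l]; first by rewrite !mulr_ge0// enorm_ge0.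
  by rewrite drift_jetE; apply: sr => // i; exact: (h1 (i, l)).
apply: mnorm_le => [|l]; first by rewrite !mulr_ge0// enorm_ge0.
rewrite mxE [X in _ + X]mxE !drift_jetE -sumrB.
under eq_bigr do rewrite -mulrBr.
rewrite mulrAC -[leRHS]mulrA mulrC.
have D0 : 0 <= C2 * `|y' - y| by rewrite mulr_ge0.
have hu i : `|F i l y' - F i l y| <= C2 * `|y' - y|.
  by have := h2 (i, l) (ms i l) y (y' - y); rewrite [y + _]addrC subrK.
apply: (le_trans (sr a _ _ D0 hu)).
by rewrite le_eqVlt; apply/orP; left; apply/eqP; ring.
Qed.

End Jets.

(** ** Bump functions *)

Section Bump.
Context {R : realType}.

(** Products of the flat function [exp (- 1 / t)] with polynomials in [1 / t]: this
  class is stable under derivation. *)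
Definition flat (p : {poly R}) (t : R) : R := if 0 < t then p.[t^-1] * expR (- t^-1) else 0.

Lemma exprn_le_expR (m : nat) (x : R) : 0 < x -> x ^+ m <= m%:R ^+ m * expR x.
Proof.
move=> x0; case: m => [|m]; first by rewrite !expr0 mul1r ltW// expR_gt1.
have h : x / m.+1%:R <= expR (x / m.+1%:R).
  by apply: le_trans (expR_ge1Dx _); rewrite lerDr.
have -> : x ^+ m.+1 = m.+1%:R ^+ m.+1 * (x / m.+1%:R) ^+ m.+1.
  by rewrite -exprMn mulrCA divff ?mulr1.
rewrite ler_wpM2l ?exprn_ge0//; apply: (@le_trans _ _ (expR (x / m.+1%:R) ^+ m.+1)).
  by rewrite lerXn2r ?nnegrE ?divr_ge0 ?expR_ge0 ?(ltW x0).
by rewrite -expRM_natl mulrCA divff// mulr1.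
Qed.

Lemma horner_le_expR (p : {poly R}) : exists2 C, 0 <= C &
  forall x : R, 0 < x -> `|p.[x]| * x ^+ 2 <= C * expR x.
Proof.
exists (\sum_(i < size p) `|p`_i| * (i + 2)%:R ^+ (i + 2)).
  by apply: sumr_ge0 => i _; rewrite mulr_ge0// exprn_ge0.
move=> x x0; rewrite horner_coef; apply: (@le_trans _ _ ((\sum_(i < size p) `|p`_i| * x ^+ i) * x ^+ 2)).
  rewrite ler_wpM2r ?sqr_ge0//; apply: (le_trans (ler_norm_sum _ _ _)).
  by apply: ler_sum => i _; rewrite normrM (ger0_norm (exprn_ge0 _ (ltW x0))).
rewrite !mulr_suml; apply: ler_sum => i _.
by rewrite -!mulrA ler_wpM2l// -exprD; exact: exprn_le_expR.
Qed.

Lemma flat_le (p : {poly R}) : exists2 C, 0 <= C & forall t, `|flat p t| <= C * t ^+ 2.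
Proof.
have [C C0 hC] := horner_le_expR p; exists C => // t.
rewrite /flat; case: ifP => [t0|_]; last by rewrite normr0 mulr_ge0// sqr_ge0.
have ti : 0 < t^-1 by rewrite invr_gt0.
rewrite normrM (ger0_norm (expR_ge0 _)) expRN ler_pdivrMr ?expR_gt0//.
have := hC _ ti; rewrite -(ler_pM2r (exprn_gt0 2 t0)) -mulrA -exprMn mulVf ?gt_eqF//.
by rewrite expr1n mulr1 mulrAC.
Qed.

Definition flatd (p : {poly R}) : {poly R} := 'X^2 * (p - p^`()).

Lemma flat_derive (p : {poly R}) (t : R) : is_derive t 1 (flat p) (flat (flatd p) t).
Proof.
have [t0|t0|t0] := ltgtP t 0.
- have -> : flat (flatd p) t = 0 by rewrite /flat ltNge ltW.
  have dc : is_derive t (1 : R) (cst (0 : R)) 0 by exact: is_derive_cst.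
  apply: (near_eq_is_derive _ dc).
  by near=> z; rewrite /flat /cst ltNge ltW//; near: z; exact: lt_nbhsl.
- have -> : flat (flatd p) t = p.[t^-1] * (expR (- t^-1) * (t ^- 2)) + expR (- t^-1) * (p^`().[t^-1] * (- t ^- 2)).
    rewrite /flat t0 /flatd hornerM hornerXn hornerD hornerN exprVn; ring.
  have di : is_derive t (1 : R) (fun t : R => t^-1) (- t ^- 2).
    have ti := lt0r_neq0 t0; have di := @derivable_id R R t 1.
    apply: DeriveDef; first exact: (derivableV (f := id) ti di).
    by have := deriveV (f := id) ti di; rewrite derive_id scaler1.
  have dn : is_derive t (1 : R) (fun t : R => - t^-1) (t ^- 2).
    by have h := @is_deriveN _ _ _ _ _ _ _ di; apply: (is_derive_eq h); rewrite opprK.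
  have d1 : is_derive t (1 : R) (fun t : R => p.[t^-1]) (p^`().[t^-1] * (- t ^- 2)).
    by apply: (@is_derive1_comp R (horner p) (fun t : R => t^-1)); exact: is_derive_poly.
  have d2 : is_derive t (1 : R) (fun t : R => expR (- t^-1)) (expR (- t^-1) * (t ^- 2)).
    by apply: (@is_derive1_comp R expR (fun t : R => - t^-1)); exact: is_derive_expR.
  have dm := @is_deriveM _ _ _ _ _ _ _ _ d1 d2.
  apply: (near_eq_is_derive _ dm).
  by near=> z; rewrite /flat ifT//; near: z; exact: lt_nbhsr.
- rewrite t0; have -> : flat (flatd p) 0 = 0 by rewrite /flat ltxx.
  have [C C0 hC] := flat_le p.
  apply/is_deriveP => e e0; have C1 : 0 < C + 1 by lra.
  exists (e / (C + 1)); first by rewrite divr_gt0.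
  move=> h hh; rewrite add0r {2}/flat ltxx subr0 mulr0 subr0.
  apply: (le_trans (hC h)); rewrite -real_normK ?num_real// expr2 mulrA ler_wpM2r//.
  by have : `|h| * (C + 1) <= e; [rewrite -ler_pdivlMr// ltW|rewrite mulrDr mulr1 mulrC => ?; have := normr_ge0 h; lra].
Unshelve. all: by end_near. Qed.

Context {n : nat}.
Local Notation vec := 'rV[R]_n.

(** The cutoff is a quotient [f / (f + g)] of flat functions of the squared Euclidean
  norm; comparing it with the maximum norm costs the factor [n.+1]. *)
Lemma bump (c : vec) (D : R) : 0 < D -> exists chi : vec -> R, [/\ smooth_on setT chi,
  forall y, `|y - c| <= D / n.+1%:R -> chi y = 1 & forall y, D <= `|y - c| -> chi y = 0].
Proof.
move=> D0; pose sg (y : vec) : R := \sum_l (y 0 l - c 0 l) * (y 0 l - c 0 l).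
pose d := D / n.+1%:R; have d0 : 0 < d by rewrite divr_gt0.
pose pk := fix pk k : {poly R} := if k is k'.+1 then flatd (pk k') else 1.
have hk k (t : R) : is_derive t 1 (flat (pk k)) (flat (pk k.+1) t) by exact: flat_derive.
have oT := @openT vec.
have sc (a : R) : smooth_on (setT : set vec) (fun=> a) by exact: smooth_on_cst.
have ssg : smooth_on setT sg.
  apply: smooth_sum => // l; apply: smooth_mul => //;
    by apply: smooth_add => //; exact: smooth_coord.
have fl (f : vec -> R) : smooth_on setT f -> smooth_on setT (fun y => flat 1 (f y)).
  by move=> hf k; exact: (Ck_comp1 0 oT hk (hf k)).
pose N1 (y : vec) := flat 1 (D ^+ 2 + (-1) * sg y); pose N2 (y : vec) := flat 1 (sg y + (- (n%:R * d ^+ 2))).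
have s1 : smooth_on setT N1.
  by apply: fl; apply: smooth_add => //; exact: smooth_mul.
have s2 : smooth_on setT N2 by apply: fl; exact: smooth_add.
have f0 t : t <= 0 -> flat 1 t = 0 by rewrite leNgt /flat => /negbTE ->.
have fp t : 0 < t -> 0 < flat 1 t by rewrite /flat => t0; rewrite t0 hornerC mul1r expR_gt0.
have fge t : 0 <= flat 1 t.
  by have [/f0 ->|/fp/ltW] := leP t 0.
have nd : n%:R * d ^+ 2 < D ^+ 2.
  rewrite /d exprMn mulrCA gtr_pMr ?exprn_gt0// exprVn ltr_pdivrMr ?exprn_gt0// mul1r.
  by rewrite -natrX ltr_nat expnS expn1 mulnS; lia.
have Np y : 0 < N1 y + N2 y.
  have [h|h] := leP (sg y) (n%:R * d ^+ 2).
    by apply: ltr_wpDr; [exact: fge|apply: fp; lra].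
  by apply: ltr_wpDl; [exact: fge|apply: fp; lra].
exists (fun y => N1 y * (N1 y + N2 y)^-1); split.
- apply: smooth_mul => // k; apply: Ck_inv => // [y _|]; first by rewrite gt_eqF.
  by apply: smooth_add.
- move=> y yc; have sy : sg y <= n%:R * d ^+ 2.
    apply: (@le_trans _ _ (\sum_(l < n) d ^+ 2)); last by rewrite sumr_const card_ord mulr_natl.
    apply: ler_sum => l _; rewrite -expr2 -real_normK ?num_real// lerXn2r ?nnegrE ?(ltW d0)//.
    by apply: le_trans yc; have := coord_le_mnorm (y - c) l; rewrite !mxE.
  have z : N2 y = 0 by apply: f0; lra.
  by have := Np y; rewrite z addr0 => N0; rewrite divff// gt_eqF.
- move=> y yc; suff h : D ^+ 2 <= sg y by rewrite /N1 f0 ?mul0r//; lra.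
  apply: (@le_trans _ _ (`|y - c| ^+ 2)); first by rewrite lerXn2r ?nnegrE ?(ltW D0).
  rewrite leNgt; apply/negP => hlt; have sg0 : 0 <= sg y by apply: sumr_ge0 => l _; rewrite -expr2 sqr_ge0.
  have : `|y - c| <= Num.sqrt (sg y).
    apply: mnorm_le => [|l]; first exact: sqrtr_ge0.
    rewrite -(ler_pXn2r (n := 2))// ?nnegrE ?sqrtr_ge0// sqr_sqrtr// real_normK ?num_real//.
    rewrite /sg (bigD1 l)//= !mxE -expr2 lerDl; apply: sumr_ge0 => j _; by rewrite -expr2 sqr_ge0.
  by rewrite -(ler_pXn2r (n := 2))// ?nnegrE ?sqrtr_ge0// sqr_sqrtr// leNgt hlt.
Qed.

End Bump.

(** * Lipschitz functions of one variable *)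

Section LipschitzAE.
Context {R : realType}.
Local Notation mu := (@lebesgue_measure R).

Section Stieltjes.
Variables (x : R -> R) (K : R).
Hypothesis xK : forall s t, `|x t - x s| <= K * `|t - s|.

(** Adding a linear function makes the Lipschitz function [x] nondecreasing. *)
Definition tilt (t : R) := x t + K * t.

Lemma tilt_nd : nondecreasing tilt.
Proof.
move=> s t st; rewrite /tilt; have := xK s t; rewrite (ger0_norm (_ : 0 <= t - s)) ?subr_ge0//.
by rewrite ler_norml => /andP[h _]; lra.
Qed.

Lemma tilt_cont : continuous tilt.
Proof.
move=> t; apply/cvgrPdist_le => e e0; have K0 : 0 <= K.
  by have := xK 0 1; rewrite subr0 normr1 mulr1; exact: le_trans.
have K1 : 0 < 2 * K + 1 by lra.
have h0 : 0 < e / (2 * K + 1) by rewrite divr_gt0.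
near=> s; have hs : `|t - s| <= e / (2 * K + 1) by near: s; exact: cvgr_dist_le.
have -> : tilt t - tilt s = (x t - x s) + K * (t - s) by rewrite /tilt; ring.
apply: (le_trans (ler_normD _ _)); rewrite normrM (ger0_norm K0).
have h1 := xK s t; rewrite ler_pdivlMr// in hs.
have := normr_ge0 (t - s); rewrite mulrDr mulr1 mulrCA in hs; lra.
Unshelve. all: by end_near. Qed.

Lemma tilt_rc : right_continuous tilt.
Proof. by move=> t; apply: cvg_at_right_filter; exact: tilt_cont. Qed.

HB.instance Definition _ := isCumulative.Build R _ R tilt tilt_nd tilt_rc.

Local Notation nu := (lebesgue_stieltjes_measure tilt).

Lemma stieltjes_itv (a b : R) : a <= b -> nu `]a, b]%classic = (tilt b - tilt a)%:E.
Proof.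
move=> ab; rewrite /lebesgue_stieltjes_measure /measure_extension measurable_mu_extE/=.
  exact: wlength_itv_bnd.
exact: is_ocitv.
Qed.

(** The increments of [tilt] are at most [2 * K] times those of the identity, and
  this passes to the outer measures. *)
Lemma stieltjes_dominated (A : set R) : mu A = 0%E -> nu A = 0%E.
Proof.
move=> A0; have K0 : 0 <= K.
  by have := xK 0 1; rewrite subr0 normr1 mulr1; exact: le_trans.
have nA0 : (0 <= nu A)%E by exact: mu_ext_ge0.
apply/eqP; rewrite eq_le nA0 andbT; apply/lee_addgt0Pr => e e0; rewrite add0e.
have e1 : 0 < e / (2 * K + 1) by rewrite divr_gt0//; lra.
have : (mu A < (e / (2 * K + 1))%:E)%E by rewrite A0 lte_fin.
rewrite /lebesgue_measure /lebesgue_stieltjes_measure /measure_extension /mu_ext.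
move=> /ereal_inf_lt[_ [I [mI AI] <-] hI].
apply: (@le_trans _ _ (\sum_(k <oo) wlength tilt (I k))%E).
  by apply: ereal_inf_lbound; exists I.
apply: (@le_trans _ _ (\sum_(k <oo) (2 * K)%:E * wlength idfun (I k))%E).
  apply: lee_nneseries => [k _ _|k _].
    exact: wlength_ge0.
  have /= [[c d] /= _ <-] := mI k.
  have [cd|dc] := leP c d.
    rewrite !wlength_itv_bnd//= -EFinM lee_fin /tilt.
    have := xK c d; rewrite (ger0_norm (_ : 0 <= d - c)) ?subr_ge0//.
    by rewrite ler_norml => /andP[_ h]; lra.
  by rewrite set_itv_ge ?wlength0 ?mule0// bnd_simp -leNgt ltW.
rewrite nneseriesZl; last by move=> k _; exact: wlength_ge0.
apply: (@le_trans _ _ ((2 * K)%:E * (e / (2 * K + 1))%:E)%E).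
  by rewrite lee_wpmul2l ?lee_fin ?mulr_ge0// ltW.
by rewrite -EFinM lee_fin mulrCA ler_piMr ?(ltW e0)// ler_pdivrMr; lra.
Qed.

(** Rademacher's theorem on the line: by domination, the Stieltjes measure of
  the monotone function [tilt] has a density. *)
Lemma lipschitz_ae (a b : R) : a < b -> exists g : R -> R, [/\ measurable_fun setT g,
  mu.-integrable `]a, b] (EFin \o g),
  forall t, a <= t -> t <= b -> x t - x a = \int[mu]_(u in `]a, t]) g u &
  {ae mu, forall t, a < t < b -> is_derive t 1 x (g t)}].
Proof.
move=> ab; have mD : measurable (`]a, b]%classic : set (measurableTypeR R)) by exact: measurable_itv.
have foo : (nu `]a, b]%classic < +oo)%E by rewrite stieltjes_itv ?ltW// ltry.
have dom : (mfrestr mD foo : set (measurableTypeR R) -> \bar R) `<< mu.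
  apply/null_content_dominatesP => A mA A0; rewrite /mfrestr /mrestr.
  apply/eqP; rewrite eq_le measure_ge0 andbT -(stieltjes_dominated A0).
  by apply: le_mu_ext; exact: subIsetl.
have [g0 [g0ge g0fin g0int g0E]] := radon_nikodym_sigma_finite dom.
pose g1 t := fine (g0 t).
have g1E : EFin \o g1 = g0 by apply/funext => t; rewrite /= /g1 fineK.
have int1 D : measurable D -> mu.-integrable D (EFin \o g1).
  by move=> mE; rewrite g1E; exact: integrableS g0int.
have F1 t : a <= t -> t <= b -> \int[mu]_(u in `]a, t]) g1 u = tilt t - tilt a.
  move=> at_ tb; rewrite /Rintegral.
  have -> : (\int[mu]_(u in `]a, t]) (g1 u)%:E = \int[mu]_(u in `]a, t]) g0 u)%E.
    by apply: eq_integral => u _; rewrite /g1 fineK.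
  rewrite -g0E; last exact: measurable_itv.
  have E : (mfrestr mD foo : set (measurableTypeR R) -> \bar R) `]a, t]%classic = (tilt t - tilt a)%:E.
    rewrite /mfrestr /mrestr setIidl ?stieltjes_itv//.
    by move=> u /=; rewrite !in_itv /= => /andP[-> /le_trans]; apply.
  exact: (congr1 fine E).
have mtc (c : R) t : a <= t -> \int[mu]_(_ in `]a, t]) c = c * (t - a).
  by move=> at_; rewrite Rintegral_cst//= lebesgue_measure_itv /= lte_fin; case: ltP => //= ta; congr (_ * _); lra.
have cint t : mu.-integrable `]a, t] (EFin \o cst K).
  apply/integrableP; split; first by apply/measurable_EFinP; exact: measurable_cst.
  have -> : (\int[mu]_(u in `]a, t]) `|(EFin \o cst K) u| = \int[mu]_(u in `]a, t]) cst `|K|%:E u)%E by [].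
  rewrite integral_cst//= lebesgue_measure_itv /= lte_fin; case: ifP => _; rewrite ?mule0 ?ltry//.
have mg1 : measurable_fun setT g1.
  by have /measurable_int/measurable_EFinP := int1 _ measurableT.
exists (fun t => g1 t - K); split.
- by apply: measurable_funB => //; exact: measurable_cst.
- rewrite (_ : EFin \o _ = (EFin \o g1) \- (EFin \o cst K))%E; last by apply/funext => t /=; rewrite EFinB.
  by apply: integrableB => //; exact: int1.
- move=> t at_ tb; rewrite RintegralB//; last exact: int1.
  by rewrite F1// mtc// /tilt; ring.
have := FTC1 (a := BRight a) (fun y => int1 _ (measurable_itv _)) (open_integrable_locally openT (int1 _ measurableT)).
apply: filterS; first exact: (ae_filter_ringOfSetsType mu).
move=> t h /andP[at_ tb]; have [|dF FE] := h; first by rewrite ?bnd_simp.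
pose F y := \int[mu]_(u in `]a, y]) g1 u.
have dF1 : is_derive t (1 : R) F (g1 t) by split=> //; rewrite -derive1E.
have d1 : is_derive t (1 : R) (fun u => F u + (tilt a - K * u)) (g1 t - K).
  have di : is_derive t (1 : R) (fun u : R => tilt a - K * u) (- K).
    apply/is_deriveP => e e0; exists 1 => // h' _.
    by rewrite (_ : _ - _ = 0) ?normr0 ?mulr_ge0 ?(ltW e0)//; ring.
  exact: (@is_deriveD _ _ _ _ _ _ _ _ _ dF1 di).
apply: (near_eq_is_derive _ d1).
near=> u; rewrite /F F1; first by rewrite /tilt; ring.
  by apply: ltW; near: u; exact: lt_nbhsr.
by apply: ltW; near: u; exact: lt_nbhsl.
Unshelve. all: by end_near. Qed.

End Stieltjes.

(** Used to extend a path by constants out of a segment. *)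
Definition clamp (a b t : R) := Num.max a (Num.min b t).

Lemma clampP (a b t : R) : a <= b -> a <= clamp a b t /\ clamp a b t <= b.
Proof. by move=> ab; rewrite le_max lexx ge_max ab ge_min lexx. Qed.

Lemma clamp_id (a b t : R) : a <= t -> t <= b -> clamp a b t = t.
Proof. by move=> at_ tb; rewrite /clamp (min_idPr _)// (max_idPr _). Qed.

Lemma clamp_mono (a b s t : R) : s <= t -> clamp a b s <= clamp a b t.
Proof.
move=> st; rewrite /clamp ge_max le_max lexx /= le_max; apply/orP; right.
by rewrite le_min !ge_min lexx st orbT.
Qed.

Lemma clamp_lip (a b s t : R) : a <= b -> s <= t -> clamp a b t - clamp a b s <= t - s.
Proof.
move=> ab st; rewrite lerBlDr /clamp ge_max; apply/andP; split.
  by apply: ler_wpDl; rewrite ?subr_ge0// le_max lexx.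
rewrite -lerBlDl le_max; apply/orP; right.
rewrite le_min; apply/andP; split; rewrite lerBlDl addrC.
  by apply: (@le_trans _ _ b); [rewrite ge_min lexx|lra].
by rewrite addrC subrK ge_min lexx orbT.
Qed.

Lemma clamp_ext (V : normedModType R) (F : R -> V) (K a b : R) : a <= b -> 0 <= K ->
  (forall s t, a <= s -> s <= t -> t <= b -> `|F t - F s| <= K * (t - s)) ->
  forall s t, `|F (clamp a b t) - F (clamp a b s)| <= K * `|t - s|.
Proof.
move=> ab K0 hF.
have main s t : s <= t -> `|F (clamp a b t) - F (clamp a b s)| <= K * (t - s).
  move=> st; have [as_ sb] := clampP s ab; have [at_ tb] := clampP t ab.
  apply: (le_trans (hF _ _ as_ (clamp_mono _ _ st) tb)).
  by rewrite ler_wpM2l// clamp_lip.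
move=> s t; have [st|/ltW ts] := leP s t.
  by rewrite (ger0_norm (_ : 0 <= t - s)) ?subr_ge0//; exact: main.
by rewrite distrC (distrC t) (ger0_norm (_ : 0 <= s - t)) ?subr_ge0//; exact: main.
Qed.

Lemma is_derive_unique (F : R -> R) (t d d' : R) : is_derive t (1 : R) F d -> is_derive t (1 : R) F d' -> d = d'.
Proof. by move=> [_ <-] [_ <-]. Qed.

Lemma near_clamp (a b t : R) : a < t < b -> \near t, clamp a b t = t.
Proof.
move=> /andP[at_ tb]; near=> u; apply: clamp_id; apply: ltW; near: u; [exact: lt_nbhsr|exact: lt_nbhsl].
Unshelve. all: by end_near. Qed.

(** A Lipschitz function is the integral of its almost everywhere derivative, by
  [lipschitz_ae]. *)
Lemma lipschitz_mean_value (F : R -> R) (K A a b : R) : a <= b -> 0 <= K -> 0 <= A ->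
  (forall s t, a <= s -> s <= t -> t <= b -> `|F t - F s| <= K * (t - s)) ->
  {ae mu, forall t, a < t < b -> exists2 d : R, is_derive t (1 : R) F d & `|d| <= A} ->
  `|F b - F a| <= A * (b - a).
Proof.
rewrite le_eqVlt => /orP[/eqP <- *|ab]; first by rewrite !subrr normr0 mulr0.
move=> K0 A0 FK Fd; have ab' := ltW ab.
have [g [mg ig gE gd]] := lipschitz_ae (clamp_ext ab' K0 FK) ab.
have := gE b ab' (lexx b); rewrite !clamp_id// => ->.
have mo : measurable (`]a, b[%classic : set R) by exact: measurable_itv.
have io : mu.-integrable `]a, b[ (EFin \o g).
  by apply: integrableS ig => //; apply: subset_itvl; rewrite bnd_simp.
rewrite -Rintegral_itv_bndo_bndc//.
have hn := @le_normr_Rintegral _ _ _ mu _ _ mo io; apply: (le_trans hn).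
have gA : {ae mu, forall t, `]a, b[%classic t -> (`|g t|%:E <= A%:E)%E}.
  apply: filterS2 Fd gd; first exact: (ae_filter_ringOfSetsType mu).
  move=> t h1 h2 /=; rewrite in_itv /= => tI; have [d dd dA] := h1 tI.
  have dc : is_derive t (1 : R) (F \o clamp a b) d.
    by apply: (near_eq_is_derive _ dd); apply: filterS (near_clamp tI) => u /= ->.
  by rewrite lee_fin (is_derive_unique (h2 tI) dc).
have le1 : (\int[mu]_(t in `]a, b[) (`|g t|%:E) <= \int[mu]_(t in `]a, b[) (cst A%:E) t)%E.
  apply: ae_ge0_le_integral => //.
  - by apply/measurable_EFinP; apply: measurableT_comp => //; exact: measurable_funTS.
have cE : (\int[mu]_(t in `]a, b[) (cst A%:E) t)%E = (A * (b - a))%:E.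
  by rewrite integral_cst//= lebesgue_measure_itv /= lte_fin ab -EFinB -EFinM.
rewrite cE in le1.
rewrite /Rintegral -lee_fin fineK//; rewrite ge0_fin_numE.
  exact: le_lt_trans le1 (ltry _).
by apply: integral_ge0 => t _; rewrite lee_fin.
Qed.

End LipschitzAE.

(** * Smooth functions and tangent vectors on a manifold *)

Section SmoothFunctions.
Context {R : realType} {n : nat} (M : smooth_manifold R n).
Local Notation vec := 'rV[R]_n.
Local Notation coord := Defs.coord.
Implicit Types (f g h : M -> R) (p : M) (v : tvec M).

Lemma chart_open (c : chart R n M) (O : set M) : atlas c -> open O ->
  open (coord c @` (dom c `&` O)).
Proof.
move=> ac oO; have [od oi pc cc cp] := atlas_chart ac.
rewrite openE => z [p [dp Op] <-]; rewrite /interior.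
have h1 : nbhs (coord c p) (coord c @` dom c) by apply: open_nbhs_nbhs; split=> //; exists p.
have h2 : nbhs (coord c p) (param c @^-1` O).
  apply: (cp (coord c p)); first by exists p.
  by rewrite pc//; exact: open_nbhs_nbhs.
by apply: filterS2 h1 h2 => _ [p' dp' <-]; rewrite /= pc// => Op'; exists p'.
Qed.

Lemma chart_image_open (c : chart R n M) : atlas c -> open (coord c @` dom c).
Proof. by move=> /atlas_chart[]. Qed.

Lemma smooth_fun_cst (a : R) : smooth_fun (fun _ : M => a).
Proof. by move=> c ac; exact: smooth_on_cst. Qed.

Lemma smooth_fun_add f g : smooth_fun f -> smooth_fun g -> smooth_fun (fun p => f p + g p).
Proof. by move=> hf hg c ac; apply: (smooth_add (chart_image_open ac)); [exact: hf|exact: hg]. Qed.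

Lemma smooth_fun_mul f g : smooth_fun f -> smooth_fun g -> smooth_fun (fun p => f p * g p).
Proof. by move=> hf hg c ac; apply: (smooth_mul (chart_image_open ac)); [exact: hf|exact: hg]. Qed.

Lemma smooth_fun_scale (a : R) f : smooth_fun f -> smooth_fun (fun p => a * f p).
Proof. by move=> hf; apply: smooth_fun_mul => //; exact: smooth_fun_cst. Qed.

Lemma smooth_fun_sub f g : smooth_fun f -> smooth_fun g -> smooth_fun (fun p => f p - g p).
Proof.
move=> hf hg; rewrite (_ : (fun p => _) = fun p => f p + -1 * g p).
  by apply: smooth_fun_add => //; exact: smooth_fun_scale.
by apply/funext => p; rewrite mulN1r.
Qed.

Lemma smooth_fun_sum (I : Type) (s : seq I) (F : I -> M -> R) :
  (forall i, smooth_fun (F i)) -> smooth_fun (fun p => \sum_(i <- s) F i p).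
Proof.
move=> hF; elim: s => [|i s IH].
  by under eq_fun do rewrite big_nil; exact: smooth_fun_cst.
by under eq_fun do rewrite big_cons; exact: smooth_fun_add.
Qed.

Section TangentVector.
Variables (p : M) (v : tvec M).
Hypothesis hv : tangent_space p v.

Lemma tvec_lin (a : R) f g : smooth_fun f -> smooth_fun g -> v (fun z => a * f z + g z) = a * v f + v g.
Proof. by move=> hf hg; case: hv => h _; exact: h. Qed.
Lemma tvecM f g : smooth_fun f -> smooth_fun g -> v (fun z => f z * g z) = v f * g p + f p * v g.
Proof. by move=> hf hg; case: hv => _ h; exact: h. Qed.
Lemma tvec0 : v (fun _ => 0) = 0.
Proof.
have h0 := smooth_fun_cst 0; have := tvec_lin (-1) h0 h0.
rewrite (_ : (fun z => _) = (fun=> 0)); last by apply/funext => z; rewrite mulr0 addr0.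
by rewrite mulN1r addNr.
Qed.
Lemma tvecD f g : smooth_fun f -> smooth_fun g -> v (fun z => f z + g z) = v f + v g.
Proof.
move=> hf hg; rewrite -[v f]mul1r -tvec_lin//; congr v.
by apply/funext => z; rewrite mul1r.
Qed.
Lemma tvecZ (a : R) f : smooth_fun f -> v (fun z => a * f z) = a * v f.
Proof.
move=> hf; have := tvec_lin a hf (smooth_fun_cst 0); rewrite tvec0 addr0 => <-.
by congr v; apply/funext => z; rewrite addr0.
Qed.
Lemma tvecB f g : smooth_fun f -> smooth_fun g -> v (fun z => f z - g z) = v f - v g.
Proof.
move=> hf hg; rewrite -mulN1r -tvecZ// -tvecD//; last exact: smooth_fun_scale.
by congr v; apply/funext => z; rewrite mulN1r.
Qed.
Lemma tvec_sum (I : Type) (s : seq I) (F : I -> M -> R) :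
  (forall i, smooth_fun (F i)) -> v (fun z => \sum_(i <- s) F i z) = \sum_(i <- s) v (F i).
Proof.
move=> hF; elim: s => [|i s IH].
  rewrite big_nil (_ : (fun z => _) = (fun=> 0)) ?tvec0//.
  by apply/funext => z; rewrite big_nil.
rewrite big_cons -IH -tvecD//; last exact: smooth_fun_sum.
by congr v; apply/funext => z; rewrite big_cons.
Qed.
Lemma tvec_cst (a : R) : v (fun _ => a) = 0.
Proof.
have v1 : v (fun _ => 1) = 0.
  have h1 := smooth_fun_cst 1; have := tvecM h1 h1.
  have -> : (fun _ : M => (1 : R) * 1) = (fun=> 1) by apply/funext => z; rewrite mulr1.
  rewrite mulr1 mul1r.
  by move=> e; lra.
rewrite (_ : (fun _ => a) = (fun z => a * (fun=> 1) z)); last by apply/funext => z; rewrite mulr1.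
by rewrite tvecZ ?v1 ?mulr0//; exact: smooth_fun_cst.
Qed.

(** Leibniz' rule for [b * (f - g) = 0], with [b] a bump function: tangent vectors
  are local. *)
Lemma tvec_local b f g : smooth_fun b -> smooth_fun f -> smooth_fun g -> b p != 0 ->
  (forall z, b z != 0 -> f z = g z) -> v f = v g.
Proof.
move=> hb hf hg bp fg; apply/eqP; rewrite -subr_eq0 -tvecB//; apply/eqP.
have hfg := smooth_fun_sub hf hg; have := tvecM hb hfg.
rewrite (fg _ bp) subrr mulr0 add0r (_ : (fun z => _) = (fun=> 0)).
  by rewrite tvec0 => /esym/eqP; rewrite mulf_eq0 (negbTE bp) /= => /eqP.
apply/funext => z; have [->|bz] := eqVneq (b z) 0; first by rewrite mul0r.
by rewrite fg// subrr mulr0.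
Qed.
End TangentVector.

(** By Leibniz' rule for [f = f * chi], at a zero of [f]. *)
Lemma vfield_support (Z : vfield M) chi f : smooth_vfield Z -> smooth_fun chi -> smooth_fun f ->
  (forall z, f z != 0 -> chi z = 1) -> forall z, Z f z != 0 -> chi z = 1.
Proof.
move=> [_ hZ] hc hf fc z Zf; apply/eqP; apply: contraNT Zf => cz.
have fz : f z = 0 by apply/eqP; apply: contraNT cz => /fc ->.
have fE : f = (fun z => f z * chi z).
  by apply/funext => w; have [->|/fc ->] := eqVneq (f w) 0; rewrite ?mul0r ?mulr1.
have := tvecM (hZ z) hf hc; rewrite -fE fz mul0r addr0 /value => e.
have : Z f z * (1 - chi z) = 0 by rewrite mulrBr mulr1 -e subrr.
by move/eqP; rewrite mulf_eq0 subr_eq0 [1 == _]eq_sym (negbTE cz) orbF.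
Qed.

(** ** The algebra of vector fields *)

Lemma vfield_smooth (Z : vfield M) f : smooth_vfield Z -> smooth_fun f -> smooth_fun (Z f).
Proof. by move=> [h _]; exact: h. Qed.

Lemma vfield_tangent (Z : vfield M) p : smooth_vfield Z -> tangent_space p (value Z p).
Proof. by move=> [_ h]; exact: h. Qed.

Lemma vfieldM (Z : vfield M) f g : smooth_vfield Z -> smooth_fun f -> smooth_fun g ->
  Z (fun z => f z * g z) = fun z => Z f z * g z + f z * Z g z.
Proof. by move=> hZ hf hg; apply/funext => p; have := tvecM (vfield_tangent p hZ) hf hg. Qed.

Lemma vfield_lin (Z : vfield M) (a : R) f g : smooth_vfield Z -> smooth_fun f -> smooth_fun g ->
  Z (fun z => a * f z + g z) = fun z => a * Z f z + Z g z.
Proof. by move=> hZ hf hg; apply/funext => p; have := tvec_lin (vfield_tangent p hZ) a hf hg. Qed.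

Lemma vfield_sum (Z : vfield M) (I : Type) (s : seq I) (a : I -> R) (F : I -> M -> R) : smooth_vfield Z ->
  (forall i, smooth_fun (F i)) ->
  Z (fun z => \sum_(i <- s) a i * F i z) = fun z => \sum_(i <- s) a i * Z (F i) z.
Proof.
move=> hZ hF; apply/funext => p.
have := tvec_sum (vfield_tangent p hZ) s (fun i => smooth_fun_scale (a i) (hF i)).
rewrite /value => ->; apply: eq_bigr => i _.
by have := tvecZ (vfield_tangent p hZ) (a i) (hF i); rewrite /value => ->.
Qed.

Lemma commutator_smooth (Z Z' : vfield M) : smooth_vfield Z -> smooth_vfield Z' ->
  smooth_vfield (commutator Z Z').
Proof.
move=> hZ hZ'; have sZ := vfield_smooth hZ; have sZ' := vfield_smooth hZ'; split=> [f hf|p].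
  by apply: smooth_fun_sub; [apply/sZ/sZ'|apply/sZ'/sZ].
rewrite /value /commutator; split=> [a f g hf hg|f g hf hg].
  rewrite !vfield_lin//; [ring|exact: sZ|exact: sZ|exact: sZ'|exact: sZ'].
rewrite !(vfieldM _ hf hg)//.
have add (V : vfield M) f1 f2 : smooth_vfield V -> smooth_fun f1 -> smooth_fun f2 ->
    V (fun z => f1 z + f2 z) p = V f1 p + V f2 p.
  by move=> hV h1 h2; have := tvecD (vfield_tangent p hV) h1 h2.
rewrite !add//; do ?[by apply: smooth_fun_mul; auto].
rewrite !vfieldM//; do ?[by auto].
ring.
Qed.

Lemma lincomb_vfield_smooth (I : finType) (a : I -> R) (Z : I -> vfield M) :
  (forall i, smooth_vfield (Z i)) -> smooth_vfield (fun f p => \sum_i a i * Z i f p).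
Proof.
move=> hZ; split=> [f hf|p]; first by apply: smooth_fun_sum => i; apply: smooth_fun_scale; exact: vfield_smooth.
rewrite /value; split=> [b f g hf hg|f g hf hg].
  rewrite mulr_sumr -big_split; apply: eq_bigr => i _ /=.
  by rewrite vfield_lin//; ring.
rewrite mulr_suml mulr_sumr -big_split; apply: eq_bigr => i _ /=.
by rewrite vfieldM//; ring.
Qed.

End SmoothFunctions.

Section BoundedSmoothIsSmooth.
Context {R : realType} {n : nat}.

Lemma Bsm_cont (f : 'rV[R]_n -> R) : Bsm f -> continuous f.
Proof.
move=> hf; suff h (y : 'rV[R]_n) : {for y, continuous f} by exact: h.
have [C C0 hC] := Bsm_lip hf; have FF : Filter (nbhs y) by exact: nbhs_filter.
apply/(@cvgrPdist_le R R^o _ (nbhs y) FF) => e e0.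
have C1 : 0 < C + 1 by lra.
have h0 : 0 < e / (C + 1) by rewrite divr_gt0.
apply/(@nbhs_normP R 'rV[R]_n); exists (e / (C + 1)) => // z /= hz.
have := hC y (z - y); rewrite [y + _]addrC subrK distrC => /le_trans; apply.
move: hz; rewrite distrC ltr_pdivlMr// => /ltW; apply: le_trans.
by rewrite mulrC ler_wpM2l// lerDl.
Qed.

Lemma Bsm_smooth (f : 'rV[R]_n -> R) U : Bsm f -> smooth_on U f.
Proof.
move=> hf k; elim: k f hf => [|k IH] f hf; (split; first by move=> x _; exact: Bsm_cont) => // j.
by split=> [x _|]; [exact: Bsm_derivable|apply: IH; exact: Bsm_d].
Qed.

End BoundedSmoothIsSmooth.

(** * Functions and fields near a point, in the coordinates of a diffeomorphism *)

(** A coordinate system around the image of 0, with three nested cutoff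
  functions: [chi1] confines supports to a ball of the coordinate domain, [chi2]
  extends the coordinates to smooth functions on the manifold, and [chi3] is
  nonzero only at points where these extensions agree with the coordinates. *)
Record patch (R : realType) (n : nat) (M : smooth_manifold R n) := Patch {
  pV : set 'rV[R]_n; pW : set M; phi : 'rV[R]_n -> M; psi : M -> 'rV[R]_n;
  pdiffeo : @diffeomorphism R n n (euclidean R n) M pV pW phi psi;
  pD : R; pballV : forall y : 'rV[R]_n, `|y| <= pD -> pV y;
  chi1 : 'rV[R]_n -> R; chi2 : 'rV[R]_n -> R; chi3 : 'rV[R]_n -> R;
  chi1_smooth : smooth_on setT chi1; chi2_smooth : smooth_on setT chi2;
  chi3_smooth : smooth_on setT chi3;
  chi10 : forall y : 'rV[R]_n, pD <= `|y| -> chi1 y = 0;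
  chi21 : forall y, chi2 y != 0 -> chi1 y = 1;
  chi32 : forall y, chi3 y != 0 -> chi2 y = 1;
  chi3_0 : chi3 0 != 0 }.

Section Patch.
Context {R : realType} {n : nat} {M : smooth_manifold R n}.
Local Notation vec := 'rV[R]_n.
Local Notation e_ j := (delta_mx 0 j : vec).
Local Notation coord := Defs.coord.
Variable P : patch M.
Local Notation V := (pV P).
Local Notation W := (pW P).
Local Notation phi := (phi P).
Local Notation psi := (psi P).
Local Notation D := (pD P).
Local Notation chi1 := (chi1 P).
Local Notation chi2 := (chi2 P).
Local Notation chi3 := (chi3 P).
Let diffeo := pdiffeo P.
Let ballV := @pballV _ _ _ P.
Let s1 := chi1_smooth P.
Let s2 := chi2_smooth P.
Let s3 := chi3_smooth P.
Let chi10 := @chi10 _ _ _ P.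
Let chi21 := @chi21 _ _ _ P.
Let chi32 := @chi32 _ _ _ P.

Let oV : open V. Proof. by case: diffeo. Qed.
Let oW : open W. Proof. by case: diffeo. Qed.
Lemma phiW y : V y -> W (phi y). Proof. by case: diffeo => _ _ h _ _ /h[]. Qed.
Lemma phiK y : V y -> psi (phi y) = y. Proof. by case: diffeo => _ _ h _ _ /h[]. Qed.
Lemma psiV p : W p -> V (psi p). Proof. by case: diffeo => _ _ _ h _ /h[]. Qed.
Lemma psiK p : W p -> phi (psi p) = p. Proof. by case: diffeo => _ _ _ h _ /h[]. Qed.
Lemma phi_cont : continuous_on V phi. Proof. by case: diffeo => _ _ _ _ [[]]. Qed.
Lemma phi_preim_open (O : set M) : open O -> open (V `&` phi @^-1` O).
Proof.
move=> oO; rewrite openE => y [Vy Oy]; rewrite /interior.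
have h1 : nbhs y V by exact: open_nbhs_nbhs.
have h2 : nbhs y (phi @^-1` O) by apply: (phi_cont Vy); exact: open_nbhs_nbhs.
exact: filterI h1 h2.
Qed.

Lemma phi_chart_smooth (c : chart R n M) : atlas c ->
  smooth_on (V `&` phi @^-1` dom c) (coord c \o phi).
Proof.
move=> ac; case: diffeo => _ _ _ _ [[_ h] _].
have := h (@id_chart R n) c erefl ac; rewrite /= image_id setTI.
by [].
Qed.

Lemma psi_chart_smooth (c : chart R n M) : atlas c ->
  smooth_on (coord c @` (dom c `&` W)) (psi \o param c).
Proof.
move=> ac; case: diffeo => _ _ _ _ [_ [_ h]].
by have := h c (@id_chart R n) ac erefl; rewrite /= preimage_setT setIT.
Qed.

Lemma smooth_comp_phi f : smooth_fun f -> smooth_on V (f \o phi).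
Proof.
move=> hf k; apply: Ck_local => y Vy; have [c ac dc] := atlas_cover (phi y).
have [od oi pc cc cp] := atlas_chart ac.
exists (V `&` phi @^-1` dom c) => //.
have oU := phi_preim_open od.
have h : Ck k (V `&` phi @^-1` dom c) ((f \o param c) \o (coord c \o phi)).
  apply: (Ck_comp oU oi _ (phi_chart_smooth ac k) (hf c ac k)).
  by move=> z [Vz dz]; exists (phi z).
apply: Ck_ext h => z [Vz dz].
have := open_nbhs_nbhs (conj oU (conj Vz dz)).
by apply: filterS => u [_ du] /=; rewrite pc.
Qed.

Definition ext (G : vec -> R) : M -> R := fun p => if `[<W p>] then G (psi p) else 0.
Definition pull (f : M -> R) : vec -> R := fun y => if `[<V y>] then f (phi y) else 0.

Lemma extE G y : V y -> ext G (phi y) = G y.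
Proof. by move=> Vy; rewrite /ext asboolT ?phiK//; exact: phiW. Qed.
Lemma extW G p : W p -> ext G p = G (psi p).
Proof. by move=> Wp; rewrite /ext asboolT. Qed.
Lemma ext0 G p : ~ W p -> ext G p = 0.
Proof. by move=> Wp; rewrite /ext asboolF. Qed.
Lemma pullE f y : V y -> pull f y = f (phi y).
Proof. by move=> Vy; rewrite /pull asboolT. Qed.

(** The image under [phi] of the closed ball containing the support is compact, hence
  closed in the Hausdorff space [M], and the extension vanishes off it. *)
Lemma ext_smooth G : smooth_on setT G -> (forall y : vec, D <= `|y| -> G y = 0) -> smooth_fun (ext G).
Proof.
move=> hG G0 c ac k; pose K := phi @` [set y : vec | `|y - 0| <= D].
have cK : closed K.
  apply: compact_closed; first exact: manifold_hausdorff.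
  apply: continuous_compact; last exact: mball_compact.
  by apply: continuous_in_subspaceT => y; rewrite inE /= subr0 => /ballV Vy; exact: phi_cont.
have [od oi pc cc cp] := atlas_chart ac.
have KW p : W p -> ~ K p -> G (psi p) = 0.
  move=> Wp nK; apply: G0; rewrite leNgt; apply/negP => h; apply: nK.
  by exists (psi p); [rewrite /= subr0 ltW|rewrite psiK].
apply: Ck_local => _ [p dp <-]; have [Wp|nW] := pselect (W p).
  exists (coord c @` (dom c `&` W)); first by exists p.
  have oU := chart_open ac oW.
  have h := Ck_comp oU (@openT vec) (fun x _ => I) (psi_chart_smooth ac k) (hG k).
  apply: Ck_ext h => z Uz; have := open_nbhs_nbhs (conj oU Uz).
  by apply: filterS => _ [p' [dp' Wp'] <-] /=; rewrite pc// extW.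
have nK : ~ K p.
  by move=> [y /=]; rewrite subr0 => /ballV Vy yp; apply: nW; rewrite -yp; exact: phiW.
exists (coord c @` (dom c `&` ~` K)); first by exists p.
have oU := chart_open ac (closed_openC cK).
apply: Ck_ext (@Ck_cst _ _ k _ 0) => z Uz; have := open_nbhs_nbhs (conj oU Uz).
apply: filterS => _ [p' [dp' nK'] <-] /=; rewrite pc//.
by have [Wp'|nW'] := pselect (W p'); [rewrite extW// KW|rewrite ext0].
Qed.

Lemma pull_Bsm f : smooth_fun f -> (forall p, f p != 0 -> W p /\ `|psi p| < D) -> Bsm (pull f).
Proof.
move=> hf fs; have f0 y : V y -> D <= `|y| -> f (phi y) = 0.
  move=> Vy yD; apply/eqP; apply: contraT => /fs[_]; rewrite phiK//.
  by rewrite ltNge yD.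
apply: (@smooth_support_Bsm _ _ _ 0 D) => [k|y].
  apply: Ck_local => y _; have [yD|yD] := ltP `|y| D.
    have Vy : V y by apply/ballV/ltW.
    exists V => //; apply: Ck_ext (smooth_comp_phi hf k) => z Vz.
    by have := open_nbhs_nbhs (conj oV Vz); apply: filterS => u Vu; rewrite pullE.
  have [Vy|nV] := pselect (V y).
    exists V => //; apply: Ck_ext (smooth_comp_phi hf k) => z Vz.
    by have := open_nbhs_nbhs (conj oV Vz); apply: filterS => u Vu; rewrite pullE.
  exists [set z : vec | D < `|z - 0|].
    by rewrite /= subr0 lt_neqAle yD andbT; apply/eqP => yD'; apply: nV; apply: ballV; rewrite yD'.
  apply: Ck_ext (@Ck_cst _ _ k _ 0) => z Uz.
  have oU : open [set z : vec | D < `|z - 0|].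
    rewrite [X in open X](_ : _ = (fun y : vec => `|y - 0|) @^-1` [set x : R | D < x])//.
    apply: open_comp; last exact: open_gt.
    by move=> u _; exact: dist_continuous.
  have := open_nbhs_nbhs (conj oU Uz); apply: filterS => u /=; rewrite subr0 => uD.
  rewrite /pull; case: asboolP => // Vu.
  by rewrite f0// ltW.
rewrite subr0 => yD; rewrite /pull; case: asboolP => // Vy.
by rewrite f0// ltW.
Qed.

Let chi20 (y : vec) : D <= `|y| -> chi2 y = 0.
Proof.
by move=> /chi10 h; apply/eqP; apply: contraT => /chi21; rewrite h => /esym/eqP; rewrite oner_eq0.
Qed.
Let chi30 (y : vec) : D <= `|y| -> chi3 y = 0.
Proof.
by move=> /chi20 h; apply/eqP; apply: contraT => /chi32; rewrite h => /esym/eqP; rewrite oner_eq0.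
Qed.
Lemma chi3V y : chi3 y != 0 -> V y.
Proof. by move=> h; apply: ballV; rewrite leNgt; apply: contraNN h => /ltW/chi30 ->. Qed.
Lemma chi3_open : open [set y | chi3 y != 0].
Proof.
rewrite [X in open X](_ : _ = chi3 @^-1` [set x : R | x != 0])//.
apply: open_comp; last exact: open_neq.
by move=> y _; apply: (Ck_cont (s3 0%N)).
Qed.

(** The coordinate functions; cut off, they become smooth on the manifold, as
  derivations require. *)
Definition cf (l : 'I_n) : M -> R := ext (fun y => y 0 l * chi2 y).

Lemma cf_smooth l : smooth_fun (cf l).
Proof.
apply: ext_smooth => [|y /chi20 ->]; last by rewrite mulr0.
apply: smooth_mul => //; [exact: openT|apply: smooth_coord; exact: openT].
Qed.

Lemma cfE l y : chi3 y != 0 -> cf l (phi y) = y 0 l.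
Proof. by move=> h; rewrite /cf extE ?chi32 ?mulr1//; exact: chi3V. Qed.

(** Functions supported where [chi1] equals 1; this class is stable under
  derivations, by [vfield_support]. *)
Definition confined (f : M -> R) := smooth_fun f /\ forall p, f p != 0 -> ext chi1 p = 1.

Lemma ext_chi1_smooth : smooth_fun (ext chi1). Proof. exact: ext_smooth. Qed.
Lemma ext_chi2_smooth : smooth_fun (ext chi2). Proof. exact: ext_smooth. Qed.
Lemma ext_chi3_smooth : smooth_fun (ext chi3). Proof. exact: ext_smooth. Qed.

Lemma ext_confined (G : vec -> R) : smooth_on setT G -> confined (ext (fun y => G y * chi2 y)).
Proof.
move=> hG; split.
  apply: ext_smooth => [|y /chi20 ->]; last by rewrite mulr0.
  by apply: smooth_mul => //; exact: openT.
move=> p; have [Wp|nW] := pselect (W p); last by rewrite ext0 ?eqxx.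
by rewrite !extW// mulf_eq0 negb_or => /andP[_ /chi21].
Qed.

Lemma confined_field (Z : vfield M) f : smooth_vfield Z -> confined f -> confined (Z f).
Proof.
move=> hZ [hf fc]; split; first exact: vfield_smooth.
exact: (vfield_support hZ ext_chi1_smooth hf fc).
Qed.

Lemma cf_confined l : confined (cf l).
Proof. by apply: ext_confined; apply: smooth_coord; exact: openT. Qed.

Lemma confined_Bsm f : confined f -> Bsm (pull f).
Proof.
move=> [hf fc]; apply: pull_Bsm => // p /fc; have [Wp|nW] := pselect (W p).
  rewrite extW// => h; split=> //; rewrite ltNge; apply/negP => /chi10; rewrite h => /eqP.
  by rewrite oner_eq0.
by rewrite ext0// => /esym/eqP; rewrite oner_eq0.
Qed.

Lemma confined_bounded f : confined f -> exists2 C : R, 0 <= C & forall p, `|f p| <= C.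
Proof.
move=> fc; have [C C0 hC] := Bsm_bound (confined_Bsm fc); exists C => // p.
have [->|/fc.2] := eqVneq (f p) 0; first by rewrite normr0.
have [Wp|nW] := pselect (W p); last by rewrite ext0// => /esym/eqP; rewrite oner_eq0.
by move=> _; have := hC (psi p); rewrite pullE ?psiK//; exact: psiV.
Qed.

(** A tangent vector is determined by its values on the coordinate functions:
  after multiplication by cutoffs, Hadamard's formula becomes an identity
  between smooth functions on the manifold, to which Leibniz' rule applies. *)
Lemma tangent_formula y (v : tvec M) g : chi3 y != 0 -> tangent_space (phi y) v -> smooth_fun g ->
  v g = \sum_l v (cf l) * 'D_(e_ l) (g \o phi) y.
Proof.
move=> y3 hv hg; have Vy := chi3V y3; have y2 := chi32 y3.
pose c2 := ext chi2; have hc2 : smooth_fun c2 := ext_chi2_smooth.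
have hgc : confined (fun p => g p * c2 p).
  split; first exact: smooth_fun_mul.
  move=> p; rewrite mulf_eq0 negb_or => /andP[_]; rewrite /c2.
  by have [Wp|nW] := pselect (W p); [rewrite !extW// => /chi21|rewrite ext0 ?eqxx].
pose G := pull (fun p => g p * c2 p).
have [Gl hGl GE] := hadamard y (confined_Bsm hgc).
pose El l := ext (fun z => Gl l z * chi2 z).
have hEl l : smooth_fun (El l).
  by have [|//] := @ext_confined (Gl l); apply: Bsm_smooth; case: (hGl l).
have idn : (fun p => g p * c2 p * (c2 p * c2 p)) =
    (fun p => G y * (c2 p * c2 p) + \sum_l (cf l p - y 0 l * c2 p) * El l p).
  apply/funext => p; have [Wp|nW] := pselect (W p); last first.
    by rewrite /c2 /El /cf ext0// !(mulr0, mul0r) add0r big1// => l _; rewrite !ext0// mulr0.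
  have -> : g p * c2 p = G (psi p) by rewrite /G pullE ?psiK//; exact: psiV.
  have -> : G (psi p) = G y + \sum_l (psi p - y) 0 l * Gl l (psi p).
    by rewrite -(GE (psi p)) addrC subrK.
  rewrite mulrDl mulr_suml; congr (_ + _); apply: eq_bigr => l _.
  by rewrite /cf /El /c2 !extW// !mxE; ring.
have hb := ext_chi3_smooth.
have b0 : ext chi3 (phi y) != 0 by rewrite extE.
have b2 p : ext chi3 p != 0 -> c2 p = 1.
  by rewrite /c2; have [Wp|nW] := pselect (W p); [rewrite !extW//; exact: chi32|rewrite ext0 ?eqxx].
have hcc := smooth_fun_mul hc2 hc2.
have E1 : v (fun p => g p * c2 p * (c2 p * c2 p)) = v g.
  apply: (tvec_local hv hb _ hg b0) => [|p /b2 ->]; last by rewrite !mulr1.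
  by apply: smooth_fun_mul => //; exact: smooth_fun_mul.
have E2 : v (fun p => c2 p * c2 p) = 0.
  have h := tvec_local hv hb hcc (smooth_fun_cst (M:=M) 1) b0; rewrite -[RHS](tvec_cst hv 1); apply: h => p /b2 ->.
  by rewrite mulr1.
have E3 : v c2 = 0.
  by have h := tvec_local hv hb hc2 (smooth_fun_cst (M:=M) 1) b0; rewrite -[RHS](tvec_cst hv 1); apply: h => p /b2 ->.
have hd l : smooth_fun (fun p => cf l p - y 0 l * c2 p).
  by apply: smooth_fun_sub; [exact: cf_smooth|exact: smooth_fun_scale].
rewrite -E1 idn (tvec_lin hv) ?E2 ?mulr0 ?add0r//; last by apply: smooth_fun_sum => l; exact: smooth_fun_mul.
rewrite (tvec_sum hv); last by move=> l; exact: smooth_fun_mul.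
apply: eq_bigr => l _; rewrite (tvecM hv)//.
rewrite (tvecB hv)//; [|exact: cf_smooth|exact: smooth_fun_scale].
rewrite (tvecZ hv)// E3 mulr0 subr0 cfE// /c2 extE// y2 mulr1 subrr mul0r addr0.
congr (_ * _); rewrite /El extE// y2 mulr1.
have [_ ->] := hGl l; apply: near_eq_derive.
have := open_nbhs_nbhs (conj chi3_open y3); apply: filterS => z z3.
by rewrite (pullE _ (chi3V z3)) /c2 (extE _ (chi3V z3)) (chi32 z3) mulr1.
Qed.

Lemma derive_cf y l k : chi3 y != 0 -> 'D_(e_ l) (cf k \o phi) y = (l == k)%:R.
Proof.
move=> y3; rewrite -(derive_coordE l k y); apply: near_eq_derive.
by have := open_nbhs_nbhs (conj chi3_open y3); apply: filterS => z z3; rewrite /= cfE.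
Qed.

(** The derivations of the algebra of functions of the coordinates restrict to
  tangent vectors of the manifold. *)
Lemma partial_tangent y l : chi3 y != 0 -> tangent_space (phi y) (fun f => 'D_(e_ l) (f \o phi) y).
Proof.
move=> y3; have df f : smooth_fun f -> derivable (f \o phi) y (e_ l).
  by move=> /smooth_comp_phi/(smooth_onS l)[h _]; apply: h; exact: chi3V.
split=> [a f g hf hg|f g hf hg].
  rewrite (_ : _ \o phi = (a \*: (f \o phi)) + (g \o phi))//.
  rewrite deriveD; [|by apply: derivableZ; exact: df|exact: df].
  by rewrite deriveZ//; exact: df.
rewrite (_ : _ \o phi = (f \o phi) * (g \o phi))// deriveM; [|exact: df|exact: df].
by rewrite -[_ *: _]/(_ * _) -[X in _ + X]/(_ * _) addrC; congr (_ + _); rewrite mulrC.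
Qed.

Section Fields.
Context {r : nat} (X : 'I_r -> vfield M).
Hypothesis hX : forall i, smooth_vfield (X i).

(** Cut off coordinates make these fields smooth and bounded on all of R^n. *)
Definition cfield (i : 'I_r) (l : 'I_n) : vec -> R := pull (X i (cf l)).

Lemma cfield_Bsm i l : Bsm (cfield i l).
Proof. by apply/confined_Bsm/confined_field/cf_confined. Qed.

Definition iterX (w : seq 'I_r) (f : M -> R) : M -> R := foldr X f w.

Lemma iterX_cat u w f : iterX (u ++ w) f = iterX u (iterX w f).
Proof. by rewrite /iterX foldr_cat. Qed.

Lemma iterX_smooth w f : smooth_fun f -> smooth_fun (iterX w f).
Proof. by move=> h; elim: w => [//|i w IH]; exact: (vfield_smooth (hX i)). Qed.

Lemma jet_iterX w y j : chi3 y != 0 -> jet cfield w y 0 j = iterX w (cf j) (phi y).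
Proof.
elim: w y => [|i w IH] y y3; first by rewrite /= cfE.
rewrite mxE /=; have hs := iterX_smooth w (cf_smooth j).
have := tangent_formula y3 (vfield_tangent (phi y) (hX i)) hs; rewrite /value => ->.
apply: eq_bigr => l _; rewrite /cfield pullE; last exact: chi3V.
congr (_ * _); apply: near_eq_derive.
by have := open_nbhs_nbhs (conj chi3_open y3); apply: filterS => z z3; rewrite /= IH.
Qed.

End Fields.

End Patch.

(** * Linear algebra of tangent vectors *)

Section Dimension.
Context {R : realType} {n : nat} {M : smooth_manifold R n}.
Local Notation tvec := (tvec M).

Lemma enum_sum (I : finType) (P : pred I) (F : I -> R) :
  \sum_(i | P i) F i = \sum_(k < #|P|) F (enum_val k).
Proof. by rewrite -big_enum_val. Qed.

Lemma spanP (I : finType) (P : pred I) (B : I -> tvec) v :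
  span_tvec [set B i | i in [set i | P i]] v -> exists c : I -> R, tvec_eq v (lincomb P c B).
Proof.
move=> [N [c [B' [hB hv]]]].
have /boolp.choice[j hj] : forall k, exists i, P i /\ B i = B' k by move=> k; have [i Pi <-] := hB k; exists i.
exists (fun i => \sum_(k | j k == i) c k) => f hf; rewrite hv// /lincomb.
rewrite (partition_big j P) => [|k _]; last by case: (hj k).
apply: eq_bigr => i Pi; rewrite mulr_suml; apply: eq_big => // k /eqP <-.
by case: (hj k) => _ ->.
Qed.

Lemma span_sub (S S' : set tvec) : S `<=` S' -> span_tvec S `<=` span_tvec S'.
Proof. by move=> SS v [N [c [B [hB hv]]]]; exists N, c, B; split=> // k; exact/SS/hB. Qed.

Lemma sub_span (S : set tvec) v : S v -> span_tvec S v.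
Proof.
move=> Sv; exists 1%N, (fun=> 1), (fun=> v); split=> // f hf.
by rewrite /lincomb big_ord1 mul1r.
Qed.

(** Steinitz: a left kernel vector of the matrix of coordinates is a linear
  relation. *)
Lemma free_card (I J : finType) (P : pred I) (Q : pred J) (B : I -> tvec) (B' : J -> tvec) :
  free_family P B -> (forall i, P i -> span_tvec [set B' j | j in [set j | Q j]] (B i)) ->
  (#|P| <= #|Q|)%N.
Proof.
move=> fB hB; rewrite leqNgt; apply/negP => lt.
have /boolp.choice[c hc] : forall k : 'I_#|P|, exists c : J -> R, tvec_eq (B (enum_val k)) (lincomb Q c B').
  by move=> k; apply: spanP; apply: hB; exact: (enum_valP k).
pose A : 'M[R]_(#|P|, #|Q|) := \matrix_(k, l) c k (enum_val l).
have [u u0 uA] : exists2 u : 'rV[R]_#|P|, u != 0 & u *m A = 0.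
  have kA : kermx A != 0.
    by rewrite kermx_eq0 -row_leq_rank -ltnNge (leq_ltn_trans (rank_leq_col A)).
  have [i ri] : exists i, row i (kermx A) != 0.
    apply/existsP; apply: contraNT kA; rewrite negb_exists => /forallP h.
    by apply/eqP/row_matrixP => i; rewrite row0; apply/eqP; move: (h i); rewrite negbK.
  by exists (row i (kermx A)) => //; rewrite -row_mul mulmx_ker row0.
have hd := fB (fun i => \sum_(k | enum_val k == i) u 0 k).
have d0 : tvec_eq (lincomb P (fun i => \sum_(k | enum_val k == i) u 0 k) B) (fun=> 0).
  move=> f hf; rewrite /lincomb (enum_sum P (fun i => (\sum_(k | enum_val k == i) u 0 k) * B i f)).
  transitivity (\sum_k u 0 k * B (enum_val k) f).
    apply: eq_bigr => k _; congr (_ * _); rewrite (bigD1 k)//= big1 ?addr0// => l /andP[/eqP/enum_val_inj ->].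
    by rewrite eqxx.
  under eq_bigr => k _ do rewrite (hc k f hf) /lincomb mulr_sumr (enum_sum Q (fun j => u 0 k * (c k j * B' j f))).
  rewrite exchange_big big1// => l _; transitivity ((u *m A) 0 l * B' (enum_val l) f).
    by rewrite mxE mulr_suml; apply: eq_bigr => k _; rewrite mxE mulrA.
  by rewrite uA mxE mul0r.
case/eqP: u0; apply/rowP => k; rewrite mxE.
have := hd d0 (enum_val k) (enum_valP k); rewrite (bigD1 k)//= big1 ?addr0// => l /andP[/eqP/enum_val_inj ->].
by rewrite eqxx.
Qed.

Lemma basis_enum (I : finType) (P : pred I) (B : I -> tvec) V :
  is_basis P B V -> is_basis predT (fun k : 'I_#|P| => B (enum_val k)) V.
Proof.
move=> [fB sB]; split.
  move=> c hc k _.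
  pose d (i : I) : R := \sum_(l | enum_val l == i) c l.
  have := fB d; move=> /(_ _ (enum_val k) (enum_valP k)); rewrite {2}/d.
  rewrite (bigD1 k)//= big1 ?addr0 => [|l /andP[/eqP/enum_val_inj ->]]; last by rewrite eqxx.
  apply=> f hf; rewrite -(hc f hf) /lincomb (enum_sum P (fun i => d i * B i f)).
  apply: eq_bigr => l _; congr (_ * _); rewrite /d (bigD1 l)//= big1 ?addr0// => m /andP[/eqP/enum_val_inj ->].
  by rewrite eqxx.
rewrite -sB; congr span_tvec; apply/seteqP; split=> v [].
  by move=> k _ <-; exists (enum_val k) => //; exact: (enum_valP k).
by move=> i Pi <-; exists (enum_rank_in Pi i) => //; rewrite enum_rankK_in.
Qed.

Lemma basis_in (I : finType) (P : pred I) (B : I -> tvec) V i : is_basis P B V -> P i -> V (B i).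
Proof. by move=> [_ <-] Pi; apply: sub_span; exists i. Qed.

Lemma dim_basis (I : finType) (P : pred I) (B : I -> tvec) V : is_basis P B V -> dim_tvec V = #|P|.
Proof.
move=> hB; have hB' := basis_enum hB; rewrite /dim_tvec.
case: xgetP => [m _ [B1 hB1]|/(_ #|P|)]; last by case; eexists; exact: hB'.
have le (J K : finType) (B2 : J -> tvec) (B3 : K -> tvec) : is_basis predT B2 V -> is_basis predT B3 V -> (#|J| <= #|K|)%N.
  move=> h2 h3; apply: (free_card h2.1 (B' := B3) (Q := predT)) => j _.
  by have := basis_in h2 (isT : predT j); rewrite -{1}h3.2.
have := le _ _ _ _ hB1 hB'; have := le _ _ _ _ hB' hB1; rewrite !card_ord => h1 h2.
by apply/eqP; rewrite eqn_leq h1 h2.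
Qed.

Lemma tangent_span p (S : set tvec) : (forall v, S v -> tangent_space p v) -> forall v, span_tvec S v ->
  exists2 w, tangent_space p w & tvec_eq v w.
Proof.
move=> hS v [N [c [B [hB hv]]]]; exists (lincomb predT c B) => //.
split=> [a f g hf hg|f g hf hg]; rewrite /lincomb.
  rewrite mulr_sumr -big_split; apply: eq_bigr => k _ /=.
  by rewrite (tvec_lin (hS _ (hB k)))//; ring.
rewrite mulr_suml mulr_sumr -big_split; apply: eq_bigr => k _ /=.
by rewrite (tvecM (hS _ (hB k)))//; ring.
Qed.

End Dimension.

(** * Iterated commutators *)

Section Brackets.
Context {R : realType} {n r : nat} {M : smooth_manifold R n}.
Variable X : 'I_r -> vfield M.
Hypothesis hX : forall i, smooth_vfield (X i).
Local Notation ser := (ser R r).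
Local Notation Z := (iter_commutator X).
Implicit Types (f : M -> R) (p : M) (s a b w : seq 'I_r).

Lemma iter_commutator_cons j s : s != [::] -> Z (j :: s) = commutator (X j) (Z s).
Proof. by case: s. Qed.

Lemma iter_commutator_smooth s : smooth_vfield (Z s).
Proof.
elim: s => [|j [|i s] IH].
- split=> [f _|p]; first exact: smooth_fun_cst.
  by split=> *; rewrite /value /=; ring.
- exact: hX.
- by rewrite iter_commutator_cons//; exact: commutator_smooth.
Qed.

Lemma big_lett_mulr k i (f : ser) (G : seq 'I_r -> R) :
  \sum_(w <- words k.+1) (f * lett i) w * G w = \sum_(w <- words k) f w * G (rcons w i).
Proof.
elim: k f G => [|k IH] f G; rewrite big_words_recl.
  under eq_bigr do rewrite big_seq1; rewrite big_seq1 (bigD1 i)//= big1 => [|j ji].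
    by rewrite addr0; congr (_ * _); rewrite -[LHS]/(f [::] * lett i [:: i] + f [:: i] * lett i [::]) /lett !eqxx mulr1 mulr0 addr0.
  rewrite -[(f * _) _]/(f [::] * lett i [:: j] + f [:: j] * lett i [::]) /lett.
  by rewrite eqseq_cons (negbTE ji) !mulr0 addr0 mul0r.
rewrite [RHS]big_words_recl; apply: eq_bigr => j _.
rewrite -[RHS](IH (fun v => f (j :: v)) (fun v => G (j :: v))).
apply: eq_big_seq => w; rewrite mem_words => /eqP sw; congr (_ * _).
rewrite -[LHS]/(f [::] * lett i (j :: w) + smul (fun v => f (j :: v)) (lett i) w).
by rewrite /lett eqseq_cons; case: w sw => // j' w _; rewrite andbF mulr0 add0r.
Qed.

Lemma big_lett_mull k i (f : ser) (G : seq 'I_r -> R) :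
  \sum_(w <- words k.+1) (lett i * f) w * G w = \sum_(w <- words k) f w * G (i :: w).
Proof.
rewrite big_words_recl (bigD1 i)//= [X in _ + X]big1 => [|j ji].
  by rewrite addr0; apply: eq_bigr => w _; rewrite lettM_cons eqxx mul1r.
by rewrite big1// => w _; rewrite lettM_cons eq_sym (negbTE ji) !mul0r.
Qed.

(** An iterated commutator is the differential operator given by the
  corresponding bracket in the free associative algebra. *)
Lemma iter_commutatorE s f p : smooth_fun f ->
  Z s f p = \sum_(w <- words (size s)) br s w * iterX X w f p.
Proof.
elim: s f p => [|j [|i s] IH] f p hf.
- by rewrite big_seq1 mul0r.
- rewrite big_words_recl (bigD1 j)//= big_seq1 big1 => [|i ij].
    by rewrite addr0 /lett eqxx mul1r.
  by rewrite big_seq1 /lett eqseq_cons eq_sym andbT eq_sym (negbTE ij) mul0r.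
set u := i :: s in IH *; have -> : br (j :: u) = lett j * br u - br u * lett j by [].
rewrite iter_commutator_cons// /commutator.
have hw w : smooth_fun (iterX X w f) by exact: iterX_smooth.
have hj : smooth_fun (X j f) by exact: vfield_smooth.
have -> : Z u f = fun q => \sum_(w <- words (size u)) br u w * iterX X w f q.
  by apply/funext => q; exact: IH.
rewrite (vfield_sum _ _ (hX j))// IH// -[size (j :: u)]/((size u).+1).
under [RHS]eq_bigr => w _ do rewrite -[(_ - _) w]/((lett j * br u) w - (br u * lett j) w) mulrBl.
rewrite [RHS]sumrB big_lett_mull big_lett_mulr; congr (_ - _).
apply: eq_bigr => w _; congr (_ * _).
by rewrite -cats1 iterX_cat.
Qed.

(** By the Jacobi identity, commutators of iterated commutators are
  combinations of right-nested ones. *)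
Lemma bracket_span a b : a != [::] -> b != [::] ->
  exists2 l : seq (R * seq 'I_r), (forall c, c \in l -> size c.2 = size a + size b)%N &
  forall f p, smooth_fun f -> commutator (Z a) (Z b) f p = \sum_(c <- l) c.1 * Z c.2 f p.
Proof.
have sZ := iter_commutator_smooth; have sm s f (hf : smooth_fun f) := vfield_smooth (sZ s) hf.
elim: a b => [//|j [|i a] IH] b _ b0.
  exists [:: (1, j :: b)] => [c|f p hf]; first by rewrite inE => /eqP ->.
  by rewrite big_seq1 mul1r [j :: b]lock /= -lock iter_commutator_cons.
set a' := i :: a in IH *; have a0 : a' != [::] by []; clearbody a'.
have [l1 s1 e1] := IH b a0 b0; have [l2 s2 e2] := IH (j :: b) a0 isT.
exists ([seq (c.1, j :: c.2) | c <- l1] ++ [seq (- c.1, c.2) | c <- l2]) => [c|f p hf].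
  rewrite mem_cat => /orP[/mapP[c' c'l ->]|/mapP[c' c'l ->]] /=; first by rewrite s1.
  by rewrite s2// addnS.
rewrite big_cat !big_map /=; under [X in _ = _ + X]eq_bigr do rewrite mulNr.
rewrite sumrN -e2//.
have -> : \sum_(c <- l1) c.1 * Z (j :: c.2) f p =
    X j (commutator (Z a') (Z b) f) p - commutator (Z a') (Z b) (X j f) p.
  have hj : smooth_fun (X j f) by exact: vfield_smooth.
  rewrite e1// (_ : commutator (Z a') (Z b) f = fun q => \sum_(c <- l1) c.1 * Z c.2 f q); last first.
    by apply/funext => q; exact: e1.
  rewrite (vfield_sum _ _ (hX j)); last by move=> c; exact: sm.
  rewrite -sumrB; apply: eq_big_seq => c cl; rewrite -mulrBr; congr (_ * _).
  have c0 : c.2 != [::] by rewrite -size_eq0 s1// addn_eq0 !size_eq0 (negbTE a0).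
  by rewrite iter_commutator_cons.
rewrite -[LHS]/(commutator (Z (j :: a')) (Z b) f p).
rewrite (iter_commutator_cons j a0) (iter_commutator_cons j b0) /commutator.
have hj : smooth_fun (X j f) by exact: vfield_smooth.
have sj f' : smooth_fun f' -> smooth_fun (X j f') by exact: vfield_smooth.
have dB (V : vfield M) f1 f2 : smooth_vfield V -> smooth_fun f1 -> smooth_fun f2 ->
    V (fun z => f1 z - f2 z) p = V f1 p - V f2 p.
  by move=> hV h1 h2; have := tvecB (vfield_tangent p hV) h1 h2.
have h1 := sm a' _ (sm b _ hf); have h2 := sm b _ (sm a' _ hf).
have h3 := sj _ (sm b _ hf); have h4 := sm b _ hj; have h5 := sj _ (sm a' _ hf); have h6 := sm a' _ hj.
rewrite !dB//; ring.
Qed.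

End Brackets.

(** * Taylor's formula along the flow of a vector field *)

Section Taylor.
Context {R : realType} {n : nat} {M : smooth_manifold R n}.
Variables (A : vfield M).
Hypothesis hA : smooth_vfield A.

(** By induction on [N], applied to the derivative [A f] of [f] along the flow, and
  the mean value theorem. *)
Lemma taylor_flow N (f : M -> R) (C s : R) (c : R -> M) : smooth_fun f -> 0 <= s ->
  (forall p, `|iter N A f p| <= C) ->
  (forall t : R, 0 <= t -> t <= 1 -> velocity c t (fun f => s * A f (c t))) ->
  forall t : R, 0 <= t -> t <= 1 ->
  `|f (c t) - \sum_(m < N) (s * t) ^+ m / m`!%:R * iter m A f (c 0)| <= C * s ^+ N.
Proof.
elim: N f => [|N IH] f hf s0 hC hc t t0 t1; first by rewrite big_ord0 subr0 mulr1; exact: hC.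
have hAf : smooth_fun (A f) by exact: vfield_smooth.
have IH' := IH (A f) hAf s0 _ hc; rewrite /= -iterSr in IH'.
pose p : {poly R} := \poly_(m < N.+1) (s ^+ m / m`!%:R * iter m A f (c 0)).
have pE (u : R) : p.[u] = \sum_(m < N.+1) (s * u) ^+ m / m`!%:R * iter m A f (c 0).
  by rewrite horner_poly; apply: eq_bigr => m _; rewrite exprMn; ring.
have p'E (u : R) : p^`().[u] = s * \sum_(m < N) (s * u) ^+ m / m`!%:R * iter m A (A f) (c 0).
  have -> : p^`() = \poly_(m < N) (s * (s ^+ m / m`!%:R * iter m A (A f) (c 0))).
    apply/polyP => m; rewrite coef_deriv !coef_poly ltnS; case: ifP => _; last by rewrite mul0rn.
    rewrite -mulr_natr factS natrM invfM exprS -iterSr -[iter m.+1 A f]/(A (iter m A f)).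
    by field; rewrite pnatr_eq0 -lt0n fact_gt0 addrC natr1 pnatr_eq0.
  by rewrite horner_poly mulr_sumr; apply: eq_bigr => m _; rewrite exprMn; ring.
pose u (t : R) := f (c t) - p.[t].
have du (v : R) : 0 <= v -> v <= 1 -> is_derive v (1 : R) u
    (s * (A f (c v) - \sum_(m < N) (s * v) ^+ m / m`!%:R * iter m A (A f) (c 0))).
  move=> v0 v1; have h1 := hc v v0 v1 f hf; have h2 := is_derive_poly p v.
  have h := @is_deriveB _ _ _ _ _ _ _ _ _ h1 h2; apply: (is_derive_eq h).
  by rewrite p'E; ring.
have C0 : 0 <= C by exact: le_trans (hC (c 0)).
have [->|tn0] := eqVneq t 0.
  rewrite big_ord_recl big1 => [|m _]; last by rewrite mulr0 expr0n/= !mul0r.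
  by rewrite mulr0 expr0 divr1 mul1r addr0 subrr normr0 mulr_ge0 ?exprn_ge0.
have tp : 0 < t by rewrite lt_neqAle eq_sym tn0.
have uc : {within `[0, t], continuous u}.
  apply: derivable_within_continuous => v; rewrite in_itv /= => /andP[v0 vt].
  by case: (du v v0 (le_trans vt t1)).
have du' (v : R) : v \in `]0, t[ -> is_derive v (1 : R) u
    (s * (A f (c v) - \sum_(m < N) (s * v) ^+ m / m`!%:R * iter m A (A f) (c 0))).
  by rewrite in_itv /= => /andP[v0 vt]; apply: du; [exact: ltW|exact: le_trans (ltW vt) t1].
have [v] := MVT tp du' uc; rewrite in_itv /= => /andP[v0 vt]; rewrite subr0.
have u0 : u 0 = 0.
  rewrite /u pE big_ord_recl big1 => [|m _]; last by rewrite mulr0 expr0n/= !mul0r.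
  by rewrite mulr0 expr0 divr1 mul1r addr0 subrr.
rewrite u0 subr0 /u pE => ->; rewrite !normrM (ger0_norm s0) (ger0_norm t0) exprS.
have v1 : v <= 1 by exact: le_trans (ltW vt) t1.
have hI := IH' hC v (ltW v0) v1.
apply: (@le_trans _ _ (s * (C * s ^+ N))); last by rewrite mulrCA.
rewrite -mulrA ler_wpM2l//; apply: (le_trans (ler_piMr (normr_ge0 _) t1)).
exact: hI.
Qed.

End Taylor.

(** * Polarization *)

Section Polarization.
Context {R : realType}.

Lemma horner_eq0 (Q : {poly R}) : (forall s, Q.[s] = 0) -> Q = 0.
Proof.
move=> h; apply/eqP; apply: contraT => Q0.
pose rs : seq R := [seq i%:R | i <- iota 0 (size Q)].
have h1 : all (root Q) rs by apply/allP => s _; rewrite /root h.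
have h2 : uniq rs by rewrite map_inj_uniq ?iota_uniq// => i j /eqP; rewrite eqr_nat => /eqP.
by have := max_poly_roots Q0 h1 h2; rewrite size_map size_iota ltnn.
Qed.

(** Uniqueness of polynomial expansions at [0]. *)
Lemma small_coef N (b : nat -> R) (C d : R) : 0 < d ->
  (forall s, 0 < s -> s <= d -> `|\sum_(m < N) s ^+ m * b m| <= C * s ^+ N) ->
  forall m, (m < N)%N -> b m = 0.
Proof.
move=> d0; elim: N b => [//|N IH] b hb.
have b0 : b 0%N = 0.
  pose K := `|C| + \sum_(m < N) `|b m.+1|.
  have K0 : 0 <= K by rewrite addr_ge0// sumr_ge0.
  apply/eqP; rewrite -normr_le0; apply/ler_addgt0Pr => e e0; rewrite add0r.
  have K1 : 0 < K + 1 by lra.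
  pose s := Num.min (Num.min d 1) (e / (K + 1)).
  have s0 : 0 < s by rewrite !lt_min d0 ltr01 divr_gt0.
  have sd : s <= d by rewrite !ge_min lexx.
  have s1 : s <= 1 by rewrite !ge_min lexx orbT.
  have se : s * (K + 1) <= e by rewrite -ler_pdivlMr// ge_min lexx orbT.
  have := hb s s0 sd; rewrite big_ord_recl /= expr0 mul1r.
  set S := \sum_(i < N) _ => hS.
  have SK : `|S| <= s * \sum_(m < N) `|b m.+1|.
    apply: (le_trans (ler_norm_sum _ _ _)); rewrite mulr_sumr; apply: ler_sum => m _.
    rewrite normrM ler_wpM2r// ger0_norm ?exprn_ge0 ?(ltW s0)// /fintype.bump add1n exprS.
    by rewrite ler_piMr ?(ltW s0)// exprn_ile1// ltW.
  have CK : C * s ^+ N.+1 <= s * `|C|.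
    rewrite exprS mulrCA ler_wpM2l ?(ltW s0)//; apply: (le_trans (ler_norm _)).
    by rewrite normrM ler_piMr// ger0_norm ?exprn_ge0 ?(ltW s0)// exprn_ile1// ltW.
  have : `|b 0%N| <= `|b 0%N + S| + `|S|.
    by rewrite -{1}(addrK S (b 0%N)); exact: ler_normB.
  have sE : s * (K + 1) = s * `|C| + s * (\sum_(m < N) `|b m.+1|) + s by rewrite /K; ring.
  move=> h; apply: (le_trans h); apply: (le_trans (lerD (le_trans hS CK) SK)).
  by apply: le_trans se; rewrite sE lerDl ltW.
case=> [//|m]; rewrite ltnS => mN; apply: (IH (fun m => b m.+1)) => // s s0 sd.
have := hb s s0 sd; rewrite big_ord_recl /= b0 mulr0 add0r.
have -> : \sum_(i < N) s ^+ fintype.bump 0 i * b (fintype.bump 0 i) = s * \sum_(i < N) s ^+ i * b i.+1.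
  by rewrite mulr_sumr; apply: eq_bigr => i _; rewrite /fintype.bump add1n exprS mulrA.
by rewrite normrM (gtr0_norm s0) exprS mulrCA ler_pM2l.
Qed.

(** A form vanishing identically has vanishing multihomogeneous parts: scale
  one variable at a time and compare coefficients. *)
Lemma multihomogeneous n p (S : seq 'I_n -> R) :
  (forall v : 'rV[R]_n, \sum_(w <- words p) mon v w * S w = 0) ->
  forall K, \sum_(w <- words p | perm_eq K w) S w = 0.
Proof.
move=> hS K.
have main (l : seq 'I_n) : forall v : 'rV[R]_n,
    \sum_(w <- words p | all (fun i => count_mem i w == count_mem i K) l) mon v w * S w = 0.
  elim: l => [|i l IH] v; first exact: hS.
  pose A (w : seq 'I_n) := all (fun i => count_mem i w == count_mem i K) l.
  pose Q : {poly R} := \sum_(w <- words p | A w) (mon v w * S w) *: 'X^(count_mem i w).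
  have Q0 : Q = 0.
    apply: horner_eq0 => s; rewrite -[RHS](IH (\row_j (if j == i then s * v 0 j else v 0 j))) /Q horner_sum.
    apply: eq_bigr => w _; rewrite hornerZ hornerXn mulrAC; congr (_ * _).
    elim: w => [|j w IHw]; first by rewrite /mon !big_nil mul1r.
    rewrite !mon_cons mxE -IHw /=; case: eqVneq => [->|_]; first by rewrite exprS; ring.
    by rewrite add0n mulrA.
  have := congr1 (fun P : {poly R} => P`_(count_mem i K)) Q0.
  rewrite /Q coef_sum coef0 => hc; rewrite -[RHS]hc big_mkcond [RHS]big_mkcond /=.
  apply: eq_bigr => w _; rewrite coefZ coefXn -/(A w) eq_sym.
  by case: (A w); case: eqVneq; rewrite ?mulr1 ?mulr0.
have := main (enum 'I_n) (const_mx 1).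
rewrite (eq_bigl (fun w => perm_eq K w)) => [h|w].
  rewrite -[RHS]h.
  apply: eq_bigr => w _; suff -> : mon (const_mx 1) w = 1 :> R by rewrite mul1r.
  by elim: w => [|i w IH]; [rewrite mon_nil|rewrite mon_cons IH mxE mulr1].
apply/allP/idP => [h|/permP h i _]; last by rewrite eq_sym; apply/eqP/h.
by rewrite /perm_eq; apply/allP => x _ /=; rewrite eq_sym h// mem_enum.
Qed.

(** Invariance under adjacent transpositions implies invariance under permutations,
  on a class of words stable under permutations. *)
Lemma perm_invariant (A : eqType) (T : seq A -> R) (P : seq A -> Prop) :
  (forall u a b w, P (u ++ [:: a, b & w]) -> T (u ++ [:: a, b & w]) = T (u ++ [:: b, a & w])) ->
  (forall L L', perm_eq L L' -> P L -> P L') ->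
  forall u v w, perm_eq u v -> P (w ++ u) -> T (w ++ u) = T (w ++ v).
Proof.
move=> hT hP u; elim: u => [|a u IH] v w uv Pu.
  by move: uv; rewrite perm_sym => /perm_nilP ->.
have av : a \in v by rewrite -(perm_mem uv) mem_head.
case/splitPr: av uv => v1 v2 uv.
have uv' : perm_eq u (v1 ++ v2).
  by rewrite -(perm_cons a); apply: (perm_trans uv); rewrite perm_catC /= perm_cons perm_catC.
have front (w' v' : seq A) : P (w' ++ a :: v' ++ v2) -> T (w' ++ a :: v' ++ v2) = T (w' ++ v' ++ a :: v2).
  elim: v' w' => [//|b v' IHv] w' Pw.
  have /= -> := hT w' a b (v' ++ v2) Pw; rewrite -[_ ++ b :: a :: _]cat_rcons.
  rewrite (IHv (rcons w' b)) ?cat_rcons//.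
  by apply: hP Pw; rewrite perm_cat2l; apply/permP => z /=; rewrite addnCA.
rewrite -front; last first.
  apply: hP Pu; rewrite perm_cat2l; apply: (perm_trans uv).
  by rewrite perm_catC /= perm_cons perm_catC.
by rewrite -!(cat_rcons a); apply: IH; rewrite ?cat_rcons.
Qed.

End Polarization.

(** * The exponential coordinates *)

Section FrameField.
Context {R : realType} {n m : nat} {M : smooth_manifold R n}.
Variable Y : 'I_m -> vfield M.
Hypothesis hY : forall j, smooth_vfield (Y j).

Definition frame_field (v : 'rV[R]_m) : vfield M := fun f p => \sum_j v 0 j * Y j f p.

Lemma frame_field_smooth v : smooth_vfield (frame_field v).
Proof. exact: lincomb_vfield_smooth. Qed.

Lemma iter_frame_field v k f : smooth_fun f -> iter k (frame_field v) f =
  fun p => \sum_(w <- words k) mon v w * iterX Y w f p.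
Proof.
move=> hf; apply/funext => p; elim: k p => [|k IH] p; first by rewrite big_seq1 mon_nil mul1r.
have -> : iter k.+1 (frame_field v) f = frame_field v (iter k (frame_field v) f) by [].
have -> : iter k (frame_field v) f = fun p => \sum_(w <- words k) mon v w * iterX Y w f p by apply/funext.
rewrite /frame_field big_words_recl; apply: eq_bigr => j _.
rewrite (vfield_sum _ _ (hY j)); last by move=> w; exact: iterX_smooth.
by rewrite mulr_sumr; apply: eq_bigr => w _; rewrite mon_cons mulrA.
Qed.

End FrameField.

Section ExpMap.
Context {R : realType} {n : nat} {M : smooth_manifold R n}.
Local Notation vec := 'rV[R]_n.
Variables (P : patch M) (x : M) (Y : 'I_n -> vfield M).
Hypothesis phiE : phi P = exp_map x Y.
Hypothesis Wx : pW P x.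

Lemma flow0 : flow_time_one x Y 0 x.
Proof.
exists 1, (fun=> x); split=> // t _ f hf; rewrite /lincomb big1 => [|j _]; last by rewrite mxE mul0r.
exact: is_derive_cst.
Qed.

Lemma zero_flow z : flow_time_one x Y 0 z -> forall f, smooth_fun f -> f z = f x.
Proof.
move=> [e [c [e0 c0 c1 hc]]] f hf.
have hz : smooth_vfield (fun (_ : M -> R) (_ : M) => 0 : R).
  split=> [g _|p]; first exact: smooth_fun_cst.
  by split=> *; rewrite /value; ring.
have hv (t : R) : 0 <= t -> t <= 1 -> velocity c t (fun f => 1 * 0).
  move=> t0 t1 g hg; rewrite mulr0.
  have := hc t _ g hg; rewrite /lincomb big1 => [|j _]; last by rewrite mxE mul0r.
  by apply; apply/andP; split; lra.
have := taylor_flow (N := 1) (C := 0) hz hf ler01 (fun p => _) hv ler01 (lexx 1).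
rewrite big_ord1 /= expr0 divr1 mul1r c0 c1 mul0r normr0 => /(_ (fun=> lexx 0)).
by rewrite normr_le0 subr_eq0 => /eqP.
Qed.

(** The time-one map is a choice among the end points of flows. A curve of velocity 0
  is constant, since smooth functions are constant along it and separate points
  in the coordinates. *)
Lemma phi0 : phi P 0 = x.
Proof.
have V0 := chi3V (chi3_0 P).
have : flow_time_one x Y 0 (phi P 0).
  by rewrite phiE /exp_map; case: xgetP => [z _ //|/(_ x)]; case; exact: flow0.
move=> /zero_flow h.
have x3 : chi3 P (psi P x) != 0.
  have := h _ (ext_chi3_smooth P); rewrite extE// extW// => <-; exact: chi3_0.
suff : psi P x = 0 by move=> <-; rewrite psiK.
apply/rowP => l; rewrite -(cfE l x3) psiK// -(h _ (cf_smooth P l)).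
by rewrite cfE ?chi3_0.
Qed.

(** Where no flow reaches time one the value of the exponential map is the base
  point, the image of 0, so that injectivity excludes this case. *)
Lemma flow_exists y : pV P y -> flow_time_one x Y y (phi P y).
Proof.
move=> Vy; have : exists z, flow_time_one x Y y z.
  apply: contrapT => nh; have yx : phi P y = x.
    rewrite phiE /exp_map; case: xgetP => // z _ hz.
    by case: nh; exists z.
  have V0 := chi3V (chi3_0 P).
  have y0 : y = 0 by rewrite -(phiK Vy) yx -phi0 (phiK V0).
  by apply: nh; exists x; rewrite y0; exact: flow0.
move=> [z hz]; rewrite phiE /exp_map; case: xgetP => [w _ //|/(_ z)].
by case.
Qed.

Hypothesis hY : forall j, smooth_vfield (Y j).

Local Notation frame_field := (frame_field Y).
Local Notation frame_field_smooth := (frame_field_smooth hY).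

Lemma iter_confined v m f : confined P f -> confined P (iter m (frame_field v) f).
Proof. by move=> h; elim: m => [//|m IH]; exact: (confined_field (frame_field_smooth v)). Qed.

(** Along the flow from the base point to [phi P (s *: v)], Taylor's formula only
  involves derivatives at the base point. *)
Lemma exp_taylor v N f : confined P f -> exists2 C : R, 0 <= C & forall s : R, 0 <= s -> pV P (s *: v) ->
  `|f (phi P (s *: v)) - \sum_(m < N) s ^+ m / m`!%:R * iter m (frame_field v) f x| <= C * s ^+ N.
Proof.
move=> cf; have [C C0 hC] := confined_bounded (iter_confined v N cf); exists C => // s s0 Vs.
have [e [c [e0 c0 c1 hc]]] := flow_exists Vs.
have hv (t : R) : 0 <= t -> t <= 1 -> velocity c t (fun f => s * frame_field v f (c t)).
  move=> t0 t1 g hg; have := hc t _ g hg; rewrite /lincomb /frame_field mulr_sumr.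
  under eq_bigr do rewrite mxE -mulrA.
  by apply; apply/andP; split; lra.
have := taylor_flow (frame_field_smooth v) cf.1 s0 hC hv ler01 (lexx 1).
by rewrite c0 c1 mulr1.
Qed.

Lemma near_ray (v : vec) : exists2 d : R, 0 < d & forall s, `|s| <= d -> chi3 P (s *: v) != 0.
Proof.
have := open_nbhs_nbhs (conj (@chi3_open _ _ _ P) (chi3_0 P : [set y | chi3 P y != 0] 0)).
move=> /(@nbhs_normP R 'rV[R]_n)[d /= d0 hd]; have v1 : 0 < `|v| + 1 by have := normr_ge0 v; lra.
exists (d / 2 / (`|v| + 1)); first by rewrite !divr_gt0.
move=> s hs; apply: hd => /=; rewrite sub0r normrN normrZ.
apply: (@le_lt_trans _ _ (`|s| * (`|v| + 1))); first by rewrite ler_wpM2l// lerDl.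
by move: hs; rewrite ler_pdivlMr// => /le_lt_trans; apply; lra.
Qed.

(** In exponential coordinates the iterated derivatives of the coordinate
  functions along the constant combinations of the frame are those of linear
  functions on straight lines. *)
Lemma exp_coord m k v : iter m (frame_field v) (cf P k) x = if m == 1%N then v 0 k else 0.
Proof.
have [d d0 hd] := near_ray v; have [C C0 hC] := exp_taylor v m.+2 (cf_confined P k).
pose b (i : nat) : R := (if i == 1%N then v 0 k else 0) - iter i (frame_field v) (cf P k) x / i`!%:R.
have hb : forall i, (i < m.+2)%N -> b i = 0.
  apply: (small_coef (C := C) d0) => s s0 sd.
  have s3 : chi3 P (s *: v) != 0 by apply: hd; rewrite gtr0_norm.
  have := hC s (ltW s0) (chi3V s3); rewrite (cfE k s3) mxE.
  suff -> : \sum_(i < m.+2) s ^+ i * b i = s * v 0 k - \sum_(i < m.+2) s ^+ i / i`!%:R * iter i (frame_field v) (cf P k) x by [].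
  have -> : s * v 0 k = \sum_(i < m.+2) (if i == 1%N :> nat then s * v 0 k else 0).
    by rewrite -big_mkcond (big_pred1 (lift ord0 ord0 : 'I_m.+2))// => i; rewrite -val_eqE.
  rewrite -sumrB; apply: eq_bigr => i _; rewrite /b mulrBr; congr (_ - _); last by ring.
  by case: eqP => [->|_]; [rewrite expr1|rewrite mulr0].
have := hb m (ltnW (ltnSn _)); rewrite /b => /eqP; rewrite subr_eq0 => /eqP h.
have f0 : (m`!%:R : R) != 0 by rewrite pnatr_eq0 -lt0n fact_gt0.
have : iter m (frame_field v) (cf P k) x = (if m == 1%N then v 0 k else 0) * m`!%:R by rewrite h divfK.
by move=> ->; case: eqP => [->|_]; [rewrite mulr1|rewrite mul0r].
Qed.

End ExpMap.

(** * Growth, weights and privileged coordinates *)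

Section Frame.
Context {R : realType} {n r : nat} {M : smooth_manifold R n}.
Local Notation vec := 'rV[R]_n.
Local Notation e_ j := (delta_mx 0 j : vec).
Variables (X : 'I_r -> vfield M) (P : patch M) (Y : 'I_n -> vfield M).
Local Notation x := (phi P 0).
Hypothesis r2 : (2 <= r)%N.
Hypothesis hcc : cc_structure X.
Local Notation Z := (iter_commutator X).
Local Notation flag i := (lie_flag X i x).
Local Notation gr i := (growth X x i).
(* The content of [adapted_frame X x Y], with its step. *)
Variable q : nat.
Hypothesis frame_first : forall (i : 'I_r) (j : 'I_n), i = j :> nat -> Y j = X i.
Hypothesis stepP : is_step X x q.
Hypothesis frameP : forall i, (2 <= i <= q)%N ->
    (forall j : 'I_n, (gr i.-1 <= j < gr i)%N -> exists2 s, size s = i & Y j = Z s) /\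
    is_basis [pred j : 'I_n | (j < gr i)%N] (fun j => value (Y j) x) (flag i).

Let hX : forall i, smooth_vfield (X i). Proof. by case: hcc. Qed.
Let hfree : free_family predT (fun i => value (X i) x). Proof. by case: hcc. Qed.
Let sZ := iter_commutator_smooth hX.
Let x3 := chi3_0 P.

Lemma tangent_spanS (S : set (tvec M)) : S `<=` tangent_space x -> span_tvec S `<=` tangent_space x.
Proof.
move=> hS v hv; have [w hw vw] := tangent_span hS hv.
split=> [a f g hf hg|f g hf hg].
  by rewrite !vw ?(tvec_lin hw)//; apply: smooth_fun_add => //; exact: smooth_fun_scale.
by rewrite !vw ?(tvecM hw)//; exact: smooth_fun_mul.
Qed.

(** In a chart the partial derivatives form a basis by [tangent_formula]; this
  identifies the dimension of the tangent spaces defined by derivations. *)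
Lemma partials_basis : is_basis predT (fun (l : 'I_n) f => 'D_(e_ l) (f \o phi P) 0) (tangent_space x).
Proof.
split=> [c hc k _|].
  have := hc _ (cf_smooth P k); rewrite /lincomb (bigD1 k)//= derive_cf// eqxx mulr1.
  by rewrite big1 ?addr0// => l lk; rewrite derive_cf// (negbTE lk) mulr0.
apply/seteqP; split=> [|v hv].
  by apply: tangent_spanS => v [l _ <-]; exact: partial_tangent.
exists n, (fun l => v (cf P l)), (fun l f => 'D_(e_ l) (f \o phi P) 0); split=> [l|f hf].
  by exists l.
exact: (tangent_formula x3 hv hf).
Qed.

Lemma dim_tangent : dim_tvec (tangent_space x) = n.
Proof. by rewrite (dim_basis partials_basis) card_ord. Qed.

Lemma flag_mono i j : (i <= j)%N -> flag i `<=` flag j.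
Proof.
move=> ij; apply: span_sub => v [s /= /andP[s1 si] <-]; exists s => //=.
by rewrite s1 (leq_trans si).
Qed.

Lemma flag_tangent i : flag i `<=` tangent_space x.
Proof. by apply: tangent_spanS => v [s _ <-]; exact: (vfield_tangent x (sZ s)). Qed.

Lemma flag_step i : (q <= i)%N -> flag i = tangent_space x.
Proof.
move=> qi; apply/seteqP; split; first exact: flag_tangent.
by have [<- _] := stepP; exact: flag_mono.
Qed.

Lemma growth_step i : (q <= i)%N -> gr i = n.
Proof. by move=> qi; rewrite /growth flag_step// dim_tangent. Qed.

Lemma basis0 : is_basis pred0 (fun j : 'I_n => value (Y j) x) (flag 0).
Proof.
split=> //; congr span_tvec; apply/seteqP; split=> v []//=.
by move=> s /andP[s0]; rewrite leqn0 => /eqP s1; rewrite s1 in s0.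
Qed.

Lemma flag1E : [set value (Z s) x | s in [set s | (1 <= size s <= 1)%N]] =
  [set value (X i) x | i in [set i | predT i]].
Proof.
apply/seteqP; split=> v.
  by move=> [[|i [|j s]]//= _ <-]; exists i.
by move=> [i _ <-]; exists [:: i].
Qed.

Lemma basis1 : is_basis predT (fun i => value (X i) x) (flag 1).
Proof. by split=> //; rewrite /lie_flag flag1E. Qed.

Lemma growth0 : gr 0 = 0%N.
Proof. by rewrite /growth (dim_basis basis0) card0. Qed.

Lemma growth1 : gr 1 = r.
Proof. by rewrite /growth (dim_basis basis1) card_ord. Qed.

Lemma step_gt0 : (0 < q)%N.
Proof.
rewrite lt0n; apply/eqP => q0; have := growth_step (leqnn q); rewrite q0 growth0 => n0.
have : (#|'I_r| <= #|'I_n|)%N.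
  apply: (free_card hfree (B' := fun (l : 'I_n) f => 'D_(e_ l) (f \o phi P) 0) (Q := predT)) => i _.
  by rewrite partials_basis.2; exact: vfield_tangent.
by rewrite !card_ord -n0 leqn0 => /eqP r0; move: r2; rewrite r0.
Qed.

Lemma flag_basis i : exists (I : finType) (Q : pred I) (B : I -> tvec M), is_basis Q B (flag i).
Proof.
have [qi|iq] := leqP q i; first by rewrite flag_step//; do 3 eexists; exact: partials_basis.
case: i iq => [|[|i]] iq; first by do 3 eexists; exact: basis0.
  by do 3 eexists; exact: basis1.
have [|_ h] := @frameP i.+2; first by apply/andP; split=> //; exact: ltnW.
by do 3 eexists; exact: h.
Qed.

Lemma growth_mono i j : (i <= j)%N -> (gr i <= gr j)%N.
Proof.
move=> ij; have [I [Q [B hB]]] := flag_basis i; have [J [Q' [B' hB']]] := flag_basis j.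
rewrite /growth (dim_basis hB) (dim_basis hB'); apply: (free_card hB.1 (B' := B')) => k Qk.
by rewrite hB'.2; apply: (flag_mono ij); exact: (basis_in hB).
Qed.

Lemma r_le_n : (r <= n)%N.
Proof. by have := growth_mono step_gt0; rewrite growth1 (growth_step (leqnn q)). Qed.

Local Notation wt := (weight X x).

Lemma weight_eq (j : 'I_n) i : (gr i.-1 <= j < gr i)%N -> wt j = i.
Proof.
move=> hi; rewrite /weight; case: xgetP => [i' _ /= hi'|/(_ i)]; last by move/(_ hi).
have lt a b : (gr a.-1 <= j < gr a)%N -> (gr b.-1 <= j < gr b)%N -> ~~ (a < b)%N.
  move=> /andP[_ ja] /andP[jb _]; apply/negP => ab.
  have h : (gr a <= gr b.-1)%N by apply: growth_mono; case: b ab {jb}.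
  by have := leq_trans ja (leq_trans h jb); rewrite ltnn.
by apply/eqP; rewrite eqn_leq leqNgt lt//= leqNgt lt.
Qed.

Lemma weightP (j : 'I_n) : [/\ (0 < wt j)%N, (wt j <= q)%N & (gr (wt j).-1 <= j < gr (wt j))%N].
Proof.
have ex : exists i, (j < gr i)%N by exists q; rewrite growth_step.
case: (ex_minnP ex) => i ji hi.
have i0 : (0 < i)%N by case: i ji {hi} => //; rewrite growth0.
have hj : (gr i.-1 <= j < gr i)%N.
  rewrite ji andbT leqNgt; apply/negP => /hi; case: i i0 {ji hi} => // i _.
  by rewrite /= ltnn.
by rewrite (weight_eq hj); split=> //; apply: hi; rewrite growth_step.
Qed.

Lemma weight_le (j : 'I_n) i : (wt j <= i)%N = (j < gr i)%N.
Proof.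
have [w0 wq /andP[h1 h2]] := weightP j; apply/idP/idP => [wi|ji].
  exact: leq_trans h2 (growth_mono wi).
rewrite leqNgt; apply/negP => iw.
have h : (gr i <= gr (wt j).-1)%N by apply: growth_mono; case: (wt j) iw.
by have := leq_trans ji (leq_trans h h1); rewrite ltnn.
Qed.

Lemma weight_first (j : 'I_n) : (wt j == 1)%N = (j < r)%N.
Proof. by have [w0 _ _] := weightP j; have := weight_le j 1; rewrite growth1 => <-; rewrite eqn_leq w0 andbT. Qed.

Lemma frame_words : exists bw : 'I_n -> seq 'I_r, forall j, size (bw j) = wt j /\ Y j = Z (bw j).
Proof.
suff /boolp.choice[bw hbw] : forall j, exists s, size s = wt j /\ Y j = Z s by exists bw.
move=> j.
have [w0 wq hj] := weightP j; have [w1|w1] := eqVneq (wt j) 1%N.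
  have jr : (j < r)%N by rewrite -weight_first w1.
  by exists [:: Ordinal jr]; rewrite w1; split=> //; exact: frame_first.
have [|h _] := @frameP (wt j); first by rewrite wq andbT ltn_neqAle eq_sym w1.
by have [s s1 s2] := h j hj; exists s.
Qed.

Variable bw : 'I_n -> seq 'I_r.
Hypothesis bwP : forall j, size (bw j) = wt j /\ Y j = Z (bw j).

Lemma frame_smooth j : smooth_vfield (Y j).
Proof. by have [_ ->] := bwP j. Qed.

Lemma bw_neq0 j : bw j != [::].
Proof. by rewrite -size_eq0 (bwP j).1 -lt0n; case: (weightP j). Qed.

(** At the base point an iterated commutator of length [i] is a combination of
  fields of the frame of weight at most [i]. *)
Lemma frame_front s : s != [::] -> exists c : 'I_n -> R,
  tvec_eq (value (Z s) x) (lincomb [pred j | (wt j <= size s)%N] c (fun j => value (Y j) x)).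
Proof.
move=> s0; pose i := minn (size s) q.
have i1 : (0 < i)%N by rewrite leq_min step_gt0 lt0n size_eq0 s0.
have Fi : flag i (value (Z s) x).
  rewrite /i; have [sq|qs] := leqP (size s) q.
    by apply: sub_span; exists s => //=; rewrite leqnn andbT lt0n size_eq0.
  by rewrite flag_step//; exact: vfield_tangent.
have sp : span_tvec [set value (Y j) x | j in [set j : 'I_n | (j < gr i)%N]] (value (Z s) x).
  have [i2|i2] := eqVneq i 1%N.
    rewrite i2 in Fi *; move: Fi; rewrite -basis1.2; apply: span_sub => _ [k _ <-].
    have kn : (k < n)%N by apply: leq_trans r_le_n.
    by exists (Ordinal kn); rewrite /= ?growth1// (@frame_first k).
  have [|_ [_ ->]//] := @frameP i.
  by rewrite geq_minr andbT ltn_neqAle eq_sym i2.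
have [c hc] := spanP sp; exists c => f hf.
rewrite hc// /lincomb big_mkcond [RHS]big_mkcond; apply: eq_bigr => j _ /=.
rewrite -weight_le /i leq_min; have [_ -> _] := weightP j; rewrite andbT.
by case: ifP.
Qed.

(** ** The coordinates are privileged *)

Definition iterZ (L : seq (seq 'I_r)) (f : M -> R) : M -> R := foldr Z f L.

Lemma iterZ_smooth L f : smooth_fun f -> smooth_fun (iterZ L f).
Proof. by move=> h; elim: L => [//|s L IH]; exact: (vfield_smooth (sZ s)). Qed.

Lemma iterZ_cat L L' f : iterZ (L ++ L') f = iterZ L (iterZ L' f).
Proof. exact: foldr_cat. Qed.

Lemma iterZ_sum L (l : seq (R * seq 'I_r)) (F : R * seq 'I_r -> M -> R) : (forall c, smooth_fun (F c)) ->
  iterZ L (fun p => \sum_(c <- l) c.1 * F c p) = fun p => \sum_(c <- l) c.1 * iterZ L (F c) p.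
Proof.
move=> hF; elim: L => [//|s L IH] /=; rewrite [iterZ L _]IH.
by apply: vfield_sum => // c; exact: iterZ_smooth.
Qed.

Lemma iterX_frame K f : iterX Y K f = iterZ (map bw K) f.
Proof. by elim: K => [//|j K IH] /=; rewrite -IH (bwP j).2. Qed.

Let good (L : seq (seq 'I_r)) := all (fun s => s != [::]) L.

Let totp (L L' : seq (seq 'I_r)) : perm_eq L L' -> sumn (map size L) = sumn (map size L').
Proof. by move=> h; rewrite !sumnE !big_map; apply: perm_big. Qed.

Hypothesis phiE : phi P = exp_map x Y.
Let Wx : pW P x. Proof. exact/phiW/chi3V. Qed.

Lemma frame_derivative m k v : iter m (frame_field Y v) (cf P k) x = if m == 1%N then v 0 k else 0.
Proof. exact: (exp_coord phiE Wx frame_smooth). Qed.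

Section Symmetric.
Variables (k : 'I_n) (m p : nat).
Hypothesis mk : (m < wt k)%N.
Local Notation T L := (iterZ L (cf P k) x).
Hypothesis IHm : forall L, good L -> (sumn (map size L) < m)%N -> T L = 0.
Hypothesis IHp : forall L, good L -> sumn (map size L) = m -> (size L < p)%N -> T L = 0.
Let Q L := [/\ good L, sumn (map size L) = m & size L = p].

Let Qperm L L' : perm_eq L L' -> Q L -> Q L'.
Proof.
move=> h [h1 h2 h3]; split; [|by rewrite -(totp h)|by rewrite -(perm_size h)].
by rewrite /good -(perm_all _ h).
Qed.

(** Exchanging two adjacent factors produces their commutator, a combination of
  iterated commutators of the same total length: one factor less, so that the
  induction hypothesis [IHp] applies. *)
Lemma iterZ_perm L L' : perm_eq L L' -> Q L -> T L = T L'.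
Proof.
move=> LL QL; apply: (perm_invariant (T := fun L => T L) (P := Q) _ Qperm (w := [::])) => // u a b w.
move=> [gL tL sL]; move: gL; rewrite /good all_cat /= => /and4P[gu a0 b0 gw].
have hw := iterZ_smooth w (cf_smooth P k).
have [l l1 l2] := bracket_span hX a0 b0.
have Zs s f : smooth_fun f -> smooth_fun (Z s f) by move=> hf; exact: (vfield_smooth (sZ s)).
have e : (fun q => Z a (Z b (iterZ w (cf P k))) q) =
    (fun q => \sum_(c <- (1, b) :: l) c.1 * (if c == (1, b) then Z b (Z a (iterZ w (cf P k))) else Z c.2 (iterZ w (cf P k))) q).
  apply/funext => q'; rewrite big_cons eqxx mul1r; have := l2 (iterZ w (cf P k)) q' hw.
  rewrite /commutator => /eqP; rewrite subr_eq addrC => /eqP ->; congr (_ + _).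
  apply: eq_big_seq => c cl; case: eqP => // cE; exfalso.
  have := l1 c cl; rewrite cE /= => /eqP; rewrite -{1}[size b]add0n eqn_add2r eq_sym size_eq0.
  by rewrite (negbTE a0).
rewrite !iterZ_cat /=.
have -> : Z a (Z b (iterZ w (cf P k))) = (fun q => Z a (Z b (iterZ w (cf P k))) q) by [].
rewrite e iterZ_sum; last by move=> c; case: ifP => _; [exact/Zs/Zs|exact: Zs].
rewrite big_cons eqxx mul1r big_seq big1 ?addr0// => c cl.
case: eqP => [cE|_].
  have := l1 c cl; rewrite cE /= => /eqP; rewrite -{1}[size b]add0n eqn_add2r eq_sym size_eq0.
  by rewrite (negbTE a0).
have -> : iterZ u (Z c.2 (iterZ w (cf P k))) x = T (u ++ c.2 :: w) by rewrite iterZ_cat.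
rewrite IHp ?mulr0//.
- by rewrite /good all_cat /= gu gw andbT -size_eq0 l1// addn_eq0 size_eq0 (negbTE a0).
- by rewrite -tL !map_cat !sumn_cat /= l1// -!addnA.
- by rewrite -sL !size_cat /= ltn_add2l.
Qed.

(** The case of products of fields of the frame is obtained by polarization of
  the powers of constant combinations of the frame. *)
Lemma iterZ_frame K : Q (map bw K) -> T (map bw K) = 0.
Proof.
move=> QK; have [_ tK sK] := QK; rewrite size_map in sK.
case: (ltngtP p 1%N) => [p0|p1|p1].
- move: sK; have -> : p = 0%N by case: p p0 {QK} => [|[]].
  by move=> /size0nil ->; rewrite /= cfE ?mxE.
- pose S (w : seq 'I_n) := iterX Y w (cf P k) x.
  have hS (v : vec) : \sum_(w <- words p) mon v w * S w = 0.
    have := frame_derivative p k v; rewrite (iter_frame_field frame_smooth _ _ (cf_smooth P k)) => ->.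
    by case: eqP p1 => // ->.
  have h := multihomogeneous hS K.
  have : \sum_(w <- words p | perm_eq K w) S w = S K *+ count (perm_eq K) (words p).
    transitivity (\sum_(w <- words p | perm_eq K w) S K); last by rewrite big_const_seq iter_addr_0.
    apply: eq_bigr => w Kw; rewrite /S !iterX_frame; apply/esym.
    by apply: iterZ_perm => //; exact: perm_map.
  rewrite h => /esym/eqP; rewrite mulrn_eq0 => /orP[|/eqP]; last by rewrite /S iterX_frame.
  rewrite eqn0Ngt -has_count => /negP[]; apply/hasP; exists K => //.
  by rewrite mem_words sK.
- move: sK tK; rewrite p1; case: K QK => [//|j [|//]] _ _ /=; rewrite addn0 => tj.
  have kj : k != j by apply: contraTN mk => /eqP ->; rewrite -tj (bwP j).1 ltnn.
  have := frame_derivative 1 k (e_ j); rewrite /= mxE eqxx (negbTE kj) => h; rewrite -[RHS]h.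
  rewrite /frame_field (bigD1 j)//= mxE !eqxx mul1r (bwP j).2 big1 ?addr0// => i ij.
  by rewrite mxE (negbTE ij) andbF mul0r.
Qed.

(** Bring a factor outside of the frame to the front, where its value at the base
  point is a combination of fields of the frame, of weight at most its length:
  smaller total length is covered by [IHm], and equal length leaves one factor
  less outside of the frame. *)
Lemma iterZ_vanish L K : Q (map bw K ++ L) -> T (map bw K ++ L) = 0.
Proof.
elim: L K => [|a L IH] K QL; first by rewrite cats0 in QL *; exact: iterZ_frame.
have pe : perm_eq (map bw K ++ a :: L) (a :: map bw K ++ L).
  by rewrite perm_catC /= perm_cons perm_catC.
rewrite (iterZ_perm pe QL); have [/= /andP[a0 gL] tL sL] := Qperm pe QL.
have [c hc] := frame_front a0.
have hs := iterZ_smooth (map bw K ++ L) (cf_smooth P k).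
have := hc _ hs; rewrite /value /= => ->; rewrite /lincomb big1// => j wj.
rewrite (_ : Y j _ x = T (bw j :: map bw K ++ L)); last by rewrite (bwP j).2.
suff -> : T (bw j :: map bw K ++ L) = 0 by rewrite mulr0.
have gj : good (bw j :: map bw K ++ L) by rewrite /good /= bw_neq0.
have := wj : (wt j <= size a)%N; rewrite leq_eqVlt => /orP[/eqP wj'|wj']; last first.
  by apply: IHm => //; rewrite -tL /= ltn_add2r (bwP j).1.
rewrite -[_ :: _]/(map bw (j :: K) ++ L); apply: IH; split=> //=.
by rewrite (bwP j).1 wj'.
Qed.

End Symmetric.

(** The coordinate of weight [w] vanishes to order [w]: a product of iterated
  commutators of total length less than [w] may be rearranged, and its first
  factor replaced by fields of the frame, up to shorter or fewer factors. *)
Lemma iterZ_privileged k L : good L -> (sumn (map size L) < wt k)%N -> iterZ L (cf P k) x = 0.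
Proof.
move: {2}(sumn _) (erefl (sumn (map size L))) => m.
elim/ltn_ind: m L => m IHm L; move: {2}(size L) (erefl (size L)) => p.
elim/ltn_ind: p L => p IHp L sL tL gL; rewrite tL => mk.
apply: (@iterZ_vanish k m p mk _ _ L [::]) => // [L' g' t'|L' g' t' s'].
  by apply: (IHm _ t') => //; exact: ltn_trans mk.
by apply: (IHp _ s') => //; rewrite t'.
Qed.

Lemma privileged_words k (w : seq 'I_r) : (size w < wt k)%N -> iterX X w (cf P k) x = 0.
Proof.
have E f : iterX X w f = iterZ [seq [:: i] | i <- w] f by elim: w => [//|i w /= ->].
have s1 : sumn (map size [seq [:: i] | i <- w]) = size w by elim: w {E} => [//|i w /= ->].
move=> hw; rewrite E; apply: iterZ_privileged; rewrite ?s1//.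
by apply/allP => _ /mapP[i _ ->].
Qed.

(** ** The nilpotent approximation along a horizontal direction *)

Local Notation Phi := (jet (cfield P X)).

(** By [iter_commutatorE] the bracket of [bw k] evaluates to the field [Y k] of the
  frame, which is the partial derivative [k] at the origin of exponential
  coordinates. *)
Lemma bracket_frame k : \sum_(w <- words (size (bw k))) br (bw k) w *: Phi w 0 = e_ k.
Proof.
apply/rowP => j; rewrite summxE mxE eqxx /=.
under eq_bigr do rewrite mxE (jet_iterX hX _ _ x3).
rewrite -(iter_commutatorE hX _ _ (cf_smooth P j)) -(bwP k).2.
have := frame_derivative 1 j (e_ k); rewrite /= mxE eqxx /= => <-.
rewrite /frame_field (bigD1 k)//= mxE !eqxx mul1r big1 ?addr0// => i ik.
by rewrite mxE (negbTE ik) andbF mul0r.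
Qed.

Lemma privileged_jet j w : (size w < wt j)%N -> Phi w 0 0 j = 0.
Proof. by move=> h; rewrite (jet_iterX hX _ _ x3) privileged_words. Qed.

(** The coordinates in the frame of the combination [c] of the fields [X], which are
  its first [r] fields. *)
Definition lift_ctrl (c : 'rV[R]_r) : vec := \row_j \sum_(i < r | i == j :> nat) c 0 i.

Lemma lift_field c : frame_field Y (lift_ctrl c) = frame_field X c.
Proof.
apply/funext => f; apply/funext => p; rewrite /frame_field.
transitivity (\sum_(j < n) \sum_(i < r | i == j :> nat) c 0 i * X i f p).
  apply: eq_bigr => j _; rewrite mxE mulr_suml; apply: eq_bigr => i /eqP ij.
  by rewrite (frame_first ij).
rewrite (exchange_big_dep predT)//=; apply: eq_bigr => i _.
by rewrite (big_pred1 (widen_ord r_le_n i))// => j; rewrite -val_eqE /= eq_sym.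
Qed.

Lemma lift_weight c j : wt j != 1%N -> lift_ctrl c 0 j = 0.
Proof.
rewrite weight_first -leqNgt => rj; rewrite mxE big_pred0// => i.
by apply/negbTE; rewrite neq_ltn (leq_trans (ltn_ord i) rj).
Qed.

Lemma lift_ctrlZ t c : lift_ctrl (t *: c) = t *: lift_ctrl c.
Proof. by apply/rowP => j; rewrite !mxE mulr_sumr; apply: eq_bigr => i _; rewrite mxE. Qed.

Lemma iter_fieldZ m t c f p : smooth_fun f ->
  iter m (frame_field X (t *: c)) f p = t ^+ m * iter m (frame_field X c) f p.
Proof.
move=> hf; rewrite !(iter_frame_field hX _ _ hf) mulr_sumr; apply: eq_big_seq => w.
by rewrite mem_words => /eqP wm; rewrite monZ wm mulrA.
Qed.

Lemma ctrl_derivative m c j : iter m (frame_field X c) (cf P j) x = if m == 1%N then lift_ctrl c 0 j else 0.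
Proof. by rewrite -lift_field frame_derivative. Qed.

(** [ray] is the derivative of order [wt j] of a coordinate along a constant
  combination of the frame, up to the factorial: it vanishes for [wt j <> 1]. *)
Lemma ray_frame c j : ray Phi wt c j = lift_ctrl c 0 j.
Proof.
transitivity (iter (wt j) (frame_field X c) (cf P j) x / (wt j)`!%:R).
  rewrite (iter_frame_field hX _ _ (cf_smooth P j)) /ray mulr_suml; apply: eq_big_seq => w.
  by rewrite mem_words => /eqP wm; rewrite (jet_iterX hX _ _ x3) /sexp wm mulrAC.
rewrite ctrl_derivative; case: eqVneq => [->|/lift_weight ->]; first by rewrite divr1.
by rewrite mul0r.
Qed.

Lemma coefficientsE i y : chi3 P y != 0 -> coefficients x Y (X i) y = \row_j X i (cf P j) (phi P y).
Proof.
move=> y3; rewrite /coefficients -phiE.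
have ex : forall f, smooth_fun f -> X i f (phi P y) =
    \sum_j (\row_j X i (cf P j) (phi P y)) ord0 j * 'D_(e_ j) (f \o phi P) y.
  move=> f hf; have := tangent_formula y3 (vfield_tangent (phi P y) (hX i)) hf; rewrite /value => ->.
  by apply: eq_bigr => j _; rewrite mxE.
case: xgetP => [a _ ha|/(_ _ ex)//]; apply/rowP => j; rewrite mxE.
rewrite (ha _ (cf_smooth P j)) (bigD1 j)//= derive_cf// eqxx mulr1 big1 ?addr0// => l lj.
by rewrite derive_cf// (negbTE lj) mulr0.
Qed.

Lemma dilation_lift l c : dilation X x l (lift_ctrl c) = l *: lift_ctrl c.
Proof.
apply/rowP => j; rewrite !mxE; case: (eqVneq (wt j) 1%N) => [->|h]; first by rewrite expr1.
by have := lift_weight c h; rewrite mxE => ->; rewrite !mulr0.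
Qed.

(** By Taylor's formula, the terms of low order vanishing because the
  coordinates are privileged. *)
Lemma nilpotent_coefficient_lift i j c : nilpotent_coefficient X x Y i j (lift_ctrl c) =
  iter (wt j).-1 (frame_field X c) (X i (cf P j)) x / ((wt j).-1)`!%:R.
Proof.
have [w0 _ _] := weightP j; set f := X i (cf P j); set m := (wt j).-1.
have wm : wt j = m.+1 by rewrite /m prednK.
have cf_ : confined P f by apply: confined_field => //; exact: cf_confined.
have [C C0 hC] := exp_taylor phiE Wx frame_smooth (lift_ctrl c) m.+1 cf_.
have [d d0 hd] := near_ray P (lift_ctrl c).
rewrite lift_field in hC; set b := iter m (frame_field X c) f x.
have low k : (k < m)%N -> iter k (frame_field X c) f x = 0.
  move=> km; rewrite (iter_frame_field hX _ _ cf_.1) big_seq big1// => w; rewrite mem_words => /eqP wk.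
  have -> : iterX X w f x = iterX X (rcons w i) (cf P j) x by rewrite -cats1 iterX_cat.
  by rewrite privileged_words ?mulr0// size_rcons wk wm.
rewrite /nilpotent_coefficient; apply: cvg_lim => //.
apply/(@cvgrPdist_le R R^o) => e e0; have C1 : 0 < C + 1 by lra.
near=> l.
have l0 : 0 < l by near: l; exact: nbhs_right_gt.
have ld : l <= d by near: l; exact: nbhs_right_le.
have le : l <= e / (C + 1) by near: l; apply: nbhs_right_le; rewrite divr_gt0.
have l3 : chi3 P (l *: lift_ctrl c) != 0 by apply: hd; rewrite gtr0_norm.
rewrite dilation_lift coefficientsE// mxE -/f.
have -> : (l ^ (1 - (wt j)%:Z) : R) = l ^- m.
  by rewrite wm (_ : 1 - m.+1%:Z = - m%:Z) ?exprnN//; lia.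
have := hC l (ltW l0) (chi3V l3); rewrite big_ord_recr /= -/b big1 => [|k _]; last by rewrite low ?mulr0.
rewrite add0r => h.
have lm : 0 < l ^+ m by rewrite exprn_gt0.
have -> : b / m`!%:R - l ^- m * f (phi P (l *: lift_ctrl c)) =
   - (l ^- m * (f (phi P (l *: lift_ctrl c)) - l ^+ m / m`!%:R * b)).
  have aux (B F L K : R) : L != 0 -> K != 0 -> B / K - L^-1 * F = - (L^-1 * (F - L / K * B)).
    by move=> L0 K0; field; rewrite L0 K0.
  by apply: aux; rewrite ?gt_eqF// ltr0n fact_gt0.
rewrite normrN normrM ger0_norm ?invr_ge0 ?(ltW lm)// mulrC ler_pdivrMr//.
apply: (le_trans h); rewrite exprS mulrCA mulrA mulrC [leRHS]mulrC ler_wpM2l ?(ltW lm)//.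
have le' : l * (C + 1) <= e by rewrite -ler_pdivlMr.
by apply: (le_trans _ le'); rewrite mulrDr mulr1 mulrC lerDl ltW.
Unshelve. all: by end_near. Qed.

Lemma iter_field_sum m c f (s : seq 'I_r) (a : 'I_r -> R) (F : 'I_r -> M -> R) : (forall i, smooth_fun (F i)) ->
  f = (fun p => \sum_(i <- s) a i * F i p) ->
  iter m (frame_field X c) f = fun p => \sum_(i <- s) a i * iter m (frame_field X c) (F i) p.
Proof.
have hA := frame_field_smooth hX c.
move=> hF ->; elim: m => [//|m IH]; rewrite iterS IH vfield_sum//.
by move=> i; rewrite /=; elim: (m) => [|k IHk]; [exact: hF|exact: (vfield_smooth hA IHk)].
Qed.

(** The combination of the coefficients is the derivative of order [wt j] of the
  coordinate [j] along a constant combination of the frame. *)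
Lemma nilpotent_sum t (c : 'rV[R]_r) j :
  \sum_i c 0 i * nilpotent_coefficient X x Y i j (t *: lift_ctrl c) = lift_ctrl c 0 j.
Proof.
have [w0 _ _] := weightP j.
have hF i : smooth_fun (X i (cf P j)) by apply: vfield_smooth => //; exact: cf_smooth.
transitivity (t ^+ (wt j).-1 / ((wt j).-1)`!%:R *
    \sum_i c 0 i * iter (wt j).-1 (frame_field X c) (X i (cf P j)) x).
  rewrite mulr_sumr; apply: eq_bigr => i _.
  rewrite -lift_ctrlZ nilpotent_coefficient_lift iter_fieldZ//.
  by have aux (a b u w : R) : a * (b * u * w) = b * w * (a * u) by [ring]; exact: aux.
have := iter_field_sum (wt j).-1 c hF (erefl (frame_field X c (cf P j))).
move=> /(congr1 (fun g => g x)) <-; rewrite -iterSr prednK// ctrl_derivative.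
by case: eqVneq => [->|/lift_weight ->]; rewrite ?mul0r ?mulr0 ?divr1 ?mul1r.
Qed.

Lemma ray_horizontal c : horizontal_line X x Y (fun t => t *: lift_ctrl c : euclidean R n).
Proof.
split; first by exists 0; rewrite scale0r.
exists c; split.
- move=> t d _ -> _; exists setT; first exact: filterT.
  split=> //; exists `|lift_ctrl c|; split; first exact: num_real.
  move=> K hK [u v] _ /=; rewrite -scalerBl normrZ mulrC ler_wpM2r//; exact: ltW.
- move=> i; split; first exact: measurable_cst.
  by exists `|c ord0 i|; apply: aeW.
- apply: aeW => t _ f hf.
  have sf : smooth_on (setT : set vec) f.
    by have := hf (@id_chart R n) erefl; rewrite /= image_id.
  have hC : C1at f (t *: lift_ctrl c) by apply: (@Ck_C1at _ _ 0 setT); [exact: openT|exact: sf|].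
  have dk (j : 'I_n) : is_derive t (1 : R) (fun s : R => (s *: lift_ctrl c) 0 j) (lift_ctrl c 0 j).
    apply/is_deriveP => e e0; exists 1 => // h _.
    by rewrite !mxE (_ : _ - _ = 0) ?normr0 ?mulr_ge0 ?(ltW e0)//; ring.
  have h := chain_curve hC dk; apply: (is_derive_eq h).
  rewrite /lincomb /value /nilpotent_field.
  under [RHS]eq_bigr do rewrite mulr_sumr; rewrite exchange_big; apply: eq_bigr => j _.
  under [RHS]eq_bigr do rewrite mulrA.
  by rewrite -mulr_suml nilpotent_sum.
Qed.

End Frame.

(** ** Existence of cutoff functions *)

(** The dilation factor [n.+1] lost by each cutoff makes the three of them nested. *)
Lemma patch_exists (R : realType) (n : nat) (M : smooth_manifold R n) V W (f : 'rV[R]_n -> M) g :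
  @diffeomorphism R n n (euclidean R n) M V W f g -> V 0 ->
  exists P : patch M, [/\ pV P = V, pW P = W, phi P = f & psi P = g].
Proof.
move=> hd V0; have oV : open V by case: hd.
have /(@nbhs_normP R 'rV[R]_n)[D0 /= D00 hD0] := open_nbhs_nbhs (conj oV V0).
pose D := D0 / 2; have Dp : 0 < D by rewrite divr_gt0.
have hD (y : 'rV[R]_n) : `|y| <= D -> V y.
  by move=> yD; apply: hD0; rewrite /= sub0r normrN (le_lt_trans yD)// /D; lra.
have D1 : 0 < D / n.+1%:R by rewrite divr_gt0.
have D2 : 0 < D / n.+1%:R / n.+1%:R by rewrite divr_gt0.
have [c1 [s1 a1 b1]] := @bump R n 0 _ Dp; have [c2 [s2 a2 b2]] := @bump R n 0 _ D1.
have [c3 [s3 a3 b3]] := @bump R n 0 _ D2.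
have step (c c' : 'rV[R]_n -> R) (E : R) : (forall y, `|y - 0| <= E -> c y = 1) ->
    (forall y, E <= `|y - 0| -> c' y = 0) -> forall y, c' y != 0 -> c y = 1.
  move=> h1 h2 y; have [yE _|/ltW/h2 ->] := leP `|y - 0| E; [exact: h1|by rewrite eqxx].
have c30 : c3 0 != 0 by rewrite a3 ?oner_eq0// subrr normr0 divr_ge0// ltW.
have b1' (y : 'rV[R]_n) : D <= `|y| -> c1 y = 0 by move=> h; apply: b1; rewrite subr0.
by exists (Patch hd hD s1 s2 s3 b1' (step _ _ _ a1 b2) (step _ _ _ a2 b3) c30).
Qed.

(** * Horizontal curves *)

Section Paths.
Context {R : realType}.
Local Notation mu := (@lebesgue_measure R).

Lemma aeS (P Q : R -> Prop) : (forall t, P t -> Q t) -> {ae mu, forall t, P t} -> {ae mu, forall t, Q t}.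
Proof. by move=> PQ; apply: filterS => //; exact: (ae_filter_ringOfSetsType mu). Qed.

Lemma aeS2 (P1 P2 Q : R -> Prop) : (forall t, P1 t -> P2 t -> Q t) ->
  {ae mu, forall t, P1 t} -> {ae mu, forall t, P2 t} -> {ae mu, forall t, Q t}.
Proof. by move=> PQ; apply: filterS2 => //; exact: (ae_filter_ringOfSetsType mu). Qed.

Lemma ae_forall (I : finType) (P : I -> R -> Prop) :
  (forall i, {ae mu, forall t, P i t}) -> {ae mu, forall t, forall i, P i t}.
Proof. by move=> hP; apply: filter_forall => //; exact: (ae_filter_ringOfSetsType mu). Qed.

(** Clamping the control to [[-1, 1]] makes it bounded everywhere without changing
  it almost everywhere; the primitive is 1-Lipschitz and has the control as
  derivative at its Lebesgue points. *)
Lemma int_path (a b : R) (h : R -> R) : a < b -> measurable_fun `[a, b] h ->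
  {ae mu, forall t, a <= t <= b -> `|h t| <= 1} -> exists x : R -> R,
  (forall s t, a <= s -> s <= t -> t <= b -> `|x t - x s| <= t - s) /\
  {ae mu, forall t, a < t < b -> is_derive t (1 : R) x (h t)}.
Proof.
move=> ab mh hb; pose k0 u := clamp (-1) 1 (h u).
have k01 u : `|k0 u| <= 1.
  have N1 : -1 <= 1 :> R by lra.
  by have [h1 h2] := clampP (h u) N1; rewrite ler_norml h1.
have mI : measurable (`[a, b]%classic : set R) by exact: measurable_itv.
have mk0 : measurable_fun `[a, b] k0.
  by apply: measurable_maxr; [exact: measurable_cst|apply: measurable_minr => //; exact: measurable_cst].
pose k := k0 \_ `[a, b]%classic.
have k1 u : `|k u| <= 1.
  by rewrite /k patchE; case: ifP => _; [exact: k01|rewrite normr0].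
have mk : measurable_fun setT k by apply/(measurable_restrictT _ mI).
have ik : mu.-integrable setT (EFin \o k).
  have : mu.-integrable `[a, b] (EFin \o k0).
    apply: measurable_bounded_integrable => //.
      have mE : mu `[a, b]%classic = (b - a)%:E by rewrite lebesgue_measure_itv /= lte_fin ab EFinB.
      by rewrite -[X in (X < _)%E]/(mu `[a, b]%classic) mE ltry.
    exists 1; split; first exact: num_real.
    by move=> M M1 u _ /=; exact: le_trans (k01 u) (ltW M1).
  move=> hi; have [h1 _] := @integrable_mkcond _ _ _ mu `[a, b]%classic (EFin \o k0) mI.
  by have := h1 hi; rewrite restrict_EFin.
have ikD D : measurable D -> mu.-integrable D (EFin \o k).
  by move=> mD; exact: integrableS ik.
exists (fun u => \int[mu]_(t in `]a, u]) k t); split.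
  move=> s t as_ st tb; rewrite Rintegral_itvB ?bnd_simp//; last by apply: ikD; exact: measurable_itv.
  have mJ : measurable (`]s, t]%classic : set R) by exact: measurable_itv.
  have hn := @le_normr_Rintegral _ _ _ mu _ _ mJ (ikD _ mJ); apply: (le_trans hn).
  have le1 : (\int[mu]_(u in `]s, t]) (`|k u|%:E) <= \int[mu]_(u in `]s, t]) (cst 1%:E) u)%E.
    apply: ge0_le_integral => //.
    - by apply/measurable_EFinP; apply: measurableT_comp => //; exact: measurable_funTS.
    - by move=> u _; rewrite lee_fin.
  have cE : (\int[mu]_(u in `]s, t]) (cst 1%:E) u)%E = (t - s)%:E.
    rewrite integral_cst//= mul1e lebesgue_measure_itv /= lte_fin.
    have [<-|st'] := eqVneq s t; first by rewrite ltxx subrr.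
    by rewrite lt_neqAle st' st EFinB.
  rewrite cE in le1; rewrite /Rintegral -lee_fin fineK//; rewrite ge0_fin_numE.
    exact: le_lt_trans le1 (ltry _).
  by apply: integral_ge0 => u _; rewrite lee_fin.
have := FTC1 (a := BRight a) (fun y => ikD _ (measurable_itv _)) (open_integrable_locally openT (ikD _ measurableT)).
move=> hF; apply: aeS2 hb hF => t ht h1 /andP[at_ tb].
have [|dF FE] := h1; first by rewrite ?bnd_simp.
split=> //; rewrite -derive1E FE /k patchE ifT; last by rewrite inE /= in_itv /= !ltW.
have := ht (introT andP (conj (ltW at_) (ltW tb))); rewrite ler_norml => /andP[h2 h3].
by rewrite /k0 clamp_id.
Qed.

Context {r : nat}.
Local Notation enorm := (@euclidean_norm R r).

(** The coordinates of the path are primitives of the controls; its speed being 1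
  almost everywhere, the mean value inequality in the direction of an increment
  bounds the increment. *)
Lemma arclength_path (a b : R) (h : R -> 'rV[R]_r) : a < b ->
  (forall i, measurable_fun `[a, b] (fun t => h t ord0 i)) ->
  {ae mu, forall t, a <= t <= b -> enorm (h t) = 1} -> exists x : R -> 'rV[R]_r,
  lip1 x /\ {ae mu, forall t, a < t < b -> forall i, is_derive t (1 : R) (fun u => x u 0 i) (h t 0 i)}.
Proof.
move=> ab mh h1; have ab' := ltW ab.
have hb i : {ae mu, forall t, a <= t <= b -> `|h t ord0 i| <= 1}.
  by apply: aeS h1 => t ht tI; rewrite -(ht tI) coord_le_enorm.
have /boolp.choice[xi hxi] : forall i : 'I_r, exists x : R -> R,
    (forall s t, a <= s -> s <= t -> t <= b -> `|x t - x s| <= t - s) /\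
    {ae mu, forall t, a < t < b -> is_derive t (1 : R) x (h t ord0 i)}.
  by move=> i; exact: int_path (mh i) (hb i).
have hd : {ae mu, forall t, forall i : 'I_r, a < t < b -> is_derive t (1 : R) (xi i) (h t ord0 i)}.
  by apply: ae_forall => i; case: (hxi i).
exists (fun u => \row_i xi i (clamp a b u)); split.
  move=> s t st; have [as_ sb] := clampP s ab'; have [at_ tb] := clampP t ab'.
  have st' := clamp_mono a b st; apply: le_trans (clamp_lip ab' st).
  set s' := clamp a b s in as_ sb st' *; set t' := clamp a b t in at_ tb st' *.
  set D := \row_i xi i t' - _; pose F u := \sum_i D 0 i * xi i u.
  have DE i : D 0 i = xi i t' - xi i s' by rewrite !mxE.
  have FK : forall u v, s' <= u -> u <= v -> v <= t' -> `|F v - F u| <= (\sum_i `|D 0 i|) * (v - u).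
    move=> u v su uv vt; rewrite /F -sumrB mulr_suml; apply: (le_trans (ler_norm_sum _ _ _)).
    apply: ler_sum => i _; rewrite -mulrBr normrM ler_wpM2l//.
    by apply: (hxi i).1 => //; [exact: le_trans su|exact: le_trans tb].
  have Fd : {ae mu, forall u, s' < u < t' -> exists2 d : R, is_derive u (1 : R) F d & `|d| <= enorm D}.
    apply: aeS2 hd h1 => u hu h1u /andP[su ut].
    have uI : a < u < b by rewrite (le_lt_trans as_ su) (lt_le_trans ut tb).
    exists (\sum_i D 0 i * h u 0 i).
      apply: is_derive_bigsum => i; have d1 := hu i uI.
      exact: is_deriveZ.
    have e1 : enorm (h u) = 1 by apply: h1u; case/andP: uI => /ltW -> /ltW ->.
    have := cauchy_schwarz D (h u); have := cauchy_schwarz (-1 *: D) (h u).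
    rewrite dotpZl enormZ normrN1 e1 mul1r !mulr1 mulN1r lerNl => h2 h3.
    by rewrite ler_norml; apply/andP; split.
  have := lipschitz_mean_value st' (sumr_ge0 _ (fun i _ => normr_ge0 _)) (enorm_ge0 D) FK Fd.
  have -> : F t' - F s' = enorm D ^+ 2.
    by rewrite enorm_sqr /F -sumrB; apply: eq_bigr => i _; rewrite -mulrBr -DE.
  rewrite ger0_norm ?sqr_ge0// expr2.
  have [->|D0] := eqVneq (enorm D) 0; first by rewrite subr_ge0.
  by rewrite ler_pM2l// lt_neqAle eq_sym D0 enorm_ge0.
apply: aeS hd => t ht tI i; have d1 := ht i tI.
apply: (near_eq_is_derive _ d1); apply: filterS (near_clamp tI) => u uE.
by rewrite mxE uE.
Qed.

End Paths.

Section CurveLipschitz.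
Context {R : realType} {n : nat} {M : smooth_manifold R n}.
Local Notation vec := 'rV[R]_n.
Local Notation coord := Defs.coord.

Lemma C1at_lip (G : vec -> R) (y : vec) : C1at G y -> exists d K : R, [/\ 0 < d, 0 <= K &
  forall z z', `|z - y| <= d -> `|z' - y| <= d -> `|G z' - G z| <= K * `|z' - z|].
Proof.
move=> /(_ 1 ltr01)[d d0 hd]; pose K := \sum_j (`|'D_(delta_mx 0 j) G y| + 1).
have K0 : 0 <= K by apply: sumr_ge0 => j _; rewrite addr_ge0.
exists (d / 3), K; split=> //; first by rewrite divr_gt0.
move=> z z' zd zd'; have zz : `|z' - z| <= d / 3 + d / 3.
  by rewrite -(subrKA y); apply: (le_trans (ler_normD _ _)); apply: lerD => //; rewrite distrC.
have near w : `|w - z| <= `|z' - z| -> `|w - y| <= d.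
  move=> wz; rewrite -(subrKA z); apply: (le_trans (ler_normD _ _)).
  by apply: (le_trans (lerD (le_trans wz zz) zd)); lra.
have [|xi hxi] := @grad_mvt R n G z (z' - z); last first.
  rewrite [z + _]addrC subrK => ->; apply: (le_trans (ler_norm_sum _ _ _)).
  rewrite /K mulr_suml; apply: ler_sum => j _; rewrite normrM mulrC; apply: ler_pM => //; last exact: coord_le_mnorm.
  have [_ h] := hd (xi j) (near _ (hxi j)) j.
  by rewrite -(subrK ('D_(delta_mx 0 j) G y) ('D_(delta_mx 0 j) G (xi j))) addrC (le_trans (ler_normD _ _))// lerD2l.
by move=> w wz j; case: (hd w (near _ wz) j).
Qed.

Lemma lipschitz_bound (I : set R) (f : R -> vec) : [lipschitz f t | t in I] -> exists2 L : R, 0 <= L &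
  forall u v, I u -> I v -> `|f u - f v| <= L * `|u - v|.
Proof.
move=> [K [_ hK]]; exists (`|K| + 1) => [|u v Iu Iv]; first by rewrite addr_ge0.
have KK : K < `|K| + 1 by rewrite (le_lt_trans (ler_norm K))// ltrDl.
exact: (hK _ KK (u, v)).
Qed.

Lemma smooth_along (I : set R) (c : R -> M) (g : M -> R) t : lipschitz_curve I c -> smooth_fun g -> I t ->
  exists d K : R, [/\ 0 < d, 0 <= K & forall u v, I u -> I v -> `|u - t| <= d -> `|v - t| <= d ->
    `|g (c u) - g (c v)| <= K * `|u - v|].
Proof.
move=> hc hg It; have [ch ac dc] := atlas_cover (c t).
have [J Jt [Jd /lipschitz_bound[L L0 hL]]] := hc t ch It ac dc.
have [od oi pc _ _] := atlas_chart ac.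
have hC : C1at (g \o param ch) (coord ch (c t)).
  by apply: (Ck_C1at oi (hg ch ac 1%N)); exists (c t).
have [d [K [d0 K0 hK]]] := C1at_lip hC.
have /(@nbhs_normP R R^o)[e /= e0 he] := Jt.
have L1 : 0 < L + 1 by lra.
pose m := Num.min (e / 2) (d / (L + 1)).
have m0 : 0 < m by rewrite lt_min !divr_gt0.
have inJ u : `|u - t| <= m -> J u.
  by move=> ut; apply: he; rewrite /= distrC (le_lt_trans ut)// gt_min; apply/orP; left; lra.
have near u : I u -> `|u - t| <= m -> `|coord ch (c u) - coord ch (c t)| <= d.
  move=> Iu ut; apply: (le_trans (hL u t _ _)); [by split=> //; exact: inJ|by split=> //; apply: inJ; rewrite subrr normr0 ltW|].
  have : `|u - t| * (L + 1) <= d by rewrite -ler_pdivlMr// (le_trans ut)// ge_min lexx orbT.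
  by rewrite mulrDr mulr1 mulrC; have := normr_ge0 (u - t); lra.
exists m, (K * L); split=> //; first exact: mulr_ge0.
move=> u v Iu Iv ut vt; have Ju := inJ _ ut; have Jv := inJ _ vt.
have := hK _ _ (near v Iv vt) (near u Iu ut); rewrite /= !pc; [|exact: Jd|exact: Jd].
move=> /le_trans; apply; rewrite -mulrA ler_wpM2l//; exact: hL.
Qed.

Lemma lipschitz_curve_sub (I J : set R) (c : R -> M) : J `<=` I -> lipschitz_curve I c -> lipschitz_curve J c.
Proof.
move=> JI hc t ch Jt ac dc; have [U Ut [Ud [K [rK hK]]]] := hc t ch (JI _ Jt) ac dc.
exists U => //; split=> [s [Js Us]|]; first by apply: Ud; split=> //; exact: JI.
exists K; split=> // L KL [u v] [/= [Ju Uu] [Jv Uv]]; apply: (hK L KL (u, v)); split; split=> //; exact: JI.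
Qed.

Lemma glue_lipschitz (p a q : R) (c1 c2 : R -> M) : c1 a = c2 a ->
  lipschitz_curve `[p, a] c1 -> lipschitz_curve `[a, q] c2 ->
  lipschitz_curve `[p, q] (fun u => if u <= a then c1 u else c2 u).
Proof.
move=> c12 h1 h2 t ch; rewrite /= in_itv /= => /andP[pt tq] ac.
have [ta|at_|ta] := ltgtP t a => dc.
- have It : `[p, a]%classic t by rewrite /= in_itv /= pt ltW.
  have [J Jt [Jd [K [rK hK]]]] := h1 t ch It ac dc.
  exists (J `&` [set s | s < a]); first by apply: filterI => //; exact: lt_nbhsl.
  have sub s : (`[p, q] `&` (J `&` [set s | s < a]))%classic s -> (`[p, a] `&` J)%classic s /\ (s <= a).
    by move=> [/=]; rewrite !in_itv /= => /andP[ps _] [Js /ltW sa]; rewrite ps sa.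
  split=> [s /sub[h ->]|]; first exact: Jd.
  exists K; split=> // L KL [u v] [/= /sub[hu ->] /sub[hv ->]].
  exact: (hK L KL (u, v)).
- have It : `[a, q]%classic t by rewrite /= in_itv /= tq ltW.
  have [J Jt [Jd [K [rK hK]]]] := h2 t ch It ac dc.
  exists (J `&` [set s | a < s]); first by apply: filterI => //; exact: lt_nbhsr.
  have sub s : (`[p, q] `&` (J `&` [set s | a < s]))%classic s -> (`[a, q] `&` J)%classic s /\ (s <= a) = false.
    by move=> [/=]; rewrite !in_itv /= => /andP[_ ps] [Js sa]; rewrite ps (ltW sa) leNgt sa.
  split=> [s /sub[h ->]|]; first exact: Jd.
  exists K; split=> // L KL [u v] [/= /sub[hu ->] /sub[hv ->]].
  exact: (hK L KL (u, v)).
- rewrite ta in pt tq dc *.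
  have I1 : `[p, a]%classic a by rewrite /= in_itv /= pt lexx.
  have I2 : `[a, q]%classic a by rewrite /= in_itv /= tq lexx.
  have [J1 J1t [J1d /lipschitz_bound[K1 K10 hK1]]] := h1 a ch I1 ac dc.
  rewrite c12 in dc; have [J2 J2t [J2d /lipschitz_bound[K2 K20 hK2]]] := h2 a ch I2 ac dc.
  have Ja1 : J1 a by exact: (nbhs_singleton J1t).
  have Ja2 : J2 a by exact: (nbhs_singleton J2t).
  have e1 s : (`[p, q] `&` (J1 `&` J2))%classic s -> s <= a -> (`[p, a] `&` J1)%classic s.
    by move=> [/=]; rewrite !in_itv /= => /andP[ps _] [Js _] ->; rewrite ps.
  have e2 s : (`[p, q] `&` (J1 `&` J2))%classic s -> a < s -> (`[a, q] `&` J2)%classic s.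
    by move=> [/=]; rewrite !in_itv /= => /andP[_ ps] [_ Js] /ltW ->; rewrite ps.
  exists (J1 `&` J2); first exact: filterI.
  split=> [s hs|]; first by have [sa|sa] := leP s a; [apply/J1d/e1|apply/J2d/e2].
  pose K := K1 + K2; have K0 : 0 <= K by exact: addr_ge0.
  have main (u v : R) : (`[p, q] `&` (J1 `&` J2))%classic u -> (`[p, q] `&` (J1 `&` J2))%classic v -> u <= v ->
      `|coord ch (if u <= a then c1 u else c2 u) - coord ch (if v <= a then c1 v else c2 v)| <= K * (v - u).
    move=> hu hv uv; have K1K : K1 <= K by rewrite lerDl.
    have K2K : K2 <= K by rewrite lerDr.
    have uv0 : 0 <= v - u by rewrite subr_ge0.
    have [ua|au] := leP u a; have [va|av] := leP v a.
    + have := hK1 u v (e1 _ hu ua) (e1 _ hv va); rewrite distrC [`|u - v|]distrC (ger0_norm uv0) => h.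
      by apply: (le_trans h); rewrite ler_wpM2r.
    + have h := hK1 u a (e1 _ hu ua) (conj I1 Ja1); have h' := hK2 a v (conj I2 Ja2) (e2 _ hv av).
      rewrite -(subrKA (coord ch (c1 a))); apply: (le_trans (ler_normD _ _)); rewrite {2}c12.
      have ua0 : 0 <= a - u by rewrite subr_ge0.
      have av0 : 0 <= v - a by rewrite subr_ge0 ltW.
      rewrite distrC [`|u - a|]distrC (ger0_norm ua0) in h; rewrite [`|a - v|]distrC (ger0_norm av0) in h'.
      rewrite distrC; apply: (le_trans (lerD h h')).
      have -> : K * (v - u) = K * (a - u) + K * (v - a) by ring.
      by apply: lerD; rewrite ler_wpM2r.
    + by have := le_lt_trans va (lt_le_trans au uv); rewrite ltxx.
    + have := hK2 u v (e2 _ hu au) (e2 _ hv av); rewrite distrC [`|u - v|]distrC (ger0_norm uv0) => h.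
      by apply: (le_trans h); rewrite ler_wpM2r.
  exists K; split; first exact: num_real.
  move=> L KL [u v] [/= hu hv]; have [uv|/ltW vu] := leP u v.
    rewrite [`|u - v|]distrC [`|v - u|]ger0_norm ?subr_ge0//; apply: (le_trans (main _ _ hu hv uv)).
    by rewrite ler_wpM2r ?subr_ge0// ltW.
  rewrite distrC [`|u - v|]ger0_norm ?subr_ge0//; apply: (le_trans (main _ _ hv hu vu)).
  by rewrite ler_wpM2r ?subr_ge0// ltW.
Qed.

(** Charts are compared with the coordinates by the smooth transition maps, which
  are locally Lipschitz. *)
Lemma phi_lipschitz (P : patch M) (I : set R) (Y : R -> vec) (K : R) : 0 <= K ->
  (forall u v, I u -> I v -> `|Y u - Y v| <= K * `|u - v|) -> (forall u, I u -> pV P (Y u)) ->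
  lipschitz_curve I (phi P \o Y).
Proof.
move=> K0 hK YV t ch It ac dc; have [od oi pc _ _] := atlas_chart ac.
have oU := phi_preim_open (P := P) od.
have Ut : (pV P `&` phi P @^-1` dom ch) (Y t) by split=> //; exact: YV.
have hs := phi_chart_smooth P ac.
pose Q (l : 'I_n) (C : R) := forall z z' : vec, `|z - Y t| * C <= 1 -> `|z' - Y t| * C <= 1 ->
    `|coord ch (phi P z') 0 l - coord ch (phi P z) 0 l| <= C * `|z' - z|.
have Qmono l (c c' : R) : c <= c' -> Q l c -> Q l c'.
  move=> cc h z z' zc zc'; apply: (le_trans (h z z' _ _)); last by rewrite ler_wpM2r.
    by apply: le_trans zc; rewrite ler_wpM2l.
  by apply: le_trans zc'; rewrite ler_wpM2l.
have [l|C C0 hC] := @seq_bound R 'I_n (enum 'I_n) Q Qmono.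
  have hl := @Ck_C1at _ _ 0 _ _ _ oU (Ck_coord l oU (hs 1%N)) Ut.
  have [d [K1 [d0 K10 hd]]] := C1at_lip hl.
  have m1 : d^-1 <= Num.max d^-1 K1 by rewrite le_max lexx.
  have m2 : K1 <= Num.max d^-1 K1 by rewrite le_max lexx orbT.
  have lt z : `|z - Y t| * Num.max d^-1 K1 <= 1 -> `|z - Y t| <= d.
    move=> h; rewrite -(mulr1 d) -ler_pdivrMl// mulrC; exact: le_trans (ler_wpM2l (normr_ge0 _) m1) h.
  exists (Num.max d^-1 K1); first by apply: le_trans m1; rewrite invr_ge0 ltW.
  move=> z z' /lt hz /lt hz'; apply: (le_trans (hd z z' hz hz')); exact: ler_wpM2r.
have /(@nbhs_normP R 'rV[R]_n)[e /= e0 he] := open_nbhs_nbhs (conj oU Ut).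
pose d := Num.min (e / 2) ((C + 1)^-1).
have C1 : 0 < C + 1 by lra.
have d0 : 0 < d by rewrite lt_min divr_gt0//= invr_gt0.
have K1 : 0 < K + 1 by lra.
have near u : I u -> `|t - u| < d / (K + 1) -> `|Y u - Y t| <= d.
  move=> Iu ut; apply: (le_trans (hK u t Iu It)); rewrite distrC.
  have : `|t - u| * (K + 1) <= d by rewrite -ler_pdivlMr// ltW.
  by rewrite mulrDr mulr1 mulrC; have := normr_ge0 (t - u); lra.
exists [set u | `|t - u| < d / (K + 1)].
  by apply/(@nbhs_normP R R^o); exists (d / (K + 1)) => //=; rewrite divr_gt0.
split=> [u [Iu /= ut]|].
  have := near u Iu ut; rewrite distrC => h.
  have h' : `|Y t - Y u| < e.
    by apply: (le_lt_trans h); rewrite /d gt_min; apply/orP; left; lra.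
  by have [] := he (Y u) h'.
have ok u : I u -> `|t - u| < d / (K + 1) -> `|Y u - Y t| * C <= 1.
  move=> Iu ut; apply: (@le_trans _ _ ((C + 1)^-1 * C)).
    by rewrite ler_wpM2r//; apply: (le_trans (near u Iu ut)); rewrite ge_min lexx orbT.
  by rewrite mulrC ler_pdivrMr// mul1r lerDl.
exists (C * K); split; first exact: num_real.
move=> L KL [u v] [/= [Iu ut] [Iv vt]].
apply: (@le_trans _ _ (C * K * `|u - v|)); last by rewrite ler_wpM2r// ltW.
apply: mnorm_le => [|l]; first by rewrite !mulr_ge0.
rewrite !mxE; apply: (le_trans (hC l _ (Y v) (Y u) (ok v Iv vt) (ok u Iu ut))); first by rewrite mem_enum.
by rewrite -mulrA ler_wpM2l//; exact: hK.
Qed.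

End CurveLipschitz.

(** * Length minimizers *)

Section Lengths.
Context {R : realType} {r : nat}.
Local Notation mu := (@lebesgue_measure R).
Local Notation enorm := (@euclidean_norm R r).

Lemma measurable_enorm (I : set R) (h : R -> 'rV[R]_r) : measurable I ->
  (forall i, measurable_fun I (fun t => h t ord0 i)) -> measurable_fun I (fun t => enorm (h t)).
Proof.
move=> mI mh; apply: measurableT_comp.
  by apply: continuous_measurable_fun; exact: sqrt_continuous.
by apply: measurable_sum => i; exact: measurable_funX.
Qed.

Lemma control_length_le (I : set R) (h h' : R -> 'rV[R]_r) : measurable I ->
  (forall i, measurable_fun I (fun t => h t ord0 i)) ->
  (forall i, measurable_fun I (fun t => h' t ord0 i)) ->
  {ae mu, forall t, I t -> enorm (h t) <= enorm (h' t)} ->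
  (control_length I h <= control_length I h')%E.
Proof.
move=> mI mh mh' hh; apply: ae_ge0_le_integral => //.
- by move=> t _; rewrite lee_fin enorm_ge0.
- by apply/measurable_EFinP; exact: measurable_enorm.
- by move=> t _; rewrite lee_fin enorm_ge0.
- by apply/measurable_EFinP; exact: measurable_enorm.
Qed.

Lemma ae_neq (a : R) : {ae mu, forall t, t != a}.
Proof.
exists [set a]; split; [exact: measurable_set1|exact: lebesgue_measure_set1|].
by move=> t /= /negP; rewrite negbK => /eqP.
Qed.

Lemma slow_length (T a b th : R) (h : R -> 'rV[R]_r) : - T <= a -> a < b -> b <= T -> 0 <= th -> th < 1 ->
  (forall i, measurable_fun `[- T, T] (fun t => h t ord0 i)) ->
  {ae mu, forall t, - T <= t <= T -> enorm (h t) <= 1} ->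
  {ae mu, forall t, a < t < b -> enorm (h t) <= th} ->
  (control_length `[(- T)%R, T] h < (2 * T)%:E)%E.
Proof.
move=> Ta ab bT th0 th1 mh h1 hth; pose c := 1 - th; have c0 : 0 < c by rewrite subr_gt0.
have TT : - T < T by exact: le_lt_trans Ta (lt_le_trans ab bT).
have mI : measurable (`[- T, T]%classic : set R) by exact: measurable_itv.
have mJ : measurable (`]a, b]%classic : set R) by exact: measurable_itv.
have muI : mu `[- T, T]%classic = (2 * T)%:E.
  by rewrite lebesgue_measure_itv /= lte_fin TT -EFinB; congr (_%:E); ring.
have muJ : mu `]a, b]%classic = (b - a)%:E by rewrite lebesgue_measure_itv /= lte_fin ab EFinB.
have mN : measurable_fun `[- T, T] (fun t => enorm (h t)) by exact: measurable_enorm.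
have mi : measurable_fun `[- T, T] (\1_(`]a, b]) : R -> R) by exact: measurable_indic.
have JI : `]a, b] `<=` `[- T, T]%classic.
  by move=> t /=; rewrite !in_itv /= => /andP[/ltW at_ tb]; rewrite (le_trans Ta at_) (le_trans tb bT).
have i0 t : 0 <= \1_(`]a, b]) t :> R by rewrite indicE.
have le1 : (\int[mu]_(t in `[(- T)%R, T]) ((enorm (h t))%:E + (c * \1_(`]a, b]) t)%:E) <= \int[mu]_(t in `[(- T)%R, T]) (cst 1%:E) t)%E.
  apply: ae_ge0_le_integral => //.
  - by move=> t _; rewrite -EFinD lee_fin addr_ge0 ?enorm_ge0// mulr_ge0// ltW.
  - apply/measurable_EFinP; apply: measurable_funD => //; exact: measurable_funM.
  - apply: aeS2 (ae_neq b) (_ : {ae mu, forall t, (- T <= t <= T -> enorm (h t) <= 1) /\ (a < t < b -> enorm (h t) <= th)}).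
      move=> t tb [k1 k2] /= tI; rewrite -EFinD lee_fin indicE; case: (boolP (t \in `]a, b]%classic)) => tJ; last first.
        by rewrite mulr0 addr0; apply: k1; move: tI; rewrite in_itv.
      rewrite mulr1 /c; suff : enorm (h t) <= th by lra.
      by apply: k2; move: tJ; rewrite inE /= in_itv /= => /andP[-> tb']; rewrite lt_neqAle tb.
    by apply: aeS2 h1 hth.
have : (\int[mu]_(t in `[(- T)%R, T]) ((enorm (h t))%:E + (c * \1_(`]a, b]) t)%:E) =
    control_length `[(- T)%R, T] h + (c * (b - a))%:E)%E.
  rewrite ge0_integralD//; [congr (_ + _)%E| | | |].
  - under eq_integral do rewrite EFinM.
    rewrite ge0_integralZl//; try exact/measurable_EFinP; try (by move=> t _; rewrite lee_fin); try by rewrite lee_fin ltW.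
    by rewrite integral_indic// setIidl// EFinM -muJ.
  - by move=> t _; rewrite lee_fin enorm_ge0.
  - exact/measurable_EFinP.
  - by move=> t _; rewrite lee_fin mulr_ge0// ltW.
  - by apply/measurable_EFinP; exact: measurable_funM.
move=> e; rewrite e integral_cst// mul1e in le1.
have {}le1 : (control_length `[(- T)%R, T] h + (c * (b - a))%:E <= (2 * T)%:E)%E by rewrite -muI; exact: le1.
have cab : 0 < c * (b - a) by rewrite mulr_gt0// subr_gt0.
move: le1; case: (control_length _ _) => [l| |]//=.
by rewrite -EFinD lee_fin lte_fin => ?; lra.
Qed.

End Lengths.

Section ControlDerivative.
Context {R : realType} {n r : nat}.
Local Notation vec := 'rV[R]_n.
Local Notation enorm := (@euclidean_norm R r).
Variables (Phi : seq 'I_r -> vec -> vec) (B La : R).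
Hypothesis HB : bounded_drift Phi B La.

(** The quadratic estimate on the increments says that the curve is differentiable
  wherever the driving path is. *)
Lemma driven_derive (C : R) (x : R -> 'rV[R]_r) (Y : R -> vec) (a b t : R) (g : 'rV[R]_r) : lip1 x ->
  0 <= C -> driven Phi C x Y a b -> a < t < b ->
  (forall i, is_derive t (1 : R) (fun u => x u 0 i) (g 0 i)) ->
  forall l, is_derive t (1 : R) (fun u => Y u 0 l) (drift Phi g (Y t) 0 l).
Proof.
move=> x1 C0 hY /andP[at_ tb] hx l; have B0 := bd_B HB; have La0 := bd_La HB.
pose F (u : R) := \sum_i Phi [:: i] (Y t) 0 l * x u 0 i.
have dF : is_derive t (1 : R) F (drift Phi g (Y t) 0 l).
  have hi i : is_derive t (1 : R) (fun u : R => Phi [:: i] (Y t) 0 l * x u 0 i) (Phi [:: i] (Y t) 0 l * g 0 i).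
    have h := hx i; exact: is_deriveZ.
  rewrite /drift summxE; apply: (is_derive_eq (is_derive_bigsum (index_enum 'I_r) hi)).
  by apply: eq_bigr => i _; rewrite mxE mulrC.
pose K := C + La * B; have K0 : 0 <= K by rewrite addr_ge0// mulr_ge0.
have key (h : R) : `|h| < Num.min (t - a) (b - t) -> `|(Y (t + h) 0 l - Y t 0 l) - (F (t + h) - F t)| <= K * h ^+ 2.
  rewrite lt_min => /andP[h1 h2].
  have FE : F (t + h) - F t = drift Phi (x (t + h) - x t) (Y t) 0 l.
    by rewrite /F -sumrB /drift summxE; apply: eq_bigr => i _; rewrite !mxE; ring.
  rewrite FE; have [h0|h0] := leP 0 h.
    rewrite ger0_norm// in h2; have := hY t (t + h) (ltW at_) _ _; rewrite lerDl => /(_ h0) hh.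
    have {hh} := hh (_ : t + h <= b) => /(_ ltac:(lra)) hh.
    have := le_trans (coord_le_mnorm _ l) hh; rewrite !mxE => hh'; apply: (le_trans hh').
    by rewrite addrC addKr ler_wpM2r ?sqr_ge0// lerDl mulr_ge0.
  rewrite ltr0_norm// in h1.
  have ht : t + h <= t by rewrite gerDl ltW.
  have ha : a <= t + h by lra.
  have hh := hY (t + h) t ha ht (ltW tb).
  have e : (Y (t + h) 0 l - Y t 0 l) - drift Phi (x (t + h) - x t) (Y t) 0 l =
    - ((Y t - Y (t + h) - drift Phi (x t - x (t + h)) (Y (t + h))) 0 l) -
      (drift Phi (x t - x (t + h)) (Y (t + h)) - drift Phi (x t - x (t + h)) (Y t)) 0 l.
    rewrite -(opprB (x t)) driftN !mxE; ring.
  rewrite e; apply: (le_trans (ler_normB _ _)); rewrite normrN /K mulrDl.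
  have tE : t - (t + h) = - h by ring.
  apply: lerD; first by have := le_trans (coord_le_mnorm _ l) hh; rewrite tE sqrrN.
  apply: (le_trans (coord_le_mnorm _ l)); apply: (le_trans (bd_lip HB _ _ _)).
  have l1 := x1 _ _ ht; rewrite tE in l1.
  have l2 := driven_lip HB x1 hY ha ht (ltW tb); rewrite tE in l2; rewrite distrC in l2.
  have h0' : 0 <= - h by rewrite oppr_ge0 ltW.
  apply: (@le_trans _ _ (La * (- h) * (B * (- h)))); last by rewrite le_eqVlt; apply/orP; left; apply/eqP; ring.
  by apply: ler_pM => //; [rewrite mulr_ge0 ?enorm_ge0|rewrite ler_wpM2l].
have dd : is_derive t (1 : R) (fun u => Y u 0 l - F u) 0.
  apply/is_deriveP => e e0; have K1 : 0 < K + 1 by lra.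
  exists (Num.min (Num.min (t - a) (b - t)) (e / (K + 1))).
    by rewrite !lt_min !subr_gt0 at_ tb divr_gt0.
  move=> h; rewrite lt_min => /andP[h1 h2]; rewrite mulr0 subr0.
  have -> : Y (t + h) 0 l - F (t + h) - (Y t 0 l - F t) = (Y (t + h) 0 l - Y t 0 l) - (F (t + h) - F t) by ring.
  apply: (le_trans (key h h1)); rewrite -real_normK ?num_real// expr2 mulrA ler_wpM2r//.
  have : `|h| * (K + 1) <= e by rewrite -ler_pdivlMr// ltW.
  by rewrite mulrDr mulr1 mulrC; have := normr_ge0 h; lra.
have ds := @is_deriveD _ _ _ _ _ _ _ _ _ dd dF.
rewrite add0r in ds; suff <- : (fun u : R => Y u 0 l - F u) + F = (fun u : R => Y u 0 l) by [].
by apply/funext => u; rewrite !fctE subrK.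
Qed.

(** A derivative is a limit of difference quotients, of norm at most [th]. *)
Lemma lip_derive_enorm (x : R -> 'rV[R]_r) (th t : R) (g : 'rV[R]_r) : 0 <= th ->
  (forall s u, s <= u -> enorm (x u - x s) <= th * (u - s)) ->
  (forall i, is_derive t (1 : R) (fun u => x u 0 i) (g 0 i)) -> enorm g <= th.
Proof.
move=> th0 hx hd; apply/ler_addgt0Pr => e e0.
pose e1 := e / r.+1%:R; have e10 : 0 < e1 by rewrite divr_gt0.
have [d d0 hh] : exists2 d : R, 0 < d & forall i, i \in enum 'I_r -> forall h, `|h| < d ->
    `|x (t + h) 0 i - x t 0 i - h * g 0 i| <= e1 * `|h|.
  elim: (enum 'I_r) => [|j s [d d0 hs]]; first by exists 1.
  have /is_deriveP/(_ e1 e10)[d' d'0 hd'] := hd j.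
  exists (Num.min d d'); first by rewrite lt_min d0.
  move=> j'; rewrite inE => js h; rewrite lt_min => /andP[hd1 hd2].
  by case/orP: js => [/eqP ->|js]; [exact: hd'|exact: hs].
pose h := d / 2; have h0 : 0 < h by rewrite divr_gt0.
have hdd : `|h| < d by rewrite gtr0_norm// /h; lra.
have k1 : enorm (x (t + h) - x t - h *: g) <= e * h.
  apply: (le_trans (enorm_le_sum _)); apply: (@le_trans _ _ (\sum_(i < r) e1 * h)).
    by apply: ler_sum => i _; rewrite !mxE; have := hh i _ h hdd; rewrite mem_enum (gtr0_norm h0); exact.
  rewrite sumr_const card_ord -[leLHS]mulr_natl mulrA ler_wpM2r ?(ltW h0)//.
  by rewrite /e1 mulrCA ler_piMr ?(ltW e0)// ler_pdivrMr// mul1r ler_nat.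
have th' : t <= t + h by rewrite lerDl ltW.
have k2 := hx t (t + h) th'; rewrite [t + h]addrC addrK in k2.
have : h * enorm g <= (th + e) * h.
  rewrite -{1}(gtr0_norm h0) -enormZ -(subrK (x (t + h) - x t) (h *: g)) addrC.
  apply: (le_trans (enormD _ _)); rewrite mulrDl; apply: lerD; first by rewrite [t + h]addrC.
  by rewrite -enormN opprB.
by rewrite mulrC ler_pM2r.
Qed.

End ControlDerivative.

Section Minimizer.
Context {R : realType} {n r : nat} {M : smooth_manifold R n}.
Local Notation vec := 'rV[R]_n.
Local Notation mu := (@lebesgue_measure R).
Local Notation enorm := (@euclidean_norm R r).
Variables (X : 'I_r -> vfield M) (T : R) (gamma : R -> M).
Hypothesis r2 : (2 <= r)%N.
Hypothesis hcc : cc_structure X.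
Hypothesis hlen : length_minimizer X (- T) T gamma.
Variable h : R -> 'rV[R]_r.
Hypothesis hor : horizontal X `[- T, T] gamma h.
Hypothesis h1 : {ae mu, forall t, - T <= t <= T -> enorm (h t) = 1}.
Variables (P : patch M) (t0 : R).
Hypothesis t0T : - T < t0 < T.
Hypothesis x0 : phi P 0 = gamma t0.

Let TT : - T < T. Proof. by case/andP: t0T => a b; exact: lt_trans b. Qed.
Let hX : forall i, smooth_vfield (X i). Proof. by case: hcc. Qed.
Let mI : measurable (`[- T, T]%classic : set R). Proof. exact: measurable_itv. Qed.

(** Controls are determined almost everywhere by the curve, so that the length
  of the minimizer is the length of its interval of definition. *)
Lemma minimal_length g k : horizontal X `[- T, T] g k -> g (- T) = gamma (- T) -> g T = gamma T ->
  ((2 * T)%:E <= control_length `[(- T)%R, T] k)%E.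
Proof.
move=> hg ga gb; have [h0 [_ mh0 vh0] e0] := hlen; have [_ mh vh] := hor.
have cck : (cc_dist X (gamma (- T)) (gamma T) <= control_length `[(- T)%R, T] k)%E.
  by apply: ereal_inf_lbound; exists (- T), T, g, k; split=> //; exact: ltW.
apply: le_trans cck; rewrite -e0.
have r0 : (0 < r)%N by exact: ltn_trans r2.
pose d (t : R) : 'rV[R]_r := delta_mx 0 (Ordinal r0).
have <- : control_length `[(- T)%R, T] d = (2 * T)%:E.
  rewrite /control_length /d enorm_delta.
  have -> : (\int[mu]_(t in `[(- T)%R, T]) 1%:E = \int[mu]_(t in `[(- T)%R, T]) cst 1%:E t)%E by [].
  rewrite integral_cst// mul1e.
  have muI : mu `[- T, T]%classic = (2 * T)%:E.
    by rewrite lebesgue_measure_itv /= lte_fin TT -EFinB; congr (_%:E); ring.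
  by rewrite -muI.
apply: (control_length_le mI) => [i|i|]; [exact: measurable_cst|by case: (mh0 i)|].
have hE : {ae mu, forall t, `[- T, T]%classic t -> h0 t = h t}; last first.
  apply: aeS2 h1 hE => t ht hh tI; rewrite /d enorm_delta.
  have tI' : - T <= t <= T by move: tI; rewrite /= in_itv.
  by rewrite hh// ht.
apply: aeS2 vh vh0.
move=> t k1 k2 tI; have v1 := k1 tI; have v2 := k2 tI.
have [_ fr _] := hcc; apply/rowP => i; apply/eqP; rewrite -subr_eq0; apply/eqP.
apply: (fr (gamma t) (fun i => h0 t ord0 i - h t ord0 i)) => // f hf.
have := is_derive_unique (v2 f hf) (v1 f hf); rewrite /lincomb => e.
under eq_bigr do rewrite mulrBl.
by rewrite sumrB; apply/eqP; rewrite subr_eq0; apply/eqP.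
Qed.

Local Notation F := (cfield P X).
Local Notation Phi := (jet F).
Variables (B La : R).
Hypothesis HB : bounded_drift Phi B La.
Variable x : R -> 'rV[R]_r.
Hypothesis x1 : lip1 x.
Hypothesis xd : {ae mu, forall t, - T < t < T -> forall i, is_derive t (1 : R) (fun u => x u 0 i) (h t 0 i)}.

Let It0 : `[- T, T]%classic t0.
Proof. by rewrite /= in_itv /=; case/andP: t0T => /ltW -> /ltW ->. Qed.

Definition near_time (d : R) := [/\ 0 < d, - T <= t0 - d & t0 + d <= T].

Lemma uniform_along (I : eqType) (s : seq I) (f : I -> M -> R) : (forall i, smooth_fun (f i)) ->
  exists d K : R, [/\ near_time d, 0 <= K & forall i, i \in s -> forall u v, `|u - t0| <= d -> `|v - t0| <= d ->
    `|f i (gamma u) - f i (gamma v)| <= K * `|u - v|].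
Proof.
move=> hf; have [lip _ _] := hor; case/andP: (t0T) => t0a t0b.
elim: s => [|i s [d [K [[d0 d1 d2] K0 hd]]]].
  exists (Num.min (t0 + T) (T - t0)), 0; split=> //.
  have m1 : Num.min (t0 + T) (T - t0) <= t0 + T by rewrite ge_min lexx.
  have m2 : Num.min (t0 + T) (T - t0) <= T - t0 by rewrite ge_min lexx orbT.
  by split; [rewrite lt_min; apply/andP; split; lra|lra|lra].
have [e [K' [e0 K'0 he]]] := smooth_along lip (hf i) It0.
have m1 : Num.min d e <= d by rewrite ge_min lexx.
have m2 : Num.min d e <= e by rewrite ge_min lexx orbT.
exists (Num.min d e), (K + K'); split; rewrite ?addr_ge0//.
  by split; [rewrite lt_min d0|lra|lra].
have inI u : `|u - t0| <= Num.min d e -> `[- T, T]%classic u.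
  by move=> ut; have := le_trans ut m1; rewrite ler_norml /= in_itv /= => /andP[a b]; apply/andP; split; lra.
move=> j; rewrite inE => /orP[/eqP ->|js] u v ut vt.
  apply: (le_trans (he u v (inI _ ut) (inI _ vt) (le_trans ut m2) (le_trans vt m2))).
  by rewrite ler_wpM2r// lerDr.
apply: (le_trans (hd j js u v (le_trans ut m1) (le_trans vt m1))).
by rewrite ler_wpM2r// lerDl.
Qed.

(** The minimizer in the coordinates, with time counted from [t0]. *)
Definition zc (u : R) : vec := psi P (gamma (t0 + u)).

(** In the coordinates of the patch, the curve is driven by the integral of its
  controls. *)
Lemma coordinates_driven (rho : R) : 0 < rho -> exists d K : R, [/\ near_time d, 0 <= K,
  forall u, `|u| <= d -> [/\ chi3 P (zc u) != 0, phi P (zc u) = gamma (t0 + u) & `|zc u| <= rho] &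
  driven Phi K (fun u => x (t0 + u)) zc (- d) d].
Proof.
move=> rho0.
have [d1 [K1 [[d10 d11 d12] K10 hd1]]] := @uniform_along unit [:: tt] (fun=> ext P (chi3 P)) (fun=> ext_chi3_smooth P).
pose fam (p : option 'I_r * 'I_n) := if p.1 is Some i then X i (cf P p.2) else cf P p.2.
have sfam p : smooth_fun (fam p).
  by case: p => -[i|] l; rewrite /fam /=; [apply: vfield_smooth|]; rewrite ?hX//; exact: cf_smooth.
have [d2 [K2 [[d20 d21 d22] K20 hd2]]] := uniform_along [seq (o, l) | o <- enum {: option 'I_r}, l <- enum 'I_n] sfam.
have lipf o l u v : `|u - t0| <= d2 -> `|v - t0| <= d2 -> `|fam (o, l) (gamma u) - fam (o, l) (gamma v)| <= K2 * `|u - v|.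
  by apply: hd2; apply/allpairsP; exists (o, l); rewrite !mem_enum.
have c30 : 0 < `|chi3 P 0| by rewrite normr_gt0 chi3_0.
have K1p : 0 < K1 + 1 by lra.
have K2p : 0 < K2 + 1 by lra.
pose d := Num.min (Num.min d1 d2) (Num.min (`|chi3 P 0| / 2 / (K1 + 1)) (rho / (K2 + 1))).
have dd1 : d <= d1 by rewrite /d !ge_min lexx.
have dd2 : d <= d2 by rewrite /d !ge_min lexx orbT.
have dd3 : d * (K1 + 1) <= `|chi3 P 0| / 2 by rewrite -ler_pdivlMr// /d !ge_min lexx !orbT.
have dd4 : d * (K2 + 1) <= rho by rewrite -ler_pdivlMr// /d !ge_min lexx !orbT.
have d0 : 0 < d by rewrite !lt_min d10 d20 !divr_gt0.
have t00 (e : R) : 0 <= e -> `|t0 - t0| <= e by rewrite subrr normr0.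
have sh (u e : R) : `|u| <= e -> `|t0 + u - t0| <= e by rewrite addrAC subrr add0r.
have e0 : ext P (chi3 P) (gamma t0) = chi3 P 0 by rewrite -x0 extE//; exact/chi3V/chi3_0.
have pos u : `|u| <= d -> chi3 P (zc u) != 0 /\ phi P (zc u) = gamma (t0 + u).
  move=> ud; have := hd1 tt (mem_head _ _) (t0 + u) t0 (sh _ _ (le_trans ud dd1)) (t00 _ (ltW d10)).
  rewrite e0 addrAC subrr add0r => hh.
  have nz : ext P (chi3 P) (gamma (t0 + u)) != 0.
    apply/eqP => z; move: hh; rewrite z sub0r normrN; apply/negP; rewrite -ltNge.
    have : `|u| * (K1 + 1) <= `|chi3 P 0| / 2 by apply: le_trans dd3; rewrite ler_wpM2r// ltW.
    by rewrite mulrDr mulr1 mulrC; have := normr_ge0 u; lra.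
  have Wu : pW P (gamma (t0 + u)) by apply: contrapT => nW; move: nz; rewrite ext0// eqxx.
  by split; [move: nz; rewrite extW|rewrite psiK].
have zE u l : `|u| <= d -> zc u 0 l = cf P l (gamma (t0 + u)).
  by move=> /pos[h3 <-]; rewrite cfE.
exists d, (r%:R * K2); split.
- by split=> //; [apply: (le_trans d11); rewrite lerD2l lerN2|apply: le_trans d12; rewrite lerD2l].
- by rewrite mulr_ge0.
- move=> u ud; have [h3 hphi] := pos u ud; split=> //.
  apply: mnorm_le => [|l]; first exact: ltW.
  have := lipf None l (t0 + u) t0 (sh _ _ (le_trans ud dd2)) (t00 _ (ltW d20)).
  rewrite /fam /= -zE// -x0 cfE ?chi3_0// mxE subr0 addrAC subrr add0r => hh; apply: (le_trans hh).
  have : `|u| * (K2 + 1) <= rho by apply: le_trans dd4; rewrite ler_wpM2r// ltW.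
  by rewrite mulrDr mulr1 mulrC; have := normr_ge0 u; lra.
- move=> s t ds st td.
  have ab (u : R) : s <= u -> u <= t -> `|u| <= d by move=> su ut; rewrite ler_norml (le_trans ds su) (le_trans ut td).
  apply: mnorm_le => [|l]; first by rewrite mulr_ge0 ?sqr_ge0// mulr_ge0.
  have [s3 sphi] := pos s (ab s (lexx s) st).
  pose G (v : R) := cf P l (gamma v) - \sum_i X i (cf P l) (gamma (t0 + s)) * x v 0 i.
  have tst : t0 + s <= t0 + t by rewrite lerD2l.
  have tn (v : R) : t0 + s <= v -> v <= t0 + t -> `|v - t0| <= d2.
    by move=> sv vt; apply: le_trans dd2; apply: ab; [rewrite lerBrDl|rewrite lerBlDl].
  have sn := tn _ (lexx _) tst.
  pose A := \sum_(i < r) `|X i (cf P l) (gamma (t0 + s))|.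
  have A0 : 0 <= A by apply: sumr_ge0.
  have GK : forall u v, t0 + s <= u -> u <= v -> v <= t0 + t -> `|G v - G u| <= (K2 + A) * (v - u).
    move=> u v su uv vt.
    have -> : G v - G u = (cf P l (gamma v) - cf P l (gamma u)) - \sum_i X i (cf P l) (gamma (t0 + s)) * (x v - x u) 0 i.
      have -> : \sum_i X i (cf P l) (gamma (t0 + s)) * (x v - x u) 0 i =
          \sum_i X i (cf P l) (gamma (t0 + s)) * x v 0 i - \sum_i X i (cf P l) (gamma (t0 + s)) * x u 0 i.
        by rewrite -sumrB; apply: eq_bigr => i _; rewrite !mxE mulrBr.
      by rewrite /G; move: (\sum_i _) (\sum_i _) => S1 S2; ring.
    apply: (le_trans (ler_normB _ _)); rewrite mulrDl; apply: lerD.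
      have := lipf None l v u (tn v (le_trans su uv) vt) (tn u su (le_trans uv vt)).
      by rewrite [`|v - u|]ger0_norm// subr_ge0.
    apply: (le_trans (ler_norm_sum _ _ _)); rewrite mulr_suml; apply: ler_sum => i _.
    rewrite normrM ler_wpM2l//; apply: (le_trans (coord_le_enorm _ _)); exact: x1.
  have Gd : {ae mu, forall v, t0 + s < v < t0 + t -> exists2 dv : R, is_derive v (1 : R) G dv & `|dv| <= r%:R * K2 * (t - s)}.
    have [_ _ vh] := hor; apply: aeS2 xd (aeS2 (fun v a b => conj a b) vh h1) => v xv [vv hv] /andP[sv vt].
    have h4 : t0 - d2 <= t0 + s by rewrite lerD2l (le_trans _ ds)// lerN2.
    have h5 : t0 + t <= t0 + d2 by rewrite lerD2l (le_trans td).
    have svI : - T < v < T by rewrite (le_lt_trans (le_trans d21 h4) sv) (lt_le_trans vt (le_trans h5 d22)).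
    have vI : - T <= v <= T by case/andP: svI => /ltW -> /ltW ->.
    have dc := vv vI (cf P l) (cf_smooth P l).
    have ds' : is_derive v (1 : R) (fun u : R => \sum_i X i (cf P l) (gamma (t0 + s)) * x u 0 i)
        (\sum_i X i (cf P l) (gamma (t0 + s)) * h v 0 i).
      by apply: is_derive_bigsum => i; have hx := xv svI i; exact: is_deriveZ.
    have dG := @is_deriveB _ _ _ _ _ _ _ _ _ dc ds'.
    eexists; first exact: dG.
    rewrite /lincomb -sumrB; apply: (le_trans (ler_norm_sum _ _ _)).
    apply: (@le_trans _ _ (\sum_(i < r) K2 * (t - s))); last by rewrite sumr_const card_ord -[leLHS]mulr_natl mulrA.
    apply: ler_sum => i _; rewrite [_ * h v 0 i]mulrC -mulrBr normrM -[leRHS]mul1r; apply: ler_pM => //.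
      by rewrite -(hv vI) coord_le_enorm.
    apply: (le_trans (lipf (Some i) l v (t0 + s) (tn v (ltW sv) (ltW vt)) sn)).
    rewrite ler_wpM2l// ger0_norm ?subr_ge0 ?(ltW sv)// lerBlDr.
    by rewrite (_ : t - s + (t0 + s) = t0 + t) ?ltW//; ring.
  have KA : 0 <= K2 + A by exact: addr_ge0.
  have rK : 0 <= r%:R * K2 * (t - s) by rewrite !mulr_ge0// subr_ge0.
  have := lipschitz_mean_value tst KA rK GK Gd.
  have -> : t0 + t - (t0 + s) = t - s by ring.
  rewrite -mulrA -expr2; apply: le_trans; rewrite le_eqVlt; apply/orP; left; apply/eqP; congr (`|_|).
  have z1 := zE t l (ab t st (lexx t)); have z2 := zE s l (ab s (lexx s) st).
  rewrite !mxE -/(zc t) z1 z2 -[(drift _ _ _) 0 l]/(drift Phi (x (t0 + t) - x (t0 + s)) (zc s) 0 l) drift_jetE /G.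
  have -> : \sum_i (x (t0 + t) - x (t0 + s)) 0 i * F i l (zc s) =
     \sum_i X i (cf P l) (gamma (t0 + s)) * x (t0 + t) 0 i - \sum_i X i (cf P l) (gamma (t0 + s)) * x (t0 + s) 0 i.
    rewrite -sumrB; apply: eq_bigr => i _; rewrite /cfield pullE ?sphi; last exact: chi3V.
    by rewrite !mxE; ring.
  ring.
Qed.

(** A faster way to join two points of the minimizer close to each other,
  followed at constant speed less than 1, would give a shorter curve. *)
Lemma minimal_conn : exists d K : R, [/\ near_time d, 0 <= K,
  driven Phi K (fun u => x (t0 + u)) zc (- d) d &
  forall s t L, - d <= s -> s <= t -> t <= d -> conn Phi B La (zc s) (zc t) L -> t - s <= L].
Proof.
have := open_nbhs_nbhs (conj (@chi3_open _ _ _ P) (chi3_0 P : [set y | chi3 P y != 0] 0)).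
move=> /(@nbhs_normP R 'rV[R]_n)[rho /= rho0 hrho].
have B0 := bd_B HB; have La0 := bd_La HB.
have r4 : 0 < rho / 4 by rewrite divr_gt0.
have [d1 [K [[d10 d11 d12] K0 hz hY]]] := coordinates_driven r4.
have B1 : 0 < B + 1 by lra.
pose d := Num.min d1 (rho / 8 / (B + 1)).
have d0 : 0 < d by rewrite lt_min d10 !divr_gt0.
have dd1 : d <= d1 by rewrite /d ge_min lexx.
have dd2 : d * (B + 1) <= rho / 8 by rewrite -ler_pdivlMr// /d ge_min lexx orbT.
exists d, K; split=> //.
- by split=> //; [apply: (le_trans d11); rewrite lerD2l lerN2|apply: le_trans d12; rewrite lerD2l].
- move=> s t ds st td; apply: hY => //; last exact: le_trans dd1.
  by apply: le_trans ds; rewrite lerN2.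
move=> s t L ds st td [xc [Yc [L0 xc1 hYc Yc0 YcL]]]; rewrite leNgt; apply/negP => Lts.
have Sd : `|s| <= d1 by apply: le_trans dd1; rewrite ler_norml ds (le_trans st td).
have Td : `|t| <= d1 by apply: le_trans dd1; rewrite ler_norml td (le_trans ds st).
have [s3 sphi sr] := hz s Sd; have [t3 tphi tr] := hz t Td.
pose a := t0 + s; pose b := t0 + t; have ba : b - a = t - s by rewrite /b /a; ring.
have ts0 : 0 < t - s by exact: le_lt_trans L0 Lts.
have ab : a < b by rewrite -subr_gt0 ba.
have Ta : - T <= a by apply: (le_trans d11); rewrite /a lerD2l; move: Sd; rewrite ler_norml => /andP[].
have bT : b <= T by apply: le_trans d12; rewrite /b lerD2l; move: Td; rewrite ler_norml => /andP[].
(* the faster way is followed at the constant speed [th], on the interval [[a, b]] *)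
pose th := L / (t - s); have th0 : 0 <= th by rewrite divr_ge0// ltW.
have th1 : th < 1 by rewrite /th ltr_pdivrMr// mul1r.
pose tau (u : R) := (u - a) * th.
have tauB u v : tau v - tau u = th * (v - u) by rewrite /tau; ring.
have tau0 : tau a = 0 by rewrite /tau subrr mul0r.
have tauL : tau b = L by rewrite /tau ba /th mulrCA divff ?mulr1// gt_eqF.
have tau_mono u v : u <= v -> tau u <= tau v.
  by move=> uv; rewrite -subr_ge0 tauB mulr_ge0// subr_ge0.
have tauI u : a <= u -> u <= b -> 0 <= tau u /\ tau u <= L.
  by move=> au ub; split; [rewrite -tau0|rewrite -tauL]; exact: tau_mono.
pose yt (u : R) := Yc (tau u); pose xt (u : R) := xc (tau u).
have xtl s' u : s' <= u -> enorm (xt u - xt s') <= th * (u - s').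
  by move=> su; rewrite -tauB; apply: xc1; exact: tau_mono.
have xt1 : lip1 xt.
  by move=> s' u su; apply: (le_trans (xtl _ _ su)); rewrite ler_piMl ?subr_ge0// ltW.
have C00 : 0 <= La * B by rewrite mulr_ge0.
have hyt : driven Phi (La * B) xt yt a b.
  move=> u v au uv vb; have [u0 _] := tauI u au (le_trans uv vb); have [_ vL] := tauI v (le_trans au uv) vb.
  apply: (le_trans (hYc _ _ u0 (tau_mono _ _ uv) vL)); rewrite ler_wpM2l// tauB exprMn.
  by rewrite ler_piMl ?sqr_ge0// expr_le1// ltW.
have yK u v : `[a, b]%classic u -> `[a, b]%classic v -> `|yt u - yt v| <= B * `|u - v|.
  rewrite /= !in_itv /= => /andP[au ub] /andP[av vb].
  exact: (driven_lip' HB xt1 hyt).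
have ya : yt a = zc s by rewrite /yt tau0 Yc0.
have yb : yt b = zc t by rewrite /yt tauL YcL.
have y3 u : a <= u -> u <= b -> chi3 P (yt u) != 0.
  move=> au ub; apply: hrho; rewrite /= sub0r normrN -(subrK (yt a) (yt u)).
  have h2 := driven_lip HB xt1 hyt (lexx a) au ub.
  have h3 : B * (u - a) <= rho / 4.
    apply: (@le_trans _ _ ((B + 1) * (d + d))); last by rewrite mulrDr -!(mulrC d); lra.
    apply: ler_pM => //; [by rewrite subr_ge0|by rewrite lerDl|].
    have : u - a <= t - s by rewrite -ba lerD2r.
    by move=> h4; apply: (le_trans h4); rewrite lerD// lerNl.
  apply: (le_lt_trans (ler_normD _ _)); rewrite ya in h2 *.
  by apply: (le_lt_trans (lerD (le_trans h2 h3) sr)); lra.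
have /boolp.choice[gi hgi] : forall i : 'I_r, exists g : R -> R, measurable_fun setT g /\
    {ae mu, forall u, a < u < b -> is_derive u (1 : R) (fun v => xt v 0 i) (g u)}.
  move=> i; have hx : forall u v, `|xt v 0 i - xt u 0 i| <= 1 * `|v - u|.
    have main (u v : R) : u <= v -> `|xt v 0 i - xt u 0 i| <= v - u.
      by move=> uv; have := le_trans (coord_le_enorm (xt v - xt u) i) (xt1 _ _ uv); rewrite !mxE.
    move=> u v; rewrite mul1r; have [uv|/ltW vu] := leP u v.
      by rewrite [`|v - u|]ger0_norm ?subr_ge0//; exact: main.
    by rewrite distrC [`|v - u|]distrC [`|u - v|]ger0_norm ?subr_ge0//; exact: main.
  by have [g [mg _ _ gd]] := lipschitz_ae hx ab; exists g.
pose g (u : R) : 'rV[R]_r := \row_i gi i u.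
have gd : {ae mu, forall u, forall i, a < u < b -> is_derive u (1 : R) (fun v => xt v 0 i) (g u 0 i)}.
  by apply: ae_forall => i; apply: aeS (hgi i).2 => u hu ui; rewrite mxE; exact: hu.
have gth : {ae mu, forall u, a < u < b -> enorm (g u) <= th}.
  apply: aeS gd => u hu ui; apply: (lip_derive_enorm th0 xtl) => i; exact: hu.
pose g2 := phi P \o yt.
(* the minimizer, with its part on [[a, b]] replaced *)
pose gt (u : R) := if u <= b then (if u <= a then gamma u else g2 u) else gamma u.
pose k (u : R) := if a < u < b then g u else h u.
have ga : gamma a = g2 a by rewrite /g2 /= ya sphi.
have gb : g2 b = gamma b by rewrite /g2 /= yb tphi.
have [lip hm vh] := hor.
have hgt : horizontal X `[- T, T] gt k.
  split.
  - apply: glue_lipschitz; first by rewrite leNgt ab.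
      apply: glue_lipschitz => //.
        apply: lipschitz_curve_sub lip => u /=; rewrite !in_itv /= => /andP[-> ua].
        exact: le_trans ua (le_trans (ltW ab) bT).
      apply: (phi_lipschitz B0 yK) => u; rewrite /= in_itv /= => /andP[au ub].
      exact/chi3V/y3.
    apply: lipschitz_curve_sub lip => u /=; rewrite !in_itv /= => /andP[bu ->].
    by rewrite (le_trans Ta (le_trans (ltW ab) bu)).
  - move=> i; split.
      rewrite (_ : (fun u => k u ord0 i) = fun u => if a < u < b then gi i u else h u ord0 i); last first.
        by apply/funext => u; rewrite /k; case: ifP => // _; rewrite mxE.
      apply: measurable_fun_if => //.
      + by apply: measurable_and; apply: measurable_fun_ltr; [exact: measurable_cst|exact: measurable_id|exact: measurable_id|exact: measurable_cst].
      + by apply: measurable_funTS; case: (hgi i).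
      + by apply: measurable_funS (hm i).1 => //; exact: subIsetl.
    exists 1; apply: aeS2 h1 gth => u hu hg /=; rewrite in_itv /= => uI.
    apply: (le_trans (coord_le_enorm _ _)); rewrite /k; case: ifP => [/hg hh|_]; last by rewrite hu.
    exact: le_trans hh (ltW th1).
  - apply: aeS2 (aeS2 (fun v e1 e2 => conj e1 e2) (ae_neq a) (ae_neq b)) (aeS2 (fun v e1 e2 => conj e1 e2) vh gd).
    move=> u [ua ub] [vu gu] uI f hf.
    have [ui|/negP nui] := boolP (a < u < b).
      have /andP[au ub'] := ui.
      have yu3 : chi3 P (yt u) != 0 by apply: y3; exact: ltW.
      have oV : open (pV P) by case: (pdiffeo P).
      have hC := Ck_C1at oV (smooth_comp_phi P hf 1%N) (chi3V yu3).
      have dy := driven_derive HB xt1 C00 hyt ui (fun i => gu i ui).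
      have hc := chain_curve hC dy.
      have nE : \near u, ((f \o phi P) \o yt) u = (f \o gt) u.
        near=> v; rewrite /gt /=; have -> : v <= b by apply: ltW; near: v; exact: lt_nbhsl.
        have -> // : (v <= a) = false.
        by apply/negbTE; rewrite -ltNge; near: v; exact: lt_nbhsr.
      have hc' := near_eq_is_derive nE hc; apply: (is_derive_eq hc').
      have gtE : gt u = phi P (yt u) by rewrite /gt (ltW ub') leNgt au.
      rewrite /lincomb /k ui gtE.
      have E i : value (X i) (phi P (yt u)) f = \sum_l F i l (yt u) * 'D_(delta_mx 0 l) (f \o phi P) (yt u).
        rewrite (tangent_formula yu3 (vfield_tangent _ (hX i)) hf); apply: eq_bigr => l _.
        by rewrite /cfield pullE//; exact: chi3V.
      under [RHS]eq_bigr do rewrite E mulr_sumr.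
      rewrite exchange_big; apply: eq_bigr => l _; rewrite drift_jetE mulr_suml.
      by apply: eq_bigr => i _; rewrite mulrA.
    have hu := vu uI f hf; have kE : k u = h u by rewrite /k ifF//; apply/negP.
    have nE : (gt u = gamma u) /\ \near u, (f \o gamma) u = (f \o gt) u.
      have [ultA|] := ltP u a.
        have e v : v < a -> gt v = gamma v by move=> va; rewrite /gt (ltW (lt_trans va ab)) (ltW va).
        split; first exact: e.
        by near=> v; rewrite /= e//; near: v; exact: lt_nbhsl.
      rewrite le_eqVlt eq_sym (negbTE ua) /= => au.
      have bu : b < u by rewrite ltNge le_eqVlt (negbTE ub) /=; apply/negP => ub'; apply: nui; rewrite au.
      have e v : b < v -> gt v = gamma v by move=> va; rewrite /gt leNgt va.
      split; first exact: e.
      by near=> v; rewrite /= e//; near: v; exact: lt_nbhsr.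
    have hu' := near_eq_is_derive nE.2 hu; apply: (is_derive_eq hu').
    by rewrite kE nE.1.
have gTa : gt (- T) = gamma (- T) by rewrite /gt Ta (le_trans Ta (ltW ab)).
have gTb : gt T = gamma T.
  rewrite /gt; case: ifP => // Tb; have -> : T = b by apply/eqP; rewrite eq_le Tb bT.
  by rewrite leNgt ab.
have := minimal_length hgt gTa gTb; rewrite leNgt => /negP; apply.
have [_ hk _] := hgt.
apply: (slow_length Ta ab bT th0 th1) => [i||]; first by case: (hk i).
  apply: aeS2 h1 gth => u hu hg uI; rewrite /k; case: ifP => [/hg hh|_]; last by rewrite hu.
  exact: le_trans hh (ltW th1).
by apply: aeS gth => u hu ui; rewrite /k ui; exact: hu.
Unshelve. all: by end_near. Qed.

End Minimizer.

(** * The tangent cone *)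

Section TangentCone.
Context {R : realType} {n r : nat} {M : smooth_manifold R n}.
Local Notation vec := 'rV[R]_n.
Variables (X : 'I_r -> vfield M) (gamma : R -> M) (t : R) (Y : 'I_n -> vfield M).
Local Notation wt := (weight X (gamma t)).

Lemma constant_horizontal_line : horizontal_line X (gamma t) Y (fun=> 0 : euclidean R n).
Proof.
split; first by exists 0.
exists 0; split.
- move=> s d _ -> _; exists setT; first exact: filterT.
  by split=> //; exists 0; split=> // K K0 [u v] _ /=; rewrite subrr normr0 mulr_ge0// ltW.
- by move=> i; split; [exact: measurable_cst|exists 0; apply: aeW => s _; rewrite mxE normr0].
- apply: aeW => s _ f hf; rewrite /lincomb big1 => [|i _]; last by rewrite mxE mul0r.
  exact: is_derive_cst.
Qed.

Lemma harmonic_cvg0 (eta : nat -> R) : (forall k, 0 < eta k <= k.+1%:R^-1) -> eta @ \oo --> (0 : R).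
Proof.
move=> he; apply/(@cvgrPdist_lt R R^o) => e e0; have := near_infty_natSinv_lt (PosNum e0).
apply: filterS => k /= ke; have /andP[h1 h2] := he k.
by rewrite sub0r normrN gtr0_norm// (le_lt_trans h2).
Qed.

Lemma constant_tangent : exp_map_inv (gamma t) Y = (fun=> 0) ->
  tangent_cone X gamma t Y (fun=> 0 : euclidean R n).
Proof.
move=> e0; exists (fun k => k.+1%:R^-1); split.
- by move=> k; rewrite invr_gt0.
- by apply/nonincreasing_seqP => k; rewrite lef_pV2 ?posrE// ler_nat.
- by apply: harmonic_cvg0 => k; rewrite invr_gt0 ltr0n lexx.
- apply/fam_cvgP => A cA S /uniform_nbhs[E [entE ES]]; exists 0%N => // k _; apply: ES => s _.
  rewrite e0 (_ : dilation _ _ _ _ = 0); first exact: entourage_refl.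
  by apply/rowP => j; rewrite !mxE mulr0.
Qed.

(** Blow-ups at one small scale suffice to construct an element of the tangent
  cone. *)
Lemma tangent_of_scales (v : vec) : (forall e K : R, 0 < e -> 0 <= K -> exists2 eta : R, 0 < eta < e &
    forall tau j, - K <= tau -> tau <= K ->
      `|eta ^- wt j * exp_map_inv (gamma t) Y (gamma (t + eta * tau)) 0 j - (tau *: v) 0 j| <= e) ->
  tangent_cone X gamma t Y (fun tau => tau *: v : euclidean R n).
Proof.
move=> hs; pose Q (p : R * R) (eta : R) := 0 < p.1 -> 0 <= p.2 -> 0 < eta < p.1 /\
    forall tau j, - p.2 <= tau -> tau <= p.2 ->
      `|eta ^- wt j * exp_map_inv (gamma t) Y (gamma (t + eta * tau)) 0 j - (tau *: v) 0 j| <= p.1.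
have /boolp.choice[G hG] : forall p, exists eta, Q p eta.
  move=> [e K]; have [e0|e0] := ltP 0 e; last by exists 0; rewrite /Q /= ltNge e0.
  have [K0|K0] := leP 0 K; last by exists 0 => _ /=; rewrite leNgt K0.
  by have [eta h1 h2] := hs e K e0 K0; exists eta.
pose eta := fix eta (k : nat) : R := if k is k'.+1 then G (Num.min (eta k') k.+1%:R^-1, k%:R) else G (1, 0).
have inv0 k : 0 < (k.+1%:R : R)^-1 by rewrite invr_gt0.
have pos k : 0 < eta k.
  elim: k => [|k IH] /=; first by have [] := hG (1, 0) ltr01 (lexx 0) => /andP[].
  have m0 : 0 < Num.min (eta k) k.+2%:R^-1 by rewrite lt_min IH inv0.
  by have [] := hG (Num.min (eta k) k.+2%:R^-1, k.+1%:R) m0 (ler0n _ _) => /andP[].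
have step k : eta k.+1 <= eta k.
  have m0 : 0 < Num.min (eta k) k.+2%:R^-1 by rewrite lt_min pos inv0.
  have [/andP[_ h] _] := hG (Num.min (eta k) k.+2%:R^-1, k.+1%:R) m0 (ler0n _ _).
  by apply: (le_trans (ltW h)); rewrite ge_min lexx.
have small k : eta k <= k.+1%:R^-1 /\ forall tau j, - k%:R <= tau -> tau <= k%:R ->
      `|eta k ^- wt j * exp_map_inv (gamma t) Y (gamma (t + eta k * tau)) 0 j - (tau *: v) 0 j| <= k.+1%:R^-1.
  case: k => [|k].
    have [/andP[_ h1] h2] := hG (1, 0) ltr01 (lexx 0); rewrite invr1; split; first exact: ltW.
    exact: h2.
  have m0 : 0 < Num.min (eta k) k.+2%:R^-1 by rewrite lt_min pos inv0.
  have [/andP[_ h1] h2] := hG (Num.min (eta k) k.+2%:R^-1, k.+1%:R) m0 (ler0n _ _).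
  have m1 : Num.min (eta k) k.+2%:R^-1 <= k.+2%:R^-1 by rewrite ge_min lexx orbT.
  split; first exact: le_trans (ltW h1) m1.
  by move=> tau j ta tb; apply: le_trans m1; exact: h2.
exists eta; split=> //.
- exact/nonincreasing_seqP.
- by apply: harmonic_cvg0 => k; rewrite pos; case: (small k).
- apply/fam_cvgP => A cA S /uniform_nbhs[E [entE ES]].
  move: entE; rewrite -entourage_ballE => -[e /= e0 he].
  have [K [_ hK]] := compact_bounded cA.
  have AK s : A s -> `|s| <= `|K| + 1.
    by move=> As; apply: hK => //; rewrite (le_lt_trans (ler_norm K))// ltrDl.
  have e2 : 0 < e / 2 by rewrite divr_gt0.
  have n1 : \forall k \near \oo, k.+1%:R^-1 < e / 2 := near_infty_natSinv_lt (PosNum e2).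
  have n2 : \forall k \near \oo, `|K| + 1 <= k%:R.
    exists (Num.truncn (`|K| + 1)).+1 => // k /= kN.
    by apply: (le_trans (ltW (truncnS_gt _))); rewrite ler_nat.
  apply: filterS2 n1 n2 => k k1 k2; apply: ES => s As; apply: he => /=.
  rewrite -ball_normE /=; apply: (@le_lt_trans _ _ (e / 2)); last by lra.
  apply: mnorm_le => [|j]; first exact: ltW.
  have sk := le_trans (AK s As) k2; move: sk; rewrite ler_norml => /andP[s1 s2].
  have := (small k).2 s j s1 s2; rewrite distrC => h; apply: le_trans (ltW k1); apply: le_trans h.
  by rewrite !mxE exprVn.
Qed.

End TangentCone.

Theorem theorem1p1 (R : realType) (n r : nat) (M : smooth_manifold R n)
    (X : 'I_r -> vfield M) (T : R) (gamma : R -> M) :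
  connected [set: M] ->
  (2 <= r)%N ->
  cc_structure X ->
  0 < T ->
  length_minimizer X (- T) T gamma ->
  arclength_parametrized X `[- T, T] gamma ->
  forall t : R, - T < t < T ->
  forall Y : 'I_n -> vfield M, adapted_frame X (gamma t) Y ->
  exists2 kappa, tangent_cone X gamma t Y kappa &
    horizontal_line X (gamma t) Y kappa.
Proof.
move=> _ r2 hcc T0 hlen [h hor h1] t tT Y hY.
pose inv := [set psi : M -> euclidean R n | exists (V : set 'rV[R]_n) (W : set M),
    [/\ V 0, W (gamma t) & @diffeomorphism R n n (euclidean R n) M V W (exp_map (gamma t) Y) psi]].
have [[psi0 hpsi0]|none] := pselect (exists psi, inv psi); last first.
  (* without a local inverse of the exponential map, the curve is constant *)
  have e0 : exp_map_inv (gamma t) Y = fun=> 0.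
    by rewrite /exp_map_inv; case: xgetP => // psi _ hpsi; case: none; exists psi.
  by exists (fun=> 0); [exact: constant_tangent|exact: constant_horizontal_line].
have [V [W [V0 Wx hd]]] : inv (exp_map_inv (gamma t) Y).
  by rewrite /exp_map_inv; case: xgetP => // /(_ psi0).
have [P [PV PW Pphi Ppsi]] := patch_exists hd V0.
have Wx' : pW P (gamma t) by rewrite PW.
have x0 : phi P 0 = gamma t := phi0 Pphi Wx'.
have hY' : adapted_frame X (phi P 0) Y by rewrite x0.
have Pphi' : phi P = exp_map (phi P 0) Y by rewrite x0.
have [ffirst [q hstep hframe]] := hY'.
have [bw hbw] := frame_words hcc ffirst hstep hframe.
have hX : forall i, smooth_vfield (X i) by case: hcc.
have TT : - T < T by case/andP: tT => a b; exact: lt_trans b.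
have [_ hm _] := hor.
have h1' : {ae @lebesgue_measure R, forall s, - T <= s <= T -> euclidean_norm (h s) = 1}.
  by apply: aeS h1 => s hs sI; apply: hs; rewrite /= in_itv.
have [x [x1 xd]] := arclength_path TT (fun i => (hm i).1) h1'.
have hF := cfield_Bsm P hX.
have [B [La HB]] := bounded_driftP hF.
have [d [K [[d0 _ _] K0 hdr hmin]]] := minimal_conn r2 hcc hlen hor h1' tT x0 HB x1 xd.
have x1' : lip1 (fun u => x (t + u)).
  by move=> s u su; have := x1 (t + s) (t + u); rewrite lerD2l => /(_ su); rewrite opprD addrACA subrr add0r.
have z0 : zc gamma P t 0 = 0.
  by rewrite /zc addr0 -x0 phiK//; exact/chi3V/chi3_0.
have hpriv := privileged_jet r2 hcc ffirst hstep hframe hbw Pphi'.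
have hbf := bracket_frame hcc hbw Pphi'.
have q0 := step_gt0 Y r2 hcc hstep.
have bs k : (0 < size (bw k) <= q)%N.
  by rewrite (hbw k).1; have [-> ->] := weightP hcc hstep hframe k.
have [c c1 hc] := control_blowup HB (fun y => erefl) (jet_estimatesP hF) bs hbf q0 hpriv x1' d0 K0 z0 hdr hmin.
exists (fun tau => tau *: lift_ctrl c : euclidean R n).
  apply: tangent_of_scales => e L e0 L0; have [eta he hb] := hc e L e0 L0.
  exists eta => // tau j ta tb; have := hb tau j ta tb.
  rewrite (ray_frame r2 hcc ffirst hstep hframe hbw Pphi') lift_ctrlZ /zc Ppsi.
  by rewrite x0.
by rewrite -x0; exact: (ray_horizontal r2 hcc ffirst hstep hframe hbw Pphi').
Qed.
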